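(* Let $T$ be a tangle consisting of $n$ arcs embedded in $B^3$. Then the link in $S^3$ obtained by doubling $T$ is an $n$-component link which is weakly doubly slice with all quasi-orientations.
   Context: All manifolds and embeddings are smooth. A tangle of $n$ arcs in $B^3$ is a proper embedding of $n$ disjoint arcs in $B^3$. The double of $T$ is the link in $S^3$ obtained by doubling the pair $(B^3,T)$: $S^3=B^3\cup_{\partial}(-B^3)$, glued by the identity of $\partial B^3$, and the link is $T\cup(-T)$. $S^3\subset S^4$ is the equator; intersections with it are transverse. A 2-sphere in $S^4$ is unknotted if it bounds an embedded 3-ball. A quasi-orientation on a link is an orientation of all its components up to simultaneous reversal. If $L=S\cap S^3$ for a 2-sphere $S\subset S^4$, then $S$ induces a quasi-orientation on $L$: orient $S$ and orient $L$ as the boundary of the part of $S$ in one of the two 4-balls bounded by $S^3$. A link with a quasi-orientation is weakly doubly slice if it is the intersection of an unknotted 2-sphere in $S^4$ with $S^3$, inducing the given quasi-orientation. *)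

(* Defs.v *)
From HB Require Import structures.
From mathcomp Require Import all_boot all_order all_algebra.
From mathcomp Require Import all_classical all_reals all_analysis.
Set Implicit Arguments.
Unset Strict Implicit.
Unset Printing Implicit Defensive.
Import Order.TTheory GRing.Theory Num.Theory.
Import numFieldNormedType.Exports.
Local Open Scope classical_set_scope.
Local Open Scope ring_scope.

(* All manifolds below are subsets of Euclidean spaces.  A map defined on such
   a subset (closed balls and closed intervals included) is smooth when it
   extends, locally in the ambient space, to a smooth map on an open set. *)

(* Used with U open and V finite-dimensional, where continuity of all iterated
   directional derivatives amounts to continuity of all partial derivatives. *)
Fixpoint Ck (R : realType) (V W : normedModType R) (k : nat)
    (U : set V) (f : V -> W) : Prop :=
  (forall x, U x -> {for x, continuous f}) /\
  (if k is k'.+1 then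
     forall v, (forall x, U x -> derivable f x v) /\ Ck k' U ('D_v f)
   else True).

Definition smooth (R : realType) (V W : normedModType R)
    (A : set V) (f : V -> W) : Prop :=
  forall x, A x -> exists (U : set V) (g : V -> W),
    [/\ open U, U x, forall k, Ck k U g & forall y, A y -> U y -> g y = f y].

(* An embedding is a diffeomorphism onto its image. *)
Definition embedding (R : realType) (V W : normedModType R)
    (M : set V) (f : V -> W) : Prop :=
  smooth M f /\
  exists g : W -> V, smooth (f @` M) g /\ forall x, M x -> g (f x) = x.

Definition sqnorm (R : realType) (d : nat) (x : 'rV[R]_d) : R :=
  \sum_(i < d) x ord0 i ^+ 2.

Definition disk (R : realType) (d : nat) : set 'rV[R]_d :=
  [set x | sqnorm x <= 1].

Definition sphere (R : realType) (d : nat) : set 'rV[R]_d.+1 :=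
  [set x | sqnorm x = 1].

Definition unit_interval (R : realType) : set R := `[0, 1].

Arguments disk {R} d.
Arguments sphere {R} d.
Arguments unit_interval {R}.

(* [velocity M p v]: v is the initial velocity of a smooth curve in M issuing
   from p.  At an interior point of a submanifold these vectors form the tangent
   space; at a boundary point, the closed half-space of vectors pointing into
   M, whence the sign in [tangent]. *)
Definition velocity (R : realType) (d : nat) (M : set 'rV[R]_d)
    (p v : 'rV[R]_d) : Prop :=
  exists c : R -> 'rV[R]_d,
    [/\ smooth setT c, c 0 = p, \forall t \near 0^'+, M (c t) & 'D_1 c 0 = v].

Definition tangent (R : realType) (d : nat) (M : set 'rV[R]_d)
    (p v : 'rV[R]_d) : Prop :=
  velocity M p v \/ velocity M p (- v).

Definition transverse (R : realType) (d : nat) (W A B : set 'rV[R]_d) : Prop :=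
  forall p, A p -> B p -> forall w, tangent W p w ->
    exists u v, [/\ tangent A p u, tangent B p v & w = u + v].

(* Properness includes transversality to the boundary sphere. *)
Definition is_tangle (R : realType) (n : nat) (T : set 'rV[R]_3) : Prop :=
  exists t : 'I_n -> R -> 'rV[R]_3,
    [/\ forall i, embedding unit_interval (t i),
        trivIset setT (fun i => t i @` unit_interval),
        T = \bigcup_i (t i @` unit_interval),
        T `<=` disk 3
      & (forall i s, unit_interval s -> sphere 2 (t i s) <-> s = 0 \/ s = 1) /\
        transverse setT T (sphere 2)].

Definition is_link (R : realType) (n : nat) (L : set 'rV[R]_4) : Prop :=
  exists c : 'I_n -> 'rV[R]_2 -> 'rV[R]_4,
    [/\ forall i, embedding (sphere 1) (c i),
        trivIset setT (fun i => c i @` sphere 1),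
        L = \bigcup_i (c i @` sphere 1)
      & L `<=` sphere 3].

(* The sphere of dimension d is the union of two copies of [disk d], the graphs
   of +- sqrt (1 - |x|^2), glued along their boundary by the identity.  The
   coordinate added to R^d is the first one.  The square root makes the double
   of an arc transverse to the boundary a smooth circle: it is the set of the
   (s, x) with x on the arc and s^2 = 1 - |x|^2. *)
Definition hemisphere (R : realType) (d : nat) (e : R) (x : 'rV[R]_d) :
    'rV[R]_d.+1 :=
  row_mx (e * Num.sqrt (1 - sqnorm x))%:M x.

Definition tangle_double (R : realType) (d : nat) (T : set 'rV[R]_d) :
    set 'rV[R]_d.+1 :=
  (hemisphere 1 @` T) `|` (hemisphere (-1) @` T).

(* Acts on points (k = 1) and on frames, stored as the rows of a matrix. *)
Definition incl (R : realType) (k d : nat) (A : 'M[R]_(k, d)) :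
    'M[R]_(k, d.+1) :=
  row_mx (0 : 'M[R]_(k, 1)) A.

Definition equator (R : realType) (d : nat) : set 'rV[R]_d.+2 :=
  @incl R 1 d.+1 @` sphere d.

Definition upper_half (R : realType) (d : nat) : set 'rV[R]_d.+1 :=
  [set x | sphere d x /\ 0 <= x ord0 ord0].

Arguments equator {R} d.
Arguments upper_half {R} d.

Definition frame (R : realType) (k d : nat) (M : set 'rV[R]_d)
    (p : 'rV[R]_d) (E : 'M[R]_(k, d)) : Prop :=
  row_free E /\ forall i, tangent M p (row i E).

(* An orientation of a k-dimensional submanifold M is given by its positive
   frames: at each point of M, one class of bases of the tangent space modulo
   positive changes of basis, containing locally a continuous field of frames. *)
Definition orientation (R : realType) (k d : nat) (M : set 'rV[R]_d)
    (o : 'rV[R]_d -> set 'M[R]_(k, d)) : Prop :=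
  [/\ forall p E, o p E -> M p /\ frame M p E,
      forall p E (P : 'M[R]_k), o p E -> (o p (P *m E) <-> 0 < \det P)
    & forall p, M p ->
        exists (U : set 'rV[R]_d) (E : 'rV[R]_d -> 'M[R]_(k, d)),
          [/\ open U, U p, {within M `&` U, continuous E}
            & forall q, (M `&` U) q -> o q (E q)]].

Definition quasi_orientation (R : realType) (d : nat) (L : set 'rV[R]_d)
    (Q : set ('rV[R]_d -> set 'rV[R]_d)) : Prop :=
  exists o : 'rV[R]_d -> set 'rV[R]_d,
    orientation L o /\ Q = [set o; fun p E => o p (- E)].

Definition outward (R : realType) (d : nat) (F bF : set 'rV[R]_d)
    (p v : 'rV[R]_d) : Prop :=
  velocity F p (- v) /\ ~ tangent bF p v.

(* Outward normal first. *)
Definition boundary_orientation (R : realType) (k d : nat)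
    (F bF : set 'rV[R]_d) (o : 'rV[R]_d -> set 'M[R]_(k.+1, d)) :
    'rV[R]_d -> set 'M[R]_(k, d) :=
  fun p E => [/\ bF p, frame bF p E
    & exists v, outward F bF p v /\ o p (col_mx v E : 'M[R]_(1 + k, d))].

(* The orientations of the link [incl @^-1` S] in the equator 3-sphere induced
   by the two orientations of S; using the other 4-ball reverses both. *)
Definition induced_quasi_orientation (R : realType) (S : set 'rV[R]_5) :
    set ('rV[R]_4 -> set 'rV[R]_4) :=
  [set o | exists oS : 'rV[R]_5 -> set 'M[R]_(2, 5),
     orientation S oS /\
     o = fun p E =>
       boundary_orientation (S `&` upper_half 4) (S `&` equator 3) oS
         (incl p) (incl E)].

Definition is_2sphere (R : realType) (S : set 'rV[R]_5) : Prop :=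
  exists f : 'rV[R]_3 -> 'rV[R]_5,
    [/\ embedding (sphere 2) f, S = f @` sphere 2 & S `<=` sphere 4].

Definition unknotted (R : realType) (S : set 'rV[R]_5) : Prop :=
  exists f : 'rV[R]_3 -> 'rV[R]_5,
    [/\ embedding (disk 3) f, f @` disk 3 `<=` sphere 4 & S = f @` sphere 2].

Definition weakly_doubly_slice (R : realType) (L : set 'rV[R]_4)
    (Q : set ('rV[R]_4 -> set 'rV[R]_4)) : Prop :=
  exists S : set 'rV[R]_5,
    [/\ is_2sphere S, unknotted S, transverse (sphere 4) S (equator 3),
        S `&` equator 3 = @incl R 1 4 @` L
      & induced_quasi_orientation S = Q].

(* Main.v *)
Require Import Defs.
From HB Require Import structures.
From mathcomp Require Import all_boot all_order all_algebra perm.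
From mathcomp Require Import all_classical all_reals all_analysis.
From mathcomp Require Import ring lra.
Set Implicit Arguments.
Unset Strict Implicit.
Unset Printing Implicit Defensive.
Import Order.TTheory GRing.Theory Num.Theory.
Import numFieldNormedType.Exports.
Local Open Scope classical_set_scope.
Local Open Scope ring_scope.

(* The arcs, each traversed in the direction prescribed by the quasi-orientation,
   are joined outside the ball into one proper line l in R^3 that is straight
   near both ends.  On quaternions let hopf v = v i v^*, a circle bundle over
   R^3 minus the origin; the preimage of a half-line of l issuing from the
   origin is a smooth plane in R^4.  Translating l so that the endpoint of the
   half-line slides along l moves this plane by an ambient isotopy, until only
   the straight end is left and the plane is flat: the plane is unknotted, as
   in Zeeman's theorem that 1-twist spun knots are trivial.  When the endpoint
   is far from the ball the bundle is a product there, so that in a chart the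
   plane is the set of the (y, x) with x on l; it meets the unit 3-sphere in the
   double of the tangle.  The plane is oriented by the direction of l and that
   of the fibres, hence induces the given quasi-orientation. *)

(** Diffeomorphisms arise here without flows: [id + V] is one as soon as [V] has Lipschitz constant
    1/2. So each small move of the endpoint gives an ambient diffeomorphism, and the equivalence
    class of the plane, being locally constant in the endpoint, is constant along a segment. The
    obstacle is the tip of the plane, over the origin, where the Hopf map is no submersion. There
    the half-line is written as (s - lam) e(s) with e smooth and nowhere zero (Hadamard's lemma),
    and the plane is moved by left multiplication with a quaternion that turns one e(s) into the
    next; it depends on s alone, hence is smooth across the tip. The chart is taken over a point at
    distance of order R0 from the tip: shrinking by R0 makes a ball of fixed size as small as the
    inverse function theorem wants, which is why the endpoint starts far out on a radial end. The
    plane becomes a sphere only far away, by flattening the cap of a huge round sphere. Orientations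
    are compared by one sign, constant because a disk minus the tip is connected; the direction of
    each arc is free because arcs are joined outside the ball, in either direction. *)

Section CkBasics.
Context {R : realType}.
Implicit Types V W : normedModType R.

(** * Calculus of maps of class C^k *)

Lemma Ck_ext V W k (U : set V) (f g : V -> W) :
  open U -> (forall x, U x -> f x = g x) -> Ck k U f -> Ck k U g.
Proof.
move=> oU; elim: k f g => [|k IH] f g fg [cf df]; split.
- move=> x Ux; have fgx : {near x, f =1 g}.
    by near=> y; apply: fg; near: y; apply: open_nbhs_nbhs.
  rewrite /prop_for /continuous_at -(fg x Ux).
  exact: cvg_trans (near_eq_cvg fgx) (cf x Ux).
- by [].
- move=> x Ux; have fgx : {near x, f =1 g}.
    by near=> y; apply: fg; near: y; apply: open_nbhs_nbhs.
  rewrite /prop_for /continuous_at -(fg x Ux).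
  exact: cvg_trans (near_eq_cvg fgx) (cf x Ux).
- move=> v; have [dfv Cf] := df v.
  have near_fg x : U x -> {near x, f =1 g}.
    by move=> Ux; near=> y; apply: fg; near: y; apply: open_nbhs_nbhs.
  split; first by move=> x Ux; apply: near_eq_derivable (near_fg x Ux) (dfv x Ux).
  by apply: IH Cf => x Ux; exact: near_eq_derive (near_fg x Ux).
Unshelve. all: by end_near. Qed.

Lemma Ck_local V W k (U : set V) (f : V -> W) :
  (forall x, U x -> exists U', U' x /\ Ck k U' f) -> Ck k U f.
Proof.
elim: k f => [|k IH] f H; split=> //.
- by move=> x /H [U' [U'x [cf _]]]; exact: cf.
- by move=> x /H [U' [U'x [cf _]]]; exact: cf.
- move=> v; split; first by move=> x /H [U' [U'x [_ /(_ v) [df _]]]]; exact: df.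
  by apply: IH => x /H [U' [U'x [_ /(_ v) [_ Cf]]]]; exists U'.
Qed.

Lemma Ck_sub V W k (U U' : set V) (f : V -> W) :
  U' `<=` U -> Ck k U f -> Ck k U' f.
Proof. by move=> UU' Cf; apply: Ck_local => x /UU' Ux; exists U. Qed.

Lemma CkS V W k (U : set V) (f : V -> W) : Ck k.+1 U f -> Ck k U f.
Proof.
elim: k f => [|k IH] f [cf df]; split=> // v.
by have [dfv /IH Cf] := df v.
Qed.

Lemma Ck_continuous V W k (U : set V) (f : V -> W) x :
  Ck k U f -> U x -> {for x, continuous f}.
Proof. by case: k => [|k] [cf _]; exact: cf. Qed.

Lemma Ck_derivable V W k (U : set V) (f : V -> W) x :
  Ck k.+1 U f -> U x -> forall v, derivable f x v.
Proof. by move=> [_ H] Ux v; have [df _] := H v; exact: df. Qed.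

Lemma Ck_derive V W k (U : set V) (f : V -> W) :
  Ck k.+1 U f -> forall v, Ck k U ('D_v f).
Proof. by move=> [_ H] v; have [] := H v. Qed.

Lemma Ck_cst V W k (U : set V) (a : W) : Ck k U (fun=> a).
Proof.
elim: k a => [|k IH] a; split=> //; try by move=> x _; exact: cvg_cst.
move=> v; split; first by move=> x _; exact: derivable_cst.
rewrite (_ : 'D_v _ = fun=> 0) //.
by apply/funext => x; rewrite derive_cst.
Qed.

Lemma Ck_id V k (U : set V) : Ck k U (@id V).
Proof.
have cid (x : V) : U x -> {for x, continuous (@id V)} by move=> _; exact: cvg_id.
case: k => [|k]; split=> // v; split; first by move=> x _; exact: derivable_id.
rewrite (_ : 'D_v _ = fun=> v); first exact: Ck_cst.
by apply/funext => x; rewrite derive_id.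
Qed.

Lemma CkD V W k (U : set V) (f g : V -> W) : open U ->
  Ck k U f -> Ck k U g -> Ck k U (fun x => f x + g x).
Proof.
move=> oU; elim: k f g => [|k IH] f g [cf df] [cg dg];
  (split; first by move=> x Ux; apply: cvgD; [exact: cf|exact: cg]) => //.
move=> v; have [dfv Cf] := df v; have [dgv Cg] := dg v; split.
  by move=> x Ux; apply: (@derivableD _ _ _ f g); [exact: dfv|exact: dgv].
apply: Ck_ext (IH _ _ Cf Cg) => // x Ux.
by rewrite -(@deriveD _ _ _ f g)//; [exact: dfv|exact: dgv].
Qed.

Lemma CkN V W k (U : set V) (f : V -> W) : open U ->
  Ck k U f -> Ck k U (fun x => - f x).
Proof.
move=> oU; elim: k f => [|k IH] f [cf df];
  (split; first by move=> x Ux; apply: cvgN; exact: cf) => //.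
move=> v; have [dfv Cf] := df v; split.
  by move=> x Ux; apply: (@derivableN _ _ _ f); exact: dfv.
apply: Ck_ext (IH _ Cf) => // x Ux.
by rewrite -(@deriveN _ _ _ f)//; exact: dfv.
Qed.

Lemma CkB V W k (U : set V) (f g : V -> W) : open U ->
  Ck k U f -> Ck k U g -> Ck k U (fun x => f x - g x).
Proof. by move=> oU Cf Cg; apply: CkD => //; apply: CkN. Qed.

Lemma CkM V k (U : set V) (f g : V -> R) : open U ->
  Ck k U f -> Ck k U g -> Ck k U (fun x => f x * g x).
Proof.
move=> oU; elim: k f g => [|k IH] f g Cf Cg.
  split=> // x Ux; apply: cvgM; [exact: (Ck_continuous Cf)|exact: (Ck_continuous Cg)].
split; first by move=> x Ux; apply: cvgM; [exact: (Ck_continuous Cf)|exact: (Ck_continuous Cg)].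
move=> v; split.
  move=> x Ux; apply: (@derivableM _ _ f g).
    exact: (Ck_derivable Cf).
  exact: (Ck_derivable Cg).
have C1 := IH _ _ (CkS Cf) (Ck_derive Cg v).
have C2 := IH _ _ (CkS Cg) (Ck_derive Cf v).
apply: Ck_ext (CkD oU C1 C2) => // x Ux.
by rewrite -[LHS](@deriveM _ _ f g)//;
  [exact: (Ck_derivable Cf)|exact: (Ck_derivable Cg)].
Qed.

Lemma continuous_mx (T : topologicalType) m n (f : T -> 'M[R]_(m, n)) x :
  (forall i j, {for x, continuous (fun y => f y i j)}) -> {for x, continuous f}.
Proof.
move=> cf; apply/cvgrPdist_le => /= e e0; near=> y.
rewrite /Num.Def.normr/= mx_normrE (bigmax_le _ (ltW e0))//= => i _.
rewrite !mxE/=; move: i; near: y; apply: filter_forall => /= i.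
exact: ((cvgrPdist_le _ _).1 (cf i.1 i.2)).
Unshelve. all: by end_near. Qed.

Lemma Ck_mx V m n k (U : set V) (f : V -> 'M[R]_(m, n)) : open U ->
  Ck k U f <-> forall i j, Ck k U (fun x => f x i j).
Proof.
move=> oU; elim: k f => [|k IH] f; split.
- move=> [cf _] i j; split=> // x Ux.
  apply: (@continuous_comp _ _ _ f (fun M : 'M[R]_(m, n) => M i j)); first exact: cf.
  exact: coord_continuous.
- by move=> Cf; split=> // x Ux; apply: continuous_mx => i j; exact: Ck_continuous (Cf i j) Ux.
- move=> [cf df] i j; split.
    move=> x Ux.
    apply: (@continuous_comp _ _ _ f (fun M : 'M[R]_(m, n) => M i j)); first exact: cf.
    exact: coord_continuous.
  move=> v; have [dfv /IH Cf] := df v; split.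
    by move=> x Ux; have /derivable_mxP := dfv x Ux; exact.
  apply: Ck_ext (Cf i j) => // x Ux.
  by rewrite derive_mx ?mxE//; exact: dfv.
- move=> Cf; split.
    by move=> x Ux; apply: continuous_mx => i j; exact: Ck_continuous (Cf i j) Ux.
  move=> v; have dfv x : U x -> derivable f x v.
    by move=> Ux; apply/derivable_mxP => i j; exact: (Ck_derivable (Cf i j)).
  split=> //; apply/IH => i j.
  apply: Ck_ext (Ck_derive (Cf i j) v) => // x Ux.
  by rewrite derive_mx ?mxE//; exact: dfv.
Qed.

Lemma Ck_rv V n k (U : set V) (f : V -> 'rV[R]_n) : open U ->
  (forall j, Ck k U (fun x => f x ord0 j)) -> Ck k U f.
Proof. by move=> oU H; apply/Ck_mx => // i j; rewrite (ord1 i). Qed.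

Lemma CkZ V m n k (U : set V) (f : V -> R) (g : V -> 'M[R]_(m, n)) : open U ->
  Ck k U f -> Ck k U g -> Ck k U (fun x => f x *: g x).
Proof.
move=> oU Cf Cg; apply/Ck_mx => // i j.
apply: (@Ck_ext _ _ k U (fun x => f x * g x i j)) => //.
  by move=> x Ux; rewrite mxE.
by apply: CkM => //; move/(Ck_mx k g oU): Cg; exact.
Qed.

Lemma Ck_coord m n k (U : set 'M[R]_(m, n)) i j : open U -> Ck k U (fun x => x i j).
Proof. by move=> oU; have /(Ck_mx k id oU) := Ck_id k U; exact. Qed.

Lemma Ck_sum V W (I : Type) (r : seq I) (P : pred I) k (U : set V) (f : I -> V -> W) :
  open U -> (forall i, P i -> Ck k U (f i)) -> Ck k U (fun x => \sum_(i <- r | P i) f i x).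
Proof.
move=> oU Cf; elim: r => [|a r IH].
  by apply: Ck_ext (Ck_cst k U 0) => // x _; rewrite big_nil.
case Pa : (P a).
  by apply: Ck_ext (CkD oU (Cf a Pa) IH) => // x _; rewrite big_cons Pa.
by apply: Ck_ext IH => // x _; rewrite big_cons Pa.
Qed.

End CkBasics.

(** * Differentiability and a coordinatewise mean value theorem *)

Section ChainRule.
Context {R : realType}.
Implicit Types V W : normedModType R.

Lemma coord_le_norm m n (x : 'M[R]_(m, n)) i j : `|x i j| <= `|x|.
Proof.
rewrite [leRHS]/Num.Def.normr/= mx_normrE.
exact: (@le_bigmax _ _ _ 0 (fun ij : 'I_m * 'I_n => `|x ij.1 ij.2|) (i, j)).
Qed.

Lemma norm_le_coord m n (x : 'M[R]_(m, n)) e :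
  0 <= e -> (forall i j, `|x i j| <= e) -> `|x| <= e.
Proof.
by move=> e0 H; rewrite [leLHS]/Num.Def.normr/= mx_normrE; apply: bigmax_le => // -[].
Qed.

(** The differential is obtained by a choice among continuous linear maps with a little-o expansion;
    an epsilon estimate for one such map makes that choice succeed. *)
Lemma differentiable_near V W (f : V -> W) x (df : {linear V -> W}) :
  continuous df ->
  (forall e, 0 < e -> \forall h \near 0, `|f (h + x) - f x - df h| <= e * `|h|) ->
  differentiable f x.
Proof.
move=> cdf H; apply/diffP => /=.
apply: (@getPex _ (fun (df : {linear V -> W}) => continuous df /\
  forall y, f y = f (lim (nbhs x)) + df (y - lim (nbhs x))
                  +o_(y \near x) (y - lim (nbhs x)))).
have E : f = (fun y => f x + df (y - x)) +o_ (nbhs x) (fun y => y - x).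
  apply/eqaddoP => e e0; have {H} := H e e0.
  rewrite nearE => /nbhs_norm0P [d /= d0 Hd]; apply/nbhs_normP.
  exists d => //= y /= xy; have := Hd (y - x); rewrite /= distrC xy => /(_ isT).
  by rewrite subrK /GRing.add/= /GRing.opp/= opprD addrA.
exists df; split=> // y; rewrite lim_id//.
exact: (congr1 (fun F => F y) E).
Qed.

(** The step from [y] to [y + d] is made one coordinate at a time, with the one-variable mean value
    theorem on each edge. In the sup norm every edge stays within [|d|] of [y]. *)
Lemma rv_mvt n (f : 'rV[R]_n -> R) (y d : 'rV[R]_n) :
  (forall z, `|z - y| <= `|d| -> forall j, derivable f z (delta_mx ord0 j)) ->
  exists xi : 'I_n -> 'rV[R]_n, (forall j, `|xi j - y| <= `|d|) /\
    f (y + d) - f y = \sum_j d ord0 j * 'D_(delta_mx ord0 j) f (xi j).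
Proof.
move=> df.
(* [p m] keeps the first [m] coordinates of [d]; the increments telescope. *)
pose p (m : nat) : 'rV[R]_n := \row_i (if (i < m)%N then d ord0 i else 0).
have pn : p n = d by apply/rowP => i; rewrite mxE ltn_ord.
have p0 : p 0%N = 0 by apply/rowP => i; rewrite !mxE.
have pS (j : 'I_n) : p j.+1 = p j + d ord0 j *: delta_mx ord0 j.
  apply/rowP => i; rewrite !mxE ltnS leq_eqVlt eqxx/= -val_eqE/=.
  by case: (ltngtP i j) => [||/ord_inj ->]; rewrite ?(mulr0,mulr1,addr0,add0r).
have step (j : 'I_n) : exists xi, `|xi - y| <= `|d| /\
    f (y + p j.+1) - f (y + p j) = d ord0 j * 'D_(delta_mx ord0 j) f xi.
  have bnd (t : R) : `|t| <= `|d ord0 j| ->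
      `|y + p j + t *: delta_mx ord0 j - y| <= `|d|.
    move=> tj; rewrite -[y + _ + _]addrA [X in `|X|]addrC addKr.
    apply: norm_le_coord => // a i; rewrite (ord1 a) !mxE eqxx/=.
    have [<-|ij] := eqVneq i j.
      by rewrite ltnn mulr1 add0r; exact: le_trans tj (coord_le_norm _ _ _).
    rewrite mulr0 addr0; case: ifP => _; last by rewrite normr0.
    exact: coord_le_norm.
  pose g (t : R) := f (y + p j + t *: delta_mx ord0 j).
  have dg (t : R) : `|t| <= `|d ord0 j| ->
      is_derive t (1 : R) g ('D_(delta_mx ord0 j) f (y + p j + t *: delta_mx ord0 j)).
    move=> tj; have := df _ (bnd t tj) j.
    set z := _ + _ *: _ => dfz.
    have E : (fun h => g (h + t)) = (fun h => f (h *: delta_mx ord0 j + z)).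
      by apply/funext => h; rewrite /g /z scalerDl addrCA.
    have -> : t = 0 + t by rewrite add0r.
    split.
      apply/derivable1P; rewrite add0r.
      rewrite (_ : (fun h => _) = (fun h => f (h *: delta_mx ord0 j + z))); last first.
        by rewrite -E; apply/funext => h; rewrite [h%:A]mulr1.
      by move/derivable1P : dfz.
    rewrite add0r /derive.
    rewrite (_ : (fun h : R => h^-1 *: ((g \o shift t) (h *: (1 : R)) - g t)) =
      (fun h => h^-1 *: ((f \o shift z) (h *: delta_mx ord0 j) - f z))) //.
    apply/funext => h /=; rewrite [h%:A]mulr1.
    by have /(congr1 (fun F => F h)) /= -> := E; rewrite /g.
  have [d0|d0] := leP 0 (d ord0 j).
    have dgc (t : R) : t \in `[0, d ord0 j] -> `|t| <= `|d ord0 j|.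
      by rewrite in_itv/= => /andP[t0 td]; rewrite !ger0_norm.
    have [|c /dgc cd E] := MVT_segment d0 (fun t tI => dg t (dgc t (subset_itv_oo_cc tI))).
    - apply: derivable_within_continuous => t /dgc /dg [].
      by [].
    - by exists (y + p j + c *: delta_mx ord0 j); split; [exact: bnd|];
        move: E; rewrite /g scale0r addr0 pS addrA => ->; rewrite subr0 mulrC.
  have dgc (t : R) : t \in `[d ord0 j, 0] -> `|t| <= `|d ord0 j|.
    by rewrite in_itv/= => /andP[t0 td]; rewrite !ler0_norm ?lerN2// ltW.
  have [|c /dgc cd E] := MVT_segment (ltW d0) (fun t tI => dg t (dgc t (subset_itv_oo_cc tI))).
  - apply: derivable_within_continuous => t /dgc /dg [].
    by [].
  - exists (y + p j + c *: delta_mx ord0 j); split; [exact: bnd|].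
    move: E; rewrite /g scale0r addr0 pS addrA => E.
    by rewrite -opprB E sub0r mulrN opprK mulrC.
have [xi Hxi] := choice step.
exists xi; split=> [j|]; first by have [] := Hxi j.
transitivity (\sum_(j < n) (f (y + p j.+1) - f (y + p j))); last first.
  by apply: eq_bigr => j _; have [] := Hxi j.
rewrite -(big_mkord xpredT (fun j => f (y + p j.+1) - f (y + p j))).
by rewrite telescope_sumr// pn p0 addr0.
Qed.

End ChainRule.

(** * The chain rule and composition in class C^k *)

Section Composition.
Context {R : realType}.
Implicit Types V W : normedModType R.

(** Continuous partial derivatives differ little between [x] and the intermediate points of
    [rv_mvt], which gives the first-order expansion. *)
Lemma Ck1_near n (U : set 'rV[R]_n) (f : 'rV[R]_n -> R) x e :
  open U -> Ck 1 U f -> U x -> 0 < e ->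
  \forall h \near (0 : 'rV[R]_n), `|f (h + x) - f x -
    \sum_j h ord0 j * 'D_(delta_mx ord0 j) f x| <= e * `|h|.
Proof.
move=> oU Cf Ux e0.
(* An equal share of [e] for each coordinate; [n.+1] covers dimension 0. *)
have e1 : 0 < e / n.+1%:R by rewrite divr_gt0.
have : \forall z \near x, U z /\ forall j,
    `|'D_(delta_mx ord0 j) f x - 'D_(delta_mx ord0 j) f z| <= e / n.+1%:R.
  near=> z; split; first by near: z; exact: open_nbhs_nbhs.
  near: z; apply: filter_forall => j.
  have := Ck_continuous (Ck_derive Cf (delta_mx ord0 j)) Ux.
  by move/cvgrPdist_le; exact.
move=> /nbhs_normP [d /= d0 Hd]; apply/nbhs_norm0P.
exists d => //= h hd.
have hball z : `|z - x| <= `|h| -> U z /\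
    forall j, `|'D_(delta_mx ord0 j) f x - 'D_(delta_mx ord0 j) f z| <= e / n.+1%:R.
  by move=> zh; apply: Hd => /=; rewrite distrC; exact: le_lt_trans zh hd.
have [z zh|xi [Hxi]] := @rv_mvt R n f x h.
  by move=> j; apply: (Ck_derivable Cf); have [] := hball z zh.
rewrite [h + x]addrC => ->; rewrite -sumrB.
apply: le_trans (ler_norm_sum _ _ _) _.
apply: (@le_trans _ _ (\sum_(j < n) `|h| * (e / n.+1%:R))).
  apply: ler_sum => j _; rewrite -mulrBr normrM ler_pM//.
    exact: coord_le_norm.
  by rewrite distrC; have [_] := hball _ (Hxi j); exact.
rewrite sumr_const card_ord -[_ *+ n]mulr_natr -mulrA [leRHS]mulrC ler_wpM2l//.
by rewrite -mulrA ler_piMr ?(ltW e0)// mulrC ler_pdivrMr// mul1r ler_nat.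
Unshelve. all: by end_near. Qed.

Lemma Ck1_differentiable n (U : set 'rV[R]_n) (f : 'rV[R]_n -> R) x :
  open U -> Ck 1 U f -> U x -> differentiable f x.
Proof.
move=> oU Cf Ux.
pose a j := 'D_(delta_mx ord0 j) f x.
pose df (h : 'rV[R]_n) : R := \sum_j h ord0 j * a j.
have dfl : linear df.
  move=> c u v; rewrite /df scaler_sumr -big_split/=; apply: eq_bigr => j _.
  by rewrite !mxE mulrDl -mulrA.
pose dfL : {linear 'rV[R]_n -> R} := HB.pack df (GRing.isLinear.Build _ _ _ _ df dfl).
have cdf : continuous dfL.
  have C0 : Ck 0 setT df.
    apply: Ck_sum => [|j _]; first exact: openT.
    apply: CkM; [exact: openT|apply: Ck_coord; exact: openT|exact: Ck_cst].
  by move=> y; exact: (Ck_continuous C0).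
by apply: (differentiable_near cdf) => e e0; exact: (Ck1_near oU Cf Ux e0).
Qed.

(** [g] is only assumed derivable along [v], so [f \o g] is restricted to the line through [x] in
    direction [v], where derivable means differentiable. *)
Lemma is_derive_chain V V' W (f : V' -> W) (g : V -> V') x v :
  differentiable f (g x) -> derivable g x v ->
  is_derive x v (f \o g) ('D_('D_v g x) f (g x)).
Proof.
move=> df dg.
pose c (h : R) := g (h *: v + x).
have c0 : c 0 = g x by rewrite /c scale0r add0r.
have dc : derivable c (0 : R) (1 : R) by exact: (derivable1P g x v).1 dg.
have Dc : 'D_(1 : R) c (0 : R) = 'D_v g x.
  rewrite /derive (_ : (fun h : R => h^-1 *: ((c \o shift 0) (h *: (1 : R)) - c 0)) =
    (fun h => h^-1 *: ((g \o shift x) (h *: v) - g x))) //.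
  by apply/funext => h /=; rewrite c0 addr0 /c [h%:A]mulr1.
have dfc : differentiable (f \o c) (0 : R).
  by apply: differentiable_comp; [exact/derivable1_diffP|rewrite c0].
split.
  by apply: (derivable1P (f \o g) x v).2; exact: (derivable1_diffP (f \o c) (0 : R)).2.
transitivity ('D_(1 : R) (f \o c) (0 : R)).
  rewrite /derive.
  rewrite (_ : (fun h : R => h^-1 *: ((f \o c \o shift 0) (h *: (1 : R)) - (f \o c) 0)) =
    (fun h => h^-1 *: ((f \o g \o shift x) (h *: v) - (f \o g) x))) //.
  by apply/funext => h /=; rewrite c0 addr0 /c [h%:A]mulr1.
rewrite deriveE// diff_comp//; [|exact/derivable1_diffP|by rewrite c0].
rewrite /= -[X in 'd f _ X]deriveE; last exact/derivable1_diffP.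
by rewrite Dc c0 [RHS]deriveE.
Qed.

Lemma derive_sum_coord n (f : 'rV[R]_n -> R) y (w : 'rV[R]_n) :
  differentiable f y ->
  'D_w f y = \sum_j w ord0 j * 'D_(delta_mx ord0 j) f y.
Proof.
move=> df; rewrite deriveE// [in LHS](row_sum_delta w) linear_sum/=.
by apply: eq_bigr => j _; rewrite linearZ/= deriveE.
Qed.

(** Induction on [k]: the derivative along [v] is a sum of coordinates of ['D_v g] times partial
    derivatives of [f] at [g x]. *)
Lemma Ck_comp V n k (U : set V) (U' : set 'rV[R]_n) (f : 'rV[R]_n -> R) (g : V -> 'rV[R]_n) :
  open U -> open U' -> (forall x, U x -> U' (g x)) ->
  Ck k U' f -> Ck k U g -> Ck k U (fun x => f (g x)).
Proof.
move=> oU oU' UU'; elim: k f => [|k IH] f Cf Cg.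
  split=> // x Ux; apply: (@continuous_comp _ _ _ g f).
    exact: Ck_continuous Cg Ux.
  by apply: (Ck_continuous Cf); exact: UU'.
have dfg x v : U x -> is_derive x v (fun x => f (g x)) ('D_('D_v g x) f (g x)).
  move=> Ux; apply: is_derive_chain; last exact: (Ck_derivable Cg).
  apply: (Ck1_differentiable oU' _ (UU' _ Ux)).
  elim: (k) Cf => // k' IHk Cf; apply: IHk; exact: CkS.
split.
  move=> x Ux; apply: (@continuous_comp _ _ _ g f).
    exact: Ck_continuous Cg Ux.
  by apply: (Ck_continuous Cf); exact: UU'.
move=> v; split; first by move=> x Ux; have [] := dfg x v Ux.
apply: (@Ck_ext _ _ _ k U (fun x => \sum_j 'D_v g x ord0 j * 'D_(delta_mx ord0 j) f (g x))) => //.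
  move=> x Ux; have [_ ->] := dfg x v Ux.
  rewrite derive_sum_coord//.
  apply: (Ck1_differentiable oU' _ (UU' _ Ux)).
  elim: (k) Cf => // k' IHk Cf; apply: IHk; exact: CkS.
apply: Ck_sum => // j _; apply: CkM => //.
  exact: (Ck_mx k ('D_v g) oU).1 (Ck_derive Cg v) _ _.
by apply: (IH ('D_(delta_mx ord0 j) f)); [exact: Ck_derive|exact: CkS].
Qed.

Lemma Ck_comp_mx V n p q k (U : set V) (U' : set 'rV[R]_n) (f : 'rV[R]_n -> 'M[R]_(p, q))
    (g : V -> 'rV[R]_n) :
  open U -> open U' -> (forall x, U x -> U' (g x)) ->
  Ck k U' f -> Ck k U g -> Ck k U (fun x => f (g x)).
Proof.
move=> oU oU' UU' Cf Cg; apply/Ck_mx => // i j.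
by apply: (@Ck_comp _ _ _ _ _ (fun y => f y i j) g oU oU') => //; apply: (Ck_mx k f oU').1.
Qed.

Lemma Ck_comp1 V k (U : set V) (U' : set R) (f : R -> R) (g : V -> R) :
  open U -> open U' -> (forall x, U x -> U' (g x)) ->
  Ck k U' f -> Ck k U g -> Ck k U (fun x => f (g x)).
Proof.
move=> oU oU' UU'; elim: k f => [|k IH] f Cf Cg.
  split=> // x Ux; apply: (@continuous_comp _ _ _ g f).
    exact: Ck_continuous Cg Ux.
  by apply: (Ck_continuous Cf); exact: UU'.
have df x : U x -> differentiable f (g x).
  by move=> Ux; apply/derivable1_diffP; apply: (Ck_derivable Cf); exact: UU'.
have dfg x v : U x -> is_derive x v (fun x => f (g x)) ('D_('D_v g x) f (g x)).
  by move=> Ux; apply: is_derive_chain; [exact: df|exact: (Ck_derivable Cg)].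
split.
  move=> x Ux; apply: (@continuous_comp _ _ _ g f).
    exact: Ck_continuous Cg Ux.
  by apply: (Ck_continuous Cf); exact: UU'.
move=> v; split; first by move=> x Ux; have [] := dfg x v Ux.
apply: (@Ck_ext _ _ _ k U (fun x => 'D_v g x * 'D_1 f (g x))) => //.
  move=> x Ux; have [_ ->] := dfg x v Ux.
  have -> : 'D_('D_v g x) f (g x) = 'd f (g x) ('D_v g x *: (1 : R)).
    by rewrite [_ *: _]mulr1 deriveE//; exact: df.
  by rewrite linearZ/= -deriveE//; exact: df.
apply: CkM => //; first exact: Ck_derive.
by apply: (IH ('D_1 f)); [exact: Ck_derive|exact: CkS].
Qed.

Lemma Ck_comp1_mx V p q k (U : set V) (U' : set R) (f : R -> 'M[R]_(p, q)) (g : V -> R) :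
  open U -> open U' -> (forall x, U x -> U' (g x)) ->
  Ck k U' f -> Ck k U g -> Ck k U (fun x => f (g x)).
Proof.
move=> oU oU' UU' Cf Cg; apply/Ck_mx => // i j.
by apply: (@Ck_comp1 _ _ _ _ (fun y => f y i j) g oU oU') => //; apply: (Ck_mx k f oU').1.
Qed.

End Composition.

Definition Cinf (R : realType) (V W : normedModType R) (U : set V) (f : V -> W) :=
  forall k, Ck k U f.

(** * Inverse, square root and a smooth step function *)

Section Elementary.
Context {R : realType}.
Implicit Types V W : normedModType R.

Lemma CkSR k (U : set R) (f f' : R -> R) : open U ->
  (forall x, U x -> is_derive x (1 : R) f (f' x)) -> Ck k U f' -> Ck k.+1 U f.
Proof.
move=> oU df Cf'.
have dif x : U x -> differentiable f x.
  by move=> Ux; apply/derivable1_diffP; have [] := df x Ux.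
split; first by move=> x Ux; apply: differentiable_continuous; exact: dif.
move=> v; split; first by move=> x Ux; apply: diff_derivable; exact: dif.
apply: (@Ck_ext _ _ _ _ _ (fun x => v * f' x)) => //; last first.
  by apply: CkM => //; exact: Ck_cst.
move=> x Ux; rewrite deriveE; last exact: dif.
rewrite (_ : v = v *: (1 : R)); last by rewrite [_ *: _]mulr1.
rewrite linearZ/= -deriveE; last exact: dif.
by have [_ ->] := df x Ux; rewrite [_ *: 1]mulr1.
Qed.

Lemma open_neq0 : open [set x : R | x != 0].
Proof. exact: open_neq. Qed.

Lemma open_gtr (a : R) : open [set x : R | a < x].
Proof. exact: open_gt. Qed.

Lemma Ck_inv k : Ck k [set x : R | x != 0] (fun x => x^-1).
Proof.
have d x : x != 0 -> is_derive x (1 : R) (fun x => x^-1) (- (x^-1 * x^-1)).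
  move=> x0.
  have := @derivableV R R id x 1 x0 (@derivable_id _ _ _ _).
  have := @deriveV R R id x 1 x0 (@derivable_id _ _ _ _).
  rewrite derive_id => E D; split=> //.
  rewrite [LHS]E [_ *: _]mulr1; congr (- _).
  by rewrite exprSr expr1 invfM.
elim: k => [|k IH].
  split=> // x /= x0; apply: differentiable_continuous.
  by apply/derivable1_diffP; have [] := d x x0.
apply: (CkSR open_neq0 d); apply: CkN; first exact: open_neq0.
by apply: CkM => //; exact: open_neq0.
Qed.

Lemma CkV V k (U : set V) (f : V -> R) : open U -> (forall x, U x -> f x != 0) ->
  Ck k U f -> Ck k U (fun x => (f x)^-1).
Proof. by move=> oU f0 Cf; apply: (Ck_comp1 oU open_neq0 f0 _ Cf); exact: Ck_inv. Qed.

Lemma Ck_sqrt0 k : @Ck R R R k [set x : R | 0 < x] (fun x => Num.sqrt x).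
Proof.
have d (x : R) : 0 < x -> is_derive x (1 : R) Num.sqrt (2 * Num.sqrt x)^-1.
  by move=> x0; exact: is_derive1_sqrt.
elim: k => [|k IH].
  by split=> // x /= x0; apply: sqrt_continuous.
apply: (CkSR (@open_gtr 0) d).
apply: CkV; first exact: open_gtr.
  by move=> x /= x0; rewrite mulf_neq0// gt_eqF// sqrtr_gt0.
by apply: CkM => //; exact: Ck_cst.
Qed.

Lemma Ck_sqrt V k (U : set V) (f : V -> R) : open U -> (forall x, U x -> 0 < f x) ->
  Ck k U f -> Ck k U (fun x => Num.sqrt (f x)).
Proof. by move=> oU f0 Cf; apply: (Ck_comp1 oU (@open_gtr 0) f0 _ Cf); exact: Ck_sqrt0. Qed.

(** The weights x^(-n) close the family under differentiation, so one induction proves all members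
    smooth at once. *)
Definition flat (n : nat) (x : R) : R :=
  if 0 < x then x^-1 ^+ n * expR (- x^-1) else 0.

Lemma flat_le0 n x : x <= 0 -> flat n x = 0.
Proof. by rewrite /flat ltNge => ->. Qed.

Lemma flat_gt0 n x : 0 < x -> 0 < flat n x.
Proof. by move=> x0; rewrite /flat x0 mulr_gt0 ?expR_gt0// exprn_gt0 ?invr_gt0. Qed.

Lemma flat_ge0 n x : 0 <= flat n x.
Proof.
by have [x0|x0] := leP x 0; [rewrite flat_le0|rewrite ltW// flat_gt0].
Qed.

(** From exp(y) >= 1 + y^(n+1)/(n+1)! at y = 1/x: one power more than [flat n] carries leaves a
    factor [x]. *)
Lemma flat_bound n x : flat n x <= (n.+1)`!%:R * `|x|.
Proof.
have [x0|x0] := leP x 0; first by rewrite flat_le0// mulr_ge0.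
rewrite /flat x0 gtr0_norm// expRN.
have y0 : 0 < x^-1 by rewrite invr_gt0.
have := expR_ge1Dxn n (ltW y0).
rewrite ler_pdivrMr ?expR_gt0// => H.
have : x^-1 ^+ n.+1 <= (n.+1)`!%:R * expR x^-1.
  rewrite mulrC -ler_pdivrMr ?ltr0n ?fact_gt0//.
  by apply: le_trans H; rewrite lerDr.
rewrite exprS => H2.
rewrite -(ler_pM2l y0); apply: le_trans H2 _.
rewrite le_eqVlt; apply/orP; left; apply/eqP; field.
by rewrite gt_eqF.
Qed.

Lemma is_derive_flat n x : is_derive x (1 : R) (flat n) (flat n.+2 x - n%:R * flat n.+1 x).
Proof.
have [x0|x0|->] := ltgtP x 0.
- apply: (@near_eq_is_derive _ _ _ (fun=> 0)).
    near=> y; rewrite flat_le0//; apply: ltW.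
    by near: y; apply: open_nbhs_nbhs; split => //; exact: open_lt.
  by rewrite !flat_le0 ?ltW// mulr0 subr0; exact: is_derive_cst.
- apply: (@near_eq_is_derive R R R (fun y : R => y^-1 ^+ n * expR (- y^-1))).
    near=> y; rewrite /flat ifT//.
    by near: y; apply: open_nbhs_nbhs; split => //; exact: open_gt.
  have x0' : x != 0 by rewrite gt_eqF.
  have dinv : is_derive x (1 : R) (fun y => y^-1) (- (x^-1 * x^-1)).
    have := @derivableV R R id x 1 x0' (@derivable_id _ _ _ _).
    have := @deriveV R R id x 1 x0' (@derivable_id _ _ _ _).
    rewrite derive_id => E D; split=> //.
    rewrite [LHS]E [_ *: _]mulr1; congr (- _).
    by rewrite exprSr expr1 invfM.
  have dpow : is_derive x (1 : R) (fun y => y^-1 ^+ n) (n%:R * x^-1 ^+ n.-1 * - (x^-1 * x^-1)).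
    have := @is_deriveX _ _ (fun y : R => y^-1) n x (1 : R) _ dinv.
    rewrite (_ : (fun y : R => y^-1) ^+ n = (fun y => y^-1 ^+ n)) //.
    by apply/funext => y; rewrite exprfctE.
  have dexp : is_derive x (1 : R) (fun y => expR (- y^-1)) (expR (- x^-1) * (x^-1 * x^-1)).
    have := @is_derive1_comp _ expR (fun y : R => - y^-1) x _ _ (is_derive_expR _)
      (is_deriveN dinv).
    by rewrite opprK.
  have [D E] := is_deriveM dpow dexp; split=> //.
  rewrite [LHS]E /flat x0.
  rewrite -[_ *: _ + _ *: _]/(_ * _ + _ * _).
  case: n {dpow D E} => [|n] /=; first by rewrite !mul0r !expr0 mulr0 addr0 mul1r subr0 !exprS expr0 mulr1 mulrC.
  rewrite !exprS; ring.
- rewrite [flat n.+2 0]flat_le0// [flat n.+1 0]flat_le0// mulr0 subr0.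
  (* For [h > 0] the difference quotient at 0 is [flat n.+1 h], which [flat_bound] squeezes to 0. *)
  have lim0 : h^-1 *: (flat n (h *: (1 : R) + 0) - flat n 0) @[h --> (0 : R)^'] --> (0 : R).
    apply/cvgrPdist_le => /= e e0.
    have c0 : 0 < (n.+2)`!%:R :> R by rewrite ltr0n fact_gt0.
    near=> h.
    have h0 : h != 0 by near: h; exact: nbhs_dnbhs_neq.
    rewrite [flat n 0]flat_le0// subr0 sub0r normrN addr0 [h *: 1]mulr1.
    apply: (@le_trans _ _ ((n.+2)`!%:R * `|h|)); last first.
      rewrite mulrC -ler_pdivlMr//.
      by near: h; apply: dnbhs0_le; rewrite divr_gt0.
    apply: le_trans (flat_bound n.+1 h).
    have [h1|h1] := leP h 0; first by rewrite flat_le0// scaler0 normr0 flat_ge0.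
    rewrite ger0_norm ?mulr_ge0 ?flat_ge0 ?invr_ge0 ?(ltW h1)//.
    by rewrite /flat h1 exprS -mulrA.
  split; first by apply/cvg_ex; exists 0.
  exact: cvg_lim lim0.
Unshelve. all: by end_near. Qed.

Lemma Ck_flat k n : Ck k setT (flat n).
Proof.
elim: k n => [|k IH] n.
  split=> // x _; apply: differentiable_continuous.
  by apply/derivable1_diffP; have [] := is_derive_flat n x.
apply: (CkSR openT (fun x _ => is_derive_flat n x)).
apply: CkB; [exact: openT|exact: IH|].
by apply: CkM; [exact: openT|exact: Ck_cst|exact: IH].
Qed.

(** The usual smooth transition from 0 on [x <= 0] to 1 on [x >= 1]. *)
Definition step (x : R) : R := flat 0 x / (flat 0 x + flat 0 (1 - x)).

Lemma step_den_gt0 x : 0 < flat 0 x + flat 0 (1 - x).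
Proof.
have [x0|x0] := leP x 0.
  by rewrite ltr_wpDl ?flat_ge0// flat_gt0// subr_gt0 (le_lt_trans x0).
by rewrite ltr_wpDr ?flat_ge0// flat_gt0.
Qed.

Lemma step_le0 x : x <= 0 -> step x = 0.
Proof. by move=> x0; rewrite /step flat_le0// mul0r. Qed.

Lemma step_ge1 x : 1 <= x -> step x = 1.
Proof.
move=> x1; rewrite /step [flat 0 (1 - x)]flat_le0 ?subr_le0// addr0 divff//.
by rewrite gt_eqF// flat_gt0// (lt_le_trans _ x1).
Qed.

Lemma step_ge0 x : 0 <= step x.
Proof. by rewrite divr_ge0 ?flat_ge0// ltW// step_den_gt0. Qed.

Lemma step_le1 x : step x <= 1.
Proof. by rewrite ler_pdivrMr ?step_den_gt0// mul1r lerDl flat_ge0. Qed.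

Lemma step_gt0 x : 0 < x -> 0 < step x.
Proof. by move=> x0; rewrite divr_gt0 ?flat_gt0// step_den_gt0. Qed.

Lemma step_lt1 x : x < 1 -> step x < 1.
Proof.
by move=> x1; rewrite ltr_pdivrMr ?step_den_gt0// mul1r ltrDl flat_gt0// subr_gt0.
Qed.

Lemma Ck_flat1B k : Ck k setT (fun x : R => flat 0 (1 - x)).
Proof.
apply: (@Ck_comp1 R R k setT setT (flat 0) (fun x => 1 - x)) => //.
- exact: openT.
- exact: openT.
- exact: Ck_flat.
- by apply: CkB; [exact: openT|exact: Ck_cst|exact: Ck_id].
Qed.

Lemma Ck_step k : Ck k setT step.
Proof.
apply: CkM; [exact: openT|exact: Ck_flat|].
apply: CkV; first exact: openT.
  by move=> x _; rewrite gt_eqF// step_den_gt0.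
by apply: CkD; [exact: openT|exact: Ck_flat|exact: Ck_flat1B].
Qed.

Lemma step_lt x y : 0 < y -> x < 1 -> x < y -> step x < step y.
Proof.
move=> y0 x1 xy.
have flat_lt u v : 0 < v -> u < v -> flat 0 u < flat 0 v.
  move=> v0 uv; have [u0|u0] := leP u 0; first by rewrite flat_le0// flat_gt0.
  by rewrite /flat u0 v0 !expr0 !mul1r ltr_expR ltrN2 ltf_pV2.
rewrite /step ltr_pdivrMr ?step_den_gt0// mulrAC ltr_pdivlMr ?step_den_gt0//.
have H1 := flat_lt _ _ y0 xy.
have H2 : flat 0 (1 - y) < flat 0 (1 - x) by apply: flat_lt; rewrite ?subr_gt0// ltrD2l ltrN2.
have := flat_ge0 0 x; have := flat_ge0 0 (1 - y).
nra.
Qed.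

Lemma step_nd x y : x <= y -> step x <= step y.
Proof.
rewrite le_eqVlt => /predU1P[->//|xy].
have [y0|y0] := leP y 0; first by rewrite step_le0 ?step_ge0// ltW// (lt_le_trans xy).
have [x1|x1] := leP 1 x; first by rewrite !step_ge1// (le_trans x1)// ltW.
by rewrite ltW// step_lt.
Qed.

End Elementary.

(** * Smooth matrix-valued maps, Jacobians, Lipschitz bounds *)

Section Smooth.
Context {R : realType}.
Implicit Types V W : normedModType R.

Lemma Ck_prod V (I : Type) (r : seq I) (P : pred I) k (U : set V) (f : I -> V -> R) :
  open U -> (forall i, P i -> Ck k U (f i)) -> Ck k U (fun x => \prod_(i <- r | P i) f i x).
Proof.
move=> oU Cf; elim: r => [|a r IH].
  by apply: Ck_ext (Ck_cst k U (1 : R)) => // x _; rewrite big_nil.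
case Pa : (P a).
  by apply: Ck_ext (CkM oU (Cf a Pa) IH) => // x _; rewrite big_cons Pa.
by apply: Ck_ext IH => // x _; rewrite big_cons Pa.
Qed.

Lemma Ck_mulmx V m n p k (U : set V) (f : V -> 'M[R]_(m, n)) (g : V -> 'M[R]_(n, p)) :
  open U -> Ck k U f -> Ck k U g -> Ck k U (fun x => f x *m g x).
Proof.
move=> oU /(Ck_mx _ _ oU) Cf /(Ck_mx _ _ oU) Cg; apply/Ck_mx => // i j.
apply: (@Ck_ext _ _ _ _ _ (fun x => \sum_l f x i l * g x l j)) => //.
  by move=> x _; rewrite mxE.
by apply: Ck_sum => // l _; exact: CkM.
Qed.

Lemma Ck_det V n k (U : set V) (f : V -> 'M[R]_n) :
  open U -> Ck k U f -> Ck k U (fun x => \det (f x)).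
Proof.
move=> oU /(Ck_mx _ _ oU) Cf; apply: Ck_sum => // s _.
apply: CkM => //; first exact: Ck_cst.
by apply: Ck_prod => // i _; exact: Cf.
Qed.

Lemma Ck_adj V n k (U : set V) (f : V -> 'M[R]_n) :
  open U -> Ck k U f -> Ck k U (fun x => \adj (f x)).
Proof.
move=> oU Cf; apply/Ck_mx => // i j.
apply: (@Ck_ext _ _ _ _ _ (fun x => cofactor (f x) j i)) => //.
  by move=> x _; rewrite mxE.
apply: CkM => //; first exact: Ck_cst.
apply: Ck_det => //; apply/Ck_mx => // a b.
apply: (@Ck_ext _ _ _ _ _ (fun x => f x (lift j a) (lift i b))) => //.
  by move=> x _; rewrite !mxE.
exact: (Ck_mx _ _ oU).1.
Qed.

Lemma Ck_invmx V n k (U : set V) (f : V -> 'M[R]_n) :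
  open U -> (forall x, U x -> f x \in unitmx) -> Ck k U f ->
  Ck k U (fun x => invmx (f x)).
Proof.
move=> oU fu Cf.
apply: (@Ck_ext _ _ _ _ _ (fun x => (\det (f x))^-1 *: \adj (f x))) => //.
  by move=> x Ux; rewrite /invmx fu.
apply: CkZ => //; last exact: Ck_adj.
apply: CkV => //; last exact: Ck_det.
by move=> x /fu; rewrite unitmxE unitfE.
Qed.

Lemma mulmx_norm m n (v : 'rV[R]_m) (A : 'M[R]_(m, n)) :
  `|v *m A| <= m%:R * `|v| * `|A|.
Proof.
apply: norm_le_coord; first by rewrite !mulr_ge0.
move=> i j; rewrite mxE; apply: le_trans (ler_norm_sum _ _ _) _.
apply: (@le_trans _ _ (\sum_(l < m) `|v| * `|A|)).
  by apply: ler_sum => l _; rewrite normrM ler_pM// coord_le_norm.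
by rewrite sumr_const card_ord -[_ *+ m]mulr_natl mulrA.
Qed.

Lemma segment_lipschitz V (f : V -> R) (y d : V) C :
  (forall t : R, 0 <= t <= 1 -> derivable f (y + t *: d) d /\
     `|'D_d f (y + t *: d)| <= C) ->
  `|f (y + d) - f y| <= C.
Proof.
move=> H; pose g (t : R) := f (y + t *: d).
have dg (t : R) : 0 <= t <= 1 -> is_derive t (1 : R) g ('D_d f (y + t *: d)).
  move=> /H [dfz _]; set z := y + t *: d in dfz *.
  have E (h : R) : g (h + t) = f (h *: d + z).
    by rewrite /g /z scalerDl addrCA.
  split.
    apply/derivable1P.
    rewrite (_ : (fun h => _) = (fun h => f (h *: d + z))).
      by move/derivable1P : dfz.
    by apply/funext => h; rewrite -E [h%:A]mulr1.
  rewrite /derive.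
  rewrite (_ : (fun h : R => h^-1 *: ((g \o shift t) (h *: (1 : R)) - g t)) =
    (fun h => h^-1 *: ((f \o shift z) (h *: d) - f z))) //.
  by apply/funext => h /=; rewrite [h%:A]mulr1 E.
have oo (t : R) : t \in `]0, 1[%R -> 0 <= t <= 1.
  by rewrite in_itv/= => /andP[/ltW -> /ltW ->].
have [|c /= cI] := MVT_segment ler01 (fun t tI => dg t (oo t tI)).
  apply: derivable_within_continuous => t tI.
  by have [|] := dg t; first by move: tI; rewrite in_itv.
rewrite /g scale0r addr0 scale1r subr0 mulr1 => ->.
by have [|_] := H c; first by move: cI; rewrite in_itv.
Qed.

(** Rows are indexed by source directions, the transpose of the usual convention, because row
    vectors are multiplied from the left: ['D_v F x = v *m jac F x]. *)
Definition jac n m (F : 'rV[R]_n -> 'rV[R]_m) (x : 'rV[R]_n) : 'M[R]_(n, m) :=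
  \matrix_(i, j) 'D_(delta_mx ord0 i) (fun y => F y ord0 j) x.

Lemma Ck_jac n m k (U : set 'rV[R]_n) (F : 'rV[R]_n -> 'rV[R]_m) :
  open U -> Ck k.+1 U F -> Ck k U (jac F).
Proof.
move=> oU CF; apply/Ck_mx => // i j.
apply: (@Ck_ext _ _ _ _ _ ('D_(delta_mx ord0 i) (fun y => F y ord0 j))) => //.
  by move=> x _; rewrite mxE.
by apply: Ck_derive; exact: (Ck_mx _ _ oU).1.
Qed.

Lemma derive_jac n m (U : set 'rV[R]_n) (F : 'rV[R]_n -> 'rV[R]_m) x v :
  open U -> Ck 1 U F -> U x -> 'D_v F x = v *m jac F x.
Proof.
move=> oU CF Ux; apply/rowP => j; rewrite derive_mx ?mxE; last exact: (Ck_derivable CF).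
have CFj := (Ck_mx _ _ oU).1 CF ord0 j.
rewrite derive_sum_coord; last exact: Ck1_differentiable CFj Ux.
by apply: eq_bigr => i _; rewrite mxE.
Qed.

Lemma is_derive_comp n m V (U : set 'rV[R]_n) (F : 'rV[R]_n -> 'rV[R]_m) (g : V -> 'rV[R]_n) x v :
  open U -> Ck 1 U F -> U (g x) -> derivable g x v ->
  is_derive x v (fun y => F (g y)) ('D_v g x *m jac F (g x)).
Proof.
move=> oU CF Ux dg.
have dj j : is_derive x v (fun y => F (g y) ord0 j) ('D_('D_v g x) (fun y => F y ord0 j) (g x)).
  apply: (@is_derive_chain _ _ _ _ (fun y => F y ord0 j) g) => //.
  exact: Ck1_differentiable ((Ck_mx _ _ oU).1 CF ord0 j) Ux.
have D : derivable (fun y => F (g y)) x v.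
  by apply/derivable_mxP => i j; rewrite (ord1 i); have [] := dj j.
split=> //; rewrite -(derive_jac _ oU CF Ux).
have DF : derivable F (g x) ('D_v g x) by exact: (Ck_derivable CF).
apply/rowP => j; rewrite (derive_mx D) (derive_mx DF) !mxE.
by have [_ ->] := dj j.
Qed.

Lemma Ck1_near_mx n m (U : set 'rV[R]_n) (F : 'rV[R]_n -> 'rV[R]_m) x e :
  open U -> Ck 1 U F -> U x -> 0 < e ->
  \forall h \near (0 : 'rV[R]_n), `|F (h + x) - F x - h *m jac F x| <= e * `|h|.
Proof.
move=> oU CF Ux e0.
have H j := Ck1_near oU ((Ck_mx _ _ oU).1 CF ord0 j) Ux e0.
near=> h; apply: norm_le_coord; first by rewrite mulr_ge0// ltW.
move=> i j; rewrite (ord1 i) !mxE.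
rewrite (_ : \sum_j _ = \sum_l h ord0 l * 'D_(delta_mx ord0 l) (fun y => F y ord0 j) x); last first.
  by apply: eq_bigr => l _; rewrite mxE.
move: j; near: h; apply: filter_forall => j; exact: H.
Unshelve. all: by end_near. Qed.

End Smooth.

(** Completeness of matrix spaces, on which the contraction argument of [id_plus_diffeo] rests. *)
HB.instance Definition _ (R : realType) m n := Complete.on 'M[R]_(m, n).

Definition diffeo (R : realType) n (F G : 'rV[R]_n -> 'rV[R]_n) :=
  [/\ Cinf setT F, Cinf setT G, cancel F G & cancel G F].

(** * Global inverses and perturbations of the identity *)

Section Inverse.
Context {R : realType}.

Lemma lipschitz_continuous (V W : normedModType R) (G : V -> W) C : 0 <= C ->
  (forall x y, `|G x - G y| <= C * `|x - y|) -> continuous G.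
Proof.
move=> C0 lipG x; apply/cvgrPdist_le => /= e e0; near=> y.
apply: le_trans (lipG _ _) _.
apply: (@le_trans _ _ ((C + 1) * `|x - y|)); first by rewrite ler_wpM2r// lerDl.
rewrite mulrC -ler_pdivlMr ?ltr_wpDl//.
near: y; apply: cvgr_dist_le; first exact: cvg_id.
by rewrite divr_gt0// ltr_wpDl.
Unshelve. all: by end_near. Qed.

Lemma unitmx_ker n (A : 'M[R]_n) : (forall v : 'rV[R]_n, v *m A = 0 -> v = 0) ->
  A \in unitmx.
Proof.
move=> H; rewrite -row_free_unit -kermx_eq0; apply/eqP/row_matrixP => i.
by rewrite row0; apply: H; rewrite -row_mul mulmx_ker row0.
Qed.

(** The Lipschitz bound turns the expansion of [F] at [G y] into one of [G] at [y], with
    differential [invmx (jac F (G y))]. This formula involves [G] only through its values, so each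
    order of smoothness yields the next. *)
Lemma smooth_inverse n (F G : 'rV[R]_n -> 'rV[R]_n) C : 0 <= C ->
  Cinf setT F -> cancel F G -> cancel G F ->
  (forall x y, `|G x - G y| <= C * `|x - y|) ->
  (forall x, jac F x \in unitmx) -> Cinf setT G.
Proof.
move=> C0 CF FG GF lipG uF.
have contG x : {for x, continuous G} by exact: (lipschitz_continuous C0 lipG).
have dG y w : is_derive y w G (w *m invmx (jac F (G y))).
  set J := jac F (G y).
  suff L : h^-1 *: (G (h *: w + y) - G y) @[h --> (0 : R)^'] --> w *m invmx J.
    by split; [apply/cvg_ex; exists (w *m invmx J)|exact: cvg_lim L].
  apply/cvgrPdist_le => /= e e0.
  (* [K] collects the factors of the final estimate, so that an error [e / K] for [F] becomes [e]
     for [G]; the [+ 1] keeps it positive. *)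
  pose K := n%:R * `|invmx J| * C * `|w| + 1.
  have K0 : 0 < K by rewrite ltr_wpDl// !mulr_ge0.
  have eK : 0 < e / K by rewrite divr_gt0.
  have /nbhs_norm0P [d /= d0 Hd] :=
    @Ck1_near_mx R n n setT F (G y) (e / K) openT (CF 1%N) I eK.
  have Cw : 0 < C * `|w| + 1 by rewrite ltr_wpDl// mulr_ge0.
  near=> h.
  have h0 : h != 0 by near: h; exact: nbhs_dnbhs_neq.
  have h0' : 0 < `|h| by rewrite normr_gt0.
  set D := G (h *: w + y) - G y.
  have Dle : `|D| <= C * (`|h| * `|w|).
    by apply: le_trans (lipG _ _) _; rewrite addrK normrZ.
  have Dd : `|D| < d.
    apply: (le_lt_trans Dle); rewrite mulrCA.
    apply: (@le_lt_trans _ _ (`|h| * (C * `|w| + 1))); first by rewrite ler_wpM2l// lerDl.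
    rewrite -ltr_pdivlMr//.
    by near: h; apply: dnbhs0_lt; rewrite divr_gt0.
  have := Hd D Dd; rewrite subrK GF GF addrK -/J => HD.
  have -> : w *m invmx J - h^-1 *: D = h^-1 *: ((h *: w - D *m J) *m invmx J).
    rewrite mulmxBl mulmxK//; last exact: uF.
    by rewrite -scalemxAl [RHS]scalerBr scalerA mulVf// scale1r.
  rewrite normrZ normfV mulrC ler_pdivrMr//.
  apply: le_trans (mulmx_norm _ _) _.
  apply: (@le_trans _ _ (n%:R * (e / K * `|D|) * `|invmx J|)).
    by rewrite ler_wpM2r// ler_wpM2l.
  apply: (@le_trans _ _ (n%:R * (e / K * (C * (`|h| * `|w|))) * `|invmx J|)).
    by rewrite ler_wpM2r// ler_wpM2l// ler_wpM2l// ltW.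
  rewrite [leLHS](_ : _ = e * `|h| * ((n%:R * `|invmx J| * C * `|w|) / K)); last by ring.
  by rewrite ler_piMr ?mulr_ge0// ?(ltW e0)// ler_pdivrMr// mul1r lerDl.
elim=> [|k IH]; first by split=> // x _; exact: contG.
split; first by move=> x _; exact: contG.
move=> w; split; first by move=> x _; have [] := dG x w.
apply: (@Ck_ext _ _ _ _ _ (fun y => w *m invmx (jac F (G y)))); first exact: openT.
  by move=> y _; have [_ ->] := dG y w.
apply: Ck_mulmx; [exact: openT|exact: Ck_cst|].
apply: Ck_invmx; [exact: openT|by move=> y _; exact: uF|].
apply: (Ck_comp_mx (U' := setT) openT openT) => //.
by apply: Ck_jac; [exact: openT|exact: CF].
Unshelve. all: by end_near. Qed.

Lemma lipschitz_jac n m (V : 'rV[R]_n -> 'rV[R]_m) C : Ck 1 setT V ->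
  (forall x y, `|V x - V y| <= C * `|x - y|) ->
  forall x (v : 'rV[R]_n), `|v *m jac V x| <= C * `|v|.
Proof.
move=> CV lipV x v; apply/ler_addgt0Pr => e e0.
have [->|v0] := eqVneq v 0; first by rewrite mul0mx !normr0 mulr0 add0r ltW.
have v0' : 0 < `|v| by rewrite normr_gt0.
have ev : 0 < e / `|v| by rewrite divr_gt0.
have /nbhs_norm0P [d /= d0 Hd] := Ck1_near_mx openT CV (I : setT x) ev.
pose t := d / 2 / `|v|; have t0 : 0 < t by rewrite !divr_gt0.
have tv : t * `|v| = d / 2 by rewrite /t divfK// gt_eqF.
have H : `|V (t *: v + x) - V x - t *: v *m jac V x| <= e / `|v| * `|t *: v|.
  by apply: Hd; rewrite /= normrZ gtr0_norm// tv ltr_pdivrMr// ltr_pMr// ltr1n.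
rewrite normrZ gtr0_norm// tv in H.
have H2 : `|t *: v *m jac V x| <= C * (t * `|v|) + e / `|v| * (d / 2).
  rewrite -[X in `|X|](subrK (V (t *: v + x) - V x)) addrC.
  apply: le_trans (ler_normD _ _) _; apply: lerD; last by rewrite distrC.
  by apply: le_trans (lipV _ _) _; rewrite addrK normrZ gtr0_norm.
rewrite -scalemxAl normrZ gtr0_norm// in H2.
rewrite -(ler_pM2l t0); apply: le_trans H2 _.
rewrite mulrDr mulrCA; apply: lerD => //.
by rewrite /t le_eqVlt; apply/orP; left; apply/eqP; ring.
Qed.

(** Solving [x + V x = y] is finding a fixed point of the contraction [x |-> y - V x]. The constant
    1/2 also makes the inverse 2-Lipschitz and the Jacobian injective, as [smooth_inverse] wants. *)
Lemma id_plus_diffeo n (V : 'rV[R]_n -> 'rV[R]_n) : Cinf setT V ->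
  (forall x y, `|V x - V y| <= 2^-1 * `|x - y|) ->
  exists G, diffeo (fun x => x + V x) G.
Proof.
move=> CV lipV.
have ex y : exists x, x + V x = y.
  have fs : set_fun setT setT (fun x => y - V x) by [].
  pose f : {fun (setT : set 'rV[R]_n) >-> (setT : set 'rV[R]_n)} := mkfun fs.
  have ctr : is_contraction f.
    exists (2^-1)%:nng; split=> /=; first by rewrite invf_lt1// ltr1n.
    move=> [x z] /= _.
    have -> : y - V x - (y - V z) = V z - V x by rewrite opprB addrC addrA subrK.
    by rewrite distrC; exact: lipV.
  have [|p _ Ep] := banach_fixed_point ctr closedT; first by exists 0.
  by exists p; rewrite {1}Ep /= subrK.
have [G HG] := choice ex.
have GF : cancel G (fun x => x + V x) by [].
have low x y : `|x - y| <= 2 * `|x + V x - (y + V y)|.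
  have := lipV x y.
  have : `|x - y| <= `|x + V x - (y + V y)| + `|V x - V y|.
    rewrite -[x - y](_ : x + V x - (y + V y) - (V x - V y) = _); last first.
      by rewrite opprD addrACA addrK.
    exact: ler_normB.
  by lra.
have FG : cancel (fun x => x + V x) G.
  move=> x; apply/eqP; rewrite -subr_eq0 -normr_le0.
  by apply: le_trans (low _ _) _; rewrite /= HG subrr normr0 mulr0.
have CF : Cinf setT (fun x => x + V x).
  by move=> k; apply: CkD; [exact: openT|exact: Ck_id|exact: CV].
exists G; split=> //.
apply: (@smooth_inverse _ _ _ 2 _ CF FG GF) => //.
  by move=> x y; apply: le_trans (low _ _) _; rewrite !HG.
move=> x; apply: unitmx_ker => v vJ.
have E : v *m jac (fun x => x + V x) x = v + v *m jac V x.
  rewrite -(derive_jac _ openT (CF 1%N) I) -(derive_jac _ openT (CV 1%N) I).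
  rewrite (@deriveD _ _ _ id V) ?derive_id//.
  exact: (Ck_derivable (CV 1%N)).
have H := lipschitz_jac (CV 1%N) lipV x v.
move: vJ; rewrite E => /eqP; rewrite addr_eq0 => /eqP vE.
have vN : `|v| = `|v *m jac V x| by rewrite {1}vE normrN.
by apply/eqP; rewrite -normr_le0; move: H; rewrite -vN; lra.
Qed.

End Inverse.

(** * Bump functions and compactly supported maps *)

Section Bumps.
Context {R : realType}.

Lemma Ck_row_mx (V : normedModType R) k m n (U : set V) (f : V -> 'rV[R]_m) (g : V -> 'rV[R]_n) :
  open U -> Ck k U f -> Ck k U g -> Ck k U (fun x => row_mx (f x) (g x)).
Proof.
move=> oU Cf Cg; apply: Ck_rv => // j; case: (split_ordP j) => i ->.
  apply: (@Ck_ext _ _ _ _ _ (fun x => f x ord0 i)) => //; last exact: (Ck_mx _ _ oU).1.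
  by move=> x _; rewrite row_mxEl.
apply: (@Ck_ext _ _ _ _ _ (fun x => g x ord0 i)) => //; last exact: (Ck_mx _ _ oU).1.
by move=> x _; rewrite row_mxEr.
Qed.

Lemma Ck_scalar_mx (V : normedModType R) k n (U : set V) (f : V -> R) :
  open U -> Ck k U f -> Ck k U (fun x => (f x)%:M : 'M[R]_n).
Proof.
move=> oU Cf; apply/Ck_mx => // i j.
apply: (@Ck_ext _ _ _ _ _ (fun x => f x * (i == j)%:R)) => //.
  by move=> x _; rewrite mxE mulr_natr.
by apply: CkM => //; exact: Ck_cst.
Qed.

Lemma Ck_sqnorm (V : normedModType R) k n (U : set V) (f : V -> 'rV[R]_n) :
  open U -> Ck k U f -> Ck k U (fun x => sqnorm (f x)).
Proof.
move=> oU Cf; apply: Ck_sum => // i _.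
by apply: (@Ck_ext _ _ _ _ _ (fun x => f x ord0 i * f x ord0 i)) => //;
  apply: CkM => //; exact: (Ck_mx _ _ oU).1.
Qed.

Lemma lip_jac n m (F : 'rV[R]_n -> 'rV[R]_m) c : 0 <= c -> Ck 1 setT F ->
  (forall z i j, `|jac F z i j| <= c) ->
  forall x y, `|F x - F y| <= n%:R * c * `|x - y|.
Proof.
move=> c0 CF Fc x y; apply: norm_le_coord; first by rewrite !mulr_ge0.
move=> i j; rewrite (ord1 i) !mxE.
have -> : F x ord0 j = F (y + (x - y)) ord0 j by rewrite addrC subrK.
apply: (@segment_lipschitz R _ (fun z => F z ord0 j)) => t _.
have CFj := (Ck_mx _ _ openT).1 CF ord0 j.
split; first exact: (Ck_derivable CFj).
rewrite derive_sum_coord; last exact: (Ck1_differentiable openT CFj I).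
apply: le_trans (ler_norm_sum _ _ _) _.
apply: (@le_trans _ _ (\sum_(l < n) c * `|x - y|)).
  apply: ler_sum => l _; rewrite normrM mulrC ler_pM//; last exact: coord_le_norm.
  by have := Fc (y + t *: (x - y)) l j; rewrite mxE.
by rewrite sumr_const card_ord -[_ *+ n]mulr_natl mulrA.
Qed.

Lemma dist_continuous (V : normedModType R) (c : V) : continuous (fun z => `|z - c|).
Proof.
move=> z; apply: (@continuous_comp _ _ _ (fun z : V => z - c) (fun z => `|z|)).
  by apply: cvgB; [exact: cvg_id|exact: cvg_cst].
exact: norm_continuous.
Qed.

Lemma open_dist_gt (V : normedModType R) (c : V) M : open [set z | M < `|z - c|].
Proof.
rewrite (_ : [set z | _] = (fun z => `|z - c|) @^-1` [set x | M < x])//.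
by apply: open_comp => [z _|]; [exact: dist_continuous|exact: open_gt].
Qed.

Lemma open_dist_lt (V : normedModType R) (c : V) M : open [set z | `|z - c| < M].
Proof.
rewrite (_ : [set z | _] = (fun z => `|z - c|) @^-1` [set x | x < M])//.
by apply: open_comp => [z _|]; [exact: dist_continuous|exact: open_lt].
Qed.

Lemma compact_ball n (c : 'rV[R]_n) r : compact [set z | `|z - c| <= r].
Proof.
apply: bounded_closed_compact.
  exists (`|c| + r); split; first exact: num_real.
  move=> M rM z /= zr; apply: ltW; apply: le_lt_trans rM.
  by rewrite -[z](subrK c) addrC; apply: le_trans (ler_normD _ _) _; rewrite lerD2l.
have -> : [set z | `|z - c| <= r] = (fun z => `|z - c|) @^-1` [set x | x <= r] by [].
apply: closed_comp; last exact: closed_le.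
by move=> z _; exact: dist_continuous.
Qed.

Lemma compact_bounded (T : topologicalType) (A : set T) (f : T -> R) :
  compact A -> (forall x, A x -> {for x, continuous f}) ->
  exists2 C, 0 <= C & forall x, A x -> `|f x| <= C.
Proof.
move=> cA cf; have [[a Aa]|A0] := pselect (exists a, A a); last first.
  by exists 0 => // x Ax; exfalso; apply: A0; exists x.
have /compact_EVT_max : A !=set0 by exists a.
move=> /(_ R (fun x => `|f x|) cA) [|c _ Hc].
  apply: continuous_in_subspaceT => x /set_mem Ax.
  exact: (continuous_comp (cf x Ax) (@norm_continuous _ _ _)).
exists `|f c| => // x Ax; apply: Hc; exact: mem_set.
Qed.

(** The Jacobian is bounded on the compact ball of radius [M] and vanishes off it. *)
Lemma compact_support_lipschitz n m (F : 'rV[R]_n -> 'rV[R]_m) c M : Ck 1 setT F ->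
  (forall z, M < `|z - c| -> F z = 0) ->
  exists2 C, 0 <= C & forall x y, `|F x - F y| <= C * `|x - y|.
Proof.
move=> CF F0.
have CJ := Ck_jac openT CF.
have bnd (ij : 'I_n * 'I_m) : exists C, 0 <= C /\ forall z, `|z - c| <= M -> `|jac F z ij.1 ij.2| <= C.
  have [|C C0 HC] := @compact_bounded _ _ (fun z => jac F z ij.1 ij.2) (@compact_ball n c M).
    by move=> z _; exact: (Ck_continuous ((Ck_mx _ _ openT).1 CJ ij.1 ij.2) I).
  by exists C.
have [C HC] := choice bnd.
exists (n%:R * \sum_ij C ij).
  by rewrite mulr_ge0// sumr_ge0// => ij _; have [] := HC ij.
apply: lip_jac => //; first by rewrite sumr_ge0// => ij _; have [] := HC ij.
move=> z i j.
have Cij : C (i, j) <= \sum_ij C ij.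
  rewrite (bigD1 (i, j))//= lerDl sumr_ge0// => ij _; by have [] := HC ij.
have [zM|zM] := leP `|z - c| M.
  by apply: le_trans Cij; have [_] := HC (i, j); exact.
rewrite mxE (near_eq_derive (g := fun=> 0)).
  rewrite derive_cst normr0; apply: le_trans Cij; by have [] := HC (i, j).
near=> y; rewrite F0 ?mxE//; near: y.
by apply: open_nbhs_nbhs; split; [exact: open_dist_gt|exact: zM].
Unshelve. all: by end_near. Qed.

(** Squares replace absolute values to keep the profile smooth at 0; it is 1 for |t| <= r and 0 for
    |t| >= r'. *)
Definition bump1 (r r' t : R) : R := step ((r' ^+ 2 - t ^+ 2) / (r' ^+ 2 - r ^+ 2)).

(** A product over coordinates, because the norm is the sup norm: plateau and support are cubes. *)
Definition bump n (c : 'rV[R]_n) (r r' : R) (z : 'rV[R]_n) : R :=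
  \prod_(i < n) bump1 r r' (z ord0 i - c ord0 i).

Lemma Ck_bump k n (c : 'rV[R]_n) r r' : Ck k setT (bump c r r').
Proof.
apply: Ck_prod => [|i _]; first exact: openT.
apply: (@Ck_comp1 _ _ _ _ setT step) => //; [exact: openT|exact: openT|exact: Ck_step|].
apply: CkM; [exact: openT| |exact: Ck_cst].
apply: CkB; [exact: openT|exact: Ck_cst|].
have Cc : Ck k setT (fun z : 'rV[R]_n => z ord0 i - c ord0 i).
  apply: CkB; [exact: openT|apply: Ck_coord; exact: openT|exact: Ck_cst].
by apply: Ck_ext (CkM openT Cc Cc) => [|z _]; [exact: openT|rewrite expr2].
Qed.

Lemma bump_ge0 n (c : 'rV[R]_n) r r' z : 0 <= bump c r r' z.
Proof. by apply: prodr_ge0 => i _; exact: step_ge0. Qed.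

Lemma bump_le1 n (c : 'rV[R]_n) r r' z : bump c r r' z <= 1.
Proof.
by apply: prodr_ile1 => i _; rewrite step_ge0 step_le1.
Qed.

Lemma bump_in n (c : 'rV[R]_n) r r' z : 0 <= r -> r < r' -> `|z - c| <= r ->
  bump c r r' z = 1.
Proof.
move=> r0 rr' zr; apply: big1 => i _; apply: step_ge1.
have d0 : 0 < r' ^+ 2 - r ^+ 2 by rewrite subr_gt0 ltr_pXn2r// nnegrE ltW// (le_lt_trans r0).
rewrite ler_pdivlMr// mul1r lerD2l lerN2.
rewrite -[leLHS]real_normK ?num_real// ler_pXn2r// ?nnegrE//.
by apply: le_trans zr; have := coord_le_norm (z - c) ord0 i; rewrite !mxE.
Qed.

Lemma bump_out n (c : 'rV[R]_n) r r' z : 0 <= r -> r < r' -> r' <= `|z - c| ->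
  bump c r r' z = 0.
Proof.
move=> r0 rr' zr.
have r'0 : 0 < r' by exact: le_lt_trans rr'.
have d0 : 0 < r' ^+ 2 - r ^+ 2 by rewrite subr_gt0 ltr_pXn2r// nnegrE ltW// (le_lt_trans r0).
have [i Hi] : exists i, r' <= `|(z - c) ord0 i|.
  apply: contrapT => H.
  have zc0 : mx_norm (z - c) != 0 by rewrite gt_eqF// (lt_le_trans r'0).
  have [[a i] E] := mx_norm_neq0 zc0.
  by apply: H; exists i; apply: le_trans zr _; move: E; rewrite (ord1 a) /= => <-.
rewrite /bump (bigD1 i)//= /bump1 step_le0 ?mul0r//.
rewrite pmulr_lle0 ?invr_gt0// subr_le0 -[leRHS]real_normK ?num_real//.
by rewrite ler_pXn2r// ?nnegrE// ?(ltW r'0)//; move: Hi; rewrite !mxE.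
Qed.

Lemma bump_lipschitz n (c : 'rV[R]_n) r r' : 0 <= r -> r < r' ->
  exists2 C, 0 <= C & forall x y, `|bump c r r' x - bump c r r' y| <= C * `|x - y|.
Proof.
move=> r0 rr'.
have CF : Ck 1 setT (fun z => (bump c r r' z)%:M : 'rV[R]_1).
  by apply: Ck_scalar_mx; [exact: openT|exact: Ck_bump].
have [z zr|C C0 HC] := @compact_support_lipschitz _ _ _ c r' CF.
  by rewrite bump_out ?(ltW zr)//; apply/matrixP => i j; rewrite !mxE mul0rn.
exists C => // x y; apply: le_trans (HC x y).
by apply: le_trans (coord_le_norm _ ord0 ord0); rewrite !mxE eqxx !mulr1n.
Qed.

End Bumps.

(** * Smooth extension from compact sets; slowly varying cutoffs *)

Section Extension.
Context {R : realType}.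

(** The one property of the source space used for extension, stated apart so as to serve both [R]
    and row vectors. *)
Definition has_bumps (V : normedModType R) := forall (U : set V) (x : V),
  open U -> U x -> exists chi : V -> R, exists N C : set V,
    [/\ Cinf setT chi, open N, N x & (forall y, N y -> chi y = 1)] /\
    [/\ closed C, C `<=` U & forall y, ~ C y -> chi y = 0].

Lemma has_bumps_rV n : has_bumps 'rV[R]_n.
Proof.
move=> U x oU Ux.
have /nbhs_normP [d /= d0 Hd] := open_nbhs_nbhs (conj oU Ux).
exists (bump x (d / 4) (d / 2)), [set y | `|y - x| < d / 4], [set y | `|y - x| <= d / 2].
have d4 : 0 <= d / 4 by rewrite divr_ge0// ltW.
have d42 : d / 4 < d / 2 by lra.
split; split.
- by move=> k; exact: Ck_bump.
- exact: open_dist_lt.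
- by rewrite /= subrr normr0 divr_gt0.
- by move=> y /= /ltW; exact: bump_in.
- rewrite (_ : [set y | _] = ~` [set y | d / 2 < `|y - x|]).
    by apply: open_closedC; exact: open_dist_gt.
  by apply/seteqP; split => y /=; rewrite leNgt => /negP.
- by move=> y /= yx; apply: Hd => /=; rewrite distrC; lra.
- by move=> y /= /negP; rewrite -ltNge => /ltW; exact: bump_out.
Qed.

Lemma norm_scalar_mx1 (t : R) : `|t%:M : 'rV[R]_1| = `|t|.
Proof.
apply/eqP; rewrite eq_le; apply/andP; split.
  by apply: norm_le_coord => // i j; rewrite !ord1 mxE eqxx mulr1n.
by have := coord_le_norm (t%:M : 'rV[R]_1) ord0 ord0; rewrite mxE eqxx mulr1n.
Qed.

Lemma has_bumps_R : has_bumps R.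
Proof.
move=> U x oU Ux.
have oU' : open ((fun v : 'rV[R]_1 => v ord0 ord0) @^-1` U).
  by apply: open_comp => // v _; exact: coord_continuous.
have Ux' : ((fun v : 'rV[R]_1 => v ord0 ord0) @^-1` U) x%:M.
  by rewrite /= mxE eqxx mulr1n.
have [chi [N [C [[Cc oN Nx N1] [cC CU C0]]]]] := has_bumps_rV oU' Ux'.
have Cs : forall k, Ck k setT (fun t : R => t%:M : 'rV[R]_1).
  by move=> k; apply: Ck_scalar_mx; [exact: openT|exact: Ck_id].
have cs (t : R) : {for t, continuous (fun t : R => t%:M : 'rV[R]_1)}.
  exact: (Ck_continuous (Cs 0%N)).
exists (fun t => chi t%:M), ((fun t : R => t%:M) @^-1` N), ((fun t : R => t%:M) @^-1` C).
split; split.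
- by move=> k; apply: (Ck_comp (U' := setT) openT openT) => //; exact: Cc.
- by apply: open_comp => // t _; exact: cs.
- by [].
- by move=> y; exact: N1.
- by apply: closed_comp => // t _; exact: cs.
- by move=> y /CU; rewrite /= mxE eqxx mulr1n.
- by move=> y; exact: C0.
Qed.

(** Along a finite cover the extension is corrected one neighbourhood at a time:
    [(1 - chi) * g + chi * h], with [h] a local extension, is right near a new point and remains
    right wherever [g] already agreed with [f]. *)
Lemma smooth_extension (V : normedModType R) (A : set V) (f : V -> R) :
  has_bumps V -> compact A -> smooth A f ->
  exists g : V -> R, Cinf setT g /\ forall x, A x -> g x = f x.
Proof.
move=> hb cA sf.
have H x : exists p : (V -> R) * set V, A x ->
    [/\ open p.2, p.2 x & forall g : V -> R, Cinf setT g -> exists g' : V -> R,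
      [/\ Cinf setT g', forall y, A y -> p.2 y -> g' y = f y &
       forall y, A y -> g y = f y -> g' y = f y]].
  have [Ax|nAx] := pselect (A x); last by exists (fun=> 0, setT).
  have [U [h [oU Ux Ch hf]]] := sf x Ax.
  have [chi [N [C [[Cc oN Nx N1] [cC CU C0]]]]] := hb U x oU Ux.
  exists (h, N) => _; split=> // g Cg.
  exists (fun y => (1 - chi y) * g y + chi y * h y); split.
  - move=> k; apply: Ck_local => y _.
    have [Cy|nCy] := pselect (C y).
      exists U; split; first exact: CU.
      have Cc' := Ck_sub (@subsetT _ U) (Cc k).
      apply: CkD => //; apply: CkM => //.
        by apply: CkB => //; exact: Ck_cst.
      exact: Ck_sub (@subsetT _ U) (Cg k).
    exists (~` C); split=> //.
    apply: (@Ck_ext _ _ _ _ _ g); first exact: closed_openC.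
      by move=> z /= /C0 ->; rewrite subr0 mul1r mul0r addr0.
    exact: Ck_sub (@subsetT _ _) (Cg k).
  - move=> y Ay /= Ny; rewrite N1// subrr mul0r add0r mul1r.
    apply: hf => //; apply: CU; apply: contrapT => /C0.
    by rewrite N1// => /eqP; rewrite oner_eq0.
  - move=> y Ay gy; have [Cy|/C0 ->] := pselect (C y).
      by rewrite gy (hf y Ay (CU _ Cy)) -mulrDl subrK mul1r.
    by rewrite subr0 mul1r mul0r addr0.
have [p Hp] := choice H.
move: cA; rewrite compact_cover => /(_ _ A (fun x => (p x).2)) [].
- by move=> x Ax; have [] := Hp x Ax.
- by move=> x Ax; exists x => //; have [] := Hp x Ax.
move=> D DA AD.
suff [g [Cg Hg]] : exists g : V -> R, Cinf setT g /\
    forall y, A y -> (exists2 x, x \in (finmap.enum_fset D) & (p x).2 y) -> g y = f y.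
  exists g; split=> // x Ax; apply: Hg => //.
  by have [z zD pz] := AD x Ax; exists z.
have {AD} : forall x, x \in (finmap.enum_fset D) -> A x by move=> x /DA /set_mem.
elim: (finmap.enum_fset D) => [_|a s IH sA].
  by exists (fun=> 0); split; [move=> k; exact: Ck_cst|move=> y _ []].
have [|g [Cg Hg]] := IH _; first by move=> x xs; apply: sA; rewrite inE xs orbT.
have [_ _ /(_ g Cg) [g' [Cg' g'1 g'2]]] := Hp a (sA a (mem_head _ _)).
exists g'; split=> // y Ay [x]; rewrite inE => /predU1P[->|xs] pxy; first exact: g'1.
by apply: g'2 => //; apply: Hg => //; exists x.
Qed.

Lemma smooth_extension_rV (V : normedModType R) n (A : set V) (f : V -> 'rV[R]_n) :
  has_bumps V -> compact A -> smooth A f ->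
  exists g : V -> 'rV[R]_n, Cinf setT g /\ forall x, A x -> g x = f x.
Proof.
move=> hb cA sf.
have H j : exists g : V -> R, Cinf setT g /\ forall x, A x -> g x = f x ord0 j.
  apply: smooth_extension => // x Ax; have [U [g [oU Ux Cg gf]]] := sf x Ax.
  exists U, (fun y => g y ord0 j); split=> //.
    by move=> k; exact: (Ck_mx _ _ oU).1.
  by move=> y Ay Uy; rewrite gf.
have [g Hg] := choice H.
exists (fun x => \row_j g j x); split.
  move=> k; apply: Ck_rv; first exact: openT.
  move=> j; apply: Ck_ext ((Hg j).1 k) => [|x _]; first exact: openT.
  by rewrite mxE.
by move=> x Ax; apply/rowP => j; rewrite mxE; have [_ ->] := Hg j.
Qed.

(** Stretching a bump by [s] divides its Lipschitz constant by [s]. This allows long translations to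
    be cut off while [id_plus_diffeo] still applies. *)
Lemma slow_cutoff n (r eta : R) : 0 <= r -> 0 < eta ->
  exists (chi : 'rV[R]_n -> R) (M : R),
  [/\ Cinf setT chi, forall z, 0 <= chi z <= 1, forall z, `|z| <= r -> chi z = 1,
   forall z, M <= `|z| -> chi z = 0 & forall x y, `|chi x - chi y| <= eta * `|x - y|].
Proof.
move=> r0 eta0; have [C C0 HC] := @bump_lipschitz R n 0 1 2 ler01 (ltr1n R 2).
(* At least [r], so that the plateau contains the ball, and at least [C / eta], for the slope. *)
pose s := r + C / eta + 1.
have s0 : 0 < s by rewrite /s ltr_wpDl// addr_ge0// divr_ge0// ltW.
have n12 : 1 < 2 :> R by rewrite ltr1n.
have nz z : `|s^-1 *: z - 0| = `|z| / s :> R.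
  by rewrite subr0 normrZ gtr0_norm ?invr_gt0// mulrC.
exists (fun z => bump 0 1 2 (s^-1 *: z)), (2 * s); split.
- move=> k; apply: (Ck_comp (U' := setT) openT openT) => //; first exact: Ck_bump.
  by apply: CkZ; [exact: openT|exact: Ck_cst|exact: Ck_id].
- by move=> z; rewrite bump_ge0 bump_le1.
- move=> z zr; apply: bump_in => //; rewrite nz ler_pdivrMr// mul1r.
  by apply: le_trans zr _; rewrite /s -addrA lerDl addr_ge0// divr_ge0// ltW.
- by move=> z zM; apply: bump_out => //; rewrite nz ler_pdivlMr.
- move=> x y; apply: le_trans (HC _ _) _.
  rewrite -scalerBr normrZ gtr0_norm ?invr_gt0// mulrA ler_wpM2r//.
  rewrite ler_pdivrMr// -ler_pdivrMl// mulrC /s.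
  by rewrite -addrA addrCA lerDl addr_ge0.
Qed.

End Extension.

(** * Extending a local diffeomorphism from a small ball *)

Section Perturbation.
Context {R : realType}.

Lemma continuous_dist_le (V W : normedModType R) (f : V -> W) x e :
  {for x, continuous f} -> 0 < e -> \forall y \near x, `|f y - f x| <= e.
Proof.
move=> /cvgrPdist_le cf e0; near=> y; rewrite distrC; near: y; exact: cf.
Unshelve. all: by end_near. Qed.

Lemma diffeo_comp n (F G F' G' : 'rV[R]_n -> 'rV[R]_n) :
  diffeo F G -> diffeo F' G' -> diffeo (F' \o F) (G \o G').
Proof.
move=> [CF CG FG GF] [CF' CG' FG' GF']; split.
- by move=> k; apply: (Ck_comp_mx (U' := setT) openT openT) => //.
- by move=> k; apply: (Ck_comp_mx (U' := setT) openT openT) => //.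
- by move=> x /=; rewrite FG' FG.
- by move=> x /=; rewrite GF GF'.
Qed.

Lemma diffeo_sym n (F G : 'rV[R]_n -> 'rV[R]_n) : diffeo F G -> diffeo G F.
Proof. by case. Qed.

Lemma diffeo_affine n (A : 'M[R]_n) (b : 'rV[R]_n) : A \in unitmx ->
  diffeo (fun x => b + x *m A) (fun y => (y - b) *m invmx A).
Proof.
move=> uA; split.
- move=> k; apply: CkD; [exact: openT|exact: Ck_cst|].
  by apply: Ck_mulmx; [exact: openT|exact: Ck_id|exact: Ck_cst].
- move=> k; apply: Ck_mulmx; [exact: openT| |exact: Ck_cst].
  by apply: CkB; [exact: openT|exact: Ck_id|exact: Ck_cst].
- by move=> x /=; rewrite [b + _]addrC addrK mulmxK.
- by move=> x /=; rewrite mulmxKV// addrC subrK.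
Qed.

(* The rescaled map z |-> (e(eps z) - e 0) A^-1 / eps is C^1-close to the
   identity on a fixed ball, so cutting off the difference leaves a diffeomorphism. *)
Lemma local_diffeo_extension n (U : set 'rV[R]_n) (e : 'rV[R]_n -> 'rV[R]_n) (r : R) :
  0 < r -> open U -> U 0 -> Cinf U e -> jac e 0 \in unitmx ->
  exists2 eps0 : R, 0 < eps0 & forall eps, 0 < eps -> eps <= eps0 ->
    exists E G, diffeo E G /\ forall z, `|z| <= r -> U (eps *: z) /\ E z = e (eps *: z).
Proof.
move=> r0 oU U0 Ce uA; set A := jac e 0 in uA.
have r12 : r < 2 * r by lra.
have [C C0 HC] := @bump_lipschitz R n 0 r (2 * r) (ltW r0) r12.
(* The product [chi * W] has Lipschitz constant at most [eta + C * (eta * (3 * r))]: [eta] bounds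
   the slope of [W], hence [eta * (3 * r)] bounds [W]. This sum is to be 1/2. *)
pose eta := 2^-1 / (1 + 3 * r * C).
have eta0 : 0 < eta by rewrite divr_gt0// ltr_wpDr// !mulr_ge0// ltW.
(* Absorbs the two dimension factors of [mulmx_norm] and the multiplication by the inverse of
   [A]. *)
pose K := (n%:R * n%:R * `|invmx A| + 1).
have K0 : 0 < K by rewrite ltr_wpDl// !mulr_ge0.
have CJ := Ck_jac oU (Ce 1%N).
have : \forall z \near (0 : 'rV[R]_n), U z /\ `|jac e z - A| <= eta / K.
  apply: filterI; first exact: open_nbhs_nbhs.
  have cJ := Ck_continuous CJ U0.
  by apply: (continuous_dist_le cJ); rewrite divr_gt0.
move=> /nbhs_norm0P [d /= d0 Hd].
exists (d / (4 * r)) => [|eps eps0 epsd]; first by rewrite divr_gt0// mulr_gt0.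
have in3 z : `|z| < 3 * r -> U (eps *: z) /\ `|jac e (eps *: z) - A| <= eta / K.
  move=> z3; apply: Hd => /=; rewrite normrZ gtr0_norm//.
  apply: (@le_lt_trans _ _ (d / (4 * r) * (3 * r))).
    by apply: ler_pM => //; [exact: ltW|exact: ltW].
  rewrite -mulrA gtr_pMr// mulrC ltr_pdivrMr; lra.
pose W (z : 'rV[R]_n) := eps^-1 *: ((e (eps *: z) - e 0) *m invmx A) - z.
have oB3 : open [set z : 'rV[R]_n | `|z| < 3 * r].
  rewrite (_ : [set z | _] = [set z : 'rV[R]_n | `|z - 0| < 3 * r]); first exact: open_dist_lt.
  by apply/seteqP; split => z /=; rewrite subr0.
have Cez k : Ck k [set z : 'rV[R]_n | `|z| < 3 * r] (fun z => e (eps *: z)).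
  apply: (Ck_comp_mx oB3 oU) => //; first by move=> z /in3 [].
  by apply: CkZ => //; [exact: Ck_cst|exact: Ck_id].
have CW k : Ck k [set z : 'rV[R]_n | `|z| < 3 * r] W.
  apply: CkB => //; last exact: Ck_id.
  apply: CkZ => //; first exact: Ck_cst.
  apply: Ck_mulmx => //; last exact: Ck_cst.
  by apply: CkB => //; exact: Ck_cst.
have lipW x y : `|x| < 3 * r -> `|y| < 3 * r -> `|W x - W y| <= eta * `|x - y|.
  move=> x3 y3; apply: norm_le_coord; first by rewrite mulr_ge0// ltW.
  move=> i j; rewrite (ord1 i) [X in `|X|]mxE [X in _ + X]mxE.
  have -> : W x ord0 j = W (y + (x - y)) ord0 j by rewrite addrC subrK.
  apply: (@segment_lipschitz R _ (fun z => W z ord0 j)) => t /andP[t0 t1].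
  set z := y + t *: (x - y).
  have z3 : `|z| < 3 * r.
    rewrite /z (_ : _ + _ = (1 - t) *: y + t *: x); last first.
      by rewrite scalerBl scale1r scalerBr [LHS]addrCA [LHS]addrC.
    apply: (le_lt_trans (ler_normD _ _)); rewrite !normrZ !ger0_norm ?subr_ge0//.
    have : (1 - t) * `|y| <= (1 - t) * Num.max `|x| `|y|.
      by rewrite ler_wpM2l ?subr_ge0// le_max lexx orbT.
    have : t * `|x| <= t * Num.max `|x| `|y| by rewrite ler_wpM2l// le_max lexx.
    have : Num.max `|x| `|y| < 3 * r by rewrite gt_max x3 y3.
    lra.
  have CWj := (Ck_mx _ _ oB3).1 (CW 1%N) ord0 j.
  split; first exact: (Ck_derivable CWj).
  have De : 'D_(x - y) (fun z => e (eps *: z)) z = (x - y) *m (eps *: jac e (eps *: z)).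
    have [Uz _] := in3 z z3.
    have d1 : is_derive z (x - y) (fun z : 'rV[R]_n => eps *: z) (eps *: (x - y)).
      exact: is_deriveZ.
    have [d1D d1E] := d1.
    have [_ ->] := is_derive_comp oU (Ce 1%N) Uz d1D.
    by rewrite d1E -scalemxAl -scalemxAr.
  have DW : 'D_(x - y) W z = ((x - y) *m (jac e (eps *: z) - A)) *m invmx A.
    have dez := Ck_derivable (Cez 1%N) z3.
    have J1 : jac W z = jac (fun z => e (eps *: z)) z *m (eps^-1 *: invmx A) - 1%:M.
      apply/row_matrixP => i'; rewrite !rowE -(derive_jac _ oB3 (CW 1%N) z3).
      rewrite mulmxBr mulmxA -(derive_jac _ oB3 (Cez 1%N) z3) mulmx1.
      set v := delta_mx _ _.
      have L1 : is_derive (e (eps *: z)) ('D_v (fun z => e (eps *: z)) z)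
          (fun q : 'rV[R]_n => (q - e 0) *m (eps^-1 *: invmx A))
          ('D_v (fun z => e (eps *: z)) z *m (eps^-1 *: invmx A)).
        have Cl : Ck 1 setT (fun q : 'rV[R]_n => (q - e 0) *m (eps^-1 *: invmx A)).
          apply: Ck_mulmx; [exact: openT| |exact: Ck_cst].
          by apply: CkB; [exact: openT|exact: Ck_id|exact: Ck_cst].
        split; first exact: (Ck_derivable Cl).
        rewrite /derive; apply: cvg_lim => //.
        apply: cvg_near_cst; near=> h.
        rewrite /= -mulmxBl opprB addrA subrK addrK.
        rewrite -scalemxAl scalerA mulVf ?scale1r//.
        by near: h; exact: nbhs_dnbhs_neq.
      have dz : derivable (fun z => e (eps *: z)) z v by exact: dez.
      have Cl : Ck 1 setT (fun q : 'rV[R]_n => (q - e 0) *m (eps^-1 *: invmx A)).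
        apply: Ck_mulmx; [exact: openT| |exact: Ck_cst].
        by apply: CkB; [exact: openT|exact: Ck_id|exact: Ck_cst].
      have [D2 E2] := is_derive_comp openT Cl (I : setT (e (eps *: z))) dz.
      rewrite -(derive_jac _ openT Cl I) in E2; have [_ E1] := L1; rewrite E1 in E2.
      rewrite -E2 (_ : W = fun z => (e (eps *: z) - e 0) *m (eps^-1 *: invmx A) - z); last first.
        by apply/funext => q; rewrite /W -scalemxAr.
      rewrite -[X in _ = _ - X](derive_id z v).
      have D3 : derivable (@id 'rV[R]_n) z v by exact: derivable_id.
      exact: (deriveB D2 D3).
    rewrite (derive_jac _ oB3 (CW 1%N) z3) J1 mulmxBr mulmx1.
    rewrite mulmxA -(derive_jac _ oB3 (Cez 1%N) z3) De -!scalemxAr -scalemxAl scalerA.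
    by rewrite mulVf ?gt_eqF// scale1r [in RHS]mulmxBr [RHS]mulmxBl mulmxK.
  have -> : 'D_(x - y) (fun z => W z ord0 j) z = ('D_(x - y) W z) ord0 j.
    by rewrite derive_mx ?mxE//; exact: (Ck_derivable (CW 1%N)).
  rewrite DW; apply: le_trans (coord_le_norm _ _ _) _.
  apply: le_trans (mulmx_norm _ _) _.
  have [_ Jz] := in3 z z3.
  apply: (@le_trans _ _ (n%:R * (n%:R * `|x - y| * (eta / K)) * `|invmx A|)).
    rewrite ler_wpM2r// ler_wpM2l//; apply: le_trans (mulmx_norm _ _) _.
    by rewrite ler_wpM2l// mulr_ge0.
  rewrite [leLHS](_ : _ = eta * `|x - y| * ((n%:R * n%:R * `|invmx A|) / K)); last by ring.
  rewrite ler_piMr//; last by rewrite ler_pdivrMr// mul1r lerDl.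
  by apply: mulr_ge0 => //; exact: ltW.
have W0 : W 0 = 0 by rewrite /W scaler0 subrr mul0mx scaler0 subr0.
have nW x : `|x| < 3 * r -> `|W x| <= eta * (3 * r).
  move=> x3; have := lipW x 0 x3; rewrite normr0 W0 !subr0 mulr_gt0// => /(_ isT) H.
  by apply: le_trans H _; rewrite ler_wpM2l// ltW.
pose chi := bump (0 : 'rV[R]_n) r (2 * r).
have chi_out z : 2 * r <= `|z| -> chi z = 0.
  by move=> z2; rewrite /chi bump_out ?(ltW r0)// subr0.
pose V z := chi z *: W z.
have CV : Cinf setT V.
  move=> k; apply: Ck_local => z _.
  have [z3|z3] := ltP `|z| (3 * r).
    exists [set z | `|z| < 3 * r]; split=> //.
    apply: CkZ => //; exact: Ck_sub (@subsetT _ _) (@Ck_bump R k n 0 r (2 * r)).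
  exists [set z | 2 * r < `|z - 0|]; split; first by rewrite /= subr0; lra.
  apply: (@Ck_ext _ _ _ _ _ (fun=> 0)); [exact: open_dist_gt| |exact: Ck_cst].
  by move=> q /=; rewrite subr0 => /ltW /chi_out; rewrite /V => ->; rewrite scale0r.
have etaE : eta * (1 + 3 * r * C) = 2^-1.
  by rewrite /eta divfK// gt_eqF// ltr_wpDr// !mulr_ge0// ltW.
have half x y : `|x| < 2 * r -> `|V x - V y| <= 2^-1 * `|x - y|.
  move=> x2; have x3 : `|x| < 3 * r by lra.
  have bx := nW x x3.
  have lipchi := HC x y; rewrite -/chi in lipchi.
  have [y3|y3] := ltP `|y| (3 * r).
    rewrite /V (_ : _ - _ = (chi x - chi y) *: W x + chi y *: (W x - W y)); last first.
      by rewrite scalerBl [X in _ = _ + X]scalerBr addrA subrK.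
    apply: le_trans (ler_normD _ _) _; rewrite !normrZ.
    have h1 : `|chi x - chi y| * `|W x| <= C * `|x - y| * (eta * (3 * r)) by apply: ler_pM.
    have h2 : `|chi y| * `|W x - W y| <= eta * `|x - y|.
      rewrite -[leRHS]mul1r; apply: ler_pM => //; last exact: lipW.
      by rewrite ger0_norm ?bump_ge0// bump_le1.
    by apply: le_trans (lerD h1 h2) _; rewrite -etaE le_eqVlt; apply/orP; left; apply/eqP; ring.
  have cy0 : chi y = 0 by apply: chi_out; lra.
  rewrite /V cy0 scale0r subr0 normrZ.
  have -> : chi x = chi x - chi y by rewrite cy0 subr0.
  apply: (@le_trans _ _ (C * `|x - y| * (eta * (3 * r)))); first by apply: ler_pM.
  rewrite -etaE; have := mulr_ge0 (ltW eta0) (normr_ge0 (x - y)); nra.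
have lipV x y : `|V x - V y| <= 2^-1 * `|x - y|.
  have [x2|x2] := ltP `|x| (2 * r); first exact: half.
  have [y2|y2] := ltP `|y| (2 * r).
    by rewrite distrC [`|x - y|]distrC; exact: half.
  by rewrite /V !chi_out// !scale0r subrr normr0 mulr_ge0.
have [G HG] := id_plus_diffeo CV lipV.
have uA' : eps *: A \in unitmx by rewrite unitmxZ// unitfE gt_eqF.
have := diffeo_comp HG (diffeo_affine (e 0) uA').
set E := (X in diffeo X _); set G' := (X in diffeo _ X) => HE.
exists E, G'; split=> // z zr.
have [|Uz _] := in3 z; first by apply: (le_lt_trans zr); lra.
split=> //; rewrite /E /= /V /chi bump_in ?(ltW r0)// ?subr0// scale1r /W [z + _]addrC subrK.
rewrite -scalemxAr -scalemxAl scalerA mulfV ?gt_eqF// scale1r mulmxKV//.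
by rewrite addrC subrK.
Unshelve. all: by end_near. Qed.

End Perturbation.

(** * Small members of a family of displacements *)

Section Family.
Context {R : realType}.

(** The parameter [mu] becomes a first coordinate, so that joint smoothness is smoothness on a
    single Euclidean space. *)
Definition cons_rv n (mu : R) (z : 'rV[R]_n) : 'rV[R]_(1 + n) := row_mx mu%:M z.

Lemma Ck_cons_rv (V : normedModType R) n k (U : set V) (f : V -> R) (g : V -> 'rV[R]_n) :
  open U -> Ck k U f -> Ck k U g -> Ck k U (fun x => cons_rv (f x) (g x)).
Proof. by move=> oU Cf Cg; apply: Ck_row_mx => //; exact: Ck_scalar_mx. Qed.

Lemma cons_rv_dist n mu mu' (z z' : 'rV[R]_n) d : `|mu - mu'| < d -> `|z - z'| < d ->
  `|cons_rv mu z - cons_rv mu' z'| < d.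
Proof.
move=> md zd; apply: (@le_lt_trans _ _ (Num.max `|mu - mu'| `|z - z'|)); last first.
  by rewrite gt_max md zd.
apply: norm_le_coord; first by rewrite le_max normr_ge0.
move=> i j; rewrite (ord1 i) le_max; case: (split_ordP j) => l ->.
  rewrite (ord1 l) [X in `|X|]mxE [X in _ + X]mxE !row_mxEl !mxE eqxx !mulr1n.
  by rewrite lexx.
rewrite [X in `|X|]mxE [X in _ + X]mxE !row_mxEr.
by have := coord_le_norm (z - z') ord0 l; rewrite !mxE => ->; rewrite orbT.
Qed.

Lemma is_derive_cons_rv n (mu : R) (z v : 'rV[R]_n) :
  is_derive z v (cons_rv mu) (row_mx 0 v).
Proof.
have L : h^-1 *: (cons_rv mu (h *: v + z) - cons_rv mu z) @[h --> (0 : R)^'] --> row_mx 0 v.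
  apply: cvg_near_cst; near=> h.
  have h0 : h != 0 by near: h; exact: nbhs_dnbhs_neq.
  by rewrite opp_row_mx add_row_mx subrr addrK scale_row_mx scaler0 scalerA mulVf// scale1r.
by split; [apply/cvg_ex; exists (row_mx 0 v)|exact: cvg_lim L].
Unshelve. all: by end_near. Qed.

(** At [mu0] the derivatives of [W] in the directions of [z] vanish; for [mu] nearby they are
    uniformly small over a compact ball, and beyond it [W] is 0. With [c] = 1/2 this feeds
    [id_plus_diffeo]. *)
Lemma small_family n m (O : set 'rV[R]_(1 + n)) (W : 'rV[R]_(1 + n) -> 'rV[R]_m)
    (mu0 M c : R) : 0 < c -> open O -> Cinf O W ->
  (forall z : 'rV[R]_n, O (cons_rv mu0 z)) ->
  (forall z : 'rV[R]_n, W (cons_rv mu0 z) = 0) ->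
  (forall mu (z : 'rV[R]_n), M <= `|z| -> W (cons_rv mu z) = 0) ->
  \forall mu \near mu0, Cinf setT (fun z => W (cons_rv mu z)) /\
    forall x y, `|W (cons_rv mu x) - W (cons_rv mu y)| <= c * `|x - y|.
Proof.
move=> c0 oO CW O0 W0 WM.
pose c' := c / n.+1%:R; have c'0 : 0 < c' by rewrite divr_gt0.
pose G (i : 'I_n) (j : 'I_m) := 'D_(row_mx 0 (delta_mx ord0 i)) (fun q => W q ord0 j).
have CWj j k : Ck k O (fun q => W q ord0 j) by exact: (Ck_mx _ _ oO).1.
have CG i j k : Ck k O (G i j) by apply: Ck_derive; exact: CWj.
have DW mu (z : 'rV[R]_n) i j : O (cons_rv mu z) ->
    is_derive z (delta_mx ord0 i) (fun z => W (cons_rv mu z) ord0 j) (G i j (cons_rv mu z)).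
  move=> Oz; have [d1 d2] := is_derive_cons_rv mu z (delta_mx ord0 i).
  have := @is_derive_chain _ _ _ _ (fun q => W q ord0 j) (cons_rv mu) z (delta_mx ord0 i).
  by rewrite d2; apply => //; exact: (Ck1_differentiable oO (CWj j 1%N)).
have G0 z i j : G i j (cons_rv mu0 z) = 0.
  have [_ <-] := DW mu0 z i j (O0 z).
  rewrite (_ : (fun z => _) = (fun=> 0)) ?derive_cst//.
  by apply/funext => y; rewrite W0 mxE.
have loc z : \forall p \near cons_rv mu0 z, O p /\ forall ij : 'I_n * 'I_m, `|G ij.1 ij.2 p| <= c'.
  near=> p; split; first by near: p; exact: open_nbhs_nbhs.
  near: p; apply: filter_forall => ij.
  have := continuous_dist_le (Ck_continuous (CG ij.1 ij.2 0%N) (O0 z)) c'0.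
  by rewrite G0; apply: filterS => p; rewrite subr0.
pose P (mu : R) (z : 'rV[R]_n) := O (cons_rv mu z) /\
  forall ij : 'I_n * 'I_m, `|G ij.1 ij.2 (cons_rv mu z)| <= c'.
(* Tube argument: compactness of the ball merges the neighbourhoods of the points over [mu0] into
   one neighbourhood of [mu0]. *)
have cov := (compact_near_coveringP _).1 (@compact_ball R n 0 (M + 1)).
have : \forall mu \near mu0, [set z | `|z - 0| <= M + 1] `<=` P mu.
  apply: (cov R (nbhs mu0) P (nbhs_filter mu0)).
  move=> z _.
  have /nbhs_normP [d /= d0 Hd] := loc z.
  exists ([set z' | `|z' - z| < d], [set mu | `|mu - mu0| < d]).
    split; apply: open_nbhs_nbhs; split; [exact: open_dist_lt|by rewrite /= subrr normr0|
      exact: open_dist_lt|by rewrite /= subrr normr0].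
  by move=> [z' mu] [/= zz mm]; apply: Hd; rewrite /= distrC; exact: cons_rv_dist.
apply: filterS => mu Hmu.
have CV : Cinf setT (fun z => W (cons_rv mu z)).
  move=> k; apply: Ck_local => z _.
  have [zM|zM] := ltP `|z| (M + 1).
    exists [set z | `|z - 0| < M + 1]; split; first by rewrite /= subr0.
    apply: (Ck_comp_mx (open_dist_lt _ _) oO); first by move=> y /ltW /Hmu [].
      exact: CW.
    apply: Ck_cons_rv; [exact: open_dist_lt|exact: Ck_cst|exact: Ck_id].
  exists [set z | M < `|z - 0|]; split; first by rewrite /= subr0; lra.
  apply: (@Ck_ext _ _ _ _ _ (fun=> 0)); [exact: open_dist_gt| |exact: Ck_cst].
  by move=> q /=; rewrite subr0 => /ltW /WM.
split=> // x y.
have cc : n%:R * c' <= c by rewrite /c' mulrCA ler_piMr ?(ltW c0)// ler_pdivrMr// mul1r ler_nat.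
apply: (@le_trans _ _ (n%:R * c' * `|x - y|)); last by rewrite ler_wpM2r.
apply: (lip_jac (ltW c'0) (CV 1%N)) => z i j; rewrite mxE.
have [zM|zM] := leP `|z - 0| (M + 1).
  have [Oz Gz] := Hmu z zM.
  by have [_ ->] := DW mu z i j Oz; exact: (Gz (i, j)).
rewrite (near_eq_derive (g := fun=> 0)); first by rewrite derive_cst normr0 ltW.
near=> q; rewrite WM ?mxE//.
suff : M < `|q - 0| by rewrite subr0 => /ltW.
near: q; apply: open_nbhs_nbhs; split; [exact: open_dist_gt|rewrite /=; lra].
Unshelve. all: by end_near. Qed.

End Family.

Lemma continuous_epsilon (R : realType) (V W : normedModType R) (f : V -> W) x :
  (forall e, 0 < e -> exists2 d : R, 0 < d & forall y, `|x - y| < d -> `|f x - f y| <= e) ->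
  {for x, continuous f}.
Proof.
move=> H; apply/cvgrPdist_le => /= e /H [d d0 Hd].
by apply/nbhs_normP; exists d => // y /= /Hd.
Qed.

(** * Weighted averages of a function over a segment of matrices *)

Section Hadamard.
Context {R : realType}.
Notation mu := (@lebesgue_measure R).
Notation I01 := (`[0, 1]%classic : set R).
Variables (n : nat) (M0 M1 : 'M[R]_n).

Definition pencil (u : R) : 'M[R]_n := M0 + u *: M1.

(** The quotient in Hadamard's lemma is such an integral. The weights [u ^+ k] and the affine
    dependence of [pencil] on [u] close the family under differentiation: a derivative of [havg k]
    combines [havg k] and [havg k.+1] of partial derivatives. *)
Definition havg (k : nat) (f : 'rV[R]_n -> R) (x : 'rV[R]_n) : R :=
  \int[mu]_(u in I01) (u ^+ k * f (x *m pencil u)).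

Lemma integrable_cont (h : R -> R) : continuous h -> mu.-integrable I01 (EFin \o h).
Proof.
move=> ch; apply: continuous_compact_integrable; first exact: segment_compact.
by apply: continuous_in_subspaceT => u _; exact: ch.
Qed.

Lemma cont_norm (h : R -> R) : continuous h -> continuous (fun u => `|h u|).
Proof. by move=> ch u; exact: (continuous_comp (ch u) (@norm_continuous _ _ _)). Qed.

Lemma Ck_pencil k : Ck k setT pencil.
Proof.
apply: CkD; [exact: openT|exact: Ck_cst|].
by apply: CkZ; [exact: openT|exact: Ck_id|exact: Ck_cst].
Qed.

Lemma integrand_cont k f (x : 'rV[R]_n) : Ck 0 setT f ->
  continuous (fun u : R => u ^+ k * f (x *m pencil u)).
Proof.
move=> Cf.
suff C : Ck 0 setT (fun u : R => u ^+ k * f (x *m pencil u)).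
  by move=> u; exact: (Ck_continuous C).
apply: CkM; first exact: openT.
  elim: k => [|k IH]; first by apply: Ck_ext (Ck_cst _ _ (1 : R)) => [|u _]; [exact: openT|rewrite expr0].
  apply: (@Ck_ext R R R _ _ (fun u : R => u * u ^+ k)); first exact: openT.
    by move=> u _; rewrite exprS.
  by apply: CkM => //; [exact: openT|exact: Ck_id].
apply: (@Ck_comp R R n 0 setT setT f (fun u => x *m pencil u) openT openT (fun _ _ => I) Cf).
by apply: Ck_mulmx; [exact: openT|exact: Ck_cst|exact: Ck_pencil].
Qed.

Lemma pencil_bound (x : 'rV[R]_n) u : 0 <= u <= 1 ->
  `|x *m pencil u| <= n%:R * (`|M0| + `|M1|) * `|x|.
Proof.
move=> /andP[u0 u1]; apply: le_trans (mulmx_norm _ _) _.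
rewrite mulrAC ler_wpM2r// ler_wpM2l//.
apply: le_trans (ler_normD _ _) _; rewrite lerD2l normrZ ger0_norm//.
by rewrite ler_piMl.
Qed.

Lemma mu01 : fine (mu I01) = 1.
Proof. by rewrite lebesgue_measure_itv/= lte_fin ltr01 -EFinB subr0. Qed.

Lemma havgB k f (x y : 'rV[R]_n) : Ck 0 setT f ->
  havg k f x - havg k f y = \int[mu]_(u in I01) (u ^+ k * f (x *m pencil u) - u ^+ k * f (y *m pencil u)).
Proof.
move=> Cf; rewrite /havg RintegralB//.
  exact: (integrable_cont (@integrand_cont k f x Cf)).
exact: (integrable_cont (@integrand_cont k f y Cf)).
Qed.

Lemma is_derive_line k f (x v : 'rV[R]_n) (t u : R) : Ck 1 setT f ->
  is_derive t (1 : R) (fun t => u ^+ k * f ((x + t *: v) *m pencil u))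
    (u ^+ k * 'D_(v *m pencil u) f ((x + t *: v) *m pencil u)).
Proof.
move=> Cf; set w := v *m pencil u.
have E s : (x + s *: v) *m pencil u = x *m pencil u + s *: w.
  by rewrite mulmxDl -scalemxAl.
have dl : is_derive t (1 : R) (fun t : R => x *m pencil u + t *: w) w.
  have L : h^-1 *: ((x *m pencil u + (h *: (1 : R) + t) *: w) - (x *m pencil u + t *: w))
      @[h --> (0 : R)^'] --> w.
    apply: cvg_near_cst; near=> h.
    have h0 : h != 0 by near: h; exact: nbhs_dnbhs_neq.
    rewrite [h *: 1]mulr1 scalerDl opprD addrACA subrr add0r addrK.
    by rewrite scalerA mulVf// scale1r.
  by split; [apply/cvg_ex; exists w|exact: cvg_lim L].
have [d1 d2] := dl.
have := @is_derive_chain _ _ _ _ f (fun t : R => x *m pencil u + t *: w) t (1 : R) _ d1.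
rewrite d2 => /(_ (Ck1_differentiable openT Cf I)) dch.
have := is_deriveZ (u ^+ k) dch; rewrite -E.
rewrite (_ : (_ \*: _) = (fun t : R => u ^+ k * f ((x + t *: v) *m pencil u))) //.
by apply/funext => s; rewrite /= E.
Unshelve. all: by end_near. Qed.

Lemma derive_bound (f : 'rV[R]_n -> R) (r : R) : Ck 1 setT f ->
  exists2 C, 0 <= C & forall y w : 'rV[R]_n, `|y - 0| <= r -> `|'D_w f y| <= C * `|w|.
Proof.
move=> Cf.
have bnd (j : 'I_n) : exists C, 0 <= C /\ forall y, `|y - 0| <= r -> `|'D_(delta_mx ord0 j) f y| <= C.
  have [|C C0 HC] := @compact_bounded _ _ _ ('D_(delta_mx ord0 j) f) (@compact_ball R n 0 r).
    by move=> y _; exact: (Ck_continuous (Ck_derive Cf _) I).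
  by exists C.
have [C HC] := choice bnd.
exists (\sum_j C j) => [|y w yr]; first by apply: sumr_ge0 => j _; have [] := HC j.
rewrite derive_sum_coord; last exact: (Ck1_differentiable openT Cf I).
apply: le_trans (ler_norm_sum _ _ _) _; rewrite mulr_suml; apply: ler_sum => j _.
rewrite normrM mulrC; apply: ler_pM => //; last exact: coord_le_norm.
by have [_] := HC j; exact.
Qed.

Lemma havg_continuous k f : Ck 1 setT f -> continuous (havg k f).
Proof.
move=> Cf x.
pose K := n%:R * (`|M0| + `|M1|).
have K0 : 0 <= K by rewrite mulr_ge0// addr_ge0.
have [C C0 HC] := derive_bound (K * (`|x| + 1)) Cf.
apply: continuous_epsilon => e e0.
have dpos : 0 < e / (C * K + 1) by rewrite divr_gt0// ltr_wpDl// mulr_ge0.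
exists (Num.min 1 (e / (C * K + 1))); first by rewrite lt_min ltr01.
move=> y; rewrite lt_min => /andP[xy1 xye].
rewrite havgB; last exact: CkS.
have -> : \int[mu]_(u in I01) (u ^+ k * f (x *m pencil u) - u ^+ k * f (y *m pencil u)) =
    \int[mu]_(u in I01) (u ^+ k * (f (x *m pencil u) - f (y *m pencil u))).
  by apply: eq_Rintegral => u _; rewrite mulrBr.
have ci : continuous (fun u : R => u ^+ k * (f (x *m pencil u) - f (y *m pencil u))).
  move=> u; rewrite (_ : (fun u => _) = (fun u => u ^+ k * f (x *m pencil u) - u ^+ k * f (y *m pencil u))).
    by apply: cvgB; apply: integrand_cont; exact: CkS.
  by apply/funext => s; rewrite mulrBr.
apply: (le_trans (le_normr_Rintegral _ (integrable_cont ci))); first exact: measurable_itv.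
rewrite -[leRHS]mulr1 -[X in _ <= _ * X]mu01 -[leRHS]Rintegral_cst; last exact: measurable_itv.
apply: le_Rintegral; first exact: measurable_itv.
- by apply: integrable_cont; apply: cont_norm; exact: ci.
- by apply: integrable_cont => u; exact: cvg_cst.
move=> u /= u01; have u01' : 0 <= u <= 1 by move: u01; rewrite in_itv.
rewrite normrM.
apply: (@le_trans _ _ `|f (x *m pencil u) - f (y *m pencil u)|).
  rewrite ler_piMl//; move/andP : u01' => [u0 u1].
  by rewrite ger0_norm ?exprn_ge0// exprn_ile1.
have -> : f (x *m pencil u) = f (y *m pencil u + (x - y) *m pencil u).
  by rewrite -mulmxDl addrC subrK.
have xyb := pencil_bound (x - y) u01'; rewrite -/K in xyb.
apply: (@le_trans _ _ (C * (K * `|x - y|))).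
  apply: segment_lipschitz => t /andP[t0 t1]; split; first exact: (Ck_derivable Cf).
  apply: (@le_trans _ _ (C * `|(x - y) *m pencil u|)); last by rewrite ler_wpM2l.
  apply: HC; rewrite subr0 scalemxAl -mulmxDl.
  apply: le_trans (pencil_bound _ u01') _; rewrite -/K ler_wpM2l//.
  rewrite (_ : y + _ = x - (1 - t) *: (x - y)); last first.
    by apply/rowP => i; rewrite !mxE; ring.
  apply: le_trans (ler_normB _ _) _; rewrite lerD2l normrZ ger0_norm ?subr_ge0//.
  rewrite -[leRHS]mulr1; apply: ler_pM => //; [by rewrite subr_ge0|by rewrite lerBlDr lerDl|exact: ltW].
rewrite mulrA; apply: (@le_trans _ _ ((C * K + 1) * `|x - y|)); first by rewrite ler_wpM2r// lerDl.
by rewrite mulrC -ler_pdivlMr ?ltW// ltr_wpDl// mulr_ge0.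
Qed.

(** Differentiation under the integral sign along [x + t *: v] for |t| < 1, with a constant as
    dominating function, since the arguments of [f] stay in a fixed ball. *)
Lemma is_derive_havg k f (x v : 'rV[R]_n) : Ck 2 setT f ->
  is_derive x v (havg k f)
   (\int[mu]_(u in I01) (u ^+ k * 'D_(v *m pencil u) f (x *m pencil u))).
Proof.
move=> C2; have Cf := CkS C2.
pose g (t u : R) := u ^+ k * f ((x + t *: v) *m pencil u).
pose K := n%:R * (`|M0| + `|M1|).
have K0 : 0 <= K by rewrite mulr_ge0// addr_ge0.
have [C C0 HC] := derive_bound (K * (`|x| + `|v|)) Cf.
have I1 : `](-1), 1[%classic (0 : R) by rewrite /= in_itv/= ltrN10 ltr01.
have ig t : `](-1), 1[%classic t -> mu.-integrable I01 (EFin \o g t).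
  by move=> _; apply: integrable_cont; apply: integrand_cont; exact: CkS.
have dg t u : `](-1), 1[%classic t -> I01 u -> derivable (g ^~ u) t 1.
  by move=> _ _; have [] := is_derive_line k x v t u Cf.
have G0 (u : R) : 0 <= C * (K * `|v|) by rewrite !mulr_ge0.
have iG : mu.-integrable I01 (EFin \o (fun=> C * (K * `|v|))).
  by apply: integrable_cont => u; exact: cvg_cst.
have Gub t u : `](-1), 1[%classic t -> I01 u -> `|partial1of2 g t u| <= C * (K * `|v|).
  move=> t1 u01; have u01' : 0 <= u <= 1 by move: u01; rewrite /= in_itv.
  have t1' : `|t| <= 1 by move: t1; rewrite /= in_itv/= => /andP[a b]; rewrite ler_norml !ltW.
  rewrite partial1of2E; have [_ ->] := is_derive_line k x v t u Cf.
  rewrite normrM -[leRHS]mul1r; apply: ler_pM => //.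
    by move/andP : u01' => [u0 u1]; rewrite ger0_norm ?exprn_ge0// exprn_ile1.
  apply: (@le_trans _ _ (C * `|v *m pencil u|)); last by rewrite ler_wpM2l// pencil_bound.
  apply: HC; rewrite subr0; apply: le_trans (pencil_bound _ u01') _; rewrite ler_wpM2l//.
  apply: le_trans (ler_normD _ _) _; rewrite lerD2l normrZ ler_piMl//.
have mI : measurable I01 by exact: measurable_itv.
have D := @derivable_under_integral R _ _ mu g I01 mI 0 (-1) 1 I1 ig dg _ G0 iG Gub.
have E := @differentiation_under_integral R _ _ mu g I01 mI 0 (-1) 1 I1 ig dg _ G0 iG Gub.
have Eg : (fun t : R => \int[mu]_(y in I01) g t y) = (fun h : R => havg k f (h *: v + x)).
  by apply/funext => t; rewrite /g /havg addrC.
rewrite Eg in D E.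
split; first exact/derivable1P.
rewrite (_ : \int[mu]_(u in I01) _ = \int[mu]_(u in I01) partial1of2 g 0 u); last first.
  apply: eq_Rintegral => u _; rewrite partial1of2E.
  by have [_ ->] := is_derive_line k x v 0 u Cf; rewrite scale0r addr0.
rewrite -E derive1E /derive.
rewrite (_ : (fun h : R => h^-1 *: ((havg k f \o shift x) (h *: v) - havg k f x)) =
 (fun h : R => h^-1 *: (((fun h : R => havg k f (h *: v + x)) \o shift 0) (h *: (1 : R)) - havg k f (0 *: v + x)))) //.
by apply/funext => h; rewrite /= [h *: 1]mulr1 addr0 scale0r add0r.
Qed.

Lemma Ck_havg K k f : Cinf setT f -> Ck K setT (havg k f).
Proof.
elim: K k f => [|K IH] k f Cf; first by split=> // x _; exact: havg_continuous.
split; first by move=> x _; exact: havg_continuous.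
move=> v; split; first by move=> x _; have [] := is_derive_havg k x v (Cf 2%N).
have Cj j : Cinf setT ('D_(delta_mx ord0 j) f) by move=> k'; apply: Ck_derive; exact: Cf.
apply: (@Ck_ext _ _ _ _ _ (fun x => \sum_j
   ((v *m M0) ord0 j * havg k ('D_(delta_mx ord0 j) f) x +
    (v *m M1) ord0 j * havg k.+1 ('D_(delta_mx ord0 j) f) x))); first exact: openT.
  move=> x _; have [_ ->] := is_derive_havg k x v (Cf 2%N).
  have ijk j k' := integrable_cont (@integrand_cont k' _ x (Cj j 0%N)).
  rewrite (_ : (fun u => _) = (fun u : R => \sum_j
      ((v *m M0) ord0 j * (u ^+ k * 'D_(delta_mx ord0 j) f (x *m pencil u)) +
       (v *m M1) ord0 j * (u ^+ k.+1 * 'D_(delta_mx ord0 j) f (x *m pencil u))))); last first.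
    apply/funext => u; rewrite derive_sum_coord; last exact: (Ck1_differentiable openT (Cf 1%N) I).
    rewrite mulr_sumr; apply: eq_bigr => j _.
    by rewrite /pencil mulmxDr -scalemxAr mxE [X in _ + X]mxE exprS; ring.
  have cD j k' c : continuous (fun u : R => c * (u ^+ k' * 'D_(delta_mx ord0 j) f (x *m pencil u))).
    by move=> u; apply: cvgM; [exact: cvg_cst|exact: (integrand_cont (Cj j 0%N))].
  elim: (index_enum _) => [|j s IHs].
    by rewrite big_nil; under eq_Rintegral do rewrite big_nil; rewrite Rintegral_cst ?mul0r//; exact: measurable_itv.
  have mI : measurable I01 by exact: measurable_itv.
  have csum r : continuous (fun u : R => \sum_(j <- r)
      ((v *m M0) ord0 j * (u ^+ k * 'D_(delta_mx ord0 j) f (x *m pencil u)) +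
       (v *m M1) ord0 j * (u ^+ k.+1 * 'D_(delta_mx ord0 j) f (x *m pencil u)))).
    elim: r => [|a r IHr] u.
      by rewrite (_ : (fun u => _) = (fun=> 0)); [exact: cvg_cst|apply/funext => w; rewrite big_nil].
    rewrite (_ : (fun u => _) = (fun u : R =>
      ((v *m M0) ord0 a * (u ^+ k * 'D_(delta_mx ord0 a) f (x *m pencil u)) +
       (v *m M1) ord0 a * (u ^+ k.+1 * 'D_(delta_mx ord0 a) f (x *m pencil u))) +
      \sum_(j <- r) ((v *m M0) ord0 j * (u ^+ k * 'D_(delta_mx ord0 j) f (x *m pencil u)) +
       (v *m M1) ord0 j * (u ^+ k.+1 * 'D_(delta_mx ord0 j) f (x *m pencil u))))); last first.
      by apply/funext => w; rewrite big_cons.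
    by apply: cvgD; [apply: cvgD; exact: cD|exact: IHr].
  rewrite big_cons IHs; under [RHS]eq_Rintegral do rewrite big_cons.
  rewrite RintegralD//; last 2 first.
  - by apply: integrable_cont => u; apply: cvgD; exact: cD.
  - by apply: integrable_cont; exact: csum.
  congr (_ + _); rewrite RintegralD//; last 2 first.
  - by apply: integrable_cont; exact: cD.
  - by apply: integrable_cont; exact: cD.
  by rewrite !RintegralZl//; exact: ijk.
apply: Ck_sum => [|j _]; first exact: openT.
apply: CkD; first exact: openT.
  by apply: CkM; [exact: openT|exact: Ck_cst|exact: IH].
by apply: CkM; [exact: openT|exact: Ck_cst|exact: IH].
Qed.

End Hadamard.

(** * Hadamard's lemma *)

Section HadamardQuotient.
Context {R : realType}.
Notation mu := (@lebesgue_measure R).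

Definition pt2 (a b : R) : 'rV[R]_2 := \row_(i < 2) (if i == 0 then a else b).

Lemma pt2E (z : 'rV[R]_2) : z = pt2 (z ord0 0) (z ord0 1).
Proof.
apply/rowP => i; rewrite mxE; case: i => [[|[|//]] H] /=; congr (z _ _); exact: val_inj.
Qed.

Lemma pt2_0 a b : pt2 a b ord0 0 = a. Proof. by rewrite mxE. Qed.
Lemma pt2_1 a b : pt2 a b ord0 1 = b. Proof. by rewrite mxE. Qed.

Lemma Ck_pt2 (V : normedModType R) k (U : set V) (f g : V -> R) :
  open U -> Ck k U f -> Ck k U g -> Ck k U (fun x => pt2 (f x) (g x)).
Proof.
move=> oU Cf Cg; apply: Ck_rv => // -[[|[|//]] H].
  by apply: Ck_ext Cf => // x _; rewrite mxE.
by apply: Ck_ext Cg => // x _; rewrite mxE.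
Qed.

(** [H] is the integral of the second partial derivative at (a, u b) for u in [0, 1]; [M0] and [M1]
    are chosen so that [pencil M0 M1 u] multiplies the second coordinate by [u]. The value of [H] on
    [b = 0] will show that a direction at the tip is nonzero. *)
Lemma hadamard (F : 'rV[R]_2 -> R) : Cinf setT F -> (forall a, F (pt2 a 0) = 0) ->
  exists H : 'rV[R]_2 -> R, Cinf setT H /\
    forall a b, F (pt2 a b) = b * H (pt2 a b) /\
     H (pt2 a 0) = 'D_(pt2 0 1) F (pt2 a 0).
Proof.
move=> CF F0.
pose M0 : 'M[R]_2 := \matrix_(i, j) ((i == 0) && (j == 0))%:R.
pose M1 : 'M[R]_2 := \matrix_(i, j) ((i == 1) && (j == 1))%:R.
have mulP a b u : pt2 a b *m (pencil M0 M1 u) = pt2 a (u * b).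
  apply/rowP => j; rewrite mxE !big_ord_recl big_ord0 !mxE /=.
  by case: j => [[|[|//]] jH] /=; rewrite ?(mulr0, mulr1, addr0, add0r)// mulrC.
have CD : Cinf setT ('D_(pt2 0 1) F) by move=> k; apply: Ck_derive; exact: CF.
exists (havg M0 M1 0 ('D_(pt2 0 1) F)); split; first by move=> k; exact: Ck_havg.
move=> a b; split; last first.
  rewrite /havg (_ : \int[mu]_(u in _) _ = \int[mu]_(u in `[0, 1]) 'D_(pt2 0 1) F (pt2 a 0)).
    by rewrite Rintegral_cst ?mu01 ?mulr1//; exact: measurable_itv.
  by apply: eq_Rintegral => u _; rewrite mulP mulr0 expr0 mul1r.
have Ek : havg M0 M1 0 ('D_(pt2 0 1) F) (pt2 a b) =
    \int[mu]_(u in `[0, 1]) 'D_(pt2 0 1) F (pt2 a (u * b)).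
  by apply: eq_Rintegral => u _; rewrite mulP expr0 mul1r.
have cD : continuous (fun u : R => 'D_(pt2 0 1) F (pt2 a (u * b))).
  have := @integrand_cont R 2 M0 M1 0 _ (pt2 a b) (CD 0%N).
  by under eq_fun do rewrite mulP expr0 mul1r.
rewrite Ek -RintegralZl; [|exact: measurable_itv|exact: integrable_cont].
have dP (t : R) : is_derive t (1 : R) (fun u : R => F (pt2 a (u * b))) (b * 'D_(pt2 0 1) F (pt2 a (t * b))).
  have := @is_derive_line R 2 M0 M1 0 F (pt2 a 0) (pt2 0 b) t 1 (CF 1%N).
  have E s : (pt2 a 0 + s *: pt2 0 b) *m pencil M0 M1 1 = pt2 a (s * b).
    rewrite (_ : _ + _ = pt2 a (s * b)); first by rewrite mulP mul1r.
    by apply/rowP => j; rewrite !mxE; case: ifP => _; rewrite ?mulr0 ?addr0 ?add0r.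
  under eq_fun do rewrite E expr0 mul1r.
  rewrite E mulP ?expr0 !mul1r.
  rewrite (_ : pt2 0 b = b *: pt2 0 1); last first.
    by apply/rowP => j; rewrite !mxE; case: ifP => _; rewrite ?mulr0 ?mulr1.
  rewrite deriveE; last exact: (Ck1_differentiable openT (CF 1%N) I).
  by rewrite linearZ/= -deriveE//; exact: (Ck1_differentiable openT (CF 1%N) I).
have cP : continuous (fun u : R => F (pt2 a (u * b))).
  move=> t; apply: differentiable_continuous; apply/derivable1_diffP.
  by have [] := dP t.
have := @continuous_FTC2 R (fun u => b * 'D_(pt2 0 1) F (pt2 a (u * b)))
  (fun u => F (pt2 a (u * b))) 0 1 ltr01 _ _ _.
rewrite mul0r mul1r F0 sube0 /Rintegral => -> //.
- by apply: continuous_in_subspaceT => u _; apply: cvgM; [exact: cvg_cst|exact: cD].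
- split.
  + by move=> t _; have [] := dP t.
  + by apply: cvg_at_right_filter; exact: cP.
  + by apply: cvg_at_left_filter; exact: cP.
- by move=> t _; rewrite derive1E; have [_ ->] := dP t.
Qed.

Lemma hadamard_rV m (F : 'rV[R]_2 -> 'rV[R]_m) : Cinf setT F -> (forall a, F (pt2 a 0) = 0) ->
  exists H : 'rV[R]_2 -> 'rV[R]_m, Cinf setT H /\
    forall a b, F (pt2 a b) = b *: H (pt2 a b) /\
     H (pt2 a 0) = 'D_(pt2 0 1) F (pt2 a 0).
Proof.
move=> CF F0.
have CFj j : Cinf setT (fun z => F z ord0 j) by move=> k; exact: (Ck_mx _ _ openT).1.
have F0j j a : F (pt2 a 0) ord0 j = 0 by rewrite F0 mxE.
have H j := hadamard (CFj j) (F0j j).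
have [h Hh] := choice H.
exists (fun z => \row_j h j z); split.
  move=> k; apply: Ck_rv => [|j]; first exact: openT.
  by apply: Ck_ext ((Hh j).1 k) => [|z _]; [exact: openT|rewrite mxE].
move=> a b; split; apply/rowP => j; rewrite !mxE.
  by have [_ /(_ a b) [-> _]] := Hh j.
rewrite derive_mx ?mxE; last exact: (Ck_derivable (CF 1%N)).
by have [_ /(_ a b) [_ ->]] := Hh j.
Qed.

Lemma hadamard1 (f : R -> R) : Cinf setT f -> f 0 = 0 ->
  exists h : R -> R, Cinf setT h /\ forall s, f s = s * h s.
Proof.
move=> Cf f0.
have [||H [CH HH]] := @hadamard (fun z => f (z ord0 1)).
- move=> k; apply: (@Ck_comp1 _ _ _ setT setT f) => //; [exact: openT|exact: openT|].
  by apply: Ck_coord; exact: openT.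
- by move=> a; rewrite pt2_1.
exists (fun s => H (pt2 0 s)); split.
  move=> k; apply: (@Ck_comp _ _ _ _ setT setT H) => //; [exact: openT|exact: openT|].
  by apply: Ck_pt2; [exact: openT|exact: Ck_cst|exact: Ck_id].
by move=> s; have [+ _] := HH 0 s; rewrite pt2_1.
Qed.

End HadamardQuotient.

(** * Smooth left inverses of injective immersed curves *)

Section Curves.
Context {R : realType}.

Lemma sqnorm_ge0 n (x : 'rV[R]_n) : 0 <= sqnorm x.
Proof. by apply: sumr_ge0 => i _; exact: sqr_ge0. Qed.

Lemma sqnorm_eq0 n (x : 'rV[R]_n) : sqnorm x = 0 -> x = 0.
Proof.
move=> /eqP; rewrite psumr_eq0 => [/allP H|i _]; last exact: sqr_ge0.
apply/rowP => i; rewrite mxE; apply/eqP; rewrite -sqrf_eq0.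
by apply: H; rewrite mem_index_enum.
Qed.

Lemma sqnorm_gt0 n (x : 'rV[R]_n) : x != 0 -> 0 < sqnorm x.
Proof.
move=> x0; rewrite lt_neqAle sqnorm_ge0 andbT eq_sym.
by apply: contra x0 => /eqP /sqnorm_eq0 ->.
Qed.

Lemma compact_min_gt0 (T : topologicalType) (A : set T) (f : T -> R) :
  compact A -> (forall x, A x -> {for x, continuous f}) -> (forall x, A x -> 0 < f x) ->
  exists2 d, 0 < d & forall x, A x -> d <= f x.
Proof.
move=> cA cf f0; have [[a Aa]|A0] := pselect (exists a, A a); last first.
  by exists 1 => // x Ax; exfalso; apply: A0; exists x.
have A0 : A !=set0 by exists a.
have [|c /set_mem Ac Hc] := compact_EVT_min A0 cA (f := f).
  by apply: continuous_in_subspaceT => x /set_mem; exact: cf.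
by exists (f c); [exact: f0|move=> x Ax; apply: Hc; exact: mem_set].
Qed.

Lemma Cinf_continuous (V W : normedModType R) (f : V -> W) : Cinf setT f -> continuous f.
Proof. by move=> Cf x; exact: (Ck_continuous (Cf 0%N) I). Qed.

Lemma Cinf_derivable (V W : normedModType R) (f : V -> W) x v : Cinf setT f -> derivable f x v.
Proof. by move=> Cf; exact: (Ck_derivable (Cf 1%N)). Qed.

(** The product of the curve with its velocity [w] at [s0] has derivative [sqnorm w] there, so it is
    locally invertible; that inverse, extended to the whole line, is composed with the linear
    form. *)
Lemma curve_local_inverse n (l : R -> 'rV[R]_n) (s0 : R) : Cinf setT l -> 'D_1 l s0 != 0 ->
  exists2 d : R, 0 < d & exists g : 'rV[R]_n -> R, Cinf setT g /\
    forall s, `|s - s0| <= d -> g (l s) = s.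
Proof.
move=> Cl l0; set w := 'D_1 l s0 in l0.
pose h (s : R) := \sum_j l s ord0 j * w ord0 j.
have Clj k j : Ck k setT (fun s => l s ord0 j) by exact: (Ck_mx _ _ openT).1 (Cl k) _ _.
have Ch k : Ck k setT h.
  apply: Ck_sum => [|j _]; first exact: openT.
  by apply: CkM; [exact: openT|exact: Clj|exact: Ck_cst].
have Dh : 'D_1 h s0 = sqnorm w.
  have H : is_derive s0 (1 : R) (fun s => \sum_j l s ord0 j * w ord0 j) (sqnorm w).
    have Hj j : is_derive s0 (1 : R) (fun s => l s ord0 j * w ord0 j) (w ord0 j ^+ 2).
      have dj : is_derive s0 (1 : R) (fun s => l s ord0 j) (w ord0 j).
        split; first exact: (Ck_derivable (Clj 1%N j)).
        by rewrite /w derive_mx ?mxE//; exact: Cinf_derivable.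
      have := is_deriveM dj (is_derive_cst (w ord0 j) s0 1).
      by rewrite scaler0 add0r expr2.
    have := is_derive_sum Hj.
    by rewrite (_ : \sum_(i < n) _ = (fun s => \sum_j l s ord0 j * w ord0 j))//;
      apply/funext => s; rewrite fct_sumE.
  by have [_ ->] := H.
pose e (z : 'rV[R]_1) : 'rV[R]_1 := (h (s0 + z ord0 ord0) - h s0)%:M.
have Ce : Cinf setT e.
  move=> k; apply: Ck_scalar_mx; first exact: openT.
  apply: CkB; [exact: openT| |exact: Ck_cst].
  apply: (@Ck_comp1 _ _ _ setT setT h) => //; [exact: openT|exact: openT|].
  by apply: CkD; [exact: openT|exact: Ck_cst|apply: Ck_coord; exact: openT].
have uJ : jac e 0 \in unitmx.
  rewrite unitmxE det_mx11 unitfE mxE.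
  rewrite (_ : 'D_ _ _ _ = sqnorm w); first by rewrite gt_eqF// sqnorm_gt0.
  rewrite -Dh /derive.
  rewrite (_ : (fun h0 : R => _) = (fun t : R => t^-1 *: ((h \o shift s0) (t *: (1 : R)) - h s0))) //.
  apply/funext => t; rewrite /e /= !mxE !eqxx !mulr1n !addr0 mulr1 [t *: 1]mulr1.
  by rewrite subrr subr0 [s0 + t]addrC.
have [eps0 e0 Heps] := local_diffeo_extension ltr01 openT I Ce uJ.
have [E [G [[_ CG EG _] HE]]] := Heps eps0 e0 (lexx _).
have GF z : `|z| <= 1 -> G (e (eps0 *: z)) = z.
  by move=> z1; have [_ <-] := HE z z1; exact: EG.
exists eps0 => //.
exists (fun x => s0 + eps0 * G ((\sum_j x ord0 j * w ord0 j - h s0)%:M) ord0 ord0); split.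
  move=> k; apply: CkD; [exact: openT|exact: Ck_cst|].
  apply: CkM; [exact: openT|exact: Ck_cst|].
  apply: (@Ck_comp _ _ _ _ setT setT (fun z => G z ord0 ord0)) => //; [exact: openT|exact: openT| |].
    exact: (Ck_mx _ _ openT).1 (CG k) _ _.
  apply: Ck_scalar_mx; first exact: openT.
  apply: CkB; [exact: openT| |exact: Ck_cst].
  apply: Ck_sum => [|j _]; first exact: openT.
  by apply: CkM; [exact: openT|apply: Ck_coord; exact: openT|exact: Ck_cst].
move=> s sd; have := GF (((s - s0) / eps0)%:M); rewrite norm_scalar_mx1.
rewrite normrM normfV (gtr0_norm e0) ler_pdivrMr// mul1r => /(_ sd).
rewrite /e !mxE eqxx mulr1n mulrCA mulfV ?gt_eqF// mulr1 [s0 + _]addrC subrK -/(h s) => ->.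
by rewrite mxE eqxx mulr1n mulrCA mulfV ?gt_eqF// mulr1 addrC subrK.
Qed.

(** The local left inverses show that the inverse of [l] is smooth on the compact image, so
    [smooth_extension] applies; injectivity keeps distant parameters away. *)
Lemma curve_left_inverse n (l : R -> 'rV[R]_n) M : Cinf setT l -> injective l ->
  (forall s, 'D_1 l s != 0) ->
  exists g : 'rV[R]_n -> R, Cinf setT g /\ forall s, `|s| <= M -> g (l s) = s.
Proof.
move=> Cl il l0.
have cl : continuous l by exact: Cinf_continuous.
have cI : compact [set s : R | `|s| <= M].
  rewrite (_ : [set s | _] = `[(- M), M]%classic); first exact: segment_compact.
  by apply/seteqP; split => s /=; rewrite in_itv/= ler_norml.
pose A := l @` [set s : R | `|s| <= M].
have cA : compact A by apply: continuous_compact => //; exact: continuous_subspaceT.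
have ex x : exists s, A x -> `|s| <= M /\ l s = x.
  by have [[s sM <-]|nA] := pselect (A x); [exists s|exists 0].
have [inv Hinv] := choice ex.
have [|g [Cg Hg]] := @smooth_extension R _ A inv (@has_bumps_rV R n) cA; last first.
  exists g; split=> // s sM; have As : A (l s) by exists s.
  by rewrite Hg//; have [_ /il] := Hinv _ As.
move=> _ [s0 s0M <-].
have [d d0 [g [Cg Hg]]] := curve_local_inverse Cl (l0 s0).
(* [m] separates [l s0] from the points whose parameter is at least [d] away from [s0]; closer than
   [m], the local inverse is the right one. *)
have [||s [sM sd]|m m0 Hm] := @compact_min_gt0 _ [set s : R | `|s| <= M /\ d <= `|s - s0|]
    (fun s => `|l s - l s0|).
- apply: (@subclosed_compact _ _ [set s : R | `|s| <= M]) => //; last by move=> s [].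
  have cD : closed [set s : R | d <= `|s - s0|].
    rewrite (_ : [set s | _] = ~` [set s : R | `|s - s0| < d]).
      by apply: open_closedC; exact: open_dist_lt.
    by apply/seteqP; split => s /=; rewrite leNgt => /negP.
  have cM := compact_closed (@Rhausdorff R) cI.
  exact: closedI cM cD.
- by move=> s _; exact: (continuous_comp (cl s) (@dist_continuous _ _ _ _)).
- rewrite normr_gt0 subr_eq0; apply/eqP => /il ss0; move: sd.
  by rewrite ss0 subrr normr0 leNgt d0.
exists [set x | `|x - l s0| < m], g; split.
- exact: open_dist_lt.
- by rewrite /= subrr normr0.
- by move=> k; exact: Ck_sub (@subsetT _ _) (Cg k).
- move=> _ [s sM <-] /= sm.
  have As : A (l s) by exists s.
  have [_ /il ->] := Hinv _ As; apply: Hg.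
  rewrite leNgt; apply/negP => /ltW ds; move: sm.
  by rewrite ltNge Hm.
Qed.

End Curves.

(** * Quaternions, the Hopf map and minimal rotations *)

Section Quaternions.
Context {R : realType}.

Notation i0 := (@Ordinal 4 0 isT).
Notation i1 := (@Ordinal 4 1 isT).
Notation i2 := (@Ordinal 4 2 isT).
Notation i3 := (@Ordinal 4 3 isT).
Notation j0 := (@Ordinal 3 0 isT).
Notation j1 := (@Ordinal 3 1 isT).
Notation j2 := (@Ordinal 3 2 isT).

Definition mk4 (a b c d : R) : 'rV[R]_4 := \row_(i < 4) nth 0 [:: a; b; c; d] i.
Definition mk3 (a b c : R) : 'rV[R]_3 := \row_(i < 3) nth 0 [:: a; b; c] i.

Lemma rv4P (x y : 'rV[R]_4) : x ord0 i0 = y ord0 i0 -> x ord0 i1 = y ord0 i1 ->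
  x ord0 i2 = y ord0 i2 -> x ord0 i3 = y ord0 i3 -> x = y.
Proof.
move=> h0 h1 h2 h3; apply/rowP => -[[|[|[|[|//]]]] H];
  rewrite (bool_irrelevance H isT)//.
Qed.

Lemma rv3P (x y : 'rV[R]_3) : x ord0 j0 = y ord0 j0 -> x ord0 j1 = y ord0 j1 ->
  x ord0 j2 = y ord0 j2 -> x = y.
Proof.
by move=> h0 h1 h2; apply/rowP => -[[|[|[|//]]] H]; rewrite (bool_irrelevance H isT).
Qed.

Lemma sqnorm4 (x : 'rV[R]_4) : sqnorm x =
  x ord0 i0 ^+ 2 + x ord0 i1 ^+ 2 + x ord0 i2 ^+ 2 + x ord0 i3 ^+ 2.
Proof.
rewrite /sqnorm !big_ord_recl big_ord0 addr0 !addrA.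
by congr (_ + _ + _ + _); congr (x _ _ ^+ 2); exact: val_inj.
Qed.

Lemma sqnorm3 (x : 'rV[R]_3) : sqnorm x =
  x ord0 j0 ^+ 2 + x ord0 j1 ^+ 2 + x ord0 j2 ^+ 2.
Proof.
rewrite /sqnorm !big_ord_recl big_ord0 addr0 !addrA.
by congr (_ + _ + _); congr (x _ _ ^+ 2); exact: val_inj.
Qed.

Definition qmul (p q : 'rV[R]_4) : 'rV[R]_4 :=
  let a := p ord0 i0 in let b := p ord0 i1 in let c := p ord0 i2 in let d := p ord0 i3 in
  let a' := q ord0 i0 in let b' := q ord0 i1 in let c' := q ord0 i2 in let d' := q ord0 i3 in
  mk4 (a * a' - b * b' - c * c' - d * d') (a * b' + b * a' + c * d' - d * c')
      (a * c' - b * d' + c * a' + d * b') (a * d' + b * c' - c * b' + d * a').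

Definition qconj (p : 'rV[R]_4) : 'rV[R]_4 :=
  mk4 (p ord0 i0) (- p ord0 i1) (- p ord0 i2) (- p ord0 i3).

Definition qone : 'rV[R]_4 := mk4 1 0 0 0.

(* [hopf v] is v i v^* and [qrot r x] is r x r^*, with R^3 identified with the
   imaginary quaternions. *)
Definition hopf (v : 'rV[R]_4) : 'rV[R]_3 :=
  let a := v ord0 i0 in let b := v ord0 i1 in let c := v ord0 i2 in let d := v ord0 i3 in
  mk3 (a * a + b * b - c * c - d * d) (2 * (b * c + a * d)) (2 * (b * d - a * c)).

Definition qrot (r : 'rV[R]_4) (x : 'rV[R]_3) : 'rV[R]_3 :=
  let p := qmul (qmul r (mk4 0 (x ord0 j0) (x ord0 j1) (x ord0 j2))) (qconj r) in
  mk3 (p ord0 i1) (p ord0 i2) (p ord0 i3).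

Lemma mk4_surj x : exists a b c d, x = mk4 a b c d.
Proof. by exists (x ord0 i0), (x ord0 i1), (x ord0 i2), (x ord0 i3); apply: rv4P; rewrite mxE. Qed.

Lemma mk3_surj x : exists a b c, x = mk3 a b c.
Proof. by exists (x ord0 j0), (x ord0 j1), (x ord0 j2); apply: rv3P; rewrite mxE. Qed.

Lemma mk4E a b c d : (mk4 a b c d ord0 i0 = a) * (mk4 a b c d ord0 i1 = b) *
  (mk4 a b c d ord0 i2 = c) * (mk4 a b c d ord0 i3 = d).
Proof. by rewrite !mxE. Qed.

Lemma mk3E a b c : (mk3 a b c ord0 j0 = a) * (mk3 a b c ord0 j1 = b) *
  (mk3 a b c ord0 j2 = c).
Proof. by rewrite !mxE. Qed.

Lemma qmulE a b c d a' b' c' d' : qmul (mk4 a b c d) (mk4 a' b' c' d') =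
  mk4 (a * a' - b * b' - c * c' - d * d') (a * b' + b * a' + c * d' - d * c')
      (a * c' - b * d' + c * a' + d * b') (a * d' + b * c' - c * b' + d * a').
Proof. by rewrite /qmul !mk4E. Qed.

Lemma qconjE a b c d : qconj (mk4 a b c d) = mk4 a (- b) (- c) (- d).
Proof. by rewrite /qconj !mk4E. Qed.

Lemma hopfE a b c d : hopf (mk4 a b c d) =
  mk3 (a * a + b * b - c * c - d * d) (2 * (b * c + a * d)) (2 * (b * d - a * c)).
Proof. by rewrite /hopf !mk4E. Qed.

Lemma mk4Z k a b c d : k *: mk4 a b c d = mk4 (k * a) (k * b) (k * c) (k * d).
Proof. by apply: rv4P; rewrite !mxE. Qed.

Lemma mk3Z k a b c : k *: mk3 a b c = mk3 (k * a) (k * b) (k * c).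
Proof. by apply: rv3P; rewrite !mxE. Qed.

Lemma qrotE a b c d x y z : qrot (mk4 a b c d) (mk3 x y z) =
  mk3 ((a * a + b * b - c * c - d * d) * x + 2 * (b * c - a * d) * y + 2 * (b * d + a * c) * z)
      (2 * (b * c + a * d) * x + (a * a - b * b + c * c - d * d) * y + 2 * (c * d - a * b) * z)
      (2 * (b * d - a * c) * x + 2 * (c * d + a * b) * y + (a * a - b * b - c * c + d * d) * z).
Proof. by rewrite /qrot !mk3E qmulE qconjE qmulE !mk4E; congr mk3; ring. Qed.

Ltac qd v := let a := fresh "a" in let b := fresh "b" in let c := fresh "c" in
  let d := fresh "d" in have [a [b [c [d ->]]]] := mk4_surj v.
Ltac xd v := let a := fresh "x" in let b := fresh "y" in let c := fresh "z" in
  have [a [b [c ->]]] := mk3_surj v.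

Lemma hopf_qmul r v : hopf (qmul r v) = qrot r (hopf v).
Proof. qd r; qd v; rewrite qmulE !hopfE qrotE; congr mk3; ring. Qed.

Lemma qrotZ r k x : qrot r (k *: x) = k *: qrot r x.
Proof. qd r; xd x; rewrite mk3Z !qrotE mk3Z; congr mk3; ring. Qed.

Lemma qrotZl r k x : qrot (k *: r) x = k ^+ 2 *: qrot r x.
Proof. qd r; xd x; rewrite mk4Z !qrotE mk3Z; congr mk3; ring. Qed.

Lemma qmulA p q r : qmul p (qmul q r) = qmul (qmul p q) r.
Proof. qd p; qd q; qd r; rewrite !qmulE; congr mk4; ring. Qed.

Lemma qrotM p q x : qrot (qmul p q) x = qrot p (qrot q x).
Proof. qd p; qd q; xd x; rewrite qmulE !qrotE; congr mk3; ring. Qed.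

Lemma qmul1q v : qmul qone v = v.
Proof. qd v; rewrite /qone qmulE; congr mk4; ring. Qed.

Lemma qrot1 x : qrot qone x = x.
Proof. xd x; rewrite /qone qrotE; congr mk3; ring. Qed.

Lemma qmulV r : sqnorm r != 0 -> qmul r ((sqnorm r)^-1 *: qconj r) = qone.
Proof.
qd r; rewrite sqnorm4 !mk4E => r0.
by rewrite qconjE mk4Z qmulE -[qone]/(mk4 1 0 0 0) -(mulVf r0); congr mk4; ring.
Qed.

Lemma qmulVr r : sqnorm r != 0 -> qmul ((sqnorm r)^-1 *: qconj r) r = qone.
Proof.
qd r; rewrite sqnorm4 !mk4E => r0.
by rewrite qconjE mk4Z qmulE -[qone]/(mk4 1 0 0 0) -(mulVf r0); congr mk4; ring.
Qed.

Lemma sqnorm_hopf v : sqnorm (hopf v) = sqnorm v ^+ 2.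
Proof. qd v; rewrite hopfE sqnorm3 sqnorm4 !mk4E !mk3E; ring. Qed.

Definition dot n (x y : 'rV[R]_n) : R := \sum_i x ord0 i * y ord0 i.

Lemma dot3 (x y : 'rV[R]_3) : dot x y =
  x ord0 j0 * y ord0 j0 + x ord0 j1 * y ord0 j1 + x ord0 j2 * y ord0 j2.
Proof.
rewrite /dot !big_ord_recl big_ord0 addr0 !addrA.
by congr (_ + _ + _); congr (x _ _ * y _ _); exact: val_inj.
Qed.

Definition enorm n (x : 'rV[R]_n) : R := Num.sqrt (sqnorm x).

(* Up to scale, 1 minus the product of the unit vectors along d' and d: the
   minimal rotation taking d to d', extended by a homothety. *)
Definition rot_wt (d d' : 'rV[R]_3) : R := enorm d * enorm d' + dot d d'.

Definition rotq (d d' : 'rV[R]_3) : 'rV[R]_4 :=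
  (enorm d * Num.sqrt (2 * rot_wt d d'))^-1 *:
   mk4 (rot_wt d d')
     (d ord0 j1 * d' ord0 j2 - d ord0 j2 * d' ord0 j1)
     (d ord0 j2 * d' ord0 j0 - d ord0 j0 * d' ord0 j2)
     (d ord0 j0 * d' ord0 j1 - d ord0 j1 * d' ord0 j0).

Lemma enorm_sqr n (x : 'rV[R]_n) : enorm x ^+ 2 = sqnorm x.
Proof. by rewrite sqr_sqrtr// sqnorm_ge0. Qed.

Lemma enorm_gt0 n (x : 'rV[R]_n) : x != 0 -> 0 < enorm x.
Proof. by move=> /sqnorm_gt0; rewrite sqrtr_gt0. Qed.

Lemma dot_self n (x : 'rV[R]_n) : dot x x = sqnorm x.
Proof. by apply: eq_bigr => i _; rewrite expr2. Qed.

Lemma rot_wt_self (d : 'rV[R]_3) : rot_wt d d = 2 * sqnorm d.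
Proof. by rewrite /rot_wt dot_self -expr2 enorm_sqr; ring. Qed.

(** The unscaled quaternion has squared length [2 * enorm d * enorm d' * rot_wt d d'] and turns the
    direction of [d] to that of [d']; the scale in [rotq] then corrects the length from [enorm d] to
    [enorm d']. *)
Lemma qrot_rotq d d' : d != 0 -> 0 < rot_wt d d' -> qrot (rotq d d') d = d'.
Proof.
move=> d0 N0; rewrite /rotq qrotZl exprVn exprMn enorm_sqr sqr_sqrtr ?mulr_ge0 ?ltW//.
have D0 := sqnorm_gt0 d0.
(* The product of the two roots is kept as an indeterminate [t] with polynomial square, so that each
   coordinate is a multiple of [t ^+ 2 - sqnorm d * sqnorm d']. *)
pose t := enorm d * enorm d'.
have tt : t ^+ 2 = sqnorm d * sqnorm d' by rewrite exprMn !enorm_sqr.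
have NE : rot_wt d d' = t + dot d d' by [].
have D0' : sqnorm d * (2 * rot_wt d d') != 0.
  by rewrite mulf_neq0 ?mulf_neq0 ?gt_eqF.
apply: (@scalerI _ _ (sqnorm d * (2 * rot_wt d d'))) => //.
rewrite scalerA mulfV// scale1r NE.
rewrite dot3 sqnorm3; rewrite !sqnorm3 in tt.
clear D0 D0' NE N0 d0; clearbody t; move: tt.
have [x [y [z ->]]] := mk3_surj d; have [x' [y' [z' ->]]] := mk3_surj d'.
rewrite !mk3E qrotE mk3Z => tt; congr mk3; apply/eqP; rewrite -subr_eq0; apply/eqP.
- transitivity ((t ^+ 2 - (x ^+ 2 + y ^+ 2 + z ^+ 2) * (x' ^+ 2 + y' ^+ 2 + z' ^+ 2)) * x); last by rewrite tt; ring.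
  ring.
- transitivity ((t ^+ 2 - (x ^+ 2 + y ^+ 2 + z ^+ 2) * (x' ^+ 2 + y' ^+ 2 + z' ^+ 2)) * y); last by rewrite tt; ring.
  ring.
- transitivity ((t ^+ 2 - (x ^+ 2 + y ^+ 2 + z ^+ 2) * (x' ^+ 2 + y' ^+ 2 + z' ^+ 2)) * z); last by rewrite tt; ring.
  ring.
Qed.

Lemma rotq_self d : d != 0 -> rotq d d = qone.
Proof.
move=> d0; have D0 := enorm_gt0 d0; rewrite /rotq rot_wt_self -enorm_sqr.
have -> : Num.sqrt (2 * (2 * enorm d ^+ 2)) = 2 * enorm d.
  rewrite (_ : 2 * _ = (2 * enorm d) ^+ 2); last by ring.
  by rewrite sqrtr_sqr ger0_norm// mulr_ge0// ltW.
have e0 : enorm d != 0 by rewrite gt_eqF.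
by rewrite mk4Z; congr mk4; field.
Qed.

Lemma rotq_neq0 d d' : d != 0 -> 0 < rot_wt d d' -> sqnorm (rotq d d') != 0.
Proof.
move=> d0 N0; rewrite gt_eqF// sqnorm_gt0//; apply/eqP => /rowP /(_ i0).
rewrite !mxE/= => /eqP; rewrite mulf_eq0 invr_eq0 (gt_eqF N0) orbF mulf_eq0.
by rewrite (gt_eqF (enorm_gt0 d0))/= gt_eqF// sqrtr_gt0 mulr_gt0.
Qed.

Lemma Ck_nth (V : normedModType R) k n (U : set V) (f : nat -> V -> R) : open U ->
  (forall i, Ck k U (f i)) -> Ck k U (fun x => \row_(i < n) f i x).
Proof.
move=> oU Cf; apply: Ck_rv => // j; apply: Ck_ext (Cf j) => // x _; by rewrite mxE.
Qed.

Lemma Ck_mk4 (V : normedModType R) k (U : set V) (a b c d : V -> R) : open U ->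
  Ck k U a -> Ck k U b -> Ck k U c -> Ck k U d -> Ck k U (fun x => mk4 (a x) (b x) (c x) (d x)).
Proof.
move=> oU Ca Cb Cc Cd.
apply: (@Ck_nth _ _ _ _ (fun i x => nth 0 [:: a x; b x; c x; d x] i)) => //.
by move=> [|[|[|[|i]]]] //=; rewrite /= ?nth_nil; exact: Ck_cst.
Qed.

Lemma Ck_mk3 (V : normedModType R) k (U : set V) (a b c : V -> R) : open U ->
  Ck k U a -> Ck k U b -> Ck k U c -> Ck k U (fun x => mk3 (a x) (b x) (c x)).
Proof.
move=> oU Ca Cb Cc.
apply: (@Ck_nth _ _ _ _ (fun i x => nth 0 [:: a x; b x; c x] i)) => //.
by move=> [|[|[|i]]] //=; rewrite /= ?nth_nil; exact: Ck_cst.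
Qed.

Ltac ckring := repeat first
 [ assumption | apply: CkB | apply: CkD | apply: CkM | apply: CkN | exact: Ck_cst ].

Lemma Ck_qmul (V : normedModType R) k (U : set V) (f g : V -> 'rV[R]_4) : open U ->
  Ck k U f -> Ck k U g -> Ck k U (fun x => qmul (f x) (g x)).
Proof.
move=> oU Cf Cg.
have Cf' i : Ck k U (fun x => f x ord0 i) by exact: (Ck_mx _ _ oU).1.
have Cg' i : Ck k U (fun x => g x ord0 i) by exact: (Ck_mx _ _ oU).1.
by apply: Ck_mk4 => //; ckring.
Qed.

Lemma Ck_hopf (V : normedModType R) k (U : set V) (f : V -> 'rV[R]_4) : open U ->
  Ck k U f -> Ck k U (fun x => hopf (f x)).
Proof.
move=> oU Cf.
have Cf' i : Ck k U (fun x => f x ord0 i) by exact: (Ck_mx _ _ oU).1.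
by apply: Ck_mk3 => //; ckring.
Qed.

Lemma Ck_dot (V : normedModType R) k n (U : set V) (f g : V -> 'rV[R]_n) : open U ->
  Ck k U f -> Ck k U g -> Ck k U (fun x => dot (f x) (g x)).
Proof.
move=> oU Cf Cg; apply: Ck_sum => // i _.
by apply: CkM => //; exact: (Ck_mx _ _ oU).1.
Qed.

Lemma Ck_enorm (V : normedModType R) k n (U : set V) (f : V -> 'rV[R]_n) : open U ->
  (forall x, U x -> f x != 0) -> Ck k U f -> Ck k U (fun x => enorm (f x)).
Proof.
move=> oU f0 Cf; apply: Ck_sqrt => //; last exact: Ck_sqnorm.
by move=> x /f0; exact: sqnorm_gt0.
Qed.

Lemma Ck_rot_wt (V : normedModType R) k (U : set V) (f g : V -> 'rV[R]_3) : open U ->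
  (forall x, U x -> f x != 0) -> (forall x, U x -> g x != 0) ->
  Ck k U f -> Ck k U g -> Ck k U (fun x => rot_wt (f x) (g x)).
Proof.
move=> oU f0 g0 Cf Cg; apply: CkD => //; last exact: Ck_dot.
by apply: CkM => //; exact: Ck_enorm.
Qed.

Lemma Ck_rotq (V : normedModType R) k (U : set V) (f g : V -> 'rV[R]_3) : open U ->
  (forall x, U x -> f x != 0) -> (forall x, U x -> g x != 0) ->
  (forall x, U x -> 0 < rot_wt (f x) (g x)) ->
  Ck k U f -> Ck k U g -> Ck k U (fun x => rotq (f x) (g x)).
Proof.
move=> oU f0 g0 w0 Cf Cg; have Cw := Ck_rot_wt oU f0 g0 Cf Cg.
have Cf' i : Ck k U (fun x => f x ord0 i) by exact: (Ck_mx _ _ oU).1.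
have Cg' i : Ck k U (fun x => g x ord0 i) by exact: (Ck_mx _ _ oU).1.
apply: CkZ => //; last by apply: Ck_mk4 => //; ckring.
apply: CkV => //.
  move=> x Ux; rewrite mulf_neq0 ?gt_eqF ?enorm_gt0 ?f0//.
  by rewrite sqrtr_gt0 mulr_gt0// w0.
apply: CkM => //; first exact: Ck_enorm.
apply: Ck_sqrt => //; first by move=> x Ux; rewrite mulr_gt0// w0.
by apply: CkM => //; exact: Ck_cst.
Qed.

End Quaternions.

(** * Smooth maps on whole spaces and open conditions *)

Section CinfCalculus.
Context {R : realType}.
Implicit Types V : normedModType R.

Lemma CicstT V (W : normedModType R) (a : W) : Cinf setT (fun _ : V => a).
Proof. by move=> k; exact: Ck_cst. Qed.

Lemma CiidT V : Cinf setT (fun x : V => x).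
Proof. by move=> k; exact: Ck_id. Qed.

Lemma CiDT V (W : normedModType R) (f g : V -> W) :
  Cinf setT f -> Cinf setT g -> Cinf setT (fun x => f x + g x).
Proof. by move=> Cf Cg k; apply: CkD => //; exact: openT. Qed.

Lemma CiBT V (W : normedModType R) (f g : V -> W) :
  Cinf setT f -> Cinf setT g -> Cinf setT (fun x => f x - g x).
Proof. by move=> Cf Cg k; apply: CkB => //; exact: openT. Qed.

Lemma CiNT V (W : normedModType R) (f : V -> W) :
  Cinf setT f -> Cinf setT (fun x => - f x).
Proof. by move=> Cf k; apply: CkN => //; exact: openT. Qed.

Lemma CiMT V (f g : V -> R) :
  Cinf setT f -> Cinf setT g -> Cinf setT (fun x => f x * g x).
Proof. by move=> Cf Cg k; apply: CkM => //; exact: openT. Qed.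

Lemma CiZT V m n (f : V -> R) (g : V -> 'M[R]_(m, n)) :
  Cinf setT f -> Cinf setT g -> Cinf setT (fun x => f x *: g x).
Proof. by move=> Cf Cg k; apply: CkZ => //; exact: openT. Qed.

Lemma Cicoord V m n (f : V -> 'M[R]_(m, n)) i j :
  Cinf setT f -> Cinf setT (fun x => f x i j).
Proof. by move=> Cf k; exact: (Ck_mx _ _ openT).1 (Cf k) i j. Qed.

Lemma Cicomp V n (f : 'rV[R]_n -> R) (g : V -> 'rV[R]_n) :
  Cinf setT f -> Cinf setT g -> Cinf setT (fun x => f (g x)).
Proof.
by move=> Cf Cg k; apply: (@Ck_comp _ _ _ _ setT setT f g); [exact: openT|exact: openT| |exact: Cf|exact: Cg].
Qed.

Lemma Cicomp_mx V n p q (f : 'rV[R]_n -> 'M[R]_(p, q)) (g : V -> 'rV[R]_n) :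
  Cinf setT f -> Cinf setT g -> Cinf setT (fun x => f (g x)).
Proof.
by move=> Cf Cg k; apply: (@Ck_comp_mx _ _ _ _ _ _ setT setT f g); [exact: openT|exact: openT| |exact: Cf|exact: Cg].
Qed.

Lemma Cicomp1 V (f : R -> R) (g : V -> R) :
  Cinf setT f -> Cinf setT g -> Cinf setT (fun x => f (g x)).
Proof.
by move=> Cf Cg k; apply: (@Ck_comp1 _ _ _ setT setT f g); [exact: openT|exact: openT| |exact: Cf|exact: Cg].
Qed.

Lemma Cicomp1_mx V p q (f : R -> 'M[R]_(p, q)) (g : V -> R) :
  Cinf setT f -> Cinf setT g -> Cinf setT (fun x => f (g x)).
Proof.
by move=> Cf Cg k; apply: (@Ck_comp1_mx _ _ _ _ _ setT setT f g); [exact: openT|exact: openT| |exact: Cf|exact: Cg].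
Qed.

Lemma Cipt2 V (f g : V -> R) :
  Cinf setT f -> Cinf setT g -> Cinf setT (fun x => pt2 (f x) (g x)).
Proof. by move=> Cf Cg k; apply: Ck_pt2 => //; exact: openT. Qed.

Lemma Cistep : Cinf setT (@step R).
Proof. by move=> k; exact: Ck_step. Qed.

Lemma Cirsub n : Cinf setT (fun z : 'rV[R]_(1 + n) => rsubmx z).
Proof.
move=> k; apply: Ck_rv => [|j]; first exact: openT.
apply: Ck_ext (Ck_coord _ ord0 (rshift 1 j) openT) => [|x _]; first exact: openT.
by rewrite mxE.
Qed.

Lemma is_derive_affine n (a v : 'rV[R]_n) (t : R) :
  is_derive t (1 : R) (fun t : R => a + t *: v) v.
Proof.
have L : h^-1 *: ((a + (h *: (1 : R) + t) *: v) - (a + t *: v)) @[h --> (0 : R)^'] --> v.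
  apply: cvg_near_cst; near=> h.
  have h0 : h != 0 by near: h; exact: nbhs_dnbhs_neq.
  by rewrite opprD addrACA subrr add0r -scalerBl addrK scalerA -[h *: 1]/(h * 1) mulr1 mulVf// scale1r.
by split; [apply/cvg_ex; exists v|exact: cvg_lim L].
Unshelve. all: by end_near. Qed.

Lemma open_pos V (f : V -> R) : continuous f -> open [set x | 0 < f x].
Proof. by move=> cf; apply: (@open_comp _ _ f [set x | 0 < x]) => //; exact: open_gt. Qed.

Lemma continuous_enorm V n (f : V -> 'rV[R]_n) : Cinf setT f -> continuous (fun x => enorm (f x)).
Proof.
move=> Cf x; apply: (@continuous_comp _ _ _ (fun y => sqnorm (f y)) Num.sqrt).
  exact: (Ck_continuous (Ck_sqnorm openT (Cf 0%N)) I).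
exact: sqrt_continuous.
Qed.

Lemma continuous_rot_wt V (f g : V -> 'rV[R]_3) : Cinf setT f -> Cinf setT g ->
  continuous (fun x => rot_wt (f x) (g x)).
Proof.
move=> Cf Cg x; apply: cvgD.
  by apply: cvgM; exact: continuous_enorm.
exact: (Ck_continuous (Ck_dot openT (Cf 0%N) (Cg 0%N)) I).
Qed.

Lemma pt2_dist (a b a' b' d : R) : `|a - a'| < d -> `|b - b'| < d -> `|pt2 a b - pt2 a' b'| < d.
Proof.
move=> ad bd; apply: (@le_lt_trans _ _ (Num.max `|a - a'| `|b - b'|)); last by rewrite gt_max ad bd.
apply: norm_le_coord; first by rewrite le_max normr_ge0.
by move=> i j; rewrite !mxE le_max; case: ifP => _; rewrite lexx ?orbT.
Qed.

(** Tube lemma over the compact segment [[a, b]]. *)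
Lemma pt2_tube (O : set 'rV[R]_2) (mu0 a b : R) : open O ->
  (forall s, a <= s <= b -> O (pt2 mu0 s)) ->
  \forall mu \near mu0, forall s, a <= s <= b -> O (pt2 mu s).
Proof.
move=> oO O0.
have cov := (compact_near_coveringP _).1 (@segment_compact R a b).
have : \forall mu \near mu0, `[a, b]%classic `<=` (fun s => O (pt2 mu s)).
  apply: (cov R (nbhs mu0) (fun mu s => O (pt2 mu s)) (nbhs_filter mu0)) => s.
  rewrite /= in_itv/= => sab.
  have /nbhs_normP [d /= d0 Hd] : nbhs (pt2 mu0 s) O by apply: open_nbhs_nbhs; split=> //; exact: O0.
  exists ([set z' | `|z' - s| < d], [set mu | `|mu - mu0| < d]).
    split; apply: open_nbhs_nbhs; split; [exact: open_dist_lt|by rewrite /= subrr normr0|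
      exact: open_dist_lt|by rewrite /= subrr normr0].
  by move=> [z' mu] [/= zz mm]; apply: Hd; rewrite /= distrC; exact: pt2_dist.
by apply: filterS => mu H s sab; apply: H; rewrite /= in_itv.
Qed.

End CinfCalculus.

Ltac cinf := repeat first [ assumption | exact: CicstT | exact: CiidT | exact: Cistep
  | apply: CiDT | apply: CiBT | apply: CiNT | apply: CiMT | apply: CiZT | apply: Cipt2 | apply: Cicoord ].

(** * Sliding the endpoint of the spun half-line *)

Section Isotopy.
Context {R : realType}.

Definition ambient_equiv n (A B : set 'rV[R]_n) := exists F G,
  diffeo F G /\ forall v, A v <-> B (F v).

Lemma ambient_equiv_refl n (A : set 'rV[R]_n) : ambient_equiv A A.
Proof. by exists id, id; split=> //; split=> //; exact: CiidT. Qed.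

Lemma ambient_equiv_sym n (A B : set 'rV[R]_n) : ambient_equiv A B -> ambient_equiv B A.
Proof.
move=> [F [G [D AB]]]; have [_ _ FG GF] := D.
by exists G, F; split; [exact: diffeo_sym|move=> v; rewrite AB GF].
Qed.

Lemma ambient_equiv_trans n (A B C : set 'rV[R]_n) :
  ambient_equiv A B -> ambient_equiv B C -> ambient_equiv A C.
Proof.
move=> [F [G [D AB]]] [F' [G' [D' BC]]].
by exists (F' \o F), (G \o G'); split; [exact: diffeo_comp|move=> v; rewrite AB BC].
Qed.

Lemma compact_bounded_norm (T : topologicalType) (W : normedModType R) (A : set T) (f : T -> W) :
  compact A -> continuous f -> exists2 C, 0 <= C & forall x, A x -> `|f x| <= C.
Proof.
move=> cA cf; have [|C C0 HC] := @compact_bounded R T A (fun x => `|f x|) cA.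
  by move=> x _; apply: (continuous_comp (cf x)); exact: norm_continuous.
by exists C => // x /HC; rewrite normr_id.
Qed.

Lemma norm_le_enorm n (x : 'rV[R]_n) : `|x| <= enorm x.
Proof.
apply: norm_le_coord; first exact: sqrtr_ge0.
move=> i j; rewrite (ord1 i) -sqrtr_sqr ler_sqrt ?sqnorm_ge0//.
by rewrite /sqnorm (bigD1 j)//= lerDl sumr_ge0// => l _; exact: sqr_ge0.
Qed.

Lemma sqnorm_le n (x : 'rV[R]_n) : sqnorm x <= n%:R * `|x| ^+ 2.
Proof.
rewrite /sqnorm -[n in n%:R]card_ord -sumr_const mulr_suml ler_sum// => i _.
by rewrite mul1r -[leLHS]ger0_norm ?sqr_ge0// normrX lerXn2r ?nnegrE// coord_le_norm.
Qed.

(** The indicator function of [P] is continuous on the segment, so by the intermediate value theorem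
    it cannot take both values 0 and 1. *)
Lemma locally_constant_segment (P : R -> Prop) (a b : R) : a <= b ->
  (forall x, a <= x <= b -> \forall y \near x, P x <-> P y) -> P a <-> P b.
Proof.
move=> ab loc; pose f x : R := if `[<P x>] then 1 else 0.
have cf : {within `[a, b], continuous f}.
  apply: continuous_in_subspaceT => x /set_mem; rewrite /= in_itv/= => xab.
  suff : f y @[y --> x] --> f x by [].
  apply: cvg_near_cst; apply: filterS (loc x xab) => y Pxy.
  by rewrite /f (asbool_equiv_eq Pxy).
have [Pa|nPa] := pselect (P a); have [Pb|nPb] := pselect (P b) => //.
- have [|c _] := @IVT R f a b 2^-1 ab cf.
    by rewrite /f asboolT// asboolF// ge_min le_max; apply/andP; split; apply/orP; [right|left]; lra.
  by rewrite /f; case: ifP => _; lra.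
- have [|c _] := @IVT R f a b 2^-1 ab cf.
    by rewrite /f asboolF// asboolT// ge_min le_max; apply/andP; split; apply/orP; [left|right]; lra.
  by rewrite /f; case: ifP => _; lra.
Qed.

(** [chi] cuts off translations of R^3 and [k] translations of the parameter; [N] bounds the
    endpoints used, [r] their positions. The Lipschitz bounds make both kinds of truncated
    translation injective or monotone. *)
Variables (l : R -> 'rV[R]_3) (chi : 'rV[R]_3 -> R) (k : R -> R) (N r M3 Zk : R).
Hypotheses (Cl : Cinf setT l) (l_inj : injective l) (dl0 : forall s : R, 'D_1 l s != 0)
 (l_proper : forall C, exists S : R, forall s : R, S <= `|s| -> C <= `|l s|)
 (Cchi : Cinf setT chi) (chi_in : forall z : 'rV[R]_3, `|z| <= r -> chi z = 1)
 (chi_out : forall z : 'rV[R]_3, M3 <= `|z| -> chi z = 0)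
 (chi_lip : forall mu, `|mu| <= N ->
   forall x y, `|chi x *: l mu - chi y *: l mu| <= 2^-1 * `|x - y|)
 (l_r : forall mu, `|mu| <= N -> `|l mu| <= r)
 (Ck' : Cinf setT k) (k_in : forall s, `|s| <= N -> k s = 1)
 (k_out : forall s, Zk <= `|s| -> k s = 0)
 (k_lip : forall x y, `|k x - k y| <= `|x - y|).

(** Brings the endpoint [l mu] to the origin, the branch point of [hopf], and is the identity far
    away. *)
Definition slide (mu : R) (x : 'rV[R]_3) := x - chi x *: l mu.

(** Over the endpoint the fibre shrinks to a point, so circles over a half-line form a plane with
    its tip at 0. *)
Definition spun (lam : R) : set 'rV[R]_4 :=
  [set v | exists s, lam <= s /\ hopf v = slide lam (l s)].

Lemma slide_diffeo mu : `|mu| <= N -> exists G, diffeo (slide mu) G.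
Proof.
move=> muN; apply: (@id_plus_diffeo _ _ (fun x => - (chi x *: l mu))).
  by cinf.
by move=> x y; rewrite opprK addrC distrC; exact: chi_lip.
Qed.

Lemma slide_self mu : `|mu| <= N -> slide mu (l mu) = 0.
Proof. by move=> muN; rewrite /slide chi_in ?l_r// scale1r subrr. Qed.

Section Step.
Variable lam0 : R.
Hypothesis lam0N : `|lam0| < N.

(** Moves [lam0] to [mu] and fixes large parameters, so that two half-lines are compared over the
    same range of [s]. *)
Definition repar (mu s : R) := s + (mu - lam0) * k s.

Lemma repar_lam0 s : repar lam0 s = s.
Proof. by rewrite /repar subrr mul0r addr0. Qed.

Lemma repar_start mu : repar mu lam0 = mu.
Proof. by rewrite /repar k_in ?ltW// mulr1 addrC subrK. Qed.

Lemma repar_ge mu s : `|mu - lam0| <= 1 -> lam0 <= s -> mu <= repar mu s.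
Proof.
move=> m1 ls; rewrite -subr_ge0 /repar.
have -> : s + (mu - lam0) * k s - mu = (s - lam0) + (mu - lam0) * (k s - k lam0).
  by rewrite (k_in (ltW lam0N)); ring.
have : `|(mu - lam0) * (k s - k lam0)| <= s - lam0.
  rewrite normrM -[leRHS]mul1r; apply: ler_pM => //.
  by apply: le_trans (k_lip _ _) _; rewrite ger0_norm// subr_ge0.
by rewrite ler_norml => /andP[]; lra.
Qed.

Lemma repar_onto mu s' : mu <= s' -> exists2 s, lam0 <= s & repar mu s = s'.
Proof.
move=> ms.
pose b := Num.max (Num.max lam0 Zk) s'.
have lb : lam0 <= b by rewrite !le_max lexx.
have rb : repar mu b = b.
  rewrite /repar k_out ?mulr0 ?addr0//; apply: le_trans (ler_norm _).
  by rewrite !le_max lexx orbT.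
have cr : continuous (repar mu).
  by apply: Cinf_continuous; apply: CiDT; [exact: CiidT|apply: CiMT; [exact: CicstT|exact: Ck']].
have [|s /[!in_itv]/= /andP[ls _] <-] := @IVT _ (repar mu) lam0 b s' lb (continuous_subspaceT cr).
  by rewrite repar_start rb ge_min ms/= le_max le_max lexx !orbT.
by exists s.
Qed.

(** Hadamard's lemma divides the moved half-line by [s - lam0], so that its direction seen from the
    tip extends smoothly over the tip. Rotations will be built from [d] and [e], not from the
    vanishing vector itself. *)
Lemma step_fields : exists (d : R -> 'rV[R]_3) (e : R -> R -> 'rV[R]_3),
  [/\ Cinf setT (fun z : 'rV[R]_2 => e (z ord0 0) (z ord0 1)),
      d = e lam0, forall s, d s != 0,
      forall mu s, `|mu| <= N -> slide mu (l (repar mu s)) = (s - lam0) *: e mu s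
    & forall s, slide lam0 (l s) = (s - lam0) *: d s].
Proof.
pose F0 (z : 'rV[R]_2) := let mu := z ord0 0 in let x := l (repar mu (z ord0 1 + lam0)) in x - chi x *: l mu.
(* Subtracting the value at the tip gives Hadamard's hypothesis for every real [mu]; that value is 0
   for |mu| <= N. *)
pose F z := F0 z - F0 (pt2 (z ord0 0) 0).
have C0 : Cinf setT (fun z : 'rV[R]_2 => z ord0 0) by apply: Cicoord; exact: CiidT.
have C1 : Cinf setT (fun z : 'rV[R]_2 => z ord0 1) by apply: Cicoord; exact: CiidT.
have Crep : Cinf setT (fun z : 'rV[R]_2 => repar (z ord0 0) (z ord0 1 + lam0)).
  apply: CiDT; first by cinf.
  apply: CiMT; first by cinf.
  by apply: Cicomp1 => //; cinf.
have CF0 : Cinf setT F0.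
  apply: CiBT; first exact: Cicomp1_mx.
  apply: CiZT; last exact: Cicomp1_mx.
  by apply: Cicomp => //; exact: Cicomp1_mx.
have CF : Cinf setT F by apply: CiBT => //; apply: Cicomp_mx => //; cinf.
have Fz a : F (pt2 a 0) = 0 by rewrite /F pt2_0 subrr.
have [H [CH HH]] := hadamard_rV CF Fz.
have F0z mu : `|mu| <= N -> F0 (pt2 mu 0) = 0.
  by move=> muN; rewrite /F0 pt2_0 pt2_1 add0r repar_start; exact: slide_self.
have FE mu s : `|mu| <= N -> F (pt2 mu s) = slide mu (l (repar mu (s + lam0))).
  by move=> muN; rewrite /F pt2_0 F0z// subr0 /F0 pt2_0 pt2_1.
have E mu s : `|mu| <= N -> slide mu (l (repar mu s)) = (s - lam0) *: H (pt2 mu (s - lam0)).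
  by move=> muN; have [<- _] := HH mu (s - lam0); rewrite FE// subrK.
exists (fun s => H (pt2 lam0 (s - lam0))), (fun mu s => H (pt2 mu (s - lam0))); split=> //.
- by apply: Cicomp_mx => //; cinf.
(* Off the tip, a zero of [d] would give two parameters the same point, against injectivity of [l]
   and [slide lam0]; at the tip it would make ['D_1 l lam0] vanish. *)
- move=> s; apply/eqP => H0.
  have [G D] := slide_diffeo (ltW lam0N); have [CK CG KG GK] := D.
  have [/subr0_eq sl|sl] := eqVneq (s - lam0) 0; last first.
    have := E lam0 s (ltW lam0N); rewrite H0 scaler0 repar_lam0 -(slide_self (ltW lam0N)).
    by move/(can_inj KG)/l_inj => sE; move: sl; rewrite sE subrr eqxx.
  move: H0; rewrite sl subrr => H0.
  have [_ HD] := HH lam0 0; move: HD; rewrite H0 => HD.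
  have q1 : is_derive (0 : R) (1 : R) (fun t : R => pt2 lam0 0 + t *: pt2 0 1) (pt2 0 1).
    exact: is_derive_affine.
  have qE (t : R) : pt2 lam0 0 + t *: pt2 0 1 = pt2 lam0 t.
    by apply/rowP => j; rewrite !mxE; case: ifP => _; rewrite ?mulr0 ?mulr1 ?addr0 ?add0r.
  have [q1a q1b] := q1.
  have := @is_derive_comp R 2 3 R setT F (fun t : R => pt2 lam0 0 + t *: pt2 0 1) 0 1 openT (CF 1%N) I q1a.
  have J := @derive_jac R 2 3 setT F (pt2 lam0 0) (pt2 0 1) openT (CF 1%N) I.
  rewrite q1b scale0r addr0 -J -HD => -[F1a F1b].
  have := @is_derive_comp R 3 3 R setT G (fun t : R => F (pt2 lam0 0 + t *: pt2 0 1)) 0 1 openT (CG 1%N) I F1a.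
  rewrite F1b mul0mx => -[_].
  under eq_fun do rewrite qE FE ?ltW// repar_lam0 KG.
  rewrite /derive /=; under eq_fun do rewrite addr0; rewrite add0r => l'0.
  by move: (dl0 lam0); rewrite /derive l'0 eqxx.
- by move=> s; have := E lam0 s (ltW lam0N); rewrite repar_lam0.
Qed.


(** Left multiplication by [rotq (d s) (e mu s)] takes the fibre over the old point with parameter
    [s] to the fibre over the new one. The parameter is recovered smoothly from [v] and the
    displacement is cut off; it vanishes for [mu = lam0], so it is small for [mu] near [lam0] and
    gives a global diffeomorphism. *)
Lemma spun_step : \forall mu \near lam0, ambient_equiv (spun lam0) (spun mu).
Proof.
have [d [e [Ce dE d0 eE dE']]] := step_fields.
have Ce2 (V : normedModType R) (a b : V -> R) : Cinf setT a -> Cinf setT b ->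
    Cinf setT (fun x => e (a x) (b x)).
  move=> Ca Cb k'.
  apply: (@Ck_ext _ _ _ _ _ (fun x => (fun z : 'rV[R]_2 => e (z ord0 0) (z ord0 1)) (pt2 (a x) (b x)))).
  - exact: openT.
  - by move=> x _; rewrite pt2_0 pt2_1.
  - by apply: (Cicomp_mx Ce); exact: Cipt2.
have [G [CK CG KG GK]] := slide_diffeo (ltW lam0N).
have [S HS] := l_proper M3.
(* Beyond [sfar] both cutoffs vanish along [l], so the two half-lines coincide and nothing has to
   move. *)
pose sfar := Num.max (Num.max S Zk) 0.
have far s : sfar <= s -> k s = 0 /\ chi (l s) = 0.
  rewrite /sfar !ge_max => /andP[/andP[sS sZ] s0].
  by split; [apply: k_out|apply/chi_out/HS]; rewrite ger0_norm.
have Cs : Cinf setT (fun s => slide lam0 (l s)).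
  by apply: (@Cicomp_mx _ _ _ _ _ (slide lam0) l) => //; exact: CK.
have [C C0 HC] := compact_bounded_norm (@segment_compact R lam0 sfar) (Cinf_continuous Cs).
(* As [sqnorm (hopf v)] is the square of [sqnorm v], the bound [C] on the curve bounds its preimage;
   this value of [m] avoids a root. *)
pose m := 1 + 3 * C ^+ 2.
have Hm s v : lam0 <= s <= sfar -> hopf v = slide lam0 (l s) -> `|v| <= m.
  move=> sI vs.
  have := HC s; rewrite /= in_itv/= => /(_ sI); rewrite -vs => sC.
  have v2 : `|v| ^+ 2 <= sqnorm v.
    by rewrite -enorm_sqr lerXn2r ?nnegrE ?sqrtr_ge0// norm_le_enorm.
  have : sqnorm v ^+ 2 <= 3 * C ^+ 2.
    rewrite -sqnorm_hopf; apply: le_trans (sqnorm_le _) _.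
    by rewrite ler_wpM2l// lerXn2r ?nnegrE.
  have v0 : 0 <= `|v| by [].
  have sv0 := sqnorm_ge0 v; have C20 := sqr_ge0 C.
  rewrite /m => svC; rewrite leNgt; apply/negP => vm.
  have : 1 + 3 * C ^+ 2 <= sqnorm v by nra.
  nra.
have m0 : 0 <= m by rewrite addr_ge0// mulr_ge0// sqr_ge0.
have [chi4 [M4 [C4 chi4b chi4_in chi4_out _]]] := @slow_cutoff R 4 m 1 m0 ltr01.
have m_M4 (v : 'rV[R]_4) : `|v| <= m -> `|v| <= M4.
  move=> vm; have v1 := chi4_in v vm; rewrite leNgt; apply/negP => /ltW vM.
  by have := chi4_out v vM; rewrite v1 => /eqP; rewrite oner_eq0.
(* Where [chi4] may be nonzero the parameters are bounded, since [l] is proper; the left inverse [g]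
   is valid only for bounded parameters. *)
have [Mg HMg] : exists Mg, forall s (v : 'rV[R]_4), `|v| <= M4 -> hopf v = slide lam0 (l s) -> `|s| <= Mg.
  have CGh : Cinf setT (fun v : 'rV[R]_4 => G (hopf v)).
    by apply: Cicomp_mx => // k'; apply: Ck_hopf; [exact: openT|exact: Ck_id].
  have [B B0 HB] := compact_bounded_norm (@compact_ball R 4 0 M4) (Cinf_continuous CGh).
  have [Mg HMg] := l_proper (B + 1); exists Mg => s v vM vs.
  rewrite leNgt; apply/negP => /ltW /HMg; have := HB v; rewrite /= subr0 => /(_ vM).
  by rewrite vs KG => lB Bl; have := le_trans Bl lB; lra.
have [g [Cg Hg]] := curve_left_inverse Mg Cl l_inj dl0.
(* The parameter of the point under [v], extended smoothly to all of R^4. *)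
pose sv (v : 'rV[R]_4) := g (G (hopf v)).
have svE s (v : 'rV[R]_4) : `|v| <= M4 -> hopf v = slide lam0 (l s) -> sv v = s.
  by move=> vM vs; rewrite /sv vs KG Hg//; exact: HMg vM vs.
pose vv (z : 'rV[R]_(1 + 4)) : 'rV[R]_4 := rsubmx z.
pose D z := d (sv (vv z)).
pose hd (z : 'rV[R]_(1 + 4)) : R := z ord0 (lshift 4 ord0).
have Chd : Cinf setT hd by apply: Cicoord; exact: CiidT.
pose E z := e (hd z) (sv (vv z)).
have Cvv : Cinf setT vv by exact: Cirsub.
have Csv : Cinf setT (fun z => sv (vv z)).
  apply: (@Cicomp _ _ _ g (fun z => G (hopf (vv z)))); first exact: Cg.
  apply: (@Cicomp_mx _ _ _ _ _ G (fun z => hopf (vv z))); first exact: CG.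
  by move=> k'; apply: Ck_hopf; [exact: openT|exact: Cvv].
have CE : Cinf setT E by apply: Ce2.
have CD : Cinf setT D by rewrite /D dE; apply: Ce2 => //; exact: CicstT.
(* Here the two directions are nonzero and not opposite, the domain where [rotq] is smooth. *)
pose O := [set z | 0 < rot_wt (D z) (E z)].
have oO : open O by apply: open_pos; exact: continuous_rot_wt.
have rot0 (x : 'rV[R]_3) : rot_wt x 0 = 0.
  by rewrite /rot_wt dot3 /enorm !sqnorm3 !mxE expr0n/= !addr0 sqrtr0 !mulr0 !addr0.
have E0 z : O z -> E z != 0.
  by move=> Oz; apply/eqP => Ez; move: Oz; rewrite /O /= Ez rot0 ltxx.
pose W z := chi4 (vv z) *: (qmul (rotq (D z) (E z)) (vv z) - vv z).
have CW : Cinf O W.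
  move=> k'; have sub (V' : normedModType R) (f : 'rV[R]_(1 + 4) -> V') : Cinf setT f -> Ck k' O f.
    by move=> Cf; exact: Ck_sub (@subsetT _ _) (Cf k').
  apply: CkZ => //; first by apply: (sub R); exact: Cicomp.
  apply: CkB => //; last exact: sub Cvv.
  apply: Ck_qmul => //; last exact: sub Cvv.
  by apply: Ck_rotq => //; [move=> z _; exact: d0|exact: sub CD|exact: sub CE].
have consv mu (v : 'rV[R]_4) : vv (cons_rv mu v) = v by exact: row_mxKr.
have consD mu (v : 'rV[R]_4) : D (cons_rv mu v) = d (sv v) by rewrite /D consv.
have consE mu (v : 'rV[R]_4) : E (cons_rv mu v) = e mu (sv v).
  rewrite /E consv; congr (e _ _).
  by rewrite /hd /cons_rv row_mxEl mxE eqxx.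
have pos : \forall mu \near lam0, forall s, lam0 <= s <= sfar -> 0 < rot_wt (d s) (e mu s).
  have oP : open [set z : 'rV[R]_2 | 0 < rot_wt (d (z ord0 1)) (e (z ord0 0) (z ord0 1))].
    apply: open_pos; apply: continuous_rot_wt.
    - by rewrite dE; apply: Ce2; cinf; exact: CiidT.
    - by apply: Ce2; cinf; exact: CiidT.
  have := pt2_tube (mu0 := lam0) (a := lam0) (b := sfar) oP.
  move=> H; apply: filterS (H _) => [mu Hmu s sI|s sI].
    by have := Hmu s sI; rewrite /= pt2_0 pt2_1.
  by rewrite /= pt2_0 pt2_1 -dE rot_wt_self mulr_gt0// sqnorm_gt0.
near=> mu.
have muN : `|mu| <= N.
  apply/ltW; rewrite -[X in `|X|]subr0; near: mu.
  by apply: open_nbhs_nbhs; split; [exact: open_dist_lt|rewrite /= subr0].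
have mu1 : `|mu - lam0| <= 1.
  apply/ltW; near: mu.
  by apply: open_nbhs_nbhs; split; [exact: open_dist_lt|rewrite /= subrr normr0].
have mupos : forall s, lam0 <= s <= sfar -> 0 < rot_wt (d s) (e mu s) by near: mu.
have [CWm WL] : Cinf setT (fun z => W (cons_rv mu z)) /\
    forall x y, `|W (cons_rv mu x) - W (cons_rv mu y)| <= 2^-1 * `|x - y|.
  near: mu; apply: (@small_family R 4 4 O W lam0 M4 2^-1 _ oO CW).
  - by rewrite invr_gt0.
  - by move=> v; rewrite /O /= consD consE -dE rot_wt_self mulr_gt0// sqnorm_gt0.
  - by move=> v; rewrite /W consD consE consv -dE rotq_self// qmul1q subrr scaler0.
  - by move=> mu v vM; rewrite /W consv chi4_out// scale0r.
have [Psi' PD] := id_plus_diffeo CWm WL.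
pose Psi v := v + W (cons_rv mu v).
have nearP s v : lam0 <= s <= sfar -> hopf v = slide lam0 (l s) ->
    Psi v = qmul (rotq (d s) (e mu s)) v.
  move=> sI vs; have vm := Hm s v sI vs.
  rewrite /Psi /W consD consE consv (svE s v)// ?m_M4//.
  by rewrite chi4_in// scale1r addrC subrK.
have farP s v : sfar <= s -> hopf v = slide lam0 (l s) -> Psi v = v.
  move=> sf vs; have [ks cs] := far s sf.
  rewrite /Psi; have [vM|/ltW vM] := leP M4 `|v|.
    by rewrite /W consv chi4_out// scale0r addr0.
  rewrite /W consD consE consv (svE s v)//.
  (* Past [sfar] both fields are the quotient of [l s] by [s - lam0], so the rotation is trivial. *)
  rewrite (_ : e mu s = d s); first by rewrite rotq_self// qmul1q subrr scaler0 addr0.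
  have sl : s - lam0 != 0.
    rewrite subr_eq0; apply/eqP => sl; have := k_in (ltW lam0N).
    by rewrite -sl ks => /esym/eqP; rewrite oner_eq0.
  apply: (scalerI sl); rewrite -eE// -dE' /repar ks mulr0 addr0.
  by rewrite /slide cs !scale0r.
have fwd s v : lam0 <= s -> hopf v = slide lam0 (l s) ->
    hopf (Psi v) = slide mu (l (repar mu s)).
  move=> ls vs; have [sf|sf] := leP s sfar.
    have sI : lam0 <= s <= sfar by rewrite ls.
    by rewrite (nearP s v)// hopf_qmul vs dE' qrotZ qrot_rotq// ?eE//; exact: mupos.
  rewrite (farP s v (ltW sf))//; have [ks cs] := far s (ltW sf).
  by rewrite vs /repar ks mulr0 addr0 /slide cs !scale0r.
have bwd v' : spun mu v' -> exists2 v, spun lam0 v & Psi v = v'.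
  move=> [s' [ms v's]]; have [s ls ss'] := repar_onto ms.
  have [sf|/ltW sf] := leP s sfar; last first.
    have [ks cs] := far s sf.
    have vs : hopf v' = slide lam0 (l s).
      by rewrite v's -ss' /repar ks mulr0 addr0 /slide cs !scale0r.
    by exists v'; [exists s|exact: farP sf vs].
  have sI : lam0 <= s <= sfar by rewrite ls.
  pose q := rotq (d s) (e mu s).
  have q0 : sqnorm q != 0 by apply: rotq_neq0 => //; exact: mupos.
  pose v := qmul ((sqnorm q)^-1 *: qconj q) v'.
  have vs : hopf v = slide lam0 (l s).
    rewrite hopf_qmul v's -ss' eE// dE' -(qrot_rotq (d0 s) (mupos s sI)) -/q.
    by rewrite -!qrotZ -qrotM qmulVr// qrot1.
  exists v; first by exists s.
  by rewrite (nearP s v)// -/q /v qmulA qmulV// qmul1q.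
exists Psi, Psi'; split=> //.
move=> v; split.
  move=> [s [ls vs]]; exists (repar mu s); split; first exact: repar_ge.
  exact: fwd.
have [_ _ PK _] := PD.
by move=> /bwd [v2 Sv2] /(can_inj PK) <-.
Unshelve. all: by end_near. Qed.

End Step.

Lemma spun_equiv lam mu : - N < lam -> lam <= mu -> mu < N ->
  ambient_equiv (spun lam) (spun mu).
Proof.
move=> Nl lm mN.
suff H : ambient_equiv (spun lam) (spun lam) <-> ambient_equiv (spun lam) (spun mu).
  exact/H/ambient_equiv_refl.
apply: (locally_constant_segment (P := fun x => ambient_equiv (spun lam) (spun x)) lm) => x /andP[lx xm].
have xN : `|x| < N by rewrite ltr_norml; apply/andP; split; [exact: lt_le_trans lx|exact: le_lt_trans mN].
apply: filterS (spun_step xN) => y xy; split=> H; first exact: ambient_equiv_trans xy.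
exact: ambient_equiv_trans (ambient_equiv_sym xy).
Qed.
End Isotopy.

(** * Lines with radial ends and the triviality of the spun plane *)

Section Line.
Context {R : realType}.

(** Both ends lie on rays from the origin: [b] is the direction of the final ray, and [a] that of
    the initial one, pointing outward, against the direction of travel. *)
Record proper_line (l : R -> 'rV[R]_3) (a b : 'rV[R]_3) (rho : R) : Prop := {
  line_smooth : Cinf setT l;
  line_inj : injective l;
  line_immersion : forall s : R, 'D_1 l s != 0;
  line_rho : 0 < rho;
  line_a : a != 0;
  line_b : b != 0;
  line_end : forall s, rho <= s -> l s = s *: b;
  line_start : forall s, s <= - rho -> l s = - s *: a }.

Lemma proper_line_proper l a b rho : proper_line l a b rho ->
  forall C : R, exists S : R, forall s : R, S <= `|s| -> C <= `|l s|.
Proof.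
move=> H C; have a0 := line_a H; have b0 := line_b H.
exists (Num.max rho (Num.max (C / `|a|) (C / `|b|))) => s.
rewrite !ge_max => /andP[rs /andP[]]; rewrite !ler_pdivrMr ?normr_gt0// => sa sb.
have [s0|s0] := leP 0 s.
  by rewrite (ger0_norm s0) in rs sb; rewrite (line_end H rs) normrZ (ger0_norm s0).
rewrite (ltr0_norm s0) in rs sa; rewrite (line_start H); last by rewrite lerNr.
by rewrite normrZ normrN (ltr0_norm s0).
Qed.

Definition half_plane_bundle (b : 'rV[R]_3) : set 'rV[R]_4 :=
  [set v | exists c, 0 <= c /\ hopf v = c *: b].

(* The endpoint is slid along the line from - R0 to beyond rho, where only the
   ray spanned by b is left to be spun and the plane is flat. *)
Lemma spun_line_trivial l a b rho R0 : proper_line l a b rho -> 0 < R0 ->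
  exists K G, [/\ diffeo K G, forall x, `|x| <= 2 -> K x = x - l (- R0), K (l (- R0)) = 0
    & ambient_equiv (half_plane_bundle b)
        [set v | exists s, - R0 <= s /\ hopf v = K (l s)]].
Proof.
move=> H R00; have Cl := line_smooth H.
(* Both ends [- R0] and [rho] of the slide lie strictly between [- N] and [N]. *)
pose N := R0 + rho + 1; have rho0 := line_rho H.
have cN : compact [set s : R | `|s| <= N].
  rewrite (_ : [set s : R | _] = `[(- N), N]%classic); first exact: segment_compact.
  by apply/seteqP; split => s /=; rewrite in_itv/= ler_norml.
have [C C0 HC] := compact_bounded_norm cN (Cinf_continuous Cl).
(* [C] bounds [l] on the endpoints in use; the [+ 2] makes the cutoff 1 on |x| <= 2 as well, so that
   [K] is a pure translation there. *)
pose r := C + 2; have r0 : 0 <= r by rewrite addr_ge0.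
(* Times |l mu| <= r, this slope is at most 1/2, the constant of [id_plus_diffeo]. *)
have eta0 : 0 < (2 * (r + 1))^-1 by rewrite invr_gt0 mulr_gt0// ltr_pwDr.
have [chi [M3 [Cchi chib chi_in chi_out chi_lip]]] := @slow_cutoff R 3 r _ r0 eta0.
have N0 : 0 <= N by rewrite /N; lra.
have [k1 [Zk [Ck1 _ k1_in k1_out k1_lip]]] := @slow_cutoff R 1 N 1 N0 ltr01.
pose k (s : R) : R := k1 s%:M.
have Ck' : Cinf setT k.
  apply: (@Cicomp _ _ _ k1 (fun s : R => s%:M)) => // k'.
  by apply: Ck_scalar_mx; [exact: openT|exact: Ck_id].
have k_in s : `|s| <= N -> k s = 1 by move=> sN; rewrite /k k1_in// norm_scalar_mx1.
have k_out s : Zk <= `|s| -> k s = 0 by move=> sN; rewrite /k k1_out// norm_scalar_mx1.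
have k_lip x y : `|k x - k y| <= `|x - y|.
  by apply: le_trans (k1_lip _ _) _; rewrite mul1r -raddfB/= norm_scalar_mx1.
have l_r mu : `|mu| <= N -> `|l mu| <= r by move=> /HC lC; rewrite /r; lra.
have chi_lip' mu : `|mu| <= N ->
    forall x y, `|chi x *: l mu - chi y *: l mu| <= 2^-1 * `|x - y|.
  move=> muN x y; rewrite -scalerBl normrZ.
  apply: le_trans (ler_pM _ _ (chi_lip x y) (l_r mu muN)) _ => //.
  rewrite mulrAC ler_wpM2r// ler_pdivrMl ?mulr_gt0 ?ltr_pwDr//.
  by lra.
have R0N : `|- R0| <= N by rewrite normrN gtr0_norm// /N; lra.
have [G D] := slide_diffeo Cchi chi_lip' R0N.
have eqv := spun_equiv Cl (line_inj H) (line_immersion H) (proper_line_proper H) Cchi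
  chi_in chi_out chi_lip' l_r Ck' k_in k_out k_lip (lam := - R0) (mu := rho).
exists (slide l chi (- R0)), G; split=> //.
- by move=> x x2; rewrite /slide chi_in ?scale1r// /r; lra.
- by rewrite (slide_self chi_in l_r).
apply: (@ambient_equiv_trans _ _ _ (spun l chi rho)); last first.
  by apply: ambient_equiv_sym; apply: eqv; rewrite /N; lra.
exists id, id; split; first by split=> //; exact: CiidT.
(* Past [rho] the line is a ray, so sliding only rescales its points; the factor runs continuously
   from 0 past any given [c]. *)
have rE s : rho <= s -> slide l chi rho (l s) = (s - chi (l s) * rho) *: b.
  move=> rs; rewrite /slide (line_end H (lexx rho)) (line_end H rs).
  by rewrite scalerA -scalerBl.
move=> v; split=> [[c [c0 vc]]|[s [rs vs]]]; last first.
  exists (s - chi (l s) * rho); split; last by rewrite -rE.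
  by have /andP[_ c1] := chib (l s); nra.
pose f s := s - chi (l s) * rho.
have cf : continuous f.
  apply: Cinf_continuous; apply: CiBT; first exact: CiidT.
  by apply: CiMT; [exact: Cicomp|exact: CicstT].
have rN : `|rho| <= N by rewrite gtr0_norm// /N; lra.
have fr : f rho = 0 by rewrite /f chi_in ?l_r// mul1r subrr.
have rc : rho <= rho + c by lra.
have [|s /[!in_itv]/= /andP[rs _] fs] := @IVT R f rho (rho + c) c rc (continuous_subspaceT cf).
  rewrite fr ge_min c0/= le_max /f; apply/orP; right.
  by have /andP[_ c1] := chib (l (rho + c)); nra.
by exists s; split=> //; rewrite vc rE// -[X in X *: _]fs.
Qed.

End Line.

(** * Circles over points and the plane over a ray *)

Section HopfChart.
Context {R : realType}.

Lemma Ck_cos_sin k : @Ck R R R k setT cos /\ @Ck R R R k setT sin.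
Proof.
elim: k => [|k [IHc IHs]]; first by split; split=> // x _; [exact: continuous_cos|exact: continuous_sin].
split; [apply: (CkSR (f' := fun x => - sin x))|apply: (CkSR (f' := cos))] => //; try exact: openT.
  exact: CkN openT IHs.
Qed.

Definition qcis (t : R) : 'rV[R]_4 := mk4 (cos t) (sin t) 0 0.
Definition qi : 'rV[R]_4 := mk4 0 1 0 0.

Lemma Ci_qcis : Cinf setT qcis.
Proof.
move=> k; have [Cc Cs] := Ck_cos_sin k.
by apply: Ck_mk4 => //; [exact: openT|exact: Ck_cst|exact: Ck_cst].
Qed.

Lemma qcisD s t : qcis (s + t) = qmul (qcis s) (qcis t).
Proof. by rewrite /qcis qmulE cosD sinD; congr mk4; ring. Qed.

Lemma hopf_qcis t : hopf (qcis t) = mk3 1 0 0.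
Proof.
rewrite /qcis hopfE; congr mk3; [|ring|ring].
by rewrite !mulr0 !subr0 -!expr2 cos2Dsin2.
Qed.

Lemma qmulq1 (v : 'rV[R]_4) : qmul v qone = v.
Proof. by have [a [b [c [d ->]]]] := mk4_surj v; rewrite /qone qmulE; congr mk4; ring. Qed.

(** [qcis t] is a unit quaternion that commutes with [i], so right multiplication by it moves along
    the fibre. *)
Lemma hopf_qmul_qcis (v : 'rV[R]_4) t : hopf (qmul v (qcis t)) = hopf v.
Proof.
rewrite hopf_qmul hopf_qcis -{2}(qmulq1 v) hopf_qmul; congr qrot.
by rewrite /qone hopfE; congr mk3; ring.
Qed.

Lemma qmulZl (p : 'rV[R]_4) k q : qmul (k *: p) q = k *: qmul p q.
Proof.
have [a [b [c [d ->]]]] := mk4_surj q; have [x [y [z [t ->]]]] := mk4_surj p.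
by rewrite mk4Z !qmulE mk4Z; congr mk4; ring.
Qed.

Lemma hopfZ k (v : 'rV[R]_4) : hopf (k *: v) = k ^+ 2 *: hopf v.
Proof.
by have [a [b [c [d ->]]]] := mk4_surj v; rewrite mk4Z !hopfE mk3Z; congr mk3; ring.
Qed.

(** [qone] lies over the first axis, and [rotq] carries that axis to any [b] not opposite to it; the
    opposite ray is covered by multiples of the quaternion [j]. *)
Lemma hopf_surj (b : 'rV[R]_3) : b != 0 -> exists2 q, sqnorm q != 0 & hopf q = b.
Proof.
move=> b0; pose e1 : 'rV[R]_3 := mk3 1 0 0.
have h1 : hopf qone = e1 by rewrite /qone hopfE; congr mk3; ring.
have e10 : e1 != 0 by apply/eqP => /rowP/(_ (@Ordinal 3 0 isT)); rewrite !mxE/= => /eqP; rewrite oner_eq0.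
have [w0|w0] := ltP 0 (rot_wt e1 b).
  by exists (rotq e1 b); [exact: rotq_neq0|rewrite -(qmulq1 (rotq e1 b)) hopf_qmul h1 qrot_rotq].
have E1 : enorm e1 = 1 by rewrite /enorm sqnorm3 !mk3E expr0n/= !addr0 expr1n sqrtr1.
move: w0; rewrite /rot_wt E1 mul1r dot3 !mk3E !mul0r !addr0 mul1r => w0.
have sb := enorm_sqr b; have nb := enorm_gt0 b0; move: sb; rewrite sqnorm3.
set x := b _ _ in w0 *; set y := b _ _; set z := b _ _ => sb.
(* [enorm b <= - x] leaves no room for the other two coordinates. *)
have y0 : y = 0 by apply/eqP; rewrite -sqrf_eq0; apply/eqP; have := sqr_ge0 y; have := sqr_ge0 z; nra.
have z0 : z = 0 by apply/eqP; rewrite -sqrf_eq0; apply/eqP; have := sqr_ge0 y; have := sqr_ge0 z; nra.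
have xb : x < 0 by lra.
exists (mk4 0 0 (Num.sqrt (- x)) 0).
  rewrite sqnorm4 !mk4E expr0n/= !addr0 add0r sqr_sqrtr; last by rewrite oppr_ge0 ltW.
  by rewrite oppr_eq0 lt_eqF.
have xx : Num.sqrt (- x) * Num.sqrt (- x) = - x by rewrite -expr2 sqr_sqrtr// oppr_ge0 ltW.
rewrite hopfE xx; apply: rv3P; rewrite mk3E.
- by rewrite -/x !mulr0 subr0 add0r sub0r opprK.
- by rewrite -/y y0 !(mul0r, mulr0) addr0 mulr0.
- by rewrite -/z z0 !(mul0r, mulr0) subr0 mulr0.
Qed.

(** After division by [q] the ray is the first axis. Vanishing of the last two coordinates of
    [hopf (mk4 x y z t)] gives (x^2 + y^2)(z^2 + t^2) = 0, and [0 <= c] for the first one decides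
    for [z = t = 0]. *)
Lemma half_plane_bundleP (q : 'rV[R]_4) b v : sqnorm q != 0 -> hopf q = b ->
  half_plane_bundle b v <-> exists c s, v = qmul q (mk4 c s 0 0).
Proof.
move=> q0 qb.
have qE : b = qrot q (mk3 1 0 0).
  by rewrite -qb -{1}(qmulq1 q) hopf_qmul /qone hopfE; congr qrot; congr mk3; ring.
split=> [[c [c0 vc]]|[c [s ->]]]; last first.
  exists (c ^+ 2 + s ^+ 2); split; first by rewrite addr_ge0 ?sqr_ge0.
  by rewrite hopf_qmul hopfE qE -qrotZ mk3Z; congr qrot; congr mk3; ring.
pose w := qmul ((sqnorm q)^-1 *: qconj q) v.
have vE : v = qmul q w by rewrite /w qmulA qmulV// qmul1q.
have : hopf w = c *: mk3 1 0 0.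
  by rewrite hopf_qmul vc qE -qrotZ -qrotM qmulVr// qrot1.
rewrite vE; have [x [y [z [t ->]]]] := mk4_surj w.
rewrite hopfE mk3Z => E.
have E0 : x * x + y * y - z * z - t * t = c.
  by have /rowP/(_ (@Ordinal 3 0 isT)) := E; rewrite !mxE/= mulr1.
have E1 : 2 * (y * z + x * t) = 0.
  by have /rowP/(_ (@Ordinal 3 1 isT)) := E; rewrite !mxE/= mulr0.
have E2 : 2 * (y * t - x * z) = 0.
  by have /rowP/(_ (@Ordinal 3 2 isT)) := E; rewrite !mxE/= mulr0.
exists x, y; congr qmul.
have zt0 : z ^+ 2 + t ^+ 2 = 0.
  have P : (x ^+ 2 + y ^+ 2) * (z ^+ 2 + t ^+ 2) = 0.
    have -> : (x ^+ 2 + y ^+ 2) * (z ^+ 2 + t ^+ 2) =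
      (y * z + x * t) ^+ 2 + (y * t - x * z) ^+ 2 by ring.
    have -> : y * z + x * t = 0 by lra.
    have -> : y * t - x * z = 0 by lra.
    by rewrite expr0n/= addr0.
  move/eqP: P; rewrite mulf_eq0 => /orP[/eqP xy|/eqP //].
  have := sqr_ge0 x; have := sqr_ge0 y; have := sqr_ge0 z; have := sqr_ge0 t.
  move: E0; rewrite -!expr2; lra.
have -> : z = 0 by apply/eqP; rewrite -sqrf_eq0; apply/eqP; have := sqr_ge0 z; have := sqr_ge0 t; lra.
have -> : t = 0 by apply/eqP; rewrite -sqrf_eq0; apply/eqP; have := sqr_ge0 z; have := sqr_ge0 t; lra.
by [].
Qed.

End HopfChart.

(** * A product chart of the circle bundle far from its tip *)

Section Chart.
Context {R : realType}.

Lemma is_derive_rv (V : normedModType R) n (f : V -> 'rV[R]_n) x v (d : 'rV[R]_n) :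
  (forall j, is_derive x v (fun x => f x ord0 j) (d ord0 j)) -> is_derive x v f d.
Proof.
move=> H; have df : derivable f x v.
  by apply/derivable_mxP => i j; rewrite (ord1 i); have [] := H j.
split=> //; apply/rowP => j; rewrite derive_mx// mxE.
by have [_ ->] := H j.
Qed.

Lemma is_derive_fibre (p : 'rV[R]_4) (k t : R) :
  is_derive t (1 : R) (fun t => qmul p (qcis (k * t))) (k *: qmul (qmul p (qcis (k * t))) qi).
Proof.
have E s j : qmul p (qcis s) ord0 j = cos s * p ord0 j + sin s * qmul p qi ord0 j.
  have [a [b [c [d ->]]]] := mk4_surj p; rewrite /qcis /qi !qmulE !mxE.
  by case: j => [[|[|[|[|//]]]] H] /=; ring.
have E' s : qmul (qmul p (qcis s)) qi = - sin s *: p + cos s *: qmul p qi.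
  have [a [b [c [d ->]]]] := mk4_surj p; rewrite /qcis /qi !qmulE.
  by apply: rv4P; rewrite !mxE /=; ring.
apply: is_derive_rv => j; rewrite E'; under eq_fun do rewrite E.
apply: is_derive_eq; rewrite !mxE; rewrite /GRing.scale /=; ring.
Qed.

(** The fibre direction: chart coordinates are (y, x) with [y] along the fibres and [x] in R^3. *)
Definition axis0 : 'rV[R]_(1 + 3) := row_mx 1%:M 0.

(** With [n = - a] and [v0] over [n], the map from (y, x) to rotq(n, n + x) v0 qcis(y) is a local
    diffeomorphism with first coordinate along the fibres. It is applied to z / R0 and multiplied by
    the root of [R0], which puts 0 over [- R0 *: a]; a large [R0] brings the ball of radius 3 into
    its domain. *)
Lemma tail_chart (a : 'rV[R]_3) : a != 0 -> exists R1 : R, forall R0, R1 <= R0 ->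
  exists E G kap, [/\ diffeo E G, 0 < kap & forall z : 'rV[R]_(1 + 3), `|z| <= 3 ->
    hopf (E z) = rsubmx z - R0 *: a /\
    forall t, `|z + t *: axis0| <= 3 -> E (z + t *: axis0) = qmul (E z) (qcis (kap * t))].
Proof.
move=> a0; pose n := - a; have n0 : n != 0 by rewrite oppr_eq0.
have [v0 v00 v0n] := hopf_surj n0.
pose hd (z : 'rV[R]_(1 + 3)) : R := z ord0 (lshift 3 ord0).
pose nx (z : 'rV[R]_(1 + 3)) : 'rV[R]_3 := n + rsubmx z.
have Chd : Cinf setT hd by apply: Cicoord; exact: CiidT.
have Cnx : Cinf setT nx by apply: CiDT; [exact: CicstT|exact: Cirsub].
pose U := [set z | 0 < rot_wt n (nx z)].
have oU : open U by apply: open_pos; apply: continuous_rot_wt => //; exact: CicstT.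
have nx0 : nx 0 = n by rewrite /nx (_ : rsubmx 0 = 0) ?addr0//; apply/rowP => j; rewrite !mxE.
have U0 : U 0 by rewrite /U /= nx0 rot_wt_self mulr_gt0// sqnorm_gt0.
have Unx z : U z -> nx z != 0.
  move=> Uz; apply/eqP => z0; move: Uz; rewrite /U /= z0.
  by rewrite /rot_wt dot3 /enorm !sqnorm3 !mxE expr0n/= !addr0 sqrtr0 !mulr0 !addr0 ltxx.
pose e (z : 'rV[R]_(1 + 3)) : 'rV[R]_(1 + 3) := qmul (rotq n (nx z)) (qmul v0 (qcis (hd z))).
have Ce : Cinf U e.
  have sub (V' : normedModType R) (f : 'rV[R]_(1 + 3) -> V') : Cinf setT f -> Cinf U f.
    by move=> Cf k'; exact: Ck_sub (@subsetT _ _) (Cf k').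
  move=> k; apply: Ck_qmul => //.
    by apply: Ck_rotq => //; [exact: Ck_cst|exact: sub Cnx k].
  apply: Ck_qmul => //; first exact: Ck_cst.
  by apply: sub; apply: (Cicomp1_mx Ci_qcis).
have hopfe z : U z -> hopf (e z) = nx z.
  by move=> Uz; rewrite /e hopf_qmul hopf_qmul_qcis v0n qrot_rotq.
have nxt z t : nx (z + t *: axis0) = nx z.
  rewrite /nx (_ : rsubmx (z + t *: axis0) = rsubmx z)//.
  by rewrite linearD linearZ /= /axis0 row_mxKr scaler0 addr0.
have hdt z t : hd (z + t *: axis0) = hd z + t.
  by rewrite /hd [LHS]mxE [X in _ + X]mxE /axis0 row_mxEl mxE eqxx mulr1.
have et z t : e (z + t *: axis0) = qmul (e z) (qcis t).
  by rewrite /e nxt hdt qcisD !qmulA.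
(* A kernel vector has zero [x] part, as seen through [hopf], hence is a multiple of [axis0]; but
   the fibre through [v0] has nonzero velocity. *)
have Je : jac e 0 \in unitmx.
  apply: unitmx_ker => v; rewrite -(@derive_jac R 4 4 U e 0 v oU (Ce 1%N) U0) => Dv.
  have de : derivable e 0 v by exact: (Ck_derivable (Ce 1%N) U0).
  have Chopf : Ck 1 setT (@hopf R) by apply: Ck_hopf; [exact: openT|exact: Ck_id].
  have := @is_derive_comp R 4 3 'rV[R]_4 setT (@hopf R) e 0 v openT Chopf I de.
  rewrite Dv mul0mx => -[_ D0].
  have D1 : 'D_v nx 0 = 0.
    rewrite -D0; apply: near_eq_derive; near=> z; rewrite -hopfe//.
    by near: z; exact: open_nbhs_nbhs.
  have vr : rsubmx v = 0.
    rewrite -D1; apply/esym; apply: cvg_lim => //; apply: cvg_near_cst; near=> h.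
    have h0 : h != 0 by near: h; exact: nbhs_dnbhs_neq.
    apply: (scalerI h0); rewrite scalerA mulfV// scale1r.
    by apply/rowP => j; rewrite /nx /= !mxE; ring.
  have vE : v = hd v *: axis0.
    apply/rowP => j; rewrite mxE /axis0; case: (split_ordP j) => i ->.
      by rewrite (ord1 i) row_mxEl mxE mulr1n mulr1.
    by rewrite row_mxEr mxE mulr0; have /rowP/(_ i) := vr; rewrite !mxE.
  have e0 : e 0 = v0.
    have hd0 : hd 0 = 0 by rewrite /hd mxE.
    by rewrite /e nx0 rotq_self// qmul1q hd0 /qcis cos0 sin0 -/qone qmulq1.
  have [_] := is_derive_fibre v0 (hd v) 0.
  have -> : 'D_(1 : R) (fun t : R => qmul v0 (qcis (hd v * t))) 0 = 'D_v e 0.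
    rewrite /derive; set f := (X in lim (X @ _) = _); set g := (X in _ = lim (X @ _)).
    suff -> : f = g by []; apply/funext => h; rewrite /f /g /= mulr0.
    rewrite !addr0 {2}vE scalerA.
    have := et 0 (h * hd v); rewrite add0r e0 => ->.
    have := et 0 0; rewrite scale0r addr0 e0 => <-.
    by rewrite -[h *: (1 : R)]/(h * 1) mulr1 [hd v * h]mulrC.
  rewrite Dv mulr0 {1}/qcis cos0 sin0 -/qone qmulq1 => /esym/eqP; rewrite scaler_eq0.
  case/orP => [/eqP hv0|/eqP v0i]; first by rewrite vE hv0 scale0r.
  have : hopf (qmul v0 qi) = 0.
    by rewrite v0i -(scale0r 0) hopfZ expr0n scale0r.
  have -> : qi = qcis (pi / 2 : R).
    by rewrite /qcis [cos _]cos_pihalf [sin _]sin_pihalf.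
  by rewrite hopf_qmul_qcis v0n => n00; rewrite n00 eqxx in n0.
have [eps0 eps00 Heps] := @local_diffeo_extension R 4 U e 3 (ltr0n _ 3) oU U0 Ce Je.
exists eps0^-1 => R0 R10.
have R00 : 0 < R0 by apply: lt_le_trans R10; rewrite invr_gt0.
have [||E [G [D HE]]] := Heps R0^-1.
- by rewrite invr_gt0.
- by rewrite -[leRHS]invrK lef_pV2// posrE// invr_gt0.
(* [hopf] is quadratic, so scaling R^4 by [s] scales R^3 by [R0]. *)
pose s := Num.sqrt R0.
have s0 : s != 0 by rewrite gt_eqF// sqrtr_gt0.
have s2 : s ^+ 2 = R0 by rewrite sqr_sqrtr// ltW.
have sU : (s%:M : 'M[R]_4) \in unitmx by rewrite unitmxE det_scalar unitrX// unitfE.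
have := diffeo_comp D (diffeo_affine 0 sU).
set F := (_ \o E); set G' := (G \o _) => DF.
have FE z : F z = s *: E z by rewrite /F /= add0r mul_mx_scalar.
exists F, G', R0^-1; split=> //; first by rewrite invr_gt0.
move=> z z3; have [Uz Ez] := HE z z3; split.
  rewrite FE hopfZ Ez hopfe// s2 /nx /n scalerDr scalerN addrC; congr (_ - _).
  by rewrite linearZ /= scalerA mulfV ?scale1r// gt_eqF.
move=> t zt3; have [Uzt Ezt] := HE _ zt3.
by rewrite !FE Ezt Ez scalerDr scalerA et qmulZl.
Unshelve. all: by end_near. Qed.

End Chart.

(** * A round sphere with a flattened cap *)

Section FlatSphere.
Context {R : realType}.
Notation i0 := (@Ordinal 4 0 isT).
Notation i1 := (@Ordinal 4 1 isT).
Notation i2 := (@Ordinal 4 2 isT).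
Notation i3 := (@Ordinal 4 3 isT).
Notation j0 := (@Ordinal 3 0 isT).
Notation j1 := (@Ordinal 3 1 isT).
Notation j2 := (@Ordinal 3 2 isT).

Lemma incl_mk3 (a b c : R) : @Defs.incl R 1 3 (mk3 a b c) = mk4 0 a b c.
Proof.
apply/rowP => j; rewrite /incl; case: (@split_ordP 1 3 j) => i ->.
  by rewrite (row_mxEl (0 : 'rV[R]_1)) !mxE; case: i => -[].
by rewrite (row_mxEr (0 : 'rV[R]_1)) !mxE; case: i => -[|[|[]]].
Qed.

(** The round sphere is enlarged to radius [r] and sheared vertically by the height of its own cap:
    the lower cap lands in a coordinate plane, and nothing else of the sphere meets the ball of
    radius [M]. *)
Lemma flat_sphere (M : R) : 0 < M -> exists B B' : 'rV[R]_4 -> 'rV[R]_4, diffeo B B' /\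
  forall c, `|c| <= M ->
    ((exists u, sphere 2 u /\ B (Defs.incl u) = c) <-> exists a b, c = mk4 a b 0 0).
Proof.
move=> M0; pose r := 3 * (M + 1); have r0 : 0 < r by rewrite /r; lra.
have rN : r != 0 by rewrite gt_eqF.
have M2 (a : R) : `|a| <= M -> a ^+ 2 <= M ^+ 2.
  by move=> aM; rewrite -[leLHS]ger0_norm ?sqr_ge0// normrX lerXn2r ?nnegrE// ltW.
(* After the shear the upper cap sits at twice the root of [r ^+ 2 - a ^+ 2 - b ^+ 2]; [r] is large
   enough for this to exceed [M]. *)
have rM (a b : R) : `|a| <= M -> `|b| <= M -> M ^+ 2 < 4 * (r ^+ 2 - a ^+ 2 - b ^+ 2).
  by move=> /M2 aM /M2 bM; rewrite /r; nra.
clearbody r.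
(* The root is smooth only where its argument is positive; an extension makes the shear a
   diffeomorphism of R^4. *)
have [|F [CF HF]] := @smooth_extension R _ [set z : 'rV[R]_2 | `|z - 0| <= M]
    (fun z => Num.sqrt (r ^+ 2 - z ord0 0 ^+ 2 - z ord0 1 ^+ 2)) (@has_bumps_rV R 2) (@compact_ball R 2 0 M).
  pose f (z : 'rV[R]_2) := r ^+ 2 - z ord0 0 ^+ 2 - z ord0 1 ^+ 2.
  have Cf : Cinf setT f.
    have C0 (i : 'I_2) : Cinf setT (fun z : 'rV[R]_2 => z ord0 i) by apply: Cicoord; exact: CiidT.
    by apply: CiBT; [apply: CiBT; [exact: CicstT|apply: CiMT; exact: C0]|apply: CiMT; exact: C0].
  have oU : open [set z | 0 < f z] by apply: open_pos; exact: Cinf_continuous.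
  move=> z; rewrite /= subr0 => zM.
  have zi (i : 'I_2) : `|z ord0 i| <= M by apply: le_trans zM; exact: coord_le_norm.
  exists [set z | 0 < f z], (fun z => Num.sqrt (f z)); split=> //.
    by have := rM _ _ (zi 0) (zi 1); rewrite /= /f; have := sqr_ge0 M; lra.
  move=> k; apply: Ck_sqrt => //; exact: Ck_sub (@subsetT _ _) (Cf k).
pose FF (a b : R) := F (pt2 a b).
have FFE a b : `|a| <= M -> `|b| <= M -> FF a b = Num.sqrt (r ^+ 2 - a ^+ 2 - b ^+ 2).
  move=> aM bM; rewrite /FF HF ?pt2_0 ?pt2_1//= subr0; apply: norm_le_coord; first exact: ltW.
  by move=> i j; rewrite mxE; case: ifP.
have CFF (a b : 'rV[R]_4 -> R) : Cinf setT a -> Cinf setT b -> Cinf setT (fun x => FF (a x) (b x)).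
  by move=> Ca Cb; apply: (Cicomp CF); exact: Cipt2.
have Cc (i : 'I_4) : Cinf setT (fun z : 'rV[R]_4 => z ord0 i) by apply: Cicoord; exact: CiidT.
pose B (u : 'rV[R]_4) := mk4 (r * u ord0 i1) (r * u ord0 i2)
  (r * u ord0 i3 + FF (r * u ord0 i1) (r * u ord0 i2)) (u ord0 i0).
pose B' (c : 'rV[R]_4) := mk4 (c ord0 i3) (r^-1 * c ord0 i0) (r^-1 * c ord0 i1)
  (r^-1 * (c ord0 i2 - FF (c ord0 i0) (c ord0 i1))).
have BE a b c d : B (mk4 a b c d) = mk4 (r * b) (r * c) (r * d + FF (r * b) (r * c)) a by rewrite /B !mk4E.
have B'E a b c d : B' (mk4 a b c d) = mk4 d (r^-1 * a) (r^-1 * b) (r^-1 * (c - FF a b)) by rewrite /B' !mk4E.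
exists B, B'; split.
  split.
  - move=> k; apply: Ck_mk4; first exact: openT.
    + by move: k; apply: CiMT => //; exact: CicstT.
    + by move: k; apply: CiMT => //; exact: CicstT.
    + by move: k; apply: CiDT; [apply: CiMT => //; exact: CicstT|apply: CFF; apply: CiMT => //; exact: CicstT].
    + exact: Cc.
  - move=> k; apply: Ck_mk4; first exact: openT.
    + exact: Cc.
    + by move: k; apply: CiMT => //; exact: CicstT.
    + by move: k; apply: CiMT => //; exact: CicstT.
    + by move: k; apply: CiMT; [exact: CicstT|apply: CiBT => //; apply: CFF].
  - move=> x; have [a [b [c [d ->]]]] := mk4_surj x.
    by rewrite BE B'E !mulKf// addrK mulKf.
  - move=> x; have [a [b [c [d ->]]]] := mk4_surj x.
    by rewrite B'E BE !mulVKf// subrK.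
move=> c cM; split=> [[u [us uc]]|[a [b cE]]].
  move: us uc cM; have [x [y [z ->]]] := mk3_surj u; rewrite incl_mk3 BE /sphere /= sqnorm3 !mk3E => us <- cM.
  have xM : `|r * x| <= M by have := coord_le_norm (mk4 (r * x) (r * y) (r * z + FF (r * x) (r * y)) 0) ord0 i0; rewrite mk4E => /le_trans; apply.
  have yM : `|r * y| <= M by have := coord_le_norm (mk4 (r * x) (r * y) (r * z + FF (r * x) (r * y)) 0) ord0 i1; rewrite mk4E => /le_trans; apply.
  have zM : `|r * z + FF (r * x) (r * y)| <= M by have := coord_le_norm (mk4 (r * x) (r * y) (r * z + FF (r * x) (r * y)) 0) ord0 i2; rewrite mk4E => /le_trans; apply.
  exists (r * x), (r * y); congr mk4; move: zM; rewrite FFE//.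
  have rz : r ^+ 2 - (r * x) ^+ 2 - (r * y) ^+ 2 = (r * z) ^+ 2.
    by rewrite !exprMn -{1}[r ^+ 2]mulr1 -us; ring.
  have := rM _ _ xM yM; rewrite rz sqrtr_sqr => rzM.
  have [z0|z0] := leP z 0.
    by move=> _; rewrite ler0_norm ?subrr// pmulr_rle0.
  rewrite [`|r * z|]ger0_norm ?ler_norml; last by rewrite mulr_ge0 ?ltW.
  by move=> /andP[_ zM]; nra.
have aM : `|a| <= M by have := coord_le_norm c ord0 i0; rewrite cE mk4E -cE => /le_trans; apply.
have bM : `|b| <= M by have := coord_le_norm c ord0 i1; rewrite cE mk4E -cE => /le_trans; apply.
have ab0 : 0 <= r ^+ 2 - a ^+ 2 - b ^+ 2 by have := rM _ _ aM bM; have := sqr_ge0 M; lra.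
exists (mk3 (r^-1 * a) (r^-1 * b) (- (r^-1 * Num.sqrt (r ^+ 2 - a ^+ 2 - b ^+ 2)))).
rewrite incl_mk3 BE mulrN !mulVKf// FFE// addNr cE; split=> //.
rewrite /sphere /= sqnorm3 !mk3E sqrrN !exprMn sqr_sqrtr//.
by field.
Qed.

End FlatSphere.

(** * Constancy of signs on a punctured disk *)

Section SignConstancy.
Context {R : realType}.

Lemma segment_sign n (f : 'rV[R]_n -> R) (w w' : 'rV[R]_n) : continuous f ->
  (forall t, 0 <= t <= 1 -> f (w + t *: (w' - w)) != 0) -> 0 < f w * f w'.
Proof.
move=> cf f0.
have cg : continuous (fun t : R => f (w + t *: (w' - w))).
  move=> t; apply: (@continuous_comp _ _ _ (fun t : R => w + t *: (w' - w)) f); last exact: cf.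
  apply: Cinf_continuous; apply: CiDT; [exact: CicstT|].
  by apply: CiZT; [exact: CiidT|exact: CicstT].
have fw : f w != 0 by have := f0 0; rewrite scale0r addr0 lexx ler01; apply.
have fw' : f w' != 0 by have := f0 1; rewrite scale1r addrC subrK lexx ler01; apply.
rewrite ltNge; apply/negP => neg.
have [|t /[!in_itv]/= tI ft] := @IVT R _ 0 1 0 ler01 (continuous_subspaceT cg).
  rewrite scale0r scale1r addr0 [w + _]addrC subrK ge_min le_max.
  have [a|a] := leP 0 (f w); have [b|b] := leP 0 (f w'); rewrite ?orbT ?(ltW a) ?(ltW b) ?orbT//=.
    have a' : 0 < f w by rewrite lt_def fw.
    have b' : 0 < f w' by rewrite lt_def fw'.
    by move: neg; rewrite leNgt mulr_gt0.
  by move: neg; rewrite leNgt nmulr_rgt0 ?a ?b.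
by have := f0 t tI; rewrite ft eqxx.
Qed.

Lemma pt2_eta (w : 'rV[R]_2) : exists a b, w = pt2 a b.
Proof. by exists (w ord0 0), (w ord0 1); exact: pt2E. Qed.

Lemma ball_convex (V : normedModType R) (M : R) (w w' : V) t : `|w| < M -> `|w'| < M -> 0 <= t <= 1 ->
  `|w + t *: (w' - w)| < M.
Proof.
move=> wM w'M /andP[t0 t1].
have -> : w + t *: (w' - w) = (1 - t) *: w + t *: w'.
  by rewrite scalerBr scalerBl scale1r; rewrite addrAC addrA.
apply: le_lt_trans (ler_normD _ _) _; rewrite !normrZ (ger0_norm t0) ger0_norm ?subr_ge0//.
have [->|t0'] := eqVneq t 0; first by rewrite subr0 mul1r mul0r addr0.
have : 0 < t by rewrite lt_neqAle eq_sym t0' t0.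
by move=> ?; have := normr_ge0 w; have := normr_ge0 w'; nra.
Qed.

(** A disk minus a point is connected: when the segment from [w] to [w'] passes through [w0], two
    segments through a point beside [w0] replace it. *)
Lemma punctured_sign (f : 'rV[R]_2 -> R) (M : R) (w0 : 'rV[R]_2) : continuous f ->
  (forall w, `|w| < M -> w != w0 -> f w != 0) ->
  forall w w', `|w| < M -> `|w'| < M -> w != w0 -> w' != w0 -> 0 < f w * f w'.
Proof.
move=> cf f0 w w' wM w'M ww0 w'w0.
have [avoid|] := pselect (forall t : R, 0 <= t <= 1 -> w + t *: (w' - w) != w0).
  by apply: segment_sign => // t tI; apply: f0; [exact: ball_convex|exact: avoid].
move=> /existsNP[t0 /not_implyP[t0I /negP/negPn/eqP wt]].
have w0M : `|w0| < M by rewrite -wt; exact: ball_convex.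
have [x [y wE]] : exists x y, w' - w = pt2 x y by exact: pt2_eta.
have dn0 : w' - w != 0.
  by apply/eqP => d0; move: wt; rewrite d0 scaler0 addr0 => /eqP; rewrite (negbTE ww0).
have xy0 : 0 < x ^+ 2 + y ^+ 2.
  have : 0 < sqnorm (w' - w) by exact: sqnorm_gt0.
  by rewrite wE /sqnorm !big_ord_recl big_ord0 !mxE addr0.
pose N := `|pt2 (- y) x|; have N0 : 0 <= N by exact: normr_ge0.
pose e := (M - `|w0|) / (N + 1) / 2.
have e0 : 0 < e by rewrite !divr_gt0// ?subr_gt0// ltr_pwDr.
(* [w0] is pushed perpendicularly to the segment, by little enough to stay in the ball. The height
   [ht] over the line of the segment is 0 at [w], [w'] and [w0] and positive at [w3], so the two new
   segments avoid [w0]. *)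
pose w3 := w0 + e *: pt2 (- y) x.
have w3M : `|w3| < M.
  apply: le_lt_trans (ler_normD _ _) _; rewrite normrZ -/N gtr0_norm//.
  suff : e * N < M - `|w0| by lra.
  have -> : e * N = (M - `|w0|) * (N / (N + 1) / 2) by rewrite /e; field; rewrite gt_eqF// ltr_pwDr.
  rewrite -[ltRHS]mulr1 ltr_pM2l ?subr_gt0// ltr_pdivrMr// ltr_pdivrMr ?ltr_pwDr//; lra.
pose ht (z : 'rV[R]_2) := - y * (z ord0 0 - w0 ord0 0) + x * (z ord0 1 - w0 ord0 1).
have htw0 : ht w0 = 0 by rewrite /ht !subrr !mulr0 addr0.
have htE z z' t : ht (z + t *: (z' - z)) = (1 - t) * ht z + t * ht z' by rewrite /ht !mxE; ring.
have ht3 : 0 < ht w3.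
  have -> : ht w3 = e * (x ^+ 2 + y ^+ 2) by rewrite /ht /w3 !mxE /=; ring.
  exact: mulr_gt0.
have ww' (i : 'I_2) : w' ord0 i = w ord0 i + pt2 x y ord0 i by rewrite -wE !mxE; ring.
have wt' (i : 'I_2) : w0 ord0 i = w ord0 i + t0 * pt2 x y ord0 i by rewrite -wt wE !mxE.
have htw : ht w = 0 by rewrite /ht !wt' !mxE /=; ring.
have htw' : ht w' = 0 by rewrite /ht !wt' !ww' !mxE /=; ring.
have P1 : 0 < f w * f w3.
  apply: segment_sign => // t tI; apply: f0; first exact: ball_convex.
  have /andP[t0' t1] := tI; have [->|tn] := eqVneq t 0; first by rewrite scale0r addr0.
  apply/eqP => E; have := htE w w3 t; rewrite E htw0 htw mulr0 add0r => /esym/eqP.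
  by rewrite mulf_eq0 (negbTE tn) gt_eqF.
have P2 : 0 < f w' * f w3.
  apply: segment_sign => // t tI; apply: f0; first exact: ball_convex.
  have /andP[t0' t1] := tI; have [->|tn] := eqVneq t 0; first by rewrite scale0r addr0.
  apply/eqP => E; have := htE w' w3 t; rewrite E htw0 htw' mulr0 add0r => /esym/eqP.
  by rewrite mulf_eq0 (negbTE tn) gt_eqF.
have : 0 < (f w * f w3) * (f w' * f w3) by exact: mulr_gt0.
have -> : (f w * f w3) * (f w' * f w3) = (f w * f w') * f w3 ^+ 2 by ring.
by rewrite pmulr_lgt0// exprn_even_gt0//= f0//; apply/eqP => E; move: ht3; rewrite E htw0 ltxx.
Qed.

End SignConstancy.

(** * The spun sphere in the chart, and its orientation *)

Section SpunSphere.
Context {R : realType}.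

Definition qinv (q : 'rV[R]_4) := (sqnorm q)^-1 *: qconj q.

Lemma Ci_qmul (V : normedModType R) (f g : V -> 'rV[R]_4) :
  Cinf setT f -> Cinf setT g -> Cinf setT (fun x => qmul (f x) (g x)).
Proof. by move=> Cf Cg k; apply: Ck_qmul; [exact: openT|exact: Cf|exact: Cg]. Qed.

Lemma Ci_mk4 (V : normedModType R) (a b c d : V -> R) :
  Cinf setT a -> Cinf setT b -> Cinf setT c -> Cinf setT d -> Cinf setT (fun x => mk4 (a x) (b x) (c x) (d x)).
Proof. by move=> *; move=> k; apply: Ck_mk4; [exact: openT|..]; auto. Qed.

Lemma qmul_diffeo q : sqnorm q != 0 -> diffeo (qmul q) (qmul (qinv q)).
Proof.
move=> q0; split.
- by apply: Ci_qmul; [exact: CicstT|exact: CiidT].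
- by apply: Ci_qmul; [exact: CicstT|exact: CiidT].
- by move=> v; rewrite qmulA qmulVr// qmul1q.
- by move=> v; rewrite qmulA qmulV// qmul1q.
Qed.

(** The lift rotates [v] by the quaternion that takes [d s] to [d (s + t)]; it provides directions
    transverse to the fibres. *)
Lemma curve_rotate (d : R -> 'rV[R]_3) (v : 'rV[R]_4) (s : R) : Cinf setT d -> d s != 0 ->
  hopf v = d s -> exists c : R -> 'rV[R]_4, [/\ derivable c 0 1, c 0 = v &
    \forall t \near (0 : R), hopf (c t) = d (s + t)].
Proof.
move=> Cd ds vs.
have Cds : Cinf setT (fun t : R => d (s + t)).
  by apply: (Cicomp1_mx Cd); apply: CiDT; [exact: CicstT|exact: CiidT].
pose U := [set t : R | 0 < rot_wt (d s) (d (s + t))].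
have oU : open U by apply: open_pos; apply: continuous_rot_wt => //; exact: CicstT.
have U0 : U 0 by rewrite /U /= addr0 rot_wt_self mulr_gt0// sqnorm_gt0.
have dst t : U t -> d (s + t) != 0.
  move=> Uz; apply/eqP => z0; move: Uz; rewrite /U /= z0.
  by rewrite /rot_wt dot3 /enorm !sqnorm3 !mxE expr0n/= !addr0 sqrtr0 !mulr0 !addr0 ltxx.
exists (fun t => qmul (rotq (d s) (d (s + t))) v); split.
- have : Ck 1 U (fun t => qmul (rotq (d s) (d (s + t))) v).
    apply: Ck_qmul; [exact: oU| |exact: Ck_cst].
    apply: Ck_rotq; [exact: oU|by []|exact: dst|by []|exact: Ck_cst|].
    exact: Ck_sub (@subsetT _ _) (Cds 1%N).
  by move=> /Ck_derivable/(_ U0); apply.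
- by rewrite addr0 rotq_self// qmul1q.
- near=> t; rewrite hopf_qmul vs qrot_rotq//.
  by near: t; exact: open_nbhs_nbhs.
Unshelve. all: by end_near. Qed.

Lemma det_col_curve (A : 'M[R]_2) (r1 r2 : 'rV[R]_2) x k :
  col_mx r1 r2 *m A = block_mx 1%:M x 0 (k%:M : 'M[R]_1) -> \det (col_mx r1 r2 : 'M[R]_2) * \det A = k.
Proof.
move=> E; have := det_ublock (1%:M : 'M[R]_1) x (k%:M : 'M[R]_1).
by rewrite det1 mul1r det_scalar1 => <-; rewrite -E; apply/esym; exact: (@det_mulmx R 2).
Qed.

Lemma sqnorm_qmul_qi (v : 'rV[R]_4) : sqnorm (qmul v qi) = sqnorm v.
Proof.
have [a [b [c [d ->]]]] := mk4_surj v.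
by rewrite /qi qmulE !sqnorm4 !mk4E; ring.
Qed.

Lemma mulmx_trmx n (u : 'rV[R]_n) : u *m u^T = (sqnorm u)%:M.
Proof.
apply/matrixP => i j; rewrite !ord1 !mxE eqxx mulr1n.
by apply: eq_bigr => m _; rewrite mxE expr2.
Qed.

Lemma is_derive_coord (V : normedModType R) n (f : V -> 'rV[R]_n) x v d j :
  is_derive x v f d -> is_derive x v (fun x => f x ord0 j) (d ord0 j).
Proof.
move=> [df <-]; split; first by have /derivable_mxP := df; apply.
by rewrite derive_mx// mxE.
Qed.

Lemma is_derive_row_mx (V : normedModType R) m n (f : V -> 'rV[R]_m) (g : V -> 'rV[R]_n) x v a b :
  is_derive x v f a -> is_derive x v g b ->
  is_derive x v (fun x => row_mx (f x) (g x)) (row_mx a b).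
Proof.
move=> df dg; apply: is_derive_rv => j; case: (split_ordP j) => i ->.
  by rewrite row_mxEl; under eq_fun do rewrite row_mxEl; exact: is_derive_coord.
by rewrite row_mxEr; under eq_fun do rewrite row_mxEr; exact: is_derive_coord.
Qed.

Lemma is_derive_translate n (l : R -> 'rV[R]_n) (s : R) : Cinf setT l ->
  is_derive (0 : R) (1 : R) (fun t => l (s + t)) ('D_1 l s).
Proof.
move=> Cl; split.
  apply: Cinf_derivable; apply: (Cicomp1_mx Cl).
  by apply: CiDT; [exact: CicstT|exact: CiidT].
rewrite /derive; set f := (X in lim (X @ _) = _); set g := (X in _ = lim (X @ _)).
by suff -> : f = g by []; apply/funext => h; rewrite /f /g /= !addr0 [s + _]addrC.
Qed.

Lemma near_norm_lt (V W : normedModType R) (f : V -> W) x r : {for x, continuous f} ->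
  `|f x| < r -> \forall y \near x, `|f y| < r.
Proof.
move=> cf fr; have N : nbhs (f x) [set w | `|w - 0| < r].
  by apply: open_nbhs_nbhs; split; [exact: open_dist_lt|rewrite /= subr0].
have cN : nbhs x [set y | `|f y - 0| < r] by exact: cf N.
by near=> y; rewrite -[f y]subr0; near: y.
Unshelve. all: by end_near.
Qed.

(** [Th] composes the flattening of a cap, the isotopy from the flat plane to the spun line, and the
    inverse chart, in which the sphere is R times [l] near the unit ball. [psi] parametrizes the
    relevant disk; [sg] records that (direction of [l], direction of fibres) is one and the same
    orientation wherever it is used. *)
Lemma spun_sphere l (a b : 'rV[R]_3) rho : proper_line l a b rho ->
  exists (Th Th' : 'rV[R]_4 -> 'rV[R]_4) (psi : 'rV[R]_2 -> 'rV[R]_4) (psi' : 'rV[R]_4 -> 'rV[R]_2) (Mb sg : R),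
  [/\ diffeo Th Th',
    forall z : 'rV[R]_(1 + 3), `|z| <= 2 ->
      (exists u, sphere 2 u /\ Th (Defs.incl u) = z) <-> exists s, rsubmx z = l s,
    [/\ Cinf setT psi, Cinf setT psi', cancel psi psi' &
      forall w, `|w| < Mb -> exists u, sphere 2 u /\ Th (Defs.incl u) = psi w],
    sg != 0
  & forall (z : 'rV[R]_(1 + 3)) s, `|z| < 2 -> rsubmx z = l s -> exists w (Q : 'M[R]_2),
    [/\ `|w| < Mb, psi w = z, Q *m jac psi w = col_mx (row_mx 0 ('D_1 l s)) axis0
      & 0 < sg * \det Q]].
Proof.
move=> H; have [R1 HR1] := tail_chart (line_a H).
have a0 : 0 < `|a| by rewrite normr_gt0; exact: line_a H.
have rho0 := line_rho H; have Cl := line_smooth H.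
(* [R1] serves the chart, [rho] puts [l (- R0)] on the initial ray, and [3 / |a|] keeps all points
   before it outside |x| <= 2, so that cutting the line there loses nothing. *)
pose R0 := Num.max R1 (Num.max rho (3 / `|a|)).
have R0R1 : R1 <= R0 by rewrite le_max lexx.
have R0rho : rho <= R0 by rewrite !le_max lexx orbT.
have R0a : 3 / `|a| <= R0 by rewrite !le_max lexx !orbT.
have R00 : 0 < R0 by exact: lt_le_trans rho0 R0rho.
clearbody R0.
have lR0 : l (- R0) = R0 *: a by rewrite (line_start H) ?opprK// lerN2.
have far s : s <= - R0 -> 2 < `|l s|.
  move=> sR0; rewrite (line_start H); last by rewrite (le_trans sR0)// lerN2.
  rewrite normrZ normrN; have R0s : R0 <= `|s| by apply: (@le_trans _ _ (- s)); [rewrite lerNr|rewrite -normrN ler_norm].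
  have : 3 <= R0 * `|a| by rewrite -ler_pdivrMr.
  move: a0 R0s; set x := `|a|; set y := `|s| => a0 R0s; clear -a0 R0s => ?; nra.
have [E [E' [kap [DE kap0 HE]]]] := HR1 R0 R0R1.
have [K [K' [DK HK K0 [F [F' [DF HF]]]]]] := spun_line_trivial H R00.
have [q q0 qb] := hopf_surj (line_b H).
have [CE CE' EK E'K] := DE; have [CK CK' KK K'K] := DK; have [CF CF' FK F'K] := DF.
have DL := qmul_diffeo q0; have [CL CL' LK L'K] := DL.
(* Straightens the spun plane [S] to the plane of the first two coordinates. *)
pose Wc (v : 'rV[R]_4) := qmul (qinv q) (F' v).
have CWc : Cinf setT Wc by apply: (Cicomp_mx CL').
have WcE v : F (qmul q (Wc v)) = v by rewrite /Wc L'K F'K.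
pose S := [set v : 'rV[R]_4 | exists s, - R0 <= s /\ hopf v = K (l s)].
have HF' v : half_plane_bundle b v <-> S (F v) by exact: HF.
have flatP c : (exists x y, c = mk4 x y 0 0) <-> S (F (qmul q c)).
  rewrite -HF' (half_plane_bundleP _ q0 qb).
  split=> [[x [y ->]]|[x [y]]]; first by exists x, y.
  by move=> /(can_inj LK) ->; exists x, y.
have CWE : Cinf setT (fun z : 'rV[R]_4 => Wc (E z)) by apply: (Cicomp_mx CWc).
have [C C0 HC] := compact_bounded_norm (@compact_ball R 4 0 2) (Cinf_continuous CWE).
have HC' (z : 'rV[R]_4) : `|z| <= 2 -> `|Wc (E z)| <= C by move=> z2; apply: HC; rewrite /= subr0.
pose Mb := C + 1; have Mb0 : 0 < Mb by rewrite /Mb; lra.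
have CMb : C < Mb by rewrite /Mb; lra.
clearbody Mb.
have [B [B' [DB HB]]] := flat_sphere Mb0; have [CB CB' BK B'K] := DB.
have SE' (z : 'rV[R]_(1 + 3)) s : `|z| <= 2 -> rsubmx z = l s -> - R0 < s /\ hopf (E z) = K (l s).
  move=> z2 zs; have z3 : `|z| <= 3 by apply: le_trans z2 _; rewrite ler_nat.
  have rz : `|l s| <= 2.
    rewrite -zs; apply: norm_le_coord => // i j; rewrite (ord1 i) mxE.
    by apply: le_trans z2; exact: coord_le_norm.
  split; first by rewrite ltNge; apply: contraTN rz => /far; rewrite ltNge.
  by rewrite (HE z z3).1 HK// zs lR0.
have SE (z : 'rV[R]_(1 + 3)) : `|z| <= 2 -> S (E z) <-> exists s, rsubmx z = l s.
  move=> z2; split; last first.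
    by case=> s /(SE' z s z2) [/ltW sR0 zs]; exists s.
  have z3 : `|z| <= 3 by apply: le_trans z2 _; rewrite ler_nat.
  have rz : `|rsubmx z| <= 2.
    apply: norm_le_coord => // i j; rewrite (ord1 i) mxE; apply: le_trans z2; exact: coord_le_norm.
  move=> [s [_ zs]]; exists s; apply: (can_inj KK).
  by rewrite -zs (HE z z3).1 HK// lR0.
pose J (w : 'rV[R]_2) := mk4 (w ord0 0) (w ord0 1) 0 0.
pose V (w : 'rV[R]_2) := F (qmul q (J w)).
pose W2 (v : 'rV[R]_4) := pt2 (Wc v ord0 (@Ordinal 4 0 isT)) (Wc v ord0 (@Ordinal 4 1 isT)).
have CJ : Cinf setT J.
  by apply: Ci_mk4; [apply: Cicoord; exact: CiidT|apply: Cicoord; exact: CiidT|exact: CicstT|exact: CicstT].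
have CV : Cinf setT V by apply: (Cicomp_mx CF); apply: (Cicomp_mx CL).
have CW2 : Cinf setT W2 by apply: Cipt2; apply: Cicoord.
have VS w : S (V w) by apply/flatP; eexists; eexists; reflexivity.
have W2V w : W2 (V w) = w by rewrite /W2 /Wc /V FK LK [RHS]pt2E /J !mk4E.
have JW2 v : S v -> J (W2 v) = Wc v.
  by rewrite -{1}(WcE v) => /flatP [x [y Wxy]]; rewrite /J pt2_0 pt2_1 Wxy !mk4E.
have VW2 v : S v -> V (W2 v) = v by move=> Sv; rewrite /V JW2// WcE.
have W2_le (v : 'rV[R]_4) : `|W2 v| <= `|Wc v|.
  by apply: norm_le_coord => // i j; rewrite mxE; case: ifP => _; exact: coord_le_norm.
have J_le w : `|w| < Mb -> `|J w| <= Mb.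
  move=> wM; apply: norm_le_coord; first exact: ltW.
  move=> i j; rewrite mxE; case: j => [[|[|[|[|//]]]] j4] /=; rewrite ?normr0 ?(ltW Mb0)//;
    by apply: le_trans (ltW wM); exact: coord_le_norm.
have CKV : Cinf setT (fun w => K' (hopf (V w))).
  by apply: (Cicomp_mx CK') => k; apply: Ck_hopf; [exact: openT|exact: CV].
have [Cs Cs0 HCs] := compact_bounded_norm (@compact_ball R 2 0 Mb) (Cinf_continuous CKV).
have [Mg HMg] := proper_line_proper H (Cs + 1).
have [g [Cg Hg]] := curve_left_inverse (Mg + 1) Cl (line_inj H) (line_immersion H).
have Mg_le w s : `|w| < Mb -> hopf (V w) = K (l s) -> `|s| < Mg.
  move=> wM ws; rewrite ltNge; apply/negP => /HMg.
  have := HCs w; rewrite /= subr0 ws KK => /(_ (ltW wM)) h1 h2.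
  have := le_trans h2 h1; apply/negP; rewrite -ltNge; exact: ltr_pwDr.
(* The parameter of the point of [l] under [V w], as a smooth function on the whole plane. *)
pose sig (w : 'rV[R]_2) : 'rV[R]_1 := (g (K' (hopf (V w))))%:M.
have Csig : Cinf setT sig.
  by move=> k; apply: Ck_scalar_mx; [exact: openT|exact: (Cicomp Cg)].
have sigE w s : `|s| <= Mg + 1 -> hopf (V w) = K (l s) -> sig w = s%:M.
  by move=> sM ws; rewrite /sig ws KK Hg.
(* A tangent vector is sent to its change of line parameter and its component along the fibre
   [qmul (V w) qi]; the sign of the determinant compares coordinates [w] with the orientation (line,
   fibre). *)
pose A (w : 'rV[R]_2) : 'M[R]_(2, 1 + 1) := row_mx (jac sig w) (jac V w *m (qmul (V w) qi)^T).
(* For a curve [c1] that advances the parameter at unit rate and a curve [c2] along the fibre, the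
   product with [A] is triangular with positive diagonal. *)
have detA (c1 c2 : R -> 'rV[R]_2) w s kk : derivable c1 0 1 -> derivable c2 0 1 -> c1 0 = w -> c2 0 = w ->
    V w != 0 -> 0 < kk -> (\forall t \near (0 : R), sig (c1 t) = (s + t)%:M) ->
    (\forall t \near (0 : R), sig (c2 t) = s%:M) ->
    'D_1 (fun t => V (c2 t)) 0 = kk *: qmul (V w) qi ->
    0 < \det (col_mx ('D_1 c1 0) ('D_1 c2 0) : 'M[R]_2) * \det (A w : 'M[R]_2).
  move=> dc1 dc2 <- c2w Vw0 kk0 s1 s2 DV; set w0 := c1 0 in c2w Vw0 DV *.
  have J1 : 'D_1 c1 0 *m jac sig w0 = 1%:M.
    have [_ <-] := @is_derive_comp R 2 1 R setT sig c1 0 1 openT (Csig 1%N) I dc1.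
    rewrite (near_eq_derive (g := fun t : R => s%:M + t *: (1%:M : 'rV[R]_1))).
      by have [_ ->] := is_derive_affine (s%:M : 'rV[R]_1) 1%:M 0.
    by apply: filterS s1 => t ->; rewrite scale_scalar_mx mulr1 raddfD.
  have J2 : 'D_1 c2 0 *m jac sig w0 = 0.
    rewrite -c2w; have [_ <-] := @is_derive_comp R 2 1 R setT sig c2 0 1 openT (Csig 1%N) I dc2.
    rewrite (near_eq_derive (g := fun _ : R => (s%:M : 'rV[R]_1))) ?derive_cst//.
  have J3 : 'D_1 c2 0 *m jac V w0 = kk *: qmul (V w0) qi.
    by rewrite -c2w; have [_ <-] := @is_derive_comp R 2 4 R setT V c2 0 1 openT (CV 1%N) I dc2; rewrite c2w.
  have -> : \det (col_mx ('D_1 c1 0) ('D_1 c2 0) : 'M[R]_2) * \det (A w0 : 'M[R]_2) =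
      kk * sqnorm (qmul (V w0) qi).
    apply: det_col_curve; apply: etrans (@mul_col_row R 1 1 2 1 1 _ _ _ _) _.
    by rewrite J1 J2 !mulmxA J3 -scalemxAl mulmx_trmx scale_scalar_mx.
  by rewrite mulr_gt0// sqnorm_qmul_qi sqnorm_gt0.
have dW2 (c : R -> 'rV[R]_4) : derivable c 0 1 -> derivable (fun t => W2 (c t)) 0 1.
  by move=> dc; have [] := @is_derive_comp R 4 2 R setT W2 c 0 1 openT (CW2 1%N) I dc.
have near1 s : `|s| < Mg -> \forall t \near (0 : R), `|s + t| <= Mg + 1.
  move=> sM; near=> t; apply: le_trans (ler_normD _ _) _; apply: lerD; first exact: ltW.
  apply/ltW; near: t; apply: (@near_norm_lt R R (fun t : R => t)); first exact: cvg_id.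
  by rewrite normr0.
have sigW2 v s : S v -> `|s| <= Mg + 1 -> hopf v = K (l s) -> sig (W2 v) = s%:M.
  by move=> Sv sM vs; apply: sigE => //; rewrite VW2.
(* [W2 0] is the tip. Elsewhere test curves exist: a lift of the half-line and the fibre circle. *)
have detAn0 w : `|w| < Mb -> w != W2 0 -> \det (A w : 'M[R]_2) != 0.
  move=> wM ww0; have [s [sR0 ws]] := VS w.
  have Vw0 : V w != 0 by apply: contra ww0 => /eqP <-; rewrite W2V.
  have sM := Mg_le w s wM ws.
  have Kls0 : K (l s) != 0.
    apply/eqP => K00; have := sqnorm_hopf (V w); rewrite ws K00.
    have -> : sqnorm (0 : 'rV[R]_3) = 0 by rewrite /sqnorm big1// => i _; rewrite mxE expr0n.
    by move/esym/eqP; rewrite sqrf_eq0 gt_eqF// sqnorm_gt0.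
  have sR0' : - R0 < s.
    rewrite lt_neqAle sR0 andbT; apply/eqP => sE; move: Kls0; rewrite -sE K0 eqxx//.
  have CKl : Cinf setT (fun s => K (l s)) by apply: (Cicomp_mx CK).
  have [c [dc c0 ct]] := curve_rotate CKl Kls0 ws.
  have Vw1 t : S (qmul (V w) (qcis (1 * t))) by exists s; split=> //; rewrite hopf_qmul_qcis.
  have dc2 : derivable (fun t : R => qmul (V w) (qcis (1 * t))) 0 1.
    by have [] := is_derive_fibre (V w) 1 0.
  suff : 0 < \det (col_mx ('D_1 (fun t : R => W2 (c t)) 0) ('D_1 (fun t : R => W2 (qmul (V w) (qcis (1 * t)))) 0) : 'M[R]_2) * \det (A w : 'M[R]_2).
    by apply: contraTneq => ->; rewrite mulr0 ltxx.
  apply: (detA _ _ _ s 1) => //.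
  - exact: dW2.
  - exact: dW2.
  - by rewrite c0 W2V.
  - by rewrite mulr0 /qcis cos0 sin0 -/qone qmulq1 W2V.
  - near=> t; have ht : hopf (c t) = K (l (s + t)) by near: t.
    apply: sigW2 => //; last by near: t; exact: near1.
    exists (s + t); split=> //; apply/ltW; rewrite -subr_gt0 opprK addrAC.
    near: t; apply: open_nbhs_nbhs; split; last by rewrite /= addr0 -[R0]opprK subr_gt0.
    by apply: open_pos; apply: Cinf_continuous; apply: CiDT; [exact: CicstT|exact: CiidT].
  - near=> t; apply: sigW2 => //; last by rewrite hopf_qmul_qcis.
    by apply: (le_trans (ltW sM)); rewrite lerDl.
  - under eq_fun do rewrite VW2//.
    by have [_ ->] := is_derive_fibre (V w) 1 0; rewrite mulr0 {1}/qcis cos0 sin0 -/qone qmulq1.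
have CdetA : continuous (fun w => \det (A w : 'M[R]_2)).
  apply: Cinf_continuous => k; apply: (@Ck_det R _ 2); first exact: openT.
  apply/Ck_mx => [|i j]; first exact: openT.
  case: (split_ordP (j : 'I_(1 + 1))) => j' ->.
    apply: (@Ck_ext _ _ _ _ _ (fun x => jac sig x i j')) => [|x _|]; first exact: openT.
      by apply/esym; exact: (@row_mxEl R 2 1 1).
    by apply: (Ck_mx _ _ openT).1; apply: Ck_jac; [exact: openT|exact: Csig].
  apply: (@Ck_ext _ _ _ _ _ (fun x => (jac V x *m (qmul (V x) qi)^T) i j')) => [|x _|]; first exact: openT.
    by apply/esym; exact: (@row_mxEr R 2 1 1).
  apply: (Ck_mx _ _ openT).1; apply: Ck_mulmx; first exact: openT.
    by apply: Ck_jac; [exact: openT|exact: CV].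
  apply/Ck_mx => [|i' j'']; first exact: openT.
  under eq_fun do rewrite mxE.
  apply: (Ck_mx _ _ openT).1; apply: Ck_qmul; [exact: openT|exact: CV|exact: Ck_cst].
pose psi w := E' (V w).
have Cpsi : Cinf setT psi by apply: (Cicomp_mx CE').
have psiE (z : 'rV[R]_4) : S (E z) -> psi (W2 (E z)) = z by move=> Sz; rewrite /psi VW2// EK.
have inter (z : 'rV[R]_(1 + 3)) s : `|z| < 2 -> rsubmx z = l s -> exists w (Q : 'M[R]_2),
    [/\ `|w| < Mb, w != W2 0, psi w = z, Q *m jac psi w = col_mx (row_mx 0 ('D_1 l s)) axis0
      & 0 < \det Q * \det (A w : 'M[R]_2)].
  move=> z2 zs; have [sR0 Ezs] := SE' z s (ltW z2) zs.
  have SEz : S (E z) by exists s; split=> //; exact: ltW.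
  have VwE := VW2 _ SEz; set w := W2 (E z) in VwE.
  have wM : `|w| < Mb by apply: le_lt_trans (W2_le _) _; apply: le_lt_trans (HC' z (ltW z2)) _.
  have hopf0 : hopf (0 : 'rV[R]_4) = 0 by rewrite -(scale0r 0) hopfZ expr0n scale0r.
  have S0 : S 0 by exists (- R0); split=> //; rewrite K0 hopf0.
  have sM : `|s| < Mg by apply: (Mg_le w) => //; rewrite VwE.
  have Ez0 : E z != 0.
    apply/eqP => Ez0; move: Ezs; rewrite Ez0 hopf0 -K0 => /(can_inj KK)/(line_inj H) sE.
    by move: sR0; rewrite -sE ltxx.
  have ww0 : w != W2 0.
    by apply/eqP => wE; move: VwE Ez0; rewrite wE VW2// => <-; rewrite eqxx.
  pose z1 (t : R) : 'rV[R]_(1 + 3) := row_mx (lsubmx z) (l (s + t)).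
  pose zz (t : R) : 'rV[R]_(1 + 3) := z + t *: axis0.
  have z1' : is_derive (0 : R) (1 : R) z1 (row_mx 0 ('D_1 l s)).
    by apply: is_derive_row_mx; exact: is_derive_translate.
  have z2' : is_derive (0 : R) (1 : R) zz axis0 by exact: is_derive_affine.
  have z10 : z1 0 = z by rewrite /z1 addr0 -zs hsubmxK.
  have z20 : zz 0 = z by rewrite /zz scale0r addr0.
  have cont (f : R -> 'rV[R]_(1 + 3)) d : is_derive (0 : R) (1 : R) f d -> f 0 = z ->
      \forall t \near (0 : R), `|f t| < 2.
    move=> [df _] f0; apply: near_norm_lt; last by rewrite f0.
    by apply: differentiable_continuous; apply/derivable1_diffP.
  have n1 := cont _ _ z1' z10; have n2 := cont _ _ z2' z20.
  have dE (f : R -> 'rV[R]_(1 + 3)) d : is_derive (0 : R) (1 : R) f d -> derivable (fun t => E (f t)) 0 1.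
    by move=> [df _]; have [] := @is_derive_comp R 4 4 R setT E f 0 1 openT (CE 1%N) I df.
  have d1 := dW2 _ (dE _ _ z1'); have d2 := dW2 _ (dE _ _ z2').
  have r2 t : rsubmx (zz t) = l s.
    by rewrite /zz linearD linearZ /= /axis0 row_mxKr scaler0 addr0.
  exists w, (col_mx ('D_1 (fun t => W2 (E (z1 t))) 0) ('D_1 (fun t => W2 (E (zz t))) 0)); split=> //.
  - exact: psiE.
  - have JJ (f : R -> 'rV[R]_(1 + 3)) d : is_derive (0 : R) (1 : R) f d -> f 0 = z ->
        derivable (fun t => W2 (E (f t))) 0 1 -> (\forall t \near (0 : R), S (E (f t))) ->
        'D_1 (fun t => W2 (E (f t))) 0 *m jac psi w = d.
      move=> [_ <-] f0 df fS; have -> : w = W2 (E (f 0)) by rewrite f0.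
      have [_ <-] := @is_derive_comp R 2 4 R setT psi _ 0 1 openT (Cpsi 1%N) I df.
      by apply: near_eq_derive; apply: filterS fS => t; exact: psiE.
    apply: etrans (@mul_col_mx R 1 1 2 4 _ _ _) _; congr col_mx.
      apply: JJ => //; apply: filterS n1 => t t2.
      by rewrite SE ?(ltW t2)//; exists (s + t); rewrite row_mxKr.
    by apply: JJ => //; apply: filterS n2 => t t2; rewrite SE ?(ltW t2)//; exists s.
  - apply: (detA _ _ _ s kap) => //; rewrite ?z10 ?z20 ?VwE//.
    + near=> t; have t2 : `|z1 t| <= 2 by apply/ltW; near: t.
      have [t0 tE] := SE' (z1 t) (s + t) t2 (row_mxKr _ _).
      apply: sigW2 => //; last by near: t; exact: near1.
      by exists (s + t); split=> //; exact: ltW.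
    + near=> t; have t2 : `|zz t| <= 2 by apply/ltW; near: t.
      have [t0 tE] := SE' (zz t) s t2 (r2 t).
      apply: sigW2 => //; first by exists s; split=> //; exact: ltW.
      by apply: (le_trans (ltW sM)); rewrite lerDl.
    + have z3 : `|z| <= 3 by apply: (le_trans (ltW z2)); rewrite ler_nat.
      rewrite (near_eq_derive (g := fun t : R => qmul (E z) (qcis (kap * t)))).
        by have [_ ->] := is_derive_fibre (E z) kap 0; rewrite mulr0 {1}/qcis cos0 sin0 -/qone qmulq1.
      apply: filterS n2 => t t2; rewrite VW2; last by rewrite SE ?(ltW t2)//; exists s.
      by apply: (HE z z3).2; apply: (le_trans (ltW t2)); rewrite ler_nat.
(* The determinant at any one point off the tip serves as [sg], by [punctured_sign]. *)
have [sg sg0 Hsg] : exists2 sg : R, sg != 0 & forall w, `|w| < Mb -> w != W2 0 -> 0 < sg * \det (A w : 'M[R]_2).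
  have [[w [wM w0]]|no] := pselect (exists w, `|w| < Mb /\ w != W2 0); last first.
    by exists 1; [exact: oner_neq0|move=> w wM w0; case: no; exists w].
  exists (\det (A w : 'M[R]_2)); first exact: detAn0.
  by move=> w' w'M w'0; apply: (punctured_sign CdetA detAn0).
exists (E' \o (F \o (qmul q \o B))), (((B' \o qmul (qinv q)) \o F') \o E), psi, (fun z => W2 (E z)), Mb, sg; split=> //.
- apply: (diffeo_comp (diffeo_comp (diffeo_comp DB DL) DF)); exact: diffeo_sym.
- move=> z z2; have cM : `|Wc (E z)| <= Mb by apply: le_trans (HC' z z2) _; exact: ltW.
  rewrite -SE// -[X in S X]WcE -flatP -HB//.
  split=> -[u [us uz]]; exists u; split=> //.
    by rewrite -uz /Wc /= E'K FK LK.
  by rewrite /= uz WcE EK.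
- split=> //.
  + exact: (Cicomp_mx CW2 CE).
  + by move=> w; rewrite /psi E'K W2V.
  move=> w wM; have [] := (HB (J w) (J_le w wM)).2; first by eexists; eexists; reflexivity.
  by move=> u [us uw]; exists u; split=> //=; rewrite uw.
move=> z s z2 zs; have [w [Q [wM w0 wz QJ Qd]]] := inter z s z2 zs.
exists w, Q; split=> //; have := Hsg w wM w0; move: Qd.
set x := \det Q; set y := \det (A w) => xy sy.
have : 0 < (x * y) * (sg * y) by exact: mulr_gt0.
have -> : (x * y) * (sg * y) = (sg * x) * y ^+ 2 by ring.
rewrite pmulr_lgt0// exprn_even_gt0//=; apply/eqP => yE; by move: sy; rewrite yE mulr0 ltxx.
Unshelve. all: by end_near. Qed.

End SpunSphere.

(** * Reparametrization of ends and height functionals *)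

Section Joining.
Context {R : realType}.

Lemma step_derive (x : R) : exists2 d : R, is_derive x (1 : R) step d &
  [/\ 0 <= d, 0 < x -> x < 1 -> 0 < d & x <= 0 \/ 1 <= x -> d = 0].
Proof.
have dF := is_derive_flat 0 x; rewrite mul0r subr0 in dF.
have dG : is_derive x (1 : R) (fun y : R => flat 0 (1 - y)) (- flat 2 (1 - x)).
  have := @is_derive_flat R 0 (1 - x); rewrite mul0r subr0 => dG.
  have d1 : is_derive x (1 : R) (fun y : R => 1 - y) (- 1).
    by apply: is_derive_eq; ring.
  have := @is_derive1_comp R (flat 0) (fun y : R => 1 - y) x _ _ dG d1.
  by rewrite mulrN1.
have H0 := step_den_gt0 x; set h := flat 0 x + flat 0 (1 - x) in H0.
have hN : h != 0 by rewrite gt_eqF.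
exists ((flat 2 x * flat 0 (1 - x) + flat 0 x * flat 2 (1 - x)) / h ^+ 2).
  have dH : is_derive x (1 : R) (fun y => flat 0 y + flat 0 (1 - y)) (flat 2 x - flat 2 (1 - x)).
    exact: is_deriveD.
  have dV := @is_deriveV R (fun y => flat 0 y + flat 0 (1 - y)) x _ 1 hN dH.
  have := is_deriveM dF dV; rewrite -/h => dM.
  apply: is_derive_eq; rewrite /GRing.scale /= /h; field; exact: hN.
split.
- by rewrite divr_ge0 ?sqr_ge0// addr_ge0// mulr_ge0// flat_ge0.
- move=> x0 x1; rewrite divr_gt0 ?exprn_gt0// ltr_pwDl ?mulr_ge0 ?flat_ge0//.
  by rewrite mulr_gt0// flat_gt0// subr_gt0.
- case=> [x0|x1]; first by rewrite !(flat_le0 _ x0) !mul0r addr0 mul0r.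
  by rewrite ![flat _ (1 - x)]flat_le0 ?subr_le0// !mulr0 addr0 mul0r.
Qed.

Lemma is_derive_comp1 n (l : R -> 'rV[R]_n) (phi : R -> R) (s d : R) : Cinf setT l ->
  is_derive s (1 : R) phi d -> is_derive s (1 : R) (fun s => l (phi s)) (d *: 'D_1 l (phi s)).
Proof.
move=> Cl dphi; apply: is_derive_rv => j; rewrite mxE mulrC.
have dl : is_derive (phi s) (1 : R) (fun s => l s ord0 j) ('D_1 l (phi s) ord0 j).
  by apply: is_derive_coord; split=> //; exact: Cinf_derivable.
exact: (@is_derive1_comp R (fun s => l s ord0 j) phi s _ _ dl dphi).
Qed.

(** A [proper_line] up to a shift [c] of the parameter on the final ray; joining lines end to end
    consumes parameter length. *)
Record line_offset (l : R -> 'rV[R]_3) (a b : 'rV[R]_3) (rho c : R) : Prop := {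
  lo_smooth : Cinf setT l;
  lo_inj : injective l;
  lo_immersion : forall s : R, 'D_1 l s != 0;
  lo_rho : 0 < rho;
  lo_a : a != 0;
  lo_b : b != 0;
  lo_end : forall s, rho <= s -> l s = (s - c) *: b;
  lo_start : forall s, s <= - rho -> l s = - s *: a }.

(** The increasing change of parameter [s + c * step (s - rho)] removes the shift and changes
    velocities by positive factors only. *)
Lemma line_offset_proper l a b rho c : 0 <= c -> line_offset l a b rho c ->
  exists l', proper_line l' a b (rho + 1) /\
    (forall x, (exists s, l' s = x) <-> (exists s, l s = x)) /\
    (forall s, exists s' k, [/\ 0 < k, l' s = l s' & 'D_1 l' s = k *: 'D_1 l s']).
Proof.
move=> c0 H; have Cl := lo_smooth H; have rho0 := lo_rho H.
pose phi s : R := s + c * step (s - rho).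
have dphi s : exists2 d, is_derive s (1 : R) phi d & 0 < d.
  have [d dd [d0 _ _]] := step_derive (s - rho).
  exists (1 + c * d); last by rewrite ltr_pwDl// mulr_ge0.
  have d1 : is_derive s (1 : R) (fun s : R => s - rho) 1.
    by apply: is_derive_eq; ring.
  have d2 := @is_derive1_comp R step (fun s : R => s - rho) s _ _ dd d1.
  by apply: is_derive_eq; rewrite /GRing.scale /=; ring.
have Cphi : Cinf setT phi.
  apply: CiDT; first exact: CiidT.
  apply: CiMT; first exact: CicstT.
  by apply: (Cicomp1 Cistep); apply: CiBT; [exact: CiidT|exact: CicstT].
have phi_lt s s' : s < s' -> phi s < phi s'.
  by move=> ss; rewrite /phi ltr_leD// ler_wpM2l// step_nd// lerD2r ltW.
have phi_inj : injective phi.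
  move=> s s' E; apply/eqP; rewrite eq_le !leNgt; apply/andP; split; apply/negP => /phi_lt.
    by rewrite E ltxx.
  by rewrite E ltxx.
have phi_onto y : exists s, phi s = y.
  have yc : y - c <= y by rewrite gerBl.
  have [|s _ <-] := @IVT R phi (y - c) y y yc (continuous_subspaceT (Cinf_continuous Cphi)); last by exists s.
  rewrite ge_min le_max /phi; apply/andP; split; apply/orP; [left|right].
    have := step_le1 (y - c - rho); have := step_ge0 (y - c - rho); nra.
  have := step_ge0 (y - rho); nra.
have D s : exists2 d : R, 0 < d & 'D_1 (fun s => l (phi s)) s = d *: 'D_1 l (phi s).
  by have [d dd d0] := dphi s; exists d => //; have [_ ->] := is_derive_comp1 Cl dd.
exists (fun s => l (phi s)); split; last split.
- split.
  + exact: (Cicomp1_mx Cl).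
  + by move=> s s' /(lo_inj H)/phi_inj.
  + by move=> s; have [d d0 ->] := D s; rewrite scaler_eq0 negb_or gt_eqF//= (lo_immersion H).
  + by rewrite addr_gt0.
  + exact: lo_a H.
  + exact: lo_b H.
  + move=> s sr; rewrite /phi step_ge1 ?mulr1; last by rewrite lerBrDr addrC.
    by rewrite (lo_end H) ?addrK//; lra.
  + move=> s sr; rewrite /phi step_le0; last by lra.
    by rewrite mulr0 addr0 (lo_start H)//; lra.
- move=> x; split=> [[s <-]|[s <-]]; first by exists (phi s).
  by have [t <-] := phi_onto s; exists t.
- by move=> s; have [d d0 E] := D s; exists (phi s), d.
Qed.

Definition indep3 (x y z : 'rV[R]_3) := forall p q r : R,
  p *: x + q *: y + r *: z = 0 -> [/\ p = 0, q = 0 & r = 0].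

Lemma dotDl n (x y w : 'rV[R]_n) : dot (x + y) w = dot x w + dot y w.
Proof. by rewrite /dot -big_split; apply: eq_bigr => i _; rewrite mxE mulrDl. Qed.

Lemma dotZl n k (x w : 'rV[R]_n) : dot (k *: x) w = k * dot x w.
Proof. by rewrite /dot mulr_sumr; apply: eq_bigr => i _; rewrite mxE mulrA. Qed.

Lemma dot_mulmx n (x w : 'rV[R]_n) : x *m w^T = (dot x w)%:M.
Proof.
apply/matrixP => i j; rewrite !ord1 !mxE eqxx mulr1n.
by apply: eq_bigr => m _; rewrite mxE.
Qed.

(** Solved with the invertible matrix of rows [x], [y], [z]. Such a [w] is a height that grows at
    unit rate along both rays to be joined. *)
Lemma indep3_functional x y z : indep3 x y z ->
  exists w : 'rV[R]_3, [/\ dot x w = 1, dot y w = 1 & dot z w = 0].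
Proof.
move=> I; pose M : 'M[R]_3 := col_mx x (col_mx y z : 'M[R]_(2, 3)).
have MU : M \in unitmx.
  apply: unitmx_ker => v; rewrite -[v](@hsubmxK _ 1 1 2).
  set p := lsubmx _; set v' := rsubmx _; rewrite -[v'](@hsubmxK _ 1 1 1).
  set q := lsubmx _; set r := rsubmx _ => E.
  have : p *m x + (q *m y + r *m z) = 0.
    by rewrite -E /M (@mul_row_col R 1 1 2 3) (@mul_row_col R 1 1 1 3).
  rewrite [p]mx11_scalar [q]mx11_scalar [r]mx11_scalar !mul_scalar_mx addrA => /I[p0 q0 r0].
  by rewrite p0 q0 r0 !raddf0 !row_mx0.
pose c : 'M[R]_(1 + (1 + 1), 1) := col_mx 1%:M (col_mx 1%:M 0).
pose w := invmx M *m c.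
have E : M *m w = c by rewrite /w mulmxA mulmxV// mul1mx.
have : col_mx (x *m w) (col_mx (y *m w) (z *m w)) = c.
  by rewrite -E /M -(@mul_col_mx R 1 1 3 1) -(@mul_col_mx R 1 2 3 1).
move=> /eq_col_mx[xw /eq_col_mx[yw zw]].
have S u (k : R) : u *m w = k%:M -> dot u w^T = k.
  by rewrite -{1}[w]trmxK dot_mulmx => /matrixP/(_ 0 0); rewrite !mxE !mulr1n.
by exists w^T; split; apply: S => //; rewrite zw raddf0.
Qed.

End Joining.

(** * Joining two lines far out *)

Section JoinLines.
Context {R : realType}.

Lemma indep3_pair (x y z : 'rV[R]_3) p q : indep3 x y z -> p *: x + q *: y = 0 -> p = 0 /\ q = 0.
Proof. by move=> I E; have [|-> ->] := I p q 0; rewrite ?E ?scale0r ?addr0. Qed.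

Lemma dot_continuous (n : nat) (w : 'rV[R]_n) (l : R -> 'rV[R]_n) : Cinf setT l ->
  continuous (fun s => dot (l s) w).
Proof.
move=> Cl; apply: Cinf_continuous => k.
by apply: Ck_dot; [exact: openT|exact: Cl|exact: Ck_cst].
Qed.

Lemma line_core_bound l (a b : 'rV[R]_3) rho w : proper_line l a b rho ->
  exists2 C : R, 0 <= C & forall s, - rho <= s <= rho -> dot (l s) w <= C.
Proof.
move=> H; have [C C0 HC] := compact_bounded_norm (@segment_compact R (- rho) rho)
  (dot_continuous (w := w) (line_smooth H)).
exists C => // s sI; apply: le_trans (ler_norm _) _; apply: HC.
by rewrite /= in_itv.
Qed.

(** The final ray of [l1] and the initial ray of [l2] are joined by a bridge in the plane of [b1]
    and [a2]. Its height, measured by [w], exceeds [N] and the heights of both compact cores;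
    independence of [a1] and [b2] from that plane keeps it off the two remaining rays. *)
Lemma join_lines l1 a1 b1 rho1 l2 a2 b2 rho2 (w : 'rV[R]_3) (N : R) :
  proper_line l1 a1 b1 rho1 -> proper_line l2 a2 b2 rho2 -> (forall s s', l1 s != l2 s') ->
  indep3 b1 a2 a1 -> indep3 b1 a2 b2 -> dot b1 w = 1 -> dot a2 w = 1 ->
  exists l rho, [/\ proper_line l a1 b2 rho,
   forall s, [\/ exists s1 k, [/\ 0 < k, l s = l1 s1 & 'D_1 l s = k *: 'D_1 l1 s1],
     exists s1 k, [/\ 0 < k, l s = l2 s1 & 'D_1 l s = k *: 'D_1 l2 s1]
     | exists p q, [/\ 0 <= p, 0 <= q, N < p + q & l s = p *: b1 + q *: a2]],
   forall s, dot (l1 s) w <= N -> exists s', l s' = l1 s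
   & forall s, dot (l2 s) w <= N -> exists s', l s' = l2 s].
Proof.
move=> H1 H2 dis I1 I2 bw aw.
have rho10 := line_rho H1; have rho20 := line_rho H2.
have [C1 C10 HC1] := line_core_bound w H1; have [C2 C20 HC2] := line_core_bound w H2.
(* Above [N], the radii past which the ends are straight, and the heights of both cores. *)
have [R1 [R1N R1rho1 R1rho2 R1C1 R1C2]] : exists R1, [/\ N < R1, rho1 < R1, rho2 < R1, C1 < R1 & C2 < R1].
  exists (`|N| + rho1 + rho2 + C1 + C2 + 1); have := normr_ge0 N; have := ler_norm N.
  by split; lra.
have R10 : 0 < R1 by exact: lt_trans R1rho1.
(* [l2] is run at [s - L], so that [s = R1 + 1] corresponds to its parameter [- R1], at height [R1]
   on its initial ray. *)
have [L LE] : exists L, L = 2 * R1 + 1 by eexists.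
(* [u] is the position between [b1] and [a2]; the height [A] passes from [s], outward along the
   first ray, to [L - s], inward along the second. *)
pose u s := step (s - R1); pose A s := s * (1 - u s) + (L - s) * u s.
pose F s := (A s * (1 - u s)) *: b1 + (A s * u s) *: a2.
pose l0 s := if s <= R1 then l1 s else if s < R1 + 1 then F s else l2 (s - L).
have u0 s : 0 <= u s <= 1 by rewrite step_ge0 step_le1.
have uL s : s <= R1 -> u s = 0 by move=> sR; rewrite /u step_le0// subr_le0.
have uR s : R1 + 1 <= s -> u s = 1 by move=> sR; rewrite /u step_ge1// lerBrDl.
have FL s : rho1 <= s -> s <= R1 -> F s = l1 s.
  move=> s1 s2; rewrite /F /A uL// subr0 mulr1 !mulr0 scale0r !addr0 mulr1.
  by rewrite (line_end H1).
have FR s : R1 + 1 <= s -> s <= L - rho2 -> F s = l2 (s - L).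
  move=> s1 s2; rewrite /F /A uR// subrr !mulr0 scale0r !add0r !mulr1.
  by rewrite (line_start H2) ?opprB//; lra.
have l0L s : s < R1 -> \forall t \near s, l0 t = l1 t.
  move=> sR; near=> t; rewrite /l0 ifT//; apply/ltW; near: t.
  by apply: open_nbhs_nbhs; split; [exact: open_lt|].
have l0R s : R1 + 1 < s -> \forall t \near s, l0 t = l2 (t - L).
  move=> sR; near=> t; have tR : R1 + 1 < t.
    by near: t; apply: open_nbhs_nbhs; split; [exact: open_gt|].
  by rewrite /l0 ifF ?ifF//; apply/negbTE; rewrite -?ltNge -?leNgt; lra.
have l0F s : rho1 < s -> s < L - rho2 -> \forall t \near s, l0 t = F t.
  move=> s1 s2; near=> t.
  have t1 : rho1 < t by near: t; apply: open_nbhs_nbhs; split; [exact: open_gt|].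
  have t2 : t < L - rho2 by near: t; apply: open_nbhs_nbhs; split; [exact: open_lt|].
  rewrite /l0; have [tR|tR] := leP t R1; first by rewrite FL ?(ltW t1).
  by have [//|tR'] := ltP t (R1 + 1); rewrite FR ?(ltW t2).
have Dtr s : 'D_1 (fun t => l2 (t - L)) s = 'D_1 l2 (s - L).
  have dsL : is_derive s (1 : R) (fun s : R => s - L) 1 by apply: is_derive_eq; ring.
  by have [_ ->] := is_derive_comp1 (line_smooth H2) dsL; rewrite scale1r.
have tri s : s < R1 \/ (rho1 < s /\ s < L - rho2) \/ R1 + 1 < s.
  have [sR|sR] := ltP s R1; [by left|right].
  have [sR'|sR'] := ltP (R1 + 1) s; [by right|left].
  by split; lra.
have Cu : Cinf setT u.
  by apply: (Cicomp1 Cistep); apply: CiBT; [exact: CiidT|exact: CicstT].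
have CA : Cinf setT A.
  by apply: CiDT; apply: CiMT => //; cinf; exact: CiidT.
have CF : Cinf setT F by apply: CiDT; apply: CiZT; cinf.
have Cl0 : Cinf setT l0.
  move=> k; apply: Ck_local => s _.
  have loc (G : R -> 'rV[R]_3) : Cinf setT G -> (\forall t \near s, l0 t = G t) ->
      exists U' : set R, U' s /\ Ck k U' l0.
    move=> CG; rewrite -[X in X -> _]/(nbhs s [set t | l0 t = G t]) nbhsE => -[U [oU Us] UG].
    exists U; split=> //; apply: Ck_ext (Ck_sub (@subsetT _ U) (CG k)) => // t Ut.
    exact/esym/UG.
  have [sL|[[s1 s2]|sR]] := tri s.
  - by apply: (loc l1); [exact: line_smooth H1|exact: l0L].
  - by apply: (loc F); [|exact: l0F].
  - apply: (loc (fun t => l2 (t - L))); last exact: l0R.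
    by apply: (Cicomp1_mx (line_smooth H2)); apply: CiBT; [exact: CiidT|exact: CicstT].
have A0 s : rho1 < s -> s < L - rho2 -> 0 < A s.
  move=> s1 s2; have := u0 s => /andP[us0 us1].
  have s0 : 0 < s by lra. have Ls : 0 < L - s by lra.
  rewrite /A; have [->|un] := eqVneq (u s) 0; first by rewrite subr0 mulr1 mulr0 addr0.
  have : 0 < u s by rewrite lt_def un.
  by move=> up; apply: ltr_wpDl; [apply: mulr_ge0; lra|apply: mulr_gt0; lra].
have dF s : rho1 < s -> s < L - rho2 -> 'D_1 F s != 0.
  move=> s1 s2; have [d du [d0 d01 _]] := step_derive (s - R1).
  have dsR : is_derive s (1 : R) (fun s : R => s - R1) 1 by apply: is_derive_eq; ring.
  have dus : is_derive s (1 : R) u d.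
    by have := @is_derive1_comp R step (fun s : R => s - R1) s _ _ du dsR; rewrite mulr1.
  pose A' := 1 - 2 * u s + (L - 2 * s) * d.
  have dA : is_derive s (1 : R) A A'.
    by apply: is_derive_eq; rewrite /GRing.scale /= /A'; ring.
  have dFs : is_derive s (1 : R) F ((A' * (1 - u s) - A s * d) *: b1 + (A' * u s + A s * d) *: a2).
    apply: is_derive_rv => j; rewrite /F; under eq_fun do rewrite !mxE.
    by apply: is_derive_eq; rewrite !mxE /GRing.scale /=; ring.
  have [_ ->] := dFs; apply/eqP => /(indep3_pair I1)[e1 e2].
  (* The coefficients add up to [A'], so [A'] and then [d] vanish; [d = 0] puts [u s] at 0 or 1,
     whereas [A' = 0] then says [u s] is 1/2. *)
  have A'0 : A' = 0 by transitivity ((A' * (1 - u s) - A s * d) + (A' * u s + A s * d)); [ring|rewrite e1 e2 addr0].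
  have /eqP := e2; rewrite A'0 mul0r add0r mulf_eq0 gt_eqF ?A0//= => /eqP dz.
  move: A'0; rewrite /A' dz mulr0 addr0 => uz.
  have x0 : 0 < s - R1 by rewrite ltNge; apply/negP => x0; move: uz; rewrite /u step_le0//; lra.
  have x1 : s - R1 < 1 by rewrite ltNge; apply/negP => x1; move: uz; rewrite /u step_ge1//; lra.
  by have := d01 x0 x1; rewrite dz ltxx.
have Dl0 s : [\/ exists s1, l0 s = l1 s1 /\ 'D_1 l0 s = 'D_1 l1 s1,
     exists s1, l0 s = l2 s1 /\ 'D_1 l0 s = 'D_1 l2 s1
     | [/\ R1 <= s, s <= R1 + 1 & l0 s = F s]].
  have [sL|sL] := ltP s R1.
    apply: Or31; exists s; split; first by rewrite /l0 ifT// ltW.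
    by apply: near_eq_derive; exact: l0L.
  have [sR|sR] := ltP (R1 + 1) s.
    apply: Or32; exists (s - L); rewrite -Dtr; split; last by apply: near_eq_derive; exact: l0R.
    by rewrite /l0 ifF ?ifF//; apply/negbTE; rewrite -?ltNge -?leNgt; lra.
  apply: Or33; split=> //; have s1 : rho1 < s by exact: lt_le_trans sL.
  have s2 : s < L - rho2 by lra.
  exact: (nbhs_singleton (l0F s s1 s2)).
have AR s : R1 <= s -> s <= R1 + 1 -> R1 <= A s.
  move=> s1 s2; have /andP[us0 us1] := u0 s.
  have -> : A s = R1 + (s - R1) * (1 - u s) + (R1 + 1 - s) * u s by rewrite /A LE; ring.
  by rewrite -addrA lerDl addr_ge0// mulr_ge0// subr_ge0.
have uI s : R1 < s -> s < R1 + 1 -> 0 < u s /\ u s < 1.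
  by move=> s1 s2; split; [apply: step_gt0|apply: step_lt1]; lra.
have dotF s : dot (F s) w = A s by rewrite /F dotDl !dotZl bw aw; ring.
(* The bridge lies strictly inside the angle between [b1] and [a2]: independence keeps it off the
   straight ends of [l1], height off the core. *)
have F1 s s1 : R1 < s -> s < R1 + 1 -> F s <> l1 s1.
  move=> sl sr E; have /andP[v0 v1] := u0 s; have [up um] := uI s sl sr.
  have As := AR s (ltW sl) (ltW sr); have Ap : 0 < A s by exact: lt_le_trans As.
  have [s1l|s1l] := ltP s1 (- rho1).
    move: E; rewrite (line_start H1) ?(ltW s1l)// /F => E.
    have [|+ _ _] := I1 (A s * (1 - u s)) (A s * u s) s1.
      by rewrite E -scalerDl addNr scale0r.
    by apply/eqP; rewrite mulf_neq0 ?gt_eqF// subr_gt0.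
  have [s1r|s1r] := ltP rho1 s1.
    move: E; rewrite (line_end H1) ?(ltW s1r)// /F => E.
    have [|_ +] := @indep3_pair _ _ _ (A s * (1 - u s) - s1) (A s * u s) I1.
      by rewrite scalerBl addrAC E subrr.
    by apply/eqP; rewrite mulf_neq0 ?gt_eqF.
  have := HC1 s1; rewrite s1l s1r -E dotF => /(_ isT) AC.
  by move: R1C1; apply/negP; rewrite -leNgt; exact: le_trans As AC.
have F2 s s1 : R1 < s -> s < R1 + 1 -> F s <> l2 s1.
  move=> sl sr E; have /andP[v0 v1] := u0 s; have [up um] := uI s sl sr.
  have As := AR s (ltW sl) (ltW sr); have Ap : 0 < A s by exact: lt_le_trans As.
  have [s1l|s1l] := ltP s1 (- rho2).
    move: E; rewrite (line_start H2) ?(ltW s1l)// /F => E.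
    have [|+ _] := @indep3_pair _ _ _ (A s * (1 - u s)) (A s * u s + s1) I1.
      by rewrite scalerDl addrA E -scalerDl addNr scale0r.
    by apply/eqP; rewrite mulf_neq0 ?gt_eqF// subr_gt0.
  have [s1r|s1r] := ltP rho2 s1.
    move: E; rewrite (line_end H2) ?(ltW s1r)// /F => E.
    have [|+ _ _] := I2 (A s * (1 - u s)) (A s * u s) (- s1).
      by rewrite E -scalerDl subrr scale0r.
    by apply/eqP; rewrite mulf_neq0 ?gt_eqF// subr_gt0.
  have := HC2 s1; rewrite s1l s1r -E dotF => /(_ isT) AC.
  by move: R1C2; apply/negP; rewrite -leNgt; exact: le_trans As AC.
have FF s s' : R1 < s -> s < R1 + 1 -> R1 < s' -> s' < R1 + 1 -> F s = F s' -> s = s'.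
  move=> s1 s2 s1' s2' E.
  have Ap : 0 < A s by apply: lt_le_trans (AR s (ltW s1) (ltW s2)).
  have [|e1 e2] := @indep3_pair _ _ _ (A s * (1 - u s) - A s' * (1 - u s')) (A s * u s - A s' * u s') I1.
    transitivity (F s - F s'); last by rewrite E subrr.
    by rewrite /F !scalerBl opprD addrACA.
  have AA : A s = A s'.
    apply/eqP; rewrite -subr_eq0; apply/eqP.
    by transitivity ((A s * (1 - u s) - A s' * (1 - u s')) + (A s * u s - A s' * u s')); [ring|rewrite e1 e2 addr0].
  have uu : u s = u s'.
    by apply: (@mulfI _ (A s)); [rewrite gt_eqF|rewrite {2}AA; apply/eqP; rewrite -subr_eq0 e2].
  have step_inj (x y : R) : 0 < x -> y < 1 -> x < y -> step x = step y -> False.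
    by move=> x0 y1 xy E'; have := @step_lt R x y; rewrite E' ltxx (lt_trans x0 xy) (lt_trans xy y1) => /(_ isT isT xy).
  have [ss|ss|//] := ltgtP s s'.
    by case: (step_inj (s - R1) (s' - R1)); rewrite ?ltrD2r ?subr_gt0 ?ltrBlDl.
  by case: (step_inj (s' - R1) (s - R1)); rewrite ?ltrD2r ?subr_gt0 ?ltrBlDl.
have l0C s : [\/ s <= R1 /\ l0 s = l1 s, [/\ R1 < s, s < R1 + 1 & l0 s = F s]
    | R1 + 1 <= s /\ l0 s = l2 (s - L)].
  rewrite /l0; have [s1|s1] := leP s R1; first by apply: Or31.
  by have [s2|s2] := ltP s (R1 + 1); [apply: Or32|apply: Or33].
have il0 : injective l0.
  move=> s s'; case: (l0C s) => [[s1 ->]|[s1 s2 ->]|[s1 ->]];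
    case: (l0C s') => [[s1' ->]|[s1' s2' ->]|[s1' ->]] E.
  - exact: line_inj H1 _ _ E.
  - by case: (F1 s' s s1' s2').
  - by move: (dis s (s' - L)); rewrite E eqxx.
  - by case: (F1 s s' s1 s2).
  - exact: FF.
  - by case: (F2 s (s' - L) s1 s2).
  - by move: (dis s' (s - L)); rewrite E eqxx.
  - by case: (F2 s' (s - L) s1' s2').
  - by have /addIr := line_inj H2 E.
have LO : line_offset l0 a1 b2 (L + rho2) L.
  split=> //.
  - move=> s; case: (tri s) => [sL|[[s1 s2]|sR]].
    + by rewrite (near_eq_derive _ (l0L s sL)); exact: line_immersion H1 s.
    + by rewrite (near_eq_derive _ (l0F s s1 s2)); exact: dF.
    + by rewrite (near_eq_derive _ (l0R s sR)) Dtr; exact: line_immersion H2 _.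
  - by lra.
  - exact: line_a H1.
  - exact: line_b H2.
  - move=> s sr; rewrite /l0 ifF ?ifF ?(line_end H2) ?lerBrDl//; try by rewrite addrC.
      by apply/negbTE; rewrite -leNgt; lra.
    by apply/negbTE; rewrite -ltNge; lra.
  - move=> s sr; rewrite /l0 ifT ?(line_start H1)//; lra.
have L0 : 0 <= L by lra.
have [l [Hl [im dl]]] := line_offset_proper L0 LO.
exists l, (L + rho2 + 1); split=> //.
- move=> s; have [s' [k [k0 -> ->]]] := dl s.
  case: (Dl0 s') => [[s1 [-> ->]]|[s1 [-> ->]]|[s1 s2 ->]].
  + by apply: Or31; exists s1, k.
  + by apply: Or32; exists s1, k.
  apply: Or33; have /andP[up um] := u0 s'; have As := AR s' s1 s2.
  have Ap : 0 < A s' by exact: lt_le_trans As.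
  exists (A s' * (1 - u s')), (A s' * u s'); split=> //.
  - by rewrite mulr_ge0 ?subr_ge0// ltW.
  - by rewrite mulr_ge0// ltW.
  - by rewrite -mulrDr subrK mulr1; exact: lt_le_trans As.
- move=> s dN; apply/im; exists s; rewrite /l0 ifT// leNgt; apply/negP => sR.
  by move: dN; rewrite (line_end H1) ?dotZl ?bw; lra.
- move=> s dN; apply/im; exists (s + L).
  have sR : - R1 <= s.
    rewrite leNgt; apply/negP => sR; move: dN.
    by rewrite (line_start H2) ?dotZl ?aw; lra.
  by rewrite /l0 ifF ?ifF ?addrK//; apply/negbTE; rewrite -?ltNge -?leNgt; lra.
Unshelve. all: by end_near. Qed.

End JoinLines.

(** * Joining several lines into one *)

Section LineSystem.
Context {R : realType}.
(** [T] is what the lines trace in the unit ball and [dirok] a condition on their velocities there,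
    stable under positive factors because joining reparametrizes. *)
Variables (T : set 'rV[R]_3) (dirok : 'rV[R]_3 -> 'rV[R]_3 -> Prop).
Hypothesis dirokZ : forall x v (k : R), 0 < k -> dirok x v -> dirok x (k *: v).

(** [D j.*2] and [D j.*2.+1] are the directions of the two ends of line [j]. Independence of any
    three of them lets two ends be joined past all others. *)
Definition line_system (m : nat) (ls : nat -> R -> 'rV[R]_3) (D : nat -> 'rV[R]_3) :=
  [/\ forall j, (j < m)%N -> exists rho, proper_line (ls j) (D j.*2) (D j.*2.+1) rho,
      forall j k, (j < m)%N -> (k < m)%N -> j != k -> forall s s', ls j s != ls k s'
    & forall e1 e2 e3, (e1 < m.*2)%N -> (e2 < m.*2)%N -> (e3 < m.*2)%N ->
        e1 != e2 -> e1 != e3 -> e2 != e3 -> indep3 (D e1) (D e2) (D e3)].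

Definition traces (m : nat) (ls : nat -> R -> 'rV[R]_3) :=
  (forall x, disk 3 x -> (exists j s, (j < m)%N /\ ls j s = x) <-> T x) /\
  (forall j s, (j < m)%N -> disk 3 (ls j s) -> dirok (ls j s) ('D_1 (ls j) s)).

Lemma dot_disk (w : 'rV[R]_3) : exists2 N, 0 <= N & forall x, disk 3 x -> dot x w <= N.
Proof.
exists (\sum_(i < 3) `|w ord0 i|); first exact: sumr_ge0.
move=> x; rewrite /disk /= => xd; rewrite /dot; apply: ler_sum => i _.
have x1 : `|x ord0 i| <= 1.
  have : `|x ord0 i| ^+ 2 <= 1.
    rewrite real_normK ?num_real//; apply: le_trans xd.
    by rewrite /sqnorm (bigD1 i)//= lerDl sumr_ge0// => j _; exact: sqr_ge0.
  by rewrite expr_le1.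
apply: le_trans (ler_norm _) _; rewrite normrM -[leRHS]mul1r.
by rewrite ler_wpM2r.
Qed.

Lemma line_system_join m ls D : line_system m.+2 ls D -> traces m.+2 ls ->
  exists ls' D', line_system m.+1 ls' D' /\ traces m.+1 ls'.
Proof.
move=> [HL Hdis HD] [tr1 tr2].
have [rho1 H1] := HL 0%N isT; have [rho2 H2] := HL 1%N isT.
have [w [bw aw _]] := indep3_functional (HD 1%N 2%N 0%N isT isT isT isT isT isT).
have [N0 N00 HN0] := dot_disk w.
have core k : exists C : R, (k < m)%N -> exists rho, [/\ 0 <= C, proper_line (ls k.+2) (D k.+2.*2) (D k.+2.*2.+1) rho
    & forall s, - rho <= s <= rho -> dot (ls k.+2 s) w <= C].
  have [km|km] := boolP (k < m)%N; last by exists 0.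
  have [rho Hk] := HL k.+2 km; have [C C0 HC] := line_core_bound w Hk.
  by exists C => _; exists rho.
have [C HC] := choice core.
(* The sum bounds the height of the compact cores of the remaining lines, so the bridge misses them;
   their straight ends are missed by independence. *)
pose N := N0 + \sum_(k < m) C k.
have CN0 (k : 'I_m) : 0 <= C k by have [rho []] := HC k (ltn_ord k).
have N0N : N0 <= N by rewrite lerDl sumr_ge0.
have CN k : (k < m)%N -> C k <= N.
  move=> km; apply: ler_wpDl => //; rewrite (bigD1 (Ordinal km))//= lerDl sumr_ge0//.
have N_ge0 : 0 <= N by exact: le_trans N0N.
have [|l [rho [Hl ltri l1_in l2_in]]] := join_lines N H1 H2 _
    (HD 1%N 2%N 0%N isT isT isT isT isT isT) (HD 1%N 2%N 3%N isT isT isT isT isT isT) bw aw.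
  by move=> s s'; apply: Hdis.
have disj k s s' : (k < m)%N -> l s != ls k.+2 s'.
  move=> km; apply/eqP => E; case: (ltri s) => [[s1 [_ [_ e _]]]|[s1 [_ [_ e _]]]|[p [q [p0 q0 pq e]]]].
  - by have := Hdis 0%N k.+2 isT km isT s1 s'; rewrite -e E eqxx.
  - by have := Hdis 1%N k.+2 isT km isT s1 s'; rewrite -e E eqxx.
  have [rhok [_ Hk Ck]] := HC k km.
  have dpq : dot (ls k.+2 s') w = p + q by rewrite -E e dotDl !dotZl bw aw !mulr1.
  have tail e' x : (3 < e')%N -> (e' < m.+2.*2)%N -> ls k.+2 s' = x *: D e' -> False.
    move=> e3 em; rewrite -E e => /eqP; rewrite -subr_eq0 -scaleNr => /eqP.
    have e'1 : 1%N != e' by rewrite neq_ltn (leq_trans _ e3).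
    have e'2 : 2%N != e' by rewrite neq_ltn (leq_trans _ e3).
    move=> /(HD 1%N 2%N e' isT isT em isT e'1 e'2)[pz qz _].
    by move: pq; rewrite pz qz addr0 ltNge N_ge0.
  have [sl|sl] := ltP s' (- rhok).
    by apply: (tail k.+2.*2 (- s')); rewrite ?ltn_double// (line_start Hk)// ltW.
  have [sr|sr] := ltP rhok s'.
    by apply: (tail k.+2.*2.+1 s'); rewrite ?ltn_Sdouble// (line_end Hk)// ltW.
  have := Ck s'; rewrite sl sr dpq => /(_ isT) pqC.
  by have := lt_le_trans pq (le_trans pqC (CN k km)); rewrite ltxx.
(* The joined line keeps ends 0 and 3; ends 1 and 2 are used up, hence the shift by two of all later
   indices. *)
pose ls' j := if j is j'.+1 then ls j'.+2 else l.
pose D' e := if e is e'.+1 then D e'.+3 else D 0%N.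
exists ls', D'; split; split.
- move=> [_|j jm]; first by exists rho.
  by have [r Hr] := HL j.+2 jm; exists r.
- move=> [|j] [|k] jm km jk s s' //=.
  + exact: disj.
  + by rewrite eq_sym; exact: disj.
  + exact: Hdis.
- pose sh e := if e is e'.+1 then e'.+3 else 0%N.
  have D'E e : D' e = D (sh e) by case: e.
  have shm e : (e < m.+1.*2)%N -> (sh e < m.+2.*2)%N by case: e => [|e] //=; rewrite !doubleS !ltnS.
  have shi e e' : e != e' -> sh e != sh e' by case: e => [|e]; case: e' => [|e'].
  by move=> e1 e2 e3 m1 m2 m3 n12 n13 n23; rewrite !D'E; apply: HD; auto.
- move=> x xd; rewrite -tr1//; split=> [[[|j] [s [jm sx]]]|[[|[|j]] [s [jm sx]]]].
  + case: (ltri s) => [[s1 [_ [_ e _]]]|[s1 [_ [_ e _]]]|[p [q [p0 q0 pq e]]]].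
    * by exists 0%N, s1; rewrite -e.
    * by exists 1%N, s1; rewrite -e.
    have := le_trans (HN0 x xd) N0N; rewrite -sx /= e dotDl !dotZl bw aw !mulr1.
    by rewrite leNgt pq.
  + by exists j.+2, s.
  + have [|s' s'E] := l1_in s; first by rewrite sx; exact: le_trans (HN0 x xd) N0N.
    by exists 0%N, s'; rewrite /= s'E.
  + have [|s' s'E] := l2_in s; first by rewrite sx; exact: le_trans (HN0 x xd) N0N.
    by exists 0%N, s'; rewrite /= s'E.
  + by exists j.+1, s.
- move=> [|j] s jm /= sd; last exact: tr2.
  case: (ltri s) => [[s1 [k [k0 e ->]]]|[s1 [k [k0 e ->]]]|[p [q [p0 q0 pq e]]]].
  + by rewrite e; apply: dirokZ => //; apply: tr2 => //; rewrite -e.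
  + by rewrite e; apply: dirokZ => //; apply: tr2 => //; rewrite -e.
  have := le_trans (HN0 _ sd) N0N; rewrite e dotDl !dotZl bw aw !mulr1.
  by rewrite leNgt pq.
Qed.

Lemma line_system_line m ls D : line_system m.+1 ls D -> traces m.+1 ls ->
  exists l a b rho, [/\ proper_line l a b rho,
    forall x, disk 3 x -> (exists s, l s = x) <-> T x
    & forall s, disk 3 (l s) -> dirok (l s) ('D_1 l s)].
Proof.
elim: m ls D => [|m IH] ls D H tr; last first.
  by have [ls' [D' [H' tr']]] := line_system_join H tr; exact: IH H' tr'.
have [HL _ _] := H; have [tr1 tr2] := tr; have [rho H0] := HL 0%N isT.
exists (ls 0%N), (D 0%N), (D 1%N), rho; split=> //.
- move=> x xd; apply: iff_trans (tr1 x xd); split; first by case=> s sx; exists 0%N, s.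
  by move=> [[|j] [s [jm sx]]]; [exists s|move: jm].
- by move=> s sd; exact: tr2.
Qed.

End LineSystem.

(** * Vectors in general position *)

Section GeneralPosition.
Context {R : realType}.

Lemma dotDr n (w x y : 'rV[R]_n) : dot w (x + y) = dot w x + dot w y.
Proof. by rewrite /dot -big_split; apply: eq_bigr => i _; rewrite mxE mulrDr. Qed.

Lemma dotC n (x y : 'rV[R]_n) : dot x y = dot y x.
Proof. by apply: eq_bigr => i _; rewrite mulrC. Qed.

Lemma dotNr n (w x : 'rV[R]_n) : dot w (- x) = - dot w x.
Proof. by rewrite /dot -sumrN; apply: eq_bigr => i _; rewrite mxE mulrN. Qed.

Lemma dotBr n (w x y : 'rV[R]_n) : dot w (x - y) = dot w x - dot w y.
Proof. by rewrite dotDr dotNr. Qed.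

Lemma dot0l n (w : 'rV[R]_n) : dot 0 w = 0.
Proof. by rewrite -(scale0r 0) dotZl mul0r. Qed.

Lemma Ci_dot (V : normedModType R) n (f g : V -> 'rV[R]_n) :
  Cinf setT f -> Cinf setT g -> Cinf setT (fun x => dot (f x) (g x)).
Proof. by move=> Cf Cg k; apply: Ck_dot; [exact: openT|exact: Cf|exact: Cg]. Qed.

Lemma open_dot_neq0 (w : 'rV[R]_3) : open [set x : 'rV[R]_3 | dot x w != 0].
Proof.
apply: (@open_comp _ _ (fun x => dot x w) [set y | y != 0]); last exact: open_neq0.
by move=> x _; apply: Cinf_continuous; apply: Ci_dot; [exact: CiidT|exact: CicstT].
Qed.

(** One plane at a time: a point on it is pushed along the normal, and being off a plane is an open
    condition, imposed on all later choices. *)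
Lemma avoid_planes (ws : seq 'rV[R]_3) (O : set 'rV[R]_3) P : open O -> O P ->
  (forall w, w \in ws -> w != 0) -> exists x, O x /\ forall w, w \in ws -> dot x w != 0.
Proof.
elim: ws O P => [|w ws IH] O P oO OP ws0; first by exists P.
have w0 : w != 0 by apply: ws0; rewrite mem_head.
have [x [Ox xw]] : exists x, O x /\ dot x w != 0.
  have [e1|e1] := eqVneq (dot P w) 0; last by exists P.
  have co : {for (0 : R), continuous (fun e : R => P + e *: w)}.
    by apply: Cinf_continuous; apply: CiDT; [exact: CicstT|apply: CiZT; [exact: CiidT|exact: CicstT]].
  have : nbhs (0 : R) [set e : R | O (P + e *: w)].
    by apply: co; rewrite scale0r addr0; exact: open_nbhs_nbhs.
  move=> /nbhs_normP[d /= d0 Hd]; exists (P + (d / 2) *: w); split.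
    apply: Hd; rewrite /= sub0r normrN gtr0_norm ?divr_gt0//.
    by rewrite ltr_pdivrMr// mulr_natr mulr2n ltrDl.
  rewrite dotDl e1 add0r dotZl dot_self mulf_neq0//; first by rewrite gt_eqF// divr_gt0.
  by rewrite gt_eqF// sqnorm_gt0.
have [|||y [[Oy yw] yws]] := IH (O `&` [set x | dot x w != 0]) x.
- by apply: openI => //; exact: open_dot_neq0.
- by [].
- by move=> v vws; apply: ws0; rewrite in_cons vws orbT.
by exists y; split=> // v; rewrite in_cons => /orP[/eqP -> //|]; exact: yws.
Qed.

Lemma common_normal (x y : 'rV[R]_3) : exists w, [/\ w != 0, dot x w = 0 & dot y w = 0].
Proof.
pose A : 'M[R]_(3, 1 + 1) := row_mx x^T y^T.
have : kermx A != 0.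
  rewrite -mxrank_eq0 mxrank_ker -lt0n subn_gt0.
  by apply: leq_ltn_trans (rank_leq_col A) _.
move=> /rowV0Pn[w wA w0]; exists w; split=> //.
  move/sub_kermxP: wA; rewrite /A mul_mx_row -[0]row_mx0 => /eq_row_mx[+ _].
  by rewrite dotC dot_mulmx => /matrixP/(_ 0 0); rewrite !mxE mulr1n.
move/sub_kermxP: wA; rewrite /A mul_mx_row -[0]row_mx0 => /eq_row_mx[_].
by rewrite dotC dot_mulmx => /matrixP/(_ 0 0); rewrite !mxE mulr1n.
Qed.

(** Chosen successively: each vector avoids the planes through any two earlier ones. The pairs (e,
    e) take care of independence of two vectors. *)
Lemma general_position (N : nat) (O : nat -> set 'rV[R]_3) (P : nat -> 'rV[R]_3) :
  (forall e, open (O e)) -> (forall e, O e (P e)) ->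
  exists D : nat -> 'rV[R]_3, [/\ forall e, (e < N)%N -> O e (D e),
    forall e, (e < N)%N -> D e != 0,
    forall e1 e2, (e1 < N)%N -> (e2 < N)%N -> e1 != e2 ->
      forall p q, p *: D e1 + q *: D e2 = 0 -> p = 0 /\ q = 0
    & forall e1 e2 e3, (e1 < N)%N -> (e2 < N)%N -> (e3 < N)%N ->
        e1 != e2 -> e1 != e3 -> e2 != e3 -> indep3 (D e1) (D e2) (D e3)].
Proof.
move=> oO OP; elim: N => [|N [D [D1 D2 D3 D4]]]; first by exists P; split.
have W (ij : nat * nat) := common_normal (D ij.1) (D ij.2).
have [w Hw] := choice W.
(* Avoiding this one extra plane makes the first vector nonzero, when there are no pairs yet. *)
have [u [u0 _ _]] := common_normal 0 0.
pose ws := u :: [seq w (i, j) | i <- iota 0 N, j <- iota 0 N].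
have [|x [Ox xw]] := @avoid_planes ws (O N) (P N) (oO N) (OP N).
  move=> v; rewrite in_cons => /orP[/eqP -> //|/allpairsP[[i j] /= [_ _ ->]]].
  by have [] := Hw (i, j).
have x0 : x != 0.
  by apply/eqP => x0; have := xw u (mem_head _ _); rewrite x0 dot0l eqxx.
have xwij i j : (i < N)%N -> (j < N)%N -> dot x (w (i, j)) != 0.
  move=> iN jN; apply: xw; rewrite in_cons; apply/orP; right.
  by apply/allpairsP; exists (i, j); rewrite !mem_iota.
pose D' e := if e == N then x else D e.
have D'N : D' N = x by rewrite /D' eqxx.
have D'E e : (e < N)%N -> D' e = D e by move=> eN; rewrite /D' ltn_eqF.
have cases e : (e < N.+1)%N -> e = N \/ (e < N)%N.
  by rewrite ltnS leq_eqVlt => /orP[/eqP|]; [left|right].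
have pairx e p q : (e < N)%N -> p *: D e + q *: x = 0 -> p = 0 /\ q = 0.
  move=> eN E; have [_ e1 _] := Hw (e, e); rewrite /= in e1.
  have q0 : q = 0.
    have := congr1 (fun v => dot v (w (e, e))) E.
    rewrite dotDl !dotZl e1 mulr0 add0r dot0l => /eqP; rewrite mulf_eq0.
    by rewrite (negbTE (xwij e e eN eN)) orbF => /eqP.
  split=> //; move/eqP: E; rewrite q0 scale0r addr0 scaler_eq0 (negbTE (D2 e eN)) orbF.
  by move/eqP.
have triple e1 e2 p q r : (e1 < N)%N -> (e2 < N)%N -> e1 != e2 ->
    p *: D e1 + q *: D e2 + r *: x = 0 -> [/\ p = 0, q = 0 & r = 0].
  move=> m1 m2 n12 E; have [_ h1 h2] := Hw (e1, e2); rewrite /= in h1 h2.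
  have r0 : r = 0.
    have := congr1 (fun v => dot v (w (e1, e2))) E.
    rewrite !dotDl !dotZl h1 h2 !mulr0 !add0r dot0l => /eqP; rewrite mulf_eq0.
    by rewrite (negbTE (xwij e1 e2 m1 m2)) orbF => /eqP.
  move: E; rewrite r0 scale0r addr0 => E; have [-> ->] := D3 e1 e2 m1 m2 n12 p q E.
  by split.
exists D'; split.
- by move=> e /cases[->|eN]; rewrite ?D'N ?D'E//; exact: D1.
- by move=> e /cases[->|eN]; rewrite ?D'N ?D'E//; exact: D2.
- move=> e1 e2 /cases[->|m1] /cases[->|m2] n12 p q; rewrite ?D'N ?D'E//.
  + by rewrite eqxx in n12.
  + by rewrite addrC => /(pairx _ _ _ m2)[-> ->].
  + exact: pairx.
  + exact: D3.
- move=> e1 e2 e3 /cases[->|m1] /cases[->|m2] /cases[->|m3] n12 n13 n23;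
    rewrite ?eqxx// in n12 n13 n23; rewrite ?D'N ?D'E// => p q r.
  + by rewrite -addrA addrC => /(triple _ _ _ _ _ m2 m3 n23)[-> -> ->].
  + by rewrite addrAC => /(triple _ _ _ _ _ m1 m3 n13)[-> -> ->].
  + by apply: triple.
  + by apply: D4.
Qed.

End GeneralPosition.

(** * Bending the end of an arc into a radial ray *)

Section Tail.
Context {R : realType}.
Variables (tau : R -> 'rV[R]_3) (b : 'rV[R]_3) (delta : R).
Hypotheses (Ctau : Cinf setT tau) (delta0 : 0 < delta).
Let e := tau 1.

Lemma dotBl n (x y w : 'rV[R]_n) : dot (x - y) w = dot x w - dot y w.
Proof. by rewrite !(dotC _ w) dotBr. Qed.

Definition tail_step (s : R) : R := step ((s - 1) / delta).
(** A convex interpolation, over [1, 1 + delta], from the arc to the ray of [b]. Under the later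
    hypotheses the height [dot _ e] over the endpoint [e] increases along it, whence injectivity,
    immersion and staying outside the ball. *)
Definition tail (s : R) : 'rV[R]_3 := tau s + tail_step s *: (s *: b - tau s).

Lemma Ci_tail : Cinf setT tail.
Proof.
have Cu : Cinf setT tail_step.
  apply: (Cicomp1 Cistep); apply: CiMT; last exact: CicstT.
  by apply: CiBT; [exact: CiidT|exact: CicstT].
apply: CiDT => //; apply: CiZT => //; apply: CiBT => //.
by apply: CiZT; [exact: CiidT|exact: CicstT].
Qed.

Lemma tail_step01 s : 0 <= tail_step s <= 1. Proof. by rewrite step_ge0 step_le1. Qed.

Lemma tail_step_le1 s : s <= 1 -> tail_step s = 0.
Proof. by move=> s1; rewrite /tail_step step_le0// pmulr_lle0 ?invr_gt0// subr_le0. Qed.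

Lemma tail_step_ge s : 1 + delta <= s -> tail_step s = 1.
Proof. by move=> s1; rewrite /tail_step step_ge1// ler_pdivlMr// mul1r lerBrDl. Qed.

Lemma tail_le1 s : s <= 1 -> tail s = tau s.
Proof. by move=> s1; rewrite /tail tail_step_le1// scale0r addr0. Qed.

Lemma tail_ge s : 1 + delta <= s -> tail s = s *: b.
Proof. by move=> s1; rewrite /tail tail_step_ge// scale1r addrC subrK. Qed.

Lemma tail_dot s f : dot (tail s) f = (1 - tail_step s) * dot (tau s) f + tail_step s * (s * dot b f).
Proof. by rewrite /tail dotDl dotZl dotBl dotZl; ring. Qed.

Lemma tail_derive s : exists2 d, 'D_1 tail s = (1 - tail_step s) *: 'D_1 tau s + tail_step s *: b + d *: (s *: b - tau s) &
  0 <= d /\ (s <= 1 \/ 1 + delta <= s -> d = 0).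
Proof.
have [d dd [d0 _ dz]] := step_derive ((s - 1) / delta).
have d1 : is_derive s (1 : R) (fun s : R => (s - 1) / delta) (delta^-1).
  by apply: is_derive_eq; rewrite /GRing.scale /=; ring.
have d2 : is_derive s (1 : R) tail_step (d * delta^-1).
  exact: (@is_derive1_comp R step (fun s : R => (s - 1) / delta) s _ _ dd d1).
exists (d * delta^-1); last first.
  split; first by rewrite mulr_ge0// invr_ge0 ltW.
  move=> ss; rewrite dz ?mul0r//; case: ss => ss; [left|right].
    by rewrite pmulr_lle0 ?invr_gt0// subr_le0.
  by rewrite ler_pdivlMr// mul1r lerBrDl.
suff [_ ->] : is_derive s (1 : R) tail ((1 - tail_step s) *: 'D_1 tau s + tail_step s *: b + (d * delta^-1) *: (s *: b - tau s)) by [].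
apply: is_derive_rv => j; rewrite /tail; under eq_fun do rewrite !mxE.
have dt : is_derive s (1 : R) (fun s => tau s ord0 j) ('D_1 tau s ord0 j).
  by apply: is_derive_coord; split=> //; exact: Cinf_derivable.
by apply: is_derive_eq; rewrite !mxE /GRing.scale /=; ring.
Qed.

Lemma tail_derive_le1 s : s <= 1 -> 'D_1 tail s = 'D_1 tau s.
Proof.
move=> s1; have [d -> [_ dz]] := tail_derive s; rewrite dz; last by left.
by rewrite tail_step_le1// subr0 scale1r !scale0r !addr0.
Qed.

Lemma tail_pos f : (forall s, 1 <= s <= 1 + delta -> 0 < dot (tau s) f) -> 0 < dot b f ->
  forall s, 1 <= s -> 0 < dot (tail s) f.
Proof.
move=> tf bf s s1; have s0 : 0 < s by lra.
have [sd|/ltW sd] := leP s (1 + delta); last by rewrite tail_ge// dotZl mulr_gt0.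
rewrite tail_dot; have ts : 0 < dot (tau s) f by apply: tf; rewrite s1.
have sb : 0 < s * dot b f by exact: mulr_gt0.
have /andP[u0 u1] := tail_step01 s; move: u0 u1 ts sb.
set x := tail_step s; set y := dot (tau s) f; set z := s * _; clear => u0 u1 y0 z0; nra.
Qed.

Hypotheses (e1 : sqnorm e = 1)
  (dtau : forall s, 1 <= s <= 1 + delta -> 0 < dot ('D_1 tau s) e)
  (taub : forall s, 1 <= s <= 1 + delta -> dot (tau s) e < dot b e).

Lemma dot_tau_lt s s' : 1 <= s -> s < s' -> s' <= 1 + delta -> dot (tau s) e < dot (tau s') e.
Proof.
move=> s1 ss s2; pose g s := dot (tau s) e.
have dg x : is_derive x (1 : R) g (dot ('D_1 tau x) e).
  have Hj i : is_derive x (1 : R) (fun s => tau s ord0 i * e ord0 i) ('D_1 tau x ord0 i * e ord0 i).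
    have dt : is_derive x (1 : R) (fun s => tau s ord0 i) ('D_1 tau x ord0 i).
      by apply: is_derive_coord; split=> //; exact: Cinf_derivable.
    by apply: is_derive_eq; rewrite /GRing.scale /=; ring.
  have := is_derive_sum Hj.
  by rewrite (_ : \sum_(i < 3) _ = g)//; apply/funext => y; rewrite fct_sumE.
have cg : {within `[s, s'], continuous g}.
  by apply: continuous_subspaceT; apply: Cinf_continuous; apply: Ci_dot; [exact: Ctau|exact: CicstT].
have [c /[!in_itv]/= /andP[c1 c2] E] := @MVT R g (fun x => dot ('D_1 tau x) e) s s' ss (fun x _ => dg x) cg.
rewrite -/(g s) -/(g s') -subr_gt0 E mulr_gt0 ?subr_gt0//.
by apply: dtau; apply/andP; split; lra.
Qed.

(** Arc and ray both gain height and the ray is the higher one, so shifting weight to the ray only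
    adds. *)
Lemma tail_mono s s' : 1 <= s -> s < s' -> dot (tail s) e < dot (tail s') e.
Proof.
move=> s1 ss.
have b1 : 1 < dot b e.
  by rewrite -e1 -dot_self; apply: taub; rewrite lexx lerDl ltW.
have [sd|/ltW sd] := leP s' (1 + delta); last first.
  rewrite (tail_ge sd) dotZl tail_dot; have /andP[u0 u1] := tail_step01 s.
  have [s2|/ltW s2] := leP s (1 + delta).
    have tb : dot (tau s) e < dot b e by apply: taub; rewrite s1.
    move: u0 u1 tb b1 ss s1; set x := tail_step s; set y := dot (tau s) e; set z := dot b e.
    clear => u0 u1 tb b1 ss s1.
    have h1 : (1 - x) * y <= (1 - x) * z by rewrite ler_wpM2l ?subr_ge0// ltW.
    have h2 : (1 - x) * z <= (1 - x) * (s * z) by rewrite ler_wpM2l ?subr_ge0// ler_peMl//; lra.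
    have h3 : s * z < s' * z by rewrite ltr_pM2r//; lra.
    by apply: le_lt_trans h3; rewrite -lerBrDr; apply: le_trans h1 _; apply: le_trans h2 _; lra.
  rewrite tail_step_ge// subrr mul0r add0r mul1r ltr_pM2r//; lra.
have t1 : dot (tau s) e < dot (tau s') e by exact: dot_tau_lt.
have t2 : dot (tau s') e < dot b e by apply: taub; rewrite sd andbT; lra.
rewrite !tail_dot; have /andP[u0 u1] := tail_step01 s; have /andP[v0 v1] := tail_step01 s'.
have uv : tail_step s <= tail_step s'.
  by apply: step_nd; rewrite ler_pM2r ?invr_gt0// lerD2r ltW.
move: u0 u1 v0 v1 uv t1 t2 b1 ss s1.
set x := tail_step s; set x' := tail_step s'; set y := dot (tau s) e; set y' := dot (tau s') e; set z := dot b e.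
clear => u0 u1 v0 v1 uv t1 t2 b1 ss s1.
have z0 : 0 < z by lra.
have sz : s * z < s' * z by rewrite ltr_pM2r.
have zz : y' < s' * z by apply: lt_le_trans t2 _; rewrite ler_peMl//; lra.
have h : (1 - x) * y + x * (s * z) < (1 - x) * y' + x * (s' * z).
  have [->|x0] := eqVneq x 0; first by rewrite subr0 !mul1r !mul0r !addr0.
  apply: ler_ltD; first by rewrite ler_wpM2l ?subr_ge0// ltW.
  by rewrite ltr_pM2l// lt_def x0.
apply: lt_le_trans h _; rewrite -subr_ge0.
have -> : (1 - x') * y' + x' * (s' * z) - ((1 - x) * y' + x * (s' * z)) = (x' - x) * (s' * z - y') by ring.
by rewrite mulr_ge0// subr_ge0// ltW.
Qed.

Lemma tail_derive_neq0 s : 1 <= s -> 'D_1 tail s != 0.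
Proof.
move=> s1; have [d -> [d0 dz]] := tail_derive s.
have b1 : 1 < dot b e by rewrite -e1 -dot_self; apply: taub; rewrite lexx lerDl ltW.
suff : 0 < dot ((1 - tail_step s) *: 'D_1 tau s + tail_step s *: b + d *: (s *: b - tau s)) e.
  by apply: contraTneq => ->; rewrite dot0l ltxx.
rewrite !dotDl !dotZl dotBl dotZl.
have [sd|/ltW sd] := leP s (1 + delta); last first.
  by rewrite tail_step_ge// dz; [rewrite subrr !mul0r add0r addr0 mul1r; lra|right].
have sI : 1 <= s <= 1 + delta by rewrite s1.
have ta := dtau sI; have tb := taub sI; have /andP[u0 u1] := tail_step01 s.
move: ta tb b1 d0 u0 u1; set x := tail_step s; set y := dot ('D_1 tau s) e; set y' := dot (tau s) e; set z := dot b e.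
clear -s1 => ta tb b1 d0 u0 u1.
have h : 0 <= d * (s * z - y').
  by rewrite mulr_ge0// subr_ge0 (le_trans (ltW tb))// ler_peMl//; lra.
nra.
Qed.

(** A point whose product with the unit vector [e] exceeds 1 lies outside the unit ball, by
    Cauchy-Schwarz in the form |x - e|^2 >= 0. *)
Lemma tail_out s : 1 < s -> 1 < sqnorm (tail s).
Proof.
move=> s1; have := tail_mono (lexx 1) s1; rewrite tail_le1// -/e dot_self e1.
set x := tail s => xe; have := sqnorm_ge0 (x - e).
rewrite -dot_self dotBr !dotBl !dot_self e1 (dotC e x); lra.
Qed.

End Tail.

(** * Extending arcs to lines in general position *)

Section ArcsToLines.
Context {R : realType}.

(* Arcs are parametrized by [-1, 1], so that s *: b is a tail at both ends. *)
Record arc_system (n : nat) (t : nat -> R -> 'rV[R]_3) : Prop := {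
  as_smooth : forall i, (i < n)%N -> Cinf setT (t i);
  as_inj : forall i j s s', (i < n)%N -> (j < n)%N -> `|s| <= 1 -> `|s'| <= 1 ->
    t i s = t j s' -> i = j /\ s = s';
  as_immersion : forall i s, (i < n)%N -> `|s| <= 1 -> 'D_1 (t i) s != 0;
  as_disk : forall i s, (i < n)%N -> `|s| <= 1 -> sqnorm (t i s) <= 1;
  as_end : forall i, (i < n)%N -> sqnorm (t i 1) = 1 /\ sqnorm (t i (- 1)) = 1;
  as_out : forall i, (i < n)%N -> 0 < dot ('D_1 (t i) 1) (t i 1) /\
    dot ('D_1 (t i) (- 1)) (t i (- 1)) < 0 }.

Definition arc_union n (t : nat -> R -> 'rV[R]_3) : set 'rV[R]_3 :=
  [set x | exists i s, [/\ (i < n)%N, `|s| <= 1 & t i s = x]].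

Definition arc_direction n (t : nat -> R -> 'rV[R]_3) (x v : 'rV[R]_3) :=
  forall i s, (i < n)%N -> `|s| <= 1 -> t i s = x -> exists2 k, 0 < k & v = k *: 'D_1 (t i) s.

Lemma open_forall_pos (V : normedModType R) (I : finType) (f : I -> V -> R) :
  (forall i, continuous (f i)) -> open [set x | forall i, 0 < f i x].
Proof.
move=> cf; rewrite openE => x fx; rewrite /interior /=.
near=> y; near: y; apply: filter_forall => i.
by apply: open_nbhs_nbhs; split; [exact: open_pos|exact: fx].
Unshelve. all: by end_near. Qed.

Lemma is_derive_opp n (f : R -> 'rV[R]_n) (s : R) : Cinf setT f ->
  'D_1 (fun s => f (- s)) s = - 'D_1 f (- s).
Proof.
move=> Cf; have d : is_derive s (1 : R) (fun s : R => - s) (- 1) by apply: is_derive_eq; ring.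
by have [_ ->] := is_derive_comp1 Cf d; rewrite scaleN1r.
Qed.

(** Each of the 2n ends [E e] is bent into a ray whose direction [D e] is close to twice [E e]. The
    tail of [e] has positive product with [E e - E e'], the tail of [e'] a negative one, so tails
    are disjoint. All conditions on [D e] are open, which leaves room for general position. *)
Lemma arc_system_lines n t : arc_system n t -> exists ls D,
  line_system n ls D /\ traces (arc_union n t) (arc_direction n t) n ls.
Proof.
move=> H.
(* Ends [i.*2] and [i.*2.+1] belong to arc [i]; the arc is reversed for the even one, so that every
   end sits at [s = 1]. *)
pose tau (e : nat) (s : R) := if odd e then t e./2 s else t e./2 (- s).
pose E e := tau e 1.
have tau_odd j : tau j.*2.+1 = t j by apply/funext => s; rewrite /tau /= odd_double /= uphalf_double.
have tau_even j : tau j.*2 = (fun s => t j (- s)) by apply/funext => s; rewrite /tau odd_double doubleK.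
have dec e : (e < n.*2)%N -> exists2 j, (j < n)%N & e = j.*2 \/ e = j.*2.+1.
  move=> en; exists e./2; first by rewrite ltn_half_double.
  by rewrite -{1 3}[e]odd_double_half; case: (odd e); [right|left].
have n11 : `|1 : R| <= 1 by rewrite normr1.
have nm11 : `|- 1 : R| <= 1 by rewrite normrN normr1.
have Ctau e : (e < n.*2)%N -> Cinf setT (tau e).
  move=> /dec[j jn [->|->]]; rewrite ?tau_odd ?tau_even; last exact: as_smooth H j jn.
  by apply: (Cicomp1_mx (as_smooth H jn)); apply: CiNT; exact: CiidT.
have E1 e : (e < n.*2)%N -> sqnorm (E e) = 1.
  by move=> /dec[j jn [->|->]]; rewrite /E ?tau_odd ?tau_even; have [] := as_end H jn.
have dtau e : (e < n.*2)%N -> 0 < dot ('D_1 (tau e) 1) (E e).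
  move=> /dec[j jn [->|->]]; rewrite /E ?tau_odd ?tau_even; have [h1 h2] := as_out H jn => //.
  by rewrite is_derive_opp; [rewrite dotC dotNr dotC oppr_gt0|exact: as_smooth H j jn].
have E_inj e e' : (e < n.*2)%N -> (e' < n.*2)%N -> E e = E e' -> e = e'.
  have n1 : (- 1 : R) <> 1 by move=> h; have : (- 1 : R) < 1; [lra|rewrite h ltxx].
  move=> /dec[j jn [->|->]] /dec[k kn [->|->]]; rewrite /E ?tau_odd ?tau_even => h.
  - by have [->] := as_inj H jn kn nm11 nm11 h.
  - by have [_ /n1] := as_inj H jn kn nm11 n11 h.
  - by have [_ /esym/n1] := as_inj H jn kn n11 nm11 h.
  - by have [->] := as_inj H jn kn n11 n11 h.
have EE e e' : (e < n.*2)%N -> (e' < n.*2)%N -> e' != e -> 0 < dot (E e) (E e - E e').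
  move=> en en' ee; have : 0 < sqnorm (E e - E e').
    by apply: sqnorm_gt0; rewrite subr_eq0; apply: contra ee => /eqP/(E_inj _ _ en en') ->.
  rewrite -dot_self !dotBr !dotBl !dot_self !E1// (dotC (E e')); lra.
(* Strict conditions at the endpoint, hence valid a little beyond. The value 3/2 lies between the
   heights of [E e] and [2 *: E e]. *)
pose P (e : 'I_(n.*2)) (s : R) := [/\ 0 < dot ('D_1 (tau e) s) (E e), dot (tau e s) (E e) < 3 / 2
  & forall e' : 'I_(n.*2), e' != e -> 0 < dot (tau e s) (E e - E e')].
have nearpos (f : R -> R) : Cinf setT f -> 0 < f 1 -> \forall s \near (1 : R), 0 < f s.
  by move=> Cf f1; apply: open_nbhs_nbhs; split; [apply: open_pos; exact: Cinf_continuous|].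
have nP0 e : \forall s \near (1 : R), P e s.
  near=> s; split.
  - near: s; apply: nearpos; last by apply: dtau; exact: ltn_ord.
    apply: Ci_dot; last exact: CicstT.
    by move=> k; apply: Ck_derive; exact: Ctau (ltn_ord e) k.+1.
  - rewrite -subr_gt0; near: s; apply: nearpos; last first.
      by rewrite dot_self E1//; lra.
    by apply: CiBT; [exact: CicstT|apply: Ci_dot; [exact: Ctau (ltn_ord e)|exact: CicstT]].
  - near: s; apply: filter_forall => e'.
    have [->|ee] := eqVneq e' e; first by apply: nearW.
    have : \forall s \near (1 : R), 0 < dot (tau e s) (E e - E e').
      apply: nearpos; last by apply: EE; rewrite ?ltn_ord.
      by apply: Ci_dot; [exact: Ctau (ltn_ord e)|exact: CicstT].
    by apply: filterS.
have nP : \forall s \near (1 : R), forall e, P e s.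
  by near=> s; near: s; apply: filter_forall => e; exact: nP0.
have /nbhs_normP[d /= d0 Hd] := nP.
pose delta := d / 2; have delta0 : 0 < delta by rewrite divr_gt0.
have HP e s (en : (e < n.*2)%N) : 1 <= s <= 1 + delta -> P (Ordinal en) s.
  move=> /andP[s1 s2]; apply: Hd => /=; rewrite distrC ger0_norm ?subr_ge0//; move: s2; rewrite /delta; lra.
(* Finitely many functions to be positive at [D e]: [None] is the height condition, [Some e']
   separation from the end [e'], and 1 fills the entry [e' = e]. *)
pose gp (e : nat) (o : option 'I_(n.*2)) (x : 'rV[R]_3) : R := if o is Some e' then
  (if e' == e :> nat then 1 else dot x (E e - E e')) else dot x (E e) - 3 / 2.
have Cgp e o : continuous (gp e o).
  apply: Cinf_continuous; rewrite /gp; case: o => [e'|].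
    case: (nat_of_ord e' == e); first exact: CicstT.
    by apply: Ci_dot; [exact: CiidT|exact: CicstT].
  by apply: CiBT; [apply: Ci_dot; [exact: CiidT|exact: CicstT]|exact: CicstT].
pose Op e : set 'rV[R]_3 := [set x | (e < n.*2)%N -> forall o, 0 < gp e o x].
have oOp e : open (Op e).
  rewrite /Op; case: (e < n.*2)%N.
    rewrite (_ : [set x | _] = [set x | forall o, 0 < gp e o x]); first exact: open_forall_pos.
    by apply/seteqP; split=> [x h|x h _] //; exact: h.
  by rewrite (_ : [set x | _] = setT); [exact: openT|apply/seteqP; split].
have OpE e : Op e (2 *: E e).
  move=> en [e'|]; rewrite /gp; last by rewrite dotZl dot_self E1//; lra.
  by case: eqP => // /eqP ee; rewrite dotZl mulr_gt0// EE.
have [D [D1 D2 D3 D4]] := general_position n.*2 oOp OpE.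
pose tl e := tail (tau e) (D e) delta.
have De e (en : (e < n.*2)%N) : 3 / 2 < dot (D e) (E e) /\ forall e', (e' < n.*2)%N -> e' != e -> 0 < dot (D e) (E e - E e').
  have h := D1 e en en; split=> [|e' en' ee]; first by have := h None; rewrite /gp subr_gt0.
  by have := h (Some (Ordinal en')); rewrite /gp /= (negbTE ee).
have h1 e s : (e < n.*2)%N -> 1 <= s <= 1 + delta -> 0 < dot ('D_1 (tau e) s) (E e).
  by move=> en sI; have [] := HP e s en sI.
have h2 e s : (e < n.*2)%N -> 1 <= s <= 1 + delta -> dot (tau e s) (E e) < dot (D e) (E e).
  by move=> en sI; have [_ h _] := HP e s en sI; apply: lt_trans h (De e en).1.
have tl_sep e e' s : (e < n.*2)%N -> (e' < n.*2)%N -> e' != e -> 1 <= s -> 0 < dot (tl e s) (E e - E e').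
  move=> en en' ee; apply: tail_pos => //; last exact: (De e en).2.
  by move=> r rI; have [_ _ h] := HP e r en rI; exact: (h (Ordinal en')).
have tl_inj e e' s s' : (e < n.*2)%N -> (e' < n.*2)%N -> 1 < s -> 1 < s' -> tl e s = tl e' s' -> e = e' /\ s = s'.
  move=> en en' s1 s1' Et; have [ee|ee] := eqVneq e e'; last first.
    have := tl_sep e' e s' en' en ee (ltW s1').
    have := tl_sep e e' s en en'; rewrite eq_sym ee ltW// => /(_ isT isT).
    by rewrite Et -(opprB (E e)) dotNr => a b'; have := addr_gt0 a b'; rewrite subrr ltxx.
  split=> //; subst e'; have mono := @tail_mono R (tau e) (D e) delta (Ctau e en) delta0 (E1 e en) (fun r => h1 e r en) (fun r => h2 e r en).
  have [ss|ss|//] := ltgtP s s'.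
    by have := mono s s' (ltW s1) ss; rewrite -/(tl e) Et ltxx.
  by have := mono s' s (ltW s1') ss; rewrite -/(tl e) Et ltxx.
have tl_out e s : (e < n.*2)%N -> 1 < s -> 1 < sqnorm (tl e s).
  by move=> en; apply: tail_out => //; [exact: Ctau|exact: E1|move=> r; exact: h1|move=> r; exact: h2].
have tl_D e s : (e < n.*2)%N -> 1 <= s -> 'D_1 (tl e) s != 0.
  by move=> en; apply: tail_derive_neq0 => //; [exact: Ctau|exact: E1|move=> r; exact: h1|move=> r; exact: h2].
have Ctl e : (e < n.*2)%N -> Cinf setT (tl e) by move=> en; exact: Ci_tail (Ctau e en).
have evn j : (j < n)%N -> (j.*2 < n.*2)%N by rewrite ltn_double.
have odn j : (j < n)%N -> (j.*2.+1 < n.*2)%N by rewrite ltn_Sdouble.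
(* Both tails extend the same arc and agree with it on [-1, 1], so the case split at 0 is harmless
   for smoothness. *)
pose ls j s := if s <= 0 then tl j.*2 (- s) else tl j.*2.+1 s.
have tlL j s : s <= 1 -> tl j.*2.+1 s = t j s by move=> s1; rewrite /tl tail_le1// tau_odd.
have tlR j s : - 1 <= s -> tl j.*2 (- s) = t j s by move=> s1; rewrite /tl tail_le1 ?tau_even ?opprK// lerNl.
have lsR j s : - 1 <= s -> ls j s = tl j.*2.+1 s.
  by move=> s1; rewrite /ls; case: leP => s0 //; rewrite tlR// tlL//; lra.
have lsL j s : s <= 1 -> ls j s = tl j.*2 (- s).
  by move=> s1; rewrite /ls; case: leP => s0 //; rewrite tlR ?tlL//; lra.
have core j s : `|s| <= 1 -> ls j s = t j s.
  by rewrite ler_norml => /andP[s1 s2]; rewrite lsR// tlL.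
have cls j s : [\/ `|s| <= 1, 1 < s /\ ls j s = tl j.*2.+1 s | 1 < - s /\ ls j s = tl j.*2 (- s)].
  have [s1|s1] := ltP 1 s; first by apply: Or32; rewrite lsR//; lra.
  have [s2|s2] := ltP 1 (- s); first by apply: Or33; rewrite lsL.
  by apply: Or31; rewrite ler_norml s1 andbT lerNl.
have ls_inj j k s s' : (j < n)%N -> (k < n)%N -> ls j s = ls k s' -> j = k /\ s = s'.
  move=> jn kn; case: (cls j s) => [s1|[s1 ->]|[s1 ->]]; case: (cls k s') => [s1'|[s1' ->]|[s1' ->]]; rewrite ?(core j s) ?(core k s')// => h.
  - exact: (as_inj H jn kn s1 s1' h).
  - by have := tl_out _ _ (odn k kn) s1'; rewrite -h ltNge (as_disk H jn s1).
  - by have := tl_out _ _ (evn k kn) s1'; rewrite -h ltNge (as_disk H jn s1).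
  - by have := tl_out _ _ (odn j jn) s1; rewrite h ltNge (as_disk H kn s1').
  - by move: h => /(tl_inj _ _ _ _ (odn j jn) (odn k kn) s1 s1')[[/double_inj ->] ->].
  - move: h => /(tl_inj _ _ _ _ (odn j jn) (evn k kn) s1 s1')[/(congr1 odd) + _].
    by rewrite /= !odd_double.
  - by have := tl_out _ _ (evn j jn) s1; rewrite h ltNge (as_disk H kn s1').
  - move: h => /(tl_inj _ _ _ _ (evn j jn) (odn k kn) s1 s1')[/(congr1 odd) + _].
    by rewrite /= !odd_double.
  - by move: h => /(tl_inj _ _ _ _ (evn j jn) (evn k kn) s1 s1')[/double_inj -> /oppr_inj ->].
have nR j (s : R) : - 1 < s -> \forall r \near (s : R), ls j r = tl j.*2.+1 r.
  move=> s1; near=> r; apply: lsR; apply/ltW; near: r.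
  by apply: open_nbhs_nbhs; split; [exact: open_gt|].
have nL j (s : R) : s < 1 -> \forall r \near (s : R), ls j r = tl j.*2 (- r).
  move=> s1; near=> r; apply: lsL; apply/ltW; near: r.
  by apply: open_nbhs_nbhs; split; [exact: open_lt|].
have DR j s : - 1 < s -> 'D_1 (ls j) s = 'D_1 (tl j.*2.+1) s.
  by move=> s1; apply: near_eq_derive; exact: nR.
have DL j s : (j < n)%N -> s < 1 -> 'D_1 (ls j) s = - 'D_1 (tl j.*2) (- s).
  by move=> jn s1; rewrite (near_eq_derive _ (nL j s s1)) is_derive_opp//; exact: Ctl (evn j jn).
have Dcore j s : (j < n)%N -> `|s| <= 1 -> 'D_1 (ls j) s = 'D_1 (t j) s.
  move=> jn; rewrite ler_norml => /andP[s1 s2]; have [s1'|s1'] := ltP (- 1) s.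
    by rewrite DR// /tl (tail_derive_le1 _ (Ctau _ (odn j jn)) delta0 s2) tau_odd.
  rewrite DL//; last by lra.
  have s3 : - s <= 1 by rewrite lerNl.
  rewrite /tl (tail_derive_le1 _ (Ctau _ (evn j jn)) delta0 s3).
  by rewrite tau_even is_derive_opp ?opprK//; exact: as_smooth H j jn.
have Cls j : (j < n)%N -> Cinf setT (ls j).
  move=> jn k; apply: Ck_local => s _; have [s1|s1] := ltP (- 1) s.
    exists [set r : R | -1 < r]; split=> //.
    apply: Ck_ext (Ck_sub (@subsetT _ _) (Ctl _ (odn j jn) k)) => [|r /= /ltW r1]; first exact: open_gt.
    by rewrite lsR.
  exists [set r : R | r < 1]; split; first by rewrite /=; lra.
  have C : Cinf setT (fun r : R => tl j.*2 (- r)).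
    by apply: (Cicomp1_mx (Ctl _ (evn j jn))); apply: CiNT; exact: CiidT.
  apply: Ck_ext (Ck_sub (@subsetT _ _) (C k)) => [|r /= /ltW r1]; first exact: open_lt.
  by rewrite lsL.
exists ls, D; split; last split.
- split.
  + move=> j jn; exists (1 + delta); split.
    * exact: Cls.
    * by move=> s s' /(ls_inj j j s s' jn jn)[].
    * move=> s; have [s1|s1] := leP `|s| 1; first by rewrite Dcore//; exact: as_immersion H j s jn s1.
      have [s0|s0] := leP s 0.
        rewrite ler0_norm// in s1; rewrite DL//; last by lra.
        by rewrite oppr_eq0; apply: tl_D; [exact: evn|exact: ltW].
      rewrite gtr0_norm// in s1; rewrite DR; last by lra.
      by apply: tl_D; [exact: odn|exact: ltW].
    * by lra.
    * exact: D2 (evn j jn).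
    * exact: D2 (odn j jn).
    * by move=> s sd; rewrite lsR; [rewrite /tl tail_ge|lra].
    * by move=> s sd; rewrite lsL; [rewrite /tl tail_ge// lerNr|lra].
  + move=> j k jn kn jk s s'; apply/eqP => /(ls_inj j k s s' jn kn)[h _].
    by rewrite h eqxx in jk.
  + exact: D4.
- move=> x xd; split=> [[j [s [jn sx]]]|[j [s [jn s1 sx]]]]; last by exists j, s; rewrite core.
  exists j, s; case: (cls j s) => [s1|[s1 h]|[s1 h]]; first by rewrite -core.
    by have := tl_out _ _ (odn j jn) s1; rewrite -h sx ltNge xd.
  by have := tl_out _ _ (evn j jn) s1; rewrite -h sx ltNge xd.
- move=> j s jn sd i s' i_n s1' h.
  have s1 : `|s| <= 1.
    case: (cls j s) => [//|[s1 e]|[s1 e]].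
      by have := tl_out _ _ (odn j jn) s1; rewrite -e ltNge sd.
    by have := tl_out _ _ (evn j jn) s1; rewrite -e ltNge sd.
  rewrite core// in h; have [ij ss] := as_inj H i_n jn s1' s1 h; subst i s'.
  by exists 1; rewrite // scale1r Dcore.
Unshelve. all: by end_near. Qed.

End ArcsToLines.

(** * One-sided derivatives along arcs *)

Section OneSided.
Context {R : realType}.

Lemma right_derive_cvg (W : normedModType R) (f : R -> W) : derivable f 0 1 ->
  h^-1 *: (f h - f 0) @[h --> (0 : R)^'+] --> 'D_1 f 0.
Proof.
move=> df; have : h^-1 *: ((f \o shift 0) (h *: (1 : R)) - f 0) @[h --> (0 : R)^'] --> 'D_1 f 0 by exact: df.
move=> /cvg_dnbhs_at_right; apply: cvg_trans; apply: near_eq_cvg; near=> h.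
by rewrite /= addr0 -[h *: 1]/(h * 1) mulr1.
Unshelve. all: by end_near. Qed.

(** Velocities only constrain a curve for small positive times; a two-sided derivative is already
    determined by the limit from the right. *)
Lemma right_derive_eq (W : normedModType R) (f g : R -> W) : derivable f 0 1 -> derivable g 0 1 ->
  f 0 = g 0 -> (\forall t \near (0 : R)^'+, f t = g t) -> 'D_1 f 0 = 'D_1 g 0.
Proof.
move=> df dg f0 fg.
apply: (@cvg_unique W (@norm_hausdorff R W) (h^-1 *: (f h - f 0) @[h --> (0 : R)^'+])).
  exact: right_derive_cvg.
apply: cvg_trans (right_derive_cvg dg); apply: near_eq_cvg; near=> h.
by rewrite f0; congr (_ *: (_ - _)); apply/esym; near: h.
Unshelve. all: by end_near. Qed.

Lemma right_derive_ge0 (f : R -> R) : derivable f 0 1 -> f 0 = 0 ->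
  (\forall t \near (0 : R)^'+, 0 <= f t) -> 0 <= 'D_1 f 0.
Proof.
move=> df f0 fp; have L := right_derive_cvg df.
rewrite -(cvg_lim (@norm_hausdorff R R) L); apply: limr_ge; first by apply/cvg_ex; exists ('D_1 f 0).
near=> h; rewrite f0 subr0 -[_ *: _]/(h^-1 * f h) mulr_ge0//; last by near: h.
by rewrite invr_ge0; apply/ltW; near: h; exact: nbhs_right_gt.
Unshelve. all: by end_near. Qed.

Lemma near_right_le (e : R) : 0 < e -> \forall t \near (0 : R)^'+, 0 < t /\ t <= e.
Proof.
by move=> e0; near=> t; split; near: t; [exact: nbhs_right_gt|exact: nbhs_right_le].
Unshelve. all: by end_near. Qed.

Lemma right_derive_translate n (tau : R -> 'rV[R]_n) (s e : R) : Cinf setT tau ->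
  is_derive (0 : R) (1 : R) (fun t => tau (s + e * t)) (e *: 'D_1 tau s).
Proof.
move=> Ct; have d : is_derive (0 : R) (1 : R) (fun t : R => s + e * t) e.
  by apply: is_derive_eq; rewrite /GRing.scale /=; ring.
by have := is_derive_comp1 Ct d; rewrite mulr0 addr0.
Qed.

Lemma is_derive_left_inv n (G : 'rV[R]_n -> R) (c : R -> 'rV[R]_n) : Cinf setT G -> derivable c 0 1 ->
  derivable (fun t => G (c t)) 0 1 /\ ('D_1 c 0 = 0 -> 'D_1 (fun t => G (c t)) 0 = 0).
Proof.
move=> CG dc; have dG : differentiable G (c 0) by exact: (Ck1_differentiable openT (CG 1%N) I).
have [h1 h2] := is_derive_chain dG dc; split=> // c0.
rewrite [LHS]h2 c0; have := deriveE 0 dG => ->; exact: linear0.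
Qed.

Definition arc_inv (t : R -> 'rV[R]_3) (G : 'rV[R]_3 -> R) :=
  [/\ Cinf setT t, Cinf setT G & forall s, `|s| <= 1 -> G (t s) = s].

Lemma arc_inward (s : R) : `|s| <= 1 -> exists e : R, [/\ e != 0 & forall t, 0 <= t <= 1 -> `|s + e * t| <= 1].
Proof.
rewrite ler_norml => /andP[s1 s2]; have [s0|s0] := leP s 0.
  exists 1; split; first exact: oner_neq0.
  by move=> t /andP[t0 t1]; rewrite mul1r ler_norml; apply/andP; split; lra.
exists (-1); split; first by rewrite oppr_eq0 oner_neq0.
by move=> t /andP[t0 t1]; rewrite mulN1r ler_norml; apply/andP; split; lra.
Qed.

(** Differentiating [G (t s) = s]. At the ends of [-1, 1] this identity holds on one side only, so
    the derivative is taken in an inward direction. *)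
Lemma arc_immersion t G s : arc_inv t G -> `|s| <= 1 -> 'D_1 t s != 0.
Proof.
move=> [Ct CG GK] s1; have [e [e0 He]] := arc_inward s1.
have [dc Dc] := right_derive_translate s e Ct.
have [dG DG] := is_derive_left_inv CG dc.
apply/eqP => t0; have := DG; rewrite Dc t0 scaler0 => /(_ erefl) D0.
have d2 : is_derive (0 : R) (1 : R) (fun t : R => s + e * t) e.
  by apply: is_derive_eq; rewrite /GRing.scale /=; ring.
have [d2a d2b] := d2; suff ez : e = 0 by rewrite ez eqxx in e0.
rewrite -[LHS]d2b -[RHS]D0; apply: (right_derive_eq d2a dG); first by rewrite mulr0 addr0 GK.
apply: filterS (near_right_le ltr01) => x [x0 x1]; rewrite GK//; apply: He.
by rewrite (ltW x0).
Qed.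

(** Near 0 on the right [c] equals [t (G (c r))], so the chain rule gives its velocity. *)
Lemma arc_curve t G (c : R -> 'rV[R]_3) s : arc_inv t G -> `|s| <= 1 -> derivable c 0 1 ->
  c 0 = t s -> (\forall r \near (0 : R)^'+, exists s', `|s'| <= 1 /\ c r = t s') ->
  exists sg, 'D_1 c 0 = sg *: 'D_1 t s.
Proof.
move=> [Ct CG GK] s1 dc c0 cr.
have [dG _] := is_derive_left_inv CG dc.
exists ('D_1 (fun r => G (c r)) 0).
have d1 : is_derive (0 : R) (1 : R) (fun r => G (c r)) ('D_1 (fun r => G (c r)) 0) by split.
have [d2 D2] := is_derive_comp1 Ct d1.
rewrite (right_derive_eq dc d2) ?D2 ?c0 ?GK//.
by apply: filterS cr => r [s' [s1' ->]]; rewrite GK.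
Qed.

End OneSided.

(** * Velocities of curves on round spheres *)

Section Velocities.
Context {R : realType}.

Lemma smoothT_Cinf (V W : normedModType R) (c : V -> W) : smooth setT c -> Cinf setT c.
Proof.
move=> sc k; apply: Ck_local => x _; have [U [g [oU Ux Cg gc]]] := sc x I.
by exists U; split=> //; apply: Ck_ext (Cg k) => // y Uy; exact: gc.
Qed.

Lemma Cinf_smooth (V W : normedModType R) (A : set V) (c : V -> W) : Cinf setT c -> smooth A c.
Proof. by move=> Cc x Ax; exists setT, c; split=> //; exact: openT. Qed.

Lemma is_derive_sqnorm n (c : R -> 'rV[R]_n) (x : R) : derivable c x 1 ->
  is_derive x (1 : R) (fun r => sqnorm (c r)) (2 * dot ('D_1 c x) (c x)).
Proof.
move=> dc; have Hj i : is_derive x (1 : R) (fun s => c s ord0 i * c s ord0 i) (2 * ('D_1 c x ord0 i * c x ord0 i)).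
  have dt : is_derive x (1 : R) (fun s => c s ord0 i) ('D_1 c x ord0 i) by apply: is_derive_coord; split.
  by apply: is_derive_eq; rewrite /GRing.scale /=; ring.
have := is_derive_sum Hj.
rewrite (_ : \sum_(i < n) _ = (fun r => sqnorm (c r))); last first.
  by apply/funext => y; rewrite fct_sumE; apply: eq_bigr => i _; rewrite expr2.
by rewrite -mulr_sumr.
Qed.

(** The squared length of the curve is 1 to the right of 0, hence also at 0, so its derivative there
    vanishes. *)
Lemma velocity_sphere d (p v : 'rV[R]_d.+1) : velocity (sphere d) p v -> dot v p = 0.
Proof.
move=> [c [/smoothT_Cinf Cc c0 cs <-]].
have dc : derivable c 0 1 by exact: Cinf_derivable.
have [d1 D1] := is_derive_sqnorm dc.
have [d2 D2] := is_derive_cst (1 : R) (0 : R) (1 : R).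
have p1 : sqnorm (c 0) = 1.
  have cont : {for 0, continuous (fun r => sqnorm (c r))}.
    by apply: differentiable_continuous; apply/derivable1_diffP.
  have L1 : sqnorm (c r) @[r --> (0 : R)^'+] --> sqnorm (c 0) by apply: cvg_at_right_filter.
  apply: (@cvg_unique R (@norm_hausdorff R R) (sqnorm (c r) @[r --> (0 : R)^'+])) => //.
  by apply: cvg_near_cst; exact: cs.
have := right_derive_eq d1 d2 p1 cs; rewrite D1 D2 c0 => /eqP.
by rewrite mulf_eq0 pnatr_eq0 /= => /eqP.
Qed.

Lemma tangent_sphere d (p v : 'rV[R]_d.+1) : tangent (sphere d) p v -> dot v p = 0.
Proof.
case=> /velocity_sphere // h; have := h; rewrite dotC dotNr dotC => /eqP.
by rewrite oppr_eq0 => /eqP.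
Qed.

Lemma velocityT d (p v : 'rV[R]_d) : velocity setT p v.
Proof.
exists (fun t => p + t *: v); split=> //.
- by apply: Cinf_smooth; apply: CiDT; [exact: CicstT|apply: CiZT; [exact: CiidT|exact: CicstT]].
- by rewrite scale0r addr0.
- exact: nearW.
- by have [_ ->] := is_derive_affine p v 0.
Qed.

Lemma near_right_cts (W : normedModType R) (c : R -> W) (O : set W) : continuous c -> open O -> O (c 0) ->
  \forall r \near (0 : R)^'+, O (c r).
Proof.
move=> cc oO O0; have L : c r @[r --> (0 : R)^'+] --> c 0 by apply: cvg_at_right_filter; exact: cc.
by apply: (L O); exact: open_nbhs_nbhs.
Qed.

End Velocities.

(** * From a tangle to extended arcs *)

Section TangleArcs.
Context {R : realType}.

Definition arc_data n (t : nat -> R -> 'rV[R]_3) (G : nat -> 'rV[R]_3 -> R) :=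
  [/\ arc_system n t, forall i, (i < n)%N -> arc_inv (t i) (G i)
    & forall i s, (i < n)%N -> `|s| <= 1 -> sqnorm (t i s) = 1 -> s = 1 \/ s = - 1].

(** The other arcs are compact and miss [c 0], so for small times the curve cannot lie on them. *)
Lemma arc_union_curve n t (c : R -> 'rV[R]_3) i s : 
  (forall i, (i < n)%N -> Cinf setT (t i)) ->
  (forall i j s s', (i < n)%N -> (j < n)%N -> `|s| <= 1 -> `|s'| <= 1 -> t i s = t j s' -> i = j /\ s = s') ->
  continuous c -> (i < n)%N -> `|s| <= 1 -> c 0 = t i s ->
  (\forall r \near (0 : R)^'+, arc_union n t (c r)) ->
  \forall r \near (0 : R)^'+, exists s', `|s'| <= 1 /\ c r = t i s'.
Proof.
move=> Ct tinj cc i_n s1 c0 cr.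
have cI : compact [set s : R | `|s| <= 1].
  rewrite (_ : [set s : R | _] = `[(- 1), 1]%classic); first exact: segment_compact.
  by apply/seteqP; split => r /=; rewrite in_itv/= ler_norml.
have other (j : 'I_n) : \forall r \near (0 : R)^'+, j != i :> nat -> forall s', `|s'| <= 1 -> c r <> t j s'.
  have [ji|ji] := eqVneq (j : nat) i; first by apply: nearW.
  pose K := t j @` [set s : R | `|s| <= 1].
  have cK : closed K.
    apply: compact_closed; first exact: norm_hausdorff.
    apply: continuous_compact => //; apply: continuous_subspaceT.
    by apply: Cinf_continuous; exact: Ct (ltn_ord j).
  have oK : open (~` K) by exact: closed_openC.
  have : \forall r \near (0 : R)^'+, (~` K) (c r).
    apply: near_right_cts => // -[s' s1' e].
    have [ij _] := tinj j i s' s (ltn_ord j) i_n s1' s1 (etrans e c0).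
    by rewrite ij eqxx in ji.
  by apply: filterS => r nK _ s' s1' e; apply: nK; exists s'.
have all : \forall r \near (0 : R)^'+, forall j : 'I_n, j != i :> nat -> forall s', `|s'| <= 1 -> c r <> t j s'.
  by near=> r; near: r; apply: filter_forall => j; exact: other.
near=> r; have [j [s' [jn s1' e]]] : arc_union n t (c r) by near: r.
have : forall j : 'I_n, j != i :> nat -> forall s', `|s'| <= 1 -> c r <> t j s' by near: r.
move=> /(_ (Ordinal jn)) /=; have [<- _|ji /(_ isT s' s1')] := eqVneq j i; first by exists s'.
by rewrite e.
Unshelve. all: by end_near. Qed.

(** The arcs and their inverses are extended smoothly from compact sets and reparametrized by
    [-1, 1]. The work is at the ends, where transversality to the boundary sphere has to yield
    outward velocities. *)
Lemma tangle_arcs n (T : set 'rV[R]_3) : is_tangle n T ->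
  exists t G, arc_data n t G /\ arc_union n t = T.
Proof.
move=> [t0 [emb dis TE Td [ends trans]]].
have cI : compact (unit_interval : set R) by exact: segment_compact.
have ext (i : 'I_n) : exists tG : (R -> 'rV[R]_3) * ('rV[R]_3 -> R),
    [/\ Cinf setT tG.1, Cinf setT tG.2, forall s, unit_interval s -> tG.1 s = t0 i s
      & forall s, unit_interval s -> tG.2 (t0 i s) = s].
  have [st [g [sg gK]]] := emb i.
  have [f [Cf fE]] := smooth_extension_rV (@has_bumps_R R) cI st.
  have cA : compact (t0 i @` unit_interval).
    rewrite (_ : t0 i @` _ = f @` unit_interval); last first.
      by apply/seteqP; split=> _ [s sI <-]; exists s => //; rewrite fE.
    by apply: continuous_compact => //; apply: continuous_subspaceT; exact: Cinf_continuous.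
  have [h [Ch hE]] := @smooth_extension R _ _ g (@has_bumps_rV R 3) cA sg.
  exists (f, h); split=> //= s sI; rewrite hE ?gK//; by exists s.
have [tG HtG] := choice ext.
pose hf (s : R) := (s + 1) / 2.
have hfI s : `|s| <= 1 -> unit_interval (hf s).
  by rewrite ler_norml /unit_interval /= in_itv/= /hf => /andP[s1 s2]; apply/andP; split; lra.
have hfI' r : unit_interval r -> `|2 * r - 1| <= 1 /\ hf (2 * r - 1) = r.
  rewrite /unit_interval /= in_itv/= => /andP[r0 r1]; split; last by rewrite /hf; lra.
  by rewrite ler_norml; apply/andP; split; lra.
have hf_inj s s' : hf s = hf s' -> s = s' by rewrite /hf; lra.
pose t (i : nat) (s : R) : 'rV[R]_3 := if insub i is Some o then (tG (o : 'I_n)).1 (hf s) else 0.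
pose G (i : nat) (x : 'rV[R]_3) : R := if insub i is Some o then 2 * (tG (o : 'I_n)).2 x - 1 else 0.
have tE (i : nat) (i_n : (i < n)%N) s : t i s = (tG (Ordinal i_n)).1 (hf s) by rewrite /t insubT.
have GE (i : nat) (i_n : (i < n)%N) x : G i x = 2 * (tG (Ordinal i_n)).2 x - 1 by rewrite /G insubT.
have t0E i (i_n : (i < n)%N) s : `|s| <= 1 -> t i s = t0 (Ordinal i_n) (hf s).
  by move=> s1; have [_ _ h _] := HtG (Ordinal i_n); rewrite tE h//; exact: hfI.
have Chf : Cinf setT hf.
  by apply: CiMT; [apply: CiDT; [exact: CiidT|exact: CicstT]|exact: CicstT].
have Ct i : (i < n)%N -> Cinf setT (t i).
  move=> i_n; rewrite (_ : t i = (fun s => (tG (Ordinal i_n)).1 (hf s))); last by apply/funext => s; rewrite tE.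
  by have [h _ _ _] := HtG (Ordinal i_n); exact: (Cicomp1_mx h Chf).
have inv i : (i < n)%N -> arc_inv (t i) (G i).
  move=> i_n; have [h1 h2 h3 h4] := HtG (Ordinal i_n); split; first exact: Ct.
    rewrite (_ : G i = (fun x => 2 * (tG (Ordinal i_n)).2 x - 1)); last by apply/funext => s; rewrite GE.
    by apply: CiBT; [apply: CiMT => //|]; exact: CicstT.
  move=> s s1; rewrite GE tE h3; last exact: hfI.
  by rewrite h4; [rewrite /hf; lra|exact: hfI].
have tinj i j s s' : (i < n)%N -> (j < n)%N -> `|s| <= 1 -> `|s'| <= 1 -> t i s = t j s' -> i = j /\ s = s'.
  move=> i_n jn s1 s1' E; have ij : i = j.
    have := dis (Ordinal i_n) (Ordinal jn) I I.
    move=> h; have : Ordinal i_n = Ordinal jn.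
      apply: h; exists (t i s); split; [exists (hf s)|exists (hf s')]; try exact: hfI.
        by rewrite -t0E.
      by rewrite -t0E// E.
    by case.
  split=> //; subst j; have [_ _ GK] := inv i i_n; by rewrite -(GK s s1) E GK.
have TU : arc_union n t = T.
  rewrite TE; apply/seteqP; split=> x.
    by move=> [i [s [i_n s1 <-]]]; exists (Ordinal i_n) => //; exists (hf s); [exact: hfI|rewrite -t0E].
  move=> [i _ [r rI <-]]; have [h1 h2] := hfI' r rI.
  exists i, (2 * r - 1); split=> //; rewrite (t0E i (ltn_ord i))// h2; congr (t0 _ _); exact: val_inj.
have sph i s : (i < n)%N -> `|s| <= 1 -> sqnorm (t i s) = 1 <-> (s = 1 \/ s = -1).
  move=> i_n s1; rewrite (t0E i i_n s s1); have := ends (Ordinal i_n) _ (hfI s s1); rewrite /sphere /= => ->.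
  by rewrite /hf; split=> -[h|h]; [right|left|right|left]; lra.
have n1 : `|1 : R| <= 1 by rewrite normr1.
have nm1 : `|-1 : R| <= 1 by rewrite normrN normr1.
have dsk i s : (i < n)%N -> `|s| <= 1 -> sqnorm (t i s) <= 1.
  by move=> i_n s1; apply: Td; rewrite -TU; exists i, s.
(* The radial velocity is nonzero by transversality, and outward because the arc stays in the
   ball. *)
have out i sg : (i < n)%N -> (sg = 1 \/ sg = -1) -> 0 < sg * dot ('D_1 (t i) sg) (t i sg).
  move=> i_n sgE; have sg1 : `|sg| <= 1 by case: sgE => ->.
  have p1 : sqnorm (t i sg) = 1 by apply/sph.
  have Tp : T (t i sg) by rewrite -TU; exists i, sg.
  have velT v : velocity T (t i sg) v -> exists k, v = k *: 'D_1 (t i) sg.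
    move=> [c [/smoothT_Cinf Cc c0 cT <-]]; apply: (arc_curve (inv i i_n) sg1 _ c0).
      exact: Cinf_derivable.
    by apply: (arc_union_curve Ct tinj (Cinf_continuous Cc) i_n sg1 c0); rewrite TU.
  have tanT v : tangent T (t i sg) v -> exists k, v = k *: 'D_1 (t i) sg.
    case=> /velT[k vk]; first by exists k.
    by exists (- k); rewrite scaleNr -vk opprK.
  have nz : dot ('D_1 (t i) sg) (t i sg) != 0.
    (* Transversality is applied to the radius vector itself: its component tangent to the sphere
       does not contribute to the product with the radius, so the component along the arc must. *)
    have [u [v [/tanT[k ->] /tangent_sphere vp pE]]] := trans _ Tp p1 _ (or_introl (velocityT (t i sg) (t i sg))).
    apply/eqP => dz; have := dot_self (t i sg); rewrite p1 {1}pE dotDl dotZl dz vp mulr0 addr0.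
    by move/esym/eqP; rewrite oner_eq0.
  have [dc Dc] := right_derive_translate sg (- sg) (Ct i i_n).
  have [ds Ds] := is_derive_sqnorm dc.
  have df : is_derive (0 : R) (1 : R) (fun r => 1 - sqnorm (t i (sg + - sg * r))) (2 * (sg * dot ('D_1 (t i) sg) (t i sg))).
    have ds' : is_derive (0 : R) (1 : R) (fun r => sqnorm (t i (sg + - sg * r))) (- (2 * (sg * dot ('D_1 (t i) sg) (t i sg)))).
      by split=> //; rewrite Ds Dc mulr0 addr0 dotZl; ring.
    by apply: is_derive_eq; ring.
  have [df1 df2] := df.
  have : 0 <= 2 * (sg * dot ('D_1 (t i) sg) (t i sg)).
    rewrite -df2; apply: right_derive_ge0 => //; first by rewrite mulr0 addr0 p1 subrr.
    apply: filterS (near_right_le ltr01) => r [r0 r1]; rewrite subr_ge0; apply: dsk => //.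
    rewrite (_ : sg + - sg * r = sg * (1 - r)); last by ring.
    by rewrite normrM; apply: mulr_ile1 => //; rewrite ler_norml; apply/andP; split; lra.
  rewrite pmulr_rge0// le_eqVlt => /orP[/eqP/esym/eqP|//]; rewrite mulf_eq0 (negbTE nz) orbF => /eqP sz.
  by case: sgE => sgE; move: sz; rewrite sgE; lra.
exists t, G; split=> //; split=> //; last by move=> i s i_n s1 /(sph i s i_n s1).
split=> //.
- by move=> i s i_n; exact: arc_immersion (inv i i_n).
- by move=> i i_n; split; apply/sph => //; [left|right].
- move=> i i_n; have h1 := out i 1 i_n (or_introl erefl); have h2 := out i (-1) i_n (or_intror erefl).
  by rewrite mul1r in h1; rewrite mulN1r oppr_gt0 in h2.
Qed.

End TangleArcs.

(** * The double of a tangle is a link *)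

Section Double.
Context {R : realType}.

Definition pt4 (y : R) (x : 'rV[R]_3) : 'rV[R]_(1 + 3) := row_mx y%:M x.

Lemma pt4_eta (z : 'rV[R]_(1 + 3)) : z = pt4 (z ord0 (lshift 3 ord0)) (rsubmx z).
Proof.
rewrite /pt4 -[LHS]hsubmxK; congr row_mx; apply/rowP => j.
by rewrite !mxE (ord1 j) eqxx mulr1n.
Qed.

Lemma pt4_hd y x : pt4 y x ord0 (lshift 3 ord0) = y.
Proof. by rewrite /pt4 row_mxEl mxE eqxx mulr1n. Qed.

Lemma dot_pt4 y x y' x' : dot (pt4 y x) (pt4 y' x') = y * y' + dot x x'.
Proof.
have -> : dot (pt4 y x) (pt4 y' x') = \sum_(i < 1 + 3) pt4 y x ord0 i * pt4 y' x' ord0 i by [].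
rewrite big_split_ord /= big_ord1 !pt4_hd; congr (_ + _).
by apply: eq_bigr => i _; rewrite /pt4 !row_mxEr.
Qed.

Lemma sqnorm_pt4 y x : sqnorm (pt4 y x) = y ^+ 2 + sqnorm x.
Proof. by rewrite -!dot_self dot_pt4 expr2. Qed.

(** Both signs of the square root together are the equation y^2 = 1 - |x|^2. *)
Lemma tangle_doubleP (T : set 'rV[R]_3) (z : 'rV[R]_(1 + 3)) : T `<=` disk 3 ->
  tangle_double T z <-> T (rsubmx z) /\ sqnorm z = 1.
Proof.
move=> Td; have hE e x : hemisphere e x = pt4 (e * Num.sqrt (1 - sqnorm x)) x by [].
have sq x : T x -> Num.sqrt (1 - sqnorm x) ^+ 2 = 1 - sqnorm x.
  by move=> /Td xd; rewrite sqr_sqrtr// subr_ge0.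
rewrite /tangle_double; split.
  case=> -[x Tx <-]; rewrite hE row_mxKr sqnorm_pt4 ?mul1r ?mulN1r ?sqrrN sq//; split=> //; ring.
rewrite {2 3}(pt4_eta z) sqnorm_pt4; set y := z _ _; set x := rsubmx z => -[Tx yx].
have y2 : y ^+ 2 = 1 - sqnorm x by lra.
have ys : Num.sqrt (1 - sqnorm x) = `|y| by rewrite -y2 sqrtr_sqr.
have [y0|y0] := leP 0 y; [left|right]; exists x => //; rewrite hE ys.
  by rewrite mul1r ger0_norm// -pt4_eta.
by rewrite ltr0_norm// mulN1r opprK -pt4_eta.
Qed.

Lemma Ci_pt4 (V : normedModType R) (f : V -> R) (g : V -> 'rV[R]_3) k (U : set V) : open U ->
  Ck k U f -> Ck k U g -> Ck k U (fun x => pt4 (f x) (g x)).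
Proof. by move=> oU Cf Cg; apply: Ck_row_mx => //; exact: Ck_scalar_mx. Qed.

(* The height of the double over the arc is a smooth multiple of the height of
   the circle over [-1, 1]; transversality makes the factor nonzero at the ends. *)
Lemma arc_height n t G i : @arc_data R n t G -> (i < n)%N ->
  exists h : R -> R, [/\ Cinf setT h, forall s, 1 - sqnorm (t i s) = (1 - s ^+ 2) * h s
    & forall s, `|s| <= 1 -> 0 < h s].
Proof.
move=> [AS AI Aint] i_n; have Ct := as_smooth AS i_n; have [e1 em1] := as_end AS i_n.
pose rho s := 1 - sqnorm (t i s).
have Crho : Cinf setT rho.
  by apply: CiBT; [exact: CicstT|move=> k; apply: Ck_sqnorm; [exact: openT|exact: Ct]].
have sh (c : R) : Cinf setT (fun s : R => s + c) by apply: CiDT; [exact: CiidT|exact: CicstT].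
(* The zeros at 1 and at -1 are divided out in turn. *)
have [|k [Ck1 kE]] := @hadamard1 R (fun x => rho (x + 1)) (Cicomp1 Crho (sh 1)).
  by rewrite /rho add0r e1 subrr.
have k0 : k (- 1 - 1) = 0.
  have := kE (- 1 - 1); rewrite subrK /rho em1 subrr => /esym/eqP; rewrite mulf_eq0 => /orP[/eqP|/eqP//]; lra.
have [|m [Cm mE]] := @hadamard1 R (fun x => k (x + (- 1 - 1))) (Cicomp1 Ck1 (sh _)).
  by rewrite add0r k0.
have Ch : Cinf setT (fun s : R => - m (s + 1)) by apply: CiNT; exact: (Cicomp1 Cm (sh 1)).
have hE (s : R) : rho s = (1 - s ^+ 2) * (fun s : R => - m (s + 1)) s.
  have := kE (s - 1); rewrite subrK => ->; have := mE (s + 1).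
  rewrite (_ : s + 1 + (-1 - 1) = s - 1); last by ring.
  by move=> ->; ring.
pose h (s : R) : R := - m (s + 1); rewrite -/h in Ch *.
have {}hE s : rho s = (1 - s ^+ 2) * h s by exact: hE.
clearbody h.
exists h; split=> //.
have Drho (s : R) : 'D_1 rho s = - (2 * dot ('D_1 (t i) s) (t i s)).
  have dts : derivable (t i) s 1 by exact: Cinf_derivable.
  have [d1 D1] := is_derive_sqnorm dts.
  have d : is_derive s (1 : R) (fun s => sqnorm (t i s)) (2 * dot ('D_1 (t i) s) (t i s)) by split.
  have [_ ->] : is_derive s (1 : R) rho (- (2 * dot ('D_1 (t i) s) (t i s))) by apply: is_derive_eq; ring.
  by [].
have Drho' (s : R) : 1 - s ^+ 2 = 0 -> 'D_1 rho s = - (2 * s) * h s.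
  move=> s2; have dh : is_derive s (1 : R) h ('D_1 h s) by split=> //; exact: Cinf_derivable.
  rewrite (_ : rho = (fun s => (1 - s * s) * h s)); last by apply/funext => x; rewrite hE expr2.
  have [_ ->] : is_derive s (1 : R) (fun s => (1 - s * s) * h s) ((1 - s ^+ 2) * 'D_1 h s + - (2 * s) * h s).
    by apply: is_derive_eq; rewrite /GRing.scale /=; ring.
  by rewrite s2 mul0r add0r.
have n2 : (2 : R) != 0 by rewrite pnatr_eq0.
have [out1 outm1] := as_out AS i_n.
move=> s s1; have [s2|s2] := eqVneq (sqnorm (t i s)) 1.
  have [->|->] := Aint i s i_n s1 s2.
    have := Drho' 1; rewrite Drho expr1n subrr mulr1 mulNr => /(_ erefl)/oppr_inj/(mulfI n2) <-.
    exact: out1.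
  have := Drho' (- 1); rewrite Drho sqrrN expr1n subrr mulrN1 opprK -mulrN => /(_ erefl)/(mulfI n2) <-.
  by rewrite oppr_gt0; exact: outm1.
have r0 : 0 < rho s.
  by rewrite /rho subr_gt0 lt_neqAle s2 (as_disk AS i_n s1).
have ss : 0 <= 1 - s ^+ 2.
  by rewrite subr_ge0 -real_normK ?num_real// expr_le1.
by move: r0; rewrite hE; move: ss; rewrite le_eqVlt => /orP[/eqP <-|ss]; rewrite ?mul0r ?ltxx// pmulr_rgt0.
Qed.

(** Where 1 - |t s|^2 = (1 - s^2) h(s), a point (s, y) of the unit circle goes over the point [t s]
    with height [y * Num.sqrt (h s)], smooth at the ends as well. *)
Definition arc_circle (t : R -> 'rV[R]_3) (h : R -> R) (u : 'rV[R]_2) : 'rV[R]_(1 + 3) :=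
  pt4 (u ord0 1 * Num.sqrt (h (u ord0 0))) (t (u ord0 0)).

Lemma sphere1P (u : 'rV[R]_2) : sphere 1 u <-> u ord0 0 ^+ 2 + u ord0 1 ^+ 2 = 1.
Proof.
rewrite /sphere /= /sqnorm !big_ord_recl big_ord0 addr0.
by rewrite (_ : lift ord0 ord0 = 1)//; exact: val_inj.
Qed.

Lemma sphere1_le (u : 'rV[R]_2) : sphere 1 u -> `|u ord0 0| <= 1.
Proof.
move=> /sphere1P u1; have : `|u ord0 0| ^+ 2 <= 1.
  by rewrite real_normK ?num_real//; have := sqr_ge0 (u ord0 1); lra.
by rewrite expr_le1.
Qed.

Lemma arc_circle_embedding (t : R -> 'rV[R]_3) G (h : R -> R) : arc_inv t G -> Cinf setT h -> (forall s, `|s| <= 1 -> 0 < h s) ->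
  embedding (sphere 1) (arc_circle t h : 'rV[R]_2 -> 'rV[R]_4).
Proof.
move=> [Ct CG GK] Ch h0.
have C0 (i : 'I_2) : Cinf setT (fun u : 'rV[R]_2 => u ord0 i) by apply: Cicoord; exact: CiidT.
have Ch0 : Cinf setT (fun u : 'rV[R]_2 => h (u ord0 0)) by exact: (Cicomp1 Ch (C0 0)).
have oU : open [set u : 'rV[R]_2 | 0 < h (u ord0 0)] by apply: open_pos; exact: Cinf_continuous.
have sub (V W : normedModType R) (U : set V) (f : V -> W) k : Cinf setT f -> Ck k U f.
  by move=> Cf; exact: Ck_sub (@subsetT _ _) (Cf k).
split.
  move=> u /sphere1_le u1; exists [set u : 'rV[R]_2 | 0 < h (u ord0 0)], (arc_circle t h); split=> //.
    exact: h0.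
  move=> k; apply: Ci_pt4 => //; last by apply: sub; exact: (Cicomp1_mx Ct (C0 0)).
  by apply: CkM => //; [exact: sub (C0 1)|apply: Ck_sqrt => //; exact: sub].
have CGr : Cinf setT (fun z : 'rV[R]_(1 + 3) => G (rsubmx z)) by exact: (Cicomp CG (@Cirsub R 3)).
have Chd : Cinf setT (fun z : 'rV[R]_(1 + 3) => z ord0 (lshift 3 ord0)) by apply: Cicoord; exact: CiidT.
have ChG : Cinf setT (fun z : 'rV[R]_(1 + 3) => h (G (rsubmx z))) by exact: (Cicomp1 Ch CGr).
pose g (z : 'rV[R]_(1 + 3)) := pt2 (G (rsubmx z)) (z ord0 (lshift 3 ord0) / Num.sqrt (h (G (rsubmx z)))).
exists g; split; last first.
  move=> u us; have u1 := sphere1_le us; rewrite /g /arc_circle row_mxKr GK// pt4_hd mulfK -?pt2E//.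
  by rewrite gt_eqF// sqrtr_gt0 h0.
move=> _ [u us <-]; have u1 := sphere1_le us.
exists [set z : 'rV[R]_(1 + 3) | 0 < h (G (rsubmx z))], g; split; last by [].
- by apply: open_pos; exact: Cinf_continuous.
- by rewrite /= /arc_circle row_mxKr GK// h0.
have oV : open [set z : 'rV[R]_(1 + 3) | 0 < h (G (rsubmx z))] by apply: open_pos; exact: Cinf_continuous.
move=> k; apply: Ck_pt2 => //; first exact: sub.
apply: CkM => //; first exact: sub.
apply: CkV => //; first by move=> z hz; rewrite gt_eqF// sqrtr_gt0.
by apply: Ck_sqrt => //; exact: sub.
Qed.

Lemma arc_circleP n t G i (h : R -> R) z : @arc_data R n t G -> (i < n)%N ->
  (forall s, 1 - sqnorm (t i s) = (1 - s ^+ 2) * h s) -> (forall s, `|s| <= 1 -> 0 < h s) ->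
  (exists2 u, sphere 1 u & arc_circle (t i) h u = z) <->
  (exists2 s, `|s| <= 1 & t i s = rsubmx z) /\ sqnorm z = 1.
Proof.
move=> [AS AI Aint] i_n hE h0; split=> [[u us <-]|[[s s1 ts] z1]].
  have u1 := sphere1_le us; rewrite /arc_circle row_mxKr sqnorm_pt4; split; first by exists (u ord0 0).
  rewrite exprMn sqr_sqrtr; last by rewrite ltW// h0.
  have := hE (u ord0 0); move/sphere1P: us => us.
  have -> : 1 - u ord0 0 ^+ 2 = u ord0 1 ^+ 2 by lra.
  lra.
have hs := h0 s s1; have q0 : 0 < Num.sqrt (h s) by rewrite sqrtr_gt0.
pose y := z ord0 (lshift 3 ord0).
exists (pt2 s (y / Num.sqrt (h s))).
  apply/sphere1P; rewrite pt2_0 pt2_1 exprMn exprVn sqr_sqrtr ?ltW//.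
  have := hE s; move: z1; rewrite (pt4_eta z) sqnorm_pt4 -/y -ts => z1.
  have -> : 1 - sqnorm (t i s) = y ^+ 2 by lra.
  by move=> ->; rewrite mulfK ?gt_eqF// addrC subrK.
by rewrite /arc_circle pt2_0 pt2_1 divfK ?gt_eqF// ts -pt4_eta.
Qed.

Lemma double_is_link n t G : @arc_data R n t G -> is_link n (tangle_double (arc_union n t)).
Proof.
move=> D; have [AS AI Aint] := D.
have Td : arc_union n t `<=` disk 3 by move=> x [i [s [i_n s1 <-]]]; exact: (as_disk AS i_n s1).
have [h Hh] := choice (fun i : 'I_n => arc_height D (ltn_ord i)).
have P i z := arc_circleP z D (ltn_ord i) (let: And3 _ b _ := Hh i in b) (let: And3 _ _ c := Hh i in c).
exists (fun i : 'I_n => arc_circle (t i) (h i)); split.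
- by move=> i; have [h1 h2 h3] := Hh i; exact: (arc_circle_embedding (AI i (ltn_ord i)) h1 h3).
- move=> i j _ _ [z [/P[[s s1 ts] _] /P[[s' s1' ts'] _]]].
  by apply: val_inj; have [] := as_inj AS (ltn_ord i) (ltn_ord j) s1 s1' (etrans ts (esym ts')).
- apply/seteqP; split=> z.
    move=> /(tangle_doubleP z Td)[[i [s [i_n s1 ts]]] z1]; exists (Ordinal i_n) => //.
    by apply/P; split=> //; exists s.
  move=> [i _ /P[[s s1 ts] z1]]; apply/tangle_doubleP => //; split=> //.
  by exists i, s.
- by move=> z /(tangle_doubleP z Td)[_ z1].
Qed.

End Double.

(** * Tangents and orientations of the double *)

Section DoubleOrientation.
Context {R : realType}.

(** Differentiating y^2 + |t s|^2 = 1 along the circle gives y y' + <t', t> s' = 0, solved by s' = y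
    and y' = - <t', t>. *)
Definition double_dir (t : R -> 'rV[R]_3) (y s : R) : 'rV[R]_(1 + 3) :=
  pt4 (- dot ('D_1 t s) (t s)) (y *: 'D_1 t s).

Lemma within_comp (T V W : topologicalType) (A : set V) (f : V -> W) (z : T -> V) x0 :
  {within A, continuous f} -> {for x0, continuous z} -> A (z x0) ->
  (\forall x \near x0, A (z x)) -> {for x0, continuous (fun x => f (z x))}.
Proof.
move=> /subspace_continuousP cf cz Az0 nA B nB.
have := cf (z x0) Az0 B nB => /cz zB.
rewrite -[nbhs _ B]/(nbhs x0 [set x | B (f (z x))]).
have zB' : nbhs x0 [set x | A (z x) -> B (f (z x))] by exact: zB.
by move: nA zB'; apply: filterS2 => x Ax; apply.
Qed.

Lemma continuous_sum_dot n (T : topologicalType) (f g : 'I_n -> T -> R) x :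
  (forall j, {for x, continuous (f j)}) -> (forall j, {for x, continuous (g j)}) ->
  {for x, continuous (fun y => \sum_j f j y * g j y)}.
Proof.
move=> cf cg; have -> : (fun y => \sum_j f j y * g j y) = \sum_j (fun y => f j y * g j y).
  by apply/funext => y; rewrite fct_sumE.
apply: (big_ind (fun F : T -> R => {for x, continuous F})).
- exact: cvg_cst.
- by move=> F F' cF cF'; exact: cvgD cF cF'.
- by move=> j _; exact: cvgM (cf j) (cg j).
Qed.

Lemma is_derive_rsubmx m n (f : R -> 'rV[R]_(m + n)) (x v : R) d :
  is_derive x v f d -> is_derive x v (fun r => rsubmx (f r)) (rsubmx d).
Proof.
move=> df; apply: is_derive_rv => j; rewrite mxE; under eq_fun do rewrite mxE.
exact: is_derive_coord.
Qed.

Lemma near_open (T U : topologicalType) (f : T -> U) (O : set U) x : {for x, continuous f} -> open O ->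
  O (f x) -> \forall y \near x, O (f y).
Proof. by move=> cf oO Ofx; apply: (cf O); exact: open_nbhs_nbhs. Qed.

Lemma circle_angle (u : 'rV[R]_2) : sphere 1 u -> exists th, u = pt2 (cos th) (sin th).
Proof.
move=> us; have := sphere1_le us; rewrite ler_norml => u1; move/sphere1P: us => us.
have s2 : 1 - u ord0 0 ^+ 2 = u ord0 1 ^+ 2 by lra.
have [y0|y0] := leP 0 (u ord0 1).
  exists (acos (u ord0 0)); rewrite acosK ?in_itv// sin_acos// s2 sqrtr_sqr ger0_norm//; exact: pt2E.
exists (- acos (u ord0 0)); rewrite cosN sinN acosK ?in_itv// sin_acos// s2 sqrtr_sqr ltr0_norm// opprK; exact: pt2E.
Qed.

Lemma frame1_scale d (L : set 'rV[R]_d) (o : 'rV[R]_d -> set 'rV[R]_d) z E c :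
  orientation (k := 1) L o -> o z E -> o z (c *: E) <-> 0 < c.
Proof.
move=> [_ o2 _] oE; have := o2 z E c%:M oE.
by rewrite mul_scalar_mx det_scalar1.
Qed.

(** The projection to R^3 of a curve in the double runs on arc [i], so its velocity is
    [sg *: 'D_1 (t i) s]; orthogonality to the radius determines the first coordinate. *)
Lemma tangent_double n t G i s y v : @arc_data R n t G -> (i < n)%N -> `|s| <= 1 ->
  y ^+ 2 + sqnorm (t i s) = 1 ->
  tangent (tangle_double (arc_union n t)) (pt4 y (t i s)) v ->
  exists k, v = k *: double_dir (t i) y s.
Proof.
move=> [AS AI Aint] i_n s1 z1.
have Td : arc_union n t `<=` disk 3 by move=> x [j [r [jn r1 <-]]]; exact: (as_disk AS jn r1).
suff H w : velocity (tangle_double (arc_union n t)) (pt4 y (t i s)) w -> exists k, w = k *: double_dir (t i) y s.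
  case=> /H[k vk]; first by exists k.
  by exists (- k); rewrite scaleNr -vk opprK.
move=> vel; have vs : velocity (sphere 3) (pt4 y (t i s) : 'rV[R]_4) w.
  have [c [h1 h2 h3 h4]] := vel; exists c; split=> //.
  by apply: filterS h3 => r /(tangle_doubleP _ Td)[].
have := velocity_sphere vs; have [c [/smoothT_Cinf Cc c0 cL cw]] := vel.
pose x (r : R) : 'rV[R]_3 := rsubmx (c r : 'rV[R]_(1 + 3)).
have Cx : Cinf setT x by exact: (Cicomp_mx (@Cirsub R 3) Cc).
have x0 : x 0 = t i s by rewrite /x c0 row_mxKr.
have [|sg xs] := arc_curve (AI i i_n) s1 (Cinf_derivable Cx) x0.
  apply: (arc_union_curve (as_smooth AS) (as_inj AS) (Cinf_continuous Cx) i_n s1 x0).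
  by apply: filterS cL => r /(tangle_doubleP _ Td)[].
have wx : rsubmx (w : 'rV[R]_(1 + 3)) = 'D_1 x 0.
  have dc : is_derive (0 : R) (1 : R) c w by split=> //; exact: Cinf_derivable.
  by have [_ ->] := @is_derive_rsubmx 1 3 c 0 1 w dc.
rewrite (pt4_eta (w : 'rV[R]_(1 + 3))) wx xs; set y' := w _ _.
have -> : dot (pt4 y' (sg *: 'D_1 (t i) s) : 'rV[R]_4) (pt4 y (t i s)) = y' * y + sg * dot ('D_1 (t i) s) (t i s).
  by rewrite -dotZl; exact: dot_pt4.
set d := dot _ _ => E; rewrite /double_dir -/d.
have [y0|y0] := eqVneq y 0; last first.
  exists (sg / y); rewrite /pt4 scale_row_mx scale_scalar_mx scalerA divfK//; congr (row_mx _%:M _).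
  have -> : y' = - (sg * d) / y by rewrite -(mulfK y0 y'); congr (_ / _); lra.
  by rewrite mulrN mulrAC mulNr.
(* For [y = 0] the point is an end of the arc; there the outward condition makes [d] nonzero, which
   forces [sg = 0] and a vertical tangent. *)
have d0 : d != 0.
  move: z1; rewrite y0 expr0n/= add0r => t1.
  have [d1 dm1] := as_out AS i_n.
  by rewrite /d; have [->|->] := Aint i s i_n s1 t1; [rewrite gt_eqF|rewrite lt_eqF].
have sg0 : sg = 0.
  by move: E; rewrite y0 mulr0 add0r => /eqP; rewrite mulf_eq0 (negbTE d0) orbF => /eqP.
exists (- y' / d); rewrite y0 sg0 !scale0r /pt4 scale_row_mx scaler0 scale_scalar_mx; congr (row_mx _%:M _).
by rewrite mulrN !mulNr opprK divfK.
Qed.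

Lemma double_dir_neq0 n t G i s y : @arc_data R n t G -> (i < n)%N -> `|s| <= 1 ->
  y ^+ 2 + sqnorm (t i s) = 1 -> double_dir (t i) y s != 0.
Proof.
move=> [AS AI Aint] i_n s1 z1; apply/eqP; rewrite /double_dir /pt4 -[0]row_mx0 => /eq_row_mx[e1 /eqP].
rewrite scaler_eq0 (negbTE (as_immersion AS i_n s1)) orbF => /eqP y0.
move: z1; rewrite y0 expr0n/= add0r => t1; have [d1 dm1] := as_out AS i_n.
have d0 : dot ('D_1 (t i) s) (t i s) = 0.
  by have /matrixP/(_ 0 0) := e1; rewrite !mxE mulr1n => /eqP; rewrite oppr_eq0 => /eqP.
by move: d0; have [->|->] := Aint i s i_n s1 t1 => d0; [rewrite d0 ltxx in d1|rewrite d0 ltxx in dm1].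
Qed.

Lemma frame1_dir n t G i s y o : @arc_data R n t G -> (i < n)%N -> `|s| <= 1 ->
  y ^+ 2 + sqnorm (t i s) = 1 ->
  orientation (k := 1) (tangle_double (arc_union n t)) o -> forall E, o (pt4 y (t i s)) E ->
  exists2 a, a != 0 & E = a *: double_dir (t i) y s.
Proof.
move=> D i_n s1 z1 [or1 _ _] E /or1[_ [Ef Et]].
have [k Ek] := tangent_double D i_n s1 z1 (Et ord0).
have rE : row ord0 E = E by apply/rowP => j; rewrite mxE.
exists k; last by rewrite -Ek rE.
apply/eqP => k0; move: Ef; rewrite -rE Ek k0 scale0r /row_free mxrank0.
by [].
Qed.

(** The circle over an arc is parametrized by an angle; whether [double_dir] is positive for [o] is
    locally constant in the angle, hence constant. *)
Lemma double_sign n t G i o : @arc_data R n t G -> (i < n)%N ->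
  orientation (k := 1) (tangle_double (arc_union n t)) o ->
  exists2 e : R, e = 1 \/ e = -1 & forall s y, `|s| <= 1 -> y ^+ 2 + sqnorm (t i s) = 1 ->
    o (pt4 y (t i s)) (e *: double_dir (t i) y s).
Proof.
move=> D i_n oo; have [AS AI Aint] := D; have [or1 o2 o3] := oo.
have Td : arc_union n t `<=` disk 3 by move=> x [j [r [jn r1 <-]]]; exact: (as_disk AS jn r1).
have [h [Ch hE h0]] := arc_height D i_n.
have [Cc Cs] : Cinf setT (cos : R -> R) /\ Cinf setT (sin : R -> R) by split=> k; have [] := @Ck_cos_sin R k.
have c1 (th : R) : `|cos th| <= 1 by rewrite ler_norml cos_geN1 cos_le1.
pose y (th : R) := sin th * Num.sqrt (h (cos th)).
have Cy : Cinf setT y.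
  apply: CiMT => // k; apply: Ck_sqrt; [exact: openT|by move=> th _; exact: h0|].
  exact: (Cicomp1 Ch Cc).
have Ct := as_smooth AS i_n.
pose z th := pt4 (y th) (t i (cos th)).
have zc th : z th = arc_circle (t i) h (pt2 (cos th) (sin th)) by rewrite /arc_circle pt2_0 pt2_1.
have Cz : Cinf setT z by move=> k; apply: Ci_pt4; [exact: openT|exact: Cy|exact: (Cicomp1_mx Ct Cc)].
have CDt : Cinf setT ('D_1 (t i)) by move=> k; apply: Ck_derive; exact: Ct.
have CF : Cinf setT (fun th => double_dir (t i) (y th) (cos th)).
  move=> k; apply: Ci_pt4; first exact: openT.
    by apply: CiNT; apply: Ci_dot; [exact: (Cicomp1_mx CDt Cc)|exact: (Cicomp1_mx Ct Cc)].
  by apply: CiZT; [exact: Cy|exact: (Cicomp1_mx CDt Cc)].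
have zP th : tangle_double (arc_union n t) (z th).
  have [[s s1 ts] z1] : (exists2 s, `|s| <= 1 & t i s = rsubmx (z th)) /\ sqnorm (z th) = 1.
    apply/(arc_circleP (z th) D i_n hE h0); exists (pt2 (cos th) (sin th)); last by rewrite zc.
    by apply/sphere1P; rewrite pt2_0 pt2_1 cos2Dsin2.
  by apply/tangle_doubleP => //; split=> //; exists i, s.
have z1 th : y th ^+ 2 + sqnorm (t i (cos th)) = 1.
  by rewrite -sqnorm_pt4; have /(tangle_doubleP _ Td)[] := zP th.
pose P th := o (z th) (double_dir (t i) (y th) (cos th)).
(* Near [th0], positivity of [double_dir] is the sign of its product with a continuous positive
   frame. *)
have loc th0 : \forall th \near (th0 : R), P th0 <-> P th.
  have [U [E [oU U0 cE EP]]] := o3 (z th0) (zP th0).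
  pose g th := dot (E (z th)) (double_dir (t i) (y th) (cos th)).
  have cz : continuous z by exact: Cinf_continuous.
  have nU : \forall th \near (th0 : R), (tangle_double (arc_union n t) `&` U) (z th).
    have : \forall th \near (th0 : R), U (z th) by apply: cz; exact: open_nbhs_nbhs.
    by apply: filterS => th Uz; split.
  have cg : {for th0, continuous g}.
    have cEz : {for th0, continuous (fun th => E (z th))} by apply: (within_comp cE); [exact: cz|split|].
    have cEj j : {for th0, continuous (fun th => E (z th) ord0 j)}.
      by apply: (@continuous_comp _ _ _ (fun th => E (z th)) (fun M : 'rV[R]_4 => M ord0 j)); [exact: cEz|exact: coord_continuous].
    have cFj j : {for th0, continuous (fun th => double_dir (t i) (y th) (cos th) ord0 j)}.
      by apply: Cinf_continuous; exact: Cicoord.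
    rewrite /g /dot; apply: (@continuous_sum_dot 4 _ (fun j th => E (z th) ord0 j) (fun j th => double_dir (t i) (y th) (cos th) ord0 j)) => //.
  have Pg th : (tangle_double (arc_union n t) `&` U) (z th) -> g th != 0 /\ (P th <-> 0 < g th).
    move=> zU; have oE := EP (z th) zU.
    have [a a0 Ea] := frame1_dir D i_n (c1 th) (z1 th) oo oE.
    have F0 := sqnorm_gt0 (double_dir_neq0 D i_n (c1 th) (z1 th)).
    have gE : g th = a * sqnorm (double_dir (t i) (y th) (cos th)) by rewrite /g Ea dotZl dot_self.
    split; first by rewrite gE mulf_neq0// gt_eqF.
    rewrite gE pmulr_lgt0// /P.
    have -> : double_dir (t i) (y th) (cos th) = a^-1 *: E (z th) by rewrite Ea scalerA mulVf// scale1r.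
    by rewrite (frame1_scale _ oo oE) invr_gt0.
  have nP : \forall th \near (th0 : R), P th <-> 0 < g th by apply: filterS nU => th /Pg[].
  have [g0 P0] := Pg th0 (nbhs_singleton nU).
  have [gp|gn] := ltP 0 (g th0).
    have ng : \forall th \near (th0 : R), 0 < g th by apply: (@near_open R R g [set x : R | 0 < x] th0 cg _ gp); exact: open_gt.
    near=> th; have Pth : P th <-> 0 < g th by near: th.
    have gth : 0 < g th by near: th.
    exact: (iff_trans P0 (iff_trans (conj (fun=> gth) (fun=> gp)) (iff_sym Pth))).
  have gn' : g th0 < 0 by rewrite lt_neqAle g0 gn.
  have ng : \forall th \near (th0 : R), g th < 0 by apply: (@near_open R R g [set x : R | x < 0] th0 cg _ gn'); exact: open_lt.
  near=> th; have Pth : P th <-> 0 < g th by near: th.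
  have gth : g th < 0 by near: th.
  have neg x : x < 0 -> ~ (0 < x :> R) by move=> x0 x1; have := lt_trans x0 x1; rewrite ltxx.
  exact: (iff_trans P0 (iff_trans (conj (fun h' => False_ind _ (neg _ gn' h')) (fun h' => False_ind _ (neg _ gth h'))) (iff_sym Pth))).
have const th : P 0 <-> P th.
  have [t0|t0] := leP 0 th.
    by apply: (locally_constant_segment t0) => x _; exact: loc.
  by apply: iff_sym; apply: (locally_constant_segment (ltW t0)) => x _; exact: loc.
have angle s yy : `|s| <= 1 -> yy ^+ 2 + sqnorm (t i s) = 1 -> exists2 th, s = cos th & yy = y th.
  move=> s1 zz; have [u us] : exists2 u, sphere 1 u & arc_circle (t i) h u = pt4 yy (t i s).
    apply/(arc_circleP _ D i_n hE h0); rewrite row_mxKr sqnorm_pt4; split=> //; by exists s.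
  have [th uE] := circle_angle us; rewrite uE -zc /z /pt4 => /eq_row_mx[e1 e2].
  exists th; last by have /matrixP/(_ 0 0) := e1; rewrite !mxE !mulr1n.
  by have [] := as_inj AS i_n i_n (c1 th) s1 e2.
have [P0|nP0] := pselect (P 0).
  exists 1; first by left.
  move=> s yy s1 zz; have [th -> ->] := angle s yy s1 zz; rewrite scale1r.
  exact: (const th).1 P0.
exists (-1); first by right.
move=> s yy s1 zz; have [th -> ->] := angle s yy s1 zz.
have [U [E [oU U0 cE EP]]] := o3 (z th) (zP th); have oE := EP (z th) (conj (zP th) U0).
have [a a0 Ea] := frame1_dir D i_n (c1 th) (z1 th) oo oE.
have -> : -1 *: double_dir (t i) (y th) (cos th) = - a^-1 *: E (z th).
  by rewrite Ea scalerA mulNr mulVf.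
rewrite (frame1_scale _ oo oE) oppr_gt0 ltNge invr_ge0; apply/negP => a1.
apply: nP0; apply/(const th); rewrite /P.
have -> : double_dir (t i) (y th) (cos th) = a^-1 *: E (z th) by rewrite Ea scalerA mulVf// scale1r.
by rewrite (frame1_scale _ oo oE) invr_gt0 lt_def a0.
Unshelve. all: by end_near. Qed.

End DoubleOrientation.

(** * Directing the arcs by an orientation of the link *)

Section OrientArcs.
Context {R : realType}.

Lemma eq_le1 (x y : R) : x = y -> y <= 1 -> x <= 1.
Proof. by move=> ->. Qed.

(** Arc [i] is run as [t i (e i * s)] with the sign [e i] of [double_sign]; this multiplies
    [double_dir] by [e i] and makes it positive. Any orientation of the double is reached in this
    way. *)
Lemma arcs_oriented n t G o : @arc_data R n t G ->
  orientation (k := 1) (tangle_double (arc_union n t)) o ->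
  exists t' G', [/\ arc_data n t' G', arc_union n t' = arc_union n t
    & forall i s y, (i < n)%N -> `|s| <= 1 -> y ^+ 2 + sqnorm (t' i s) = 1 ->
      o (pt4 y (t' i s)) (double_dir (t' i) y s)].
Proof.
move=> D oo; have [AS AI Aint] := D.
have ex i : exists e : R, (e = 1 \/ e = -1) /\ ((i < n)%N -> forall s y, `|s| <= 1 -> y ^+ 2 + sqnorm (t i s) = 1 ->
    o (pt4 y (t i s)) (e *: double_dir (t i) y s)).
  have [i_n|ni] := boolP (i < n)%N; last by exists 1; split; [left|].
  by have [e e1 He] := double_sign D i_n oo; exists e.
have [e He] := choice ex.
have e1 i : e i = 1 \/ e i = -1 by have [] := He i.
have ee i : e i * e i = 1 by case: (e1 i) => ->; rewrite ?mulr1// mulrNN mulr1.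
have en i s : `|e i * s| = `|s| by case: (e1 i) => ->; rewrite ?mul1r// mulN1r normrN.
pose t' i s := t i (e i * s); pose G' i x := e i * G i x.
have Ct' i : (i < n)%N -> Cinf setT (t' i).
  move=> i_n; apply: (Cicomp1_mx (as_smooth AS i_n)).
  by apply: CiMT; [exact: CicstT|exact: CiidT].
have Dt' i s : (i < n)%N -> 'D_1 (t' i) s = e i *: 'D_1 (t i) (e i * s).
  move=> i_n; have d : is_derive s (1 : R) (fun s : R => e i * s) (e i).
    by apply: is_derive_eq; rewrite /GRing.scale /=; ring.
  by have [_ ->] := is_derive_comp1 (as_smooth AS i_n) d.
have Dir i s y : (i < n)%N -> double_dir (t' i) y s = e i *: double_dir (t i) y (e i * s).
  move=> i_n; rewrite /double_dir Dt'// /t' dotZl /pt4 scale_row_mx scale_scalar_mx mulrN.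
  by rewrite !scalerA [y * e i]mulrC.
have end' i : (i < n)%N -> (e i * 1 = 1 \/ e i * 1 = -1) /\ (e i * -1 = 1 \/ e i * -1 = -1).
  by move=> _; rewrite mulr1 mulrN1; case: (e1 i) => ->; rewrite ?opprK; split; [left|right|right|left].
have [as1 as2] : (forall i, (i < n)%N -> sqnorm (t i 1) = 1) /\ (forall i, (i < n)%N -> sqnorm (t i (-1)) = 1).
  by split=> i i_n; have [] := as_end AS i_n.
exists t', G'; split.
- split.
  + split.
    * exact: Ct'.
    * move=> i j s s' i_n jn s1 s1' E.
      have [ij ss] := as_inj AS i_n jn (eq_le1 (en i s) s1) (eq_le1 (en j s') s1') E; subst j; split=> //.
      by rewrite -[s]mul1r -(ee i) -mulrA ss mulrA ee mul1r.
    * move=> i s i_n s1; rewrite Dt'// scaler_eq0 negb_or (as_immersion AS i_n) ?en// andbT.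
      by apply/eqP => e0; have := ee i; rewrite e0 mul0r => /esym/eqP; rewrite oner_eq0.
    * by move=> i s i_n s1; apply: (as_disk AS i_n); rewrite en.
    * move=> i i_n; rewrite /t' mulr1 mulrN1; case: (e1 i) => ->; rewrite ?opprK; split; auto.
    * move=> i i_n; rewrite !Dt'// /t' mulr1 mulrN1 !dotZl; have [h1 h2] := as_out AS i_n.
      by case: (e1 i) => ->; rewrite ?opprK ?mul1r ?mulN1r ?oppr_gt0 ?oppr_lt0.
  + move=> i i_n; have [h1 h2 h3] := AI i i_n; split; first exact: Ct'.
      by apply: CiMT; [exact: CicstT|].
    by move=> s s1; rewrite /G' /t' h3 ?en// mulrA ee mul1r.
  + move=> i s i_n s1 ts; have := Aint i (e i * s) i_n (eq_le1 (en i s) s1) ts.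
    by case: (e1 i) => ->; rewrite ?mul1r// mulN1r => -[h|h]; [right|left]; lra.
- apply/seteqP; split=> x [i [s [i_n s1 <-]]]; first by exists i, (e i * s); rewrite en.
  by exists i, (e i * s); split; rewrite ?en// /t' mulrA ee mul1r.
- move=> i s y i_n s1 z1; rewrite Dir//; have [_ h] := He i.
  by apply: h => //; rewrite en.
Qed.

End OrientArcs.


(** * Tangent spaces of a parametrized sphere *)

Section ParametrizedSphere.
Context {R : realType}.
Variables (n m : nat) (F : 'rV[R]_n.+1 -> 'rV[R]_m) (G : 'rV[R]_m -> 'rV[R]_n.+1).
Hypotheses (CF : Cinf setT F) (CG : Cinf setT G) (GF : forall u, `|u| < 2 -> G (F u) = u).

Let S := F @` sphere n.

Lemma sphere_norm_lt2 d (u : 'rV[R]_d.+1) : sphere d u -> `|u| < 2.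
Proof.
move=> us; apply: (@le_lt_trans _ _ 1); last by rewrite ltr1n.
apply: norm_le_coord => // i j; rewrite (ord1 i).
have : `|u ord0 j| ^+ 2 <= 1.
  rewrite real_normK ?num_real//; move: us; rewrite /sphere /= /sqnorm (bigD1 j)//= => <-.
  by rewrite lerDl sumr_ge0// => k _; exact: sqr_ge0.
by rewrite expr_le1.
Qed.

Lemma sphere_retract u : sphere n u -> G (F u) = u.
Proof. by move=> /sphere_norm_lt2; exact: GF. Qed.

Lemma jac_retract u : sphere n u -> jac F u *m jac G (F u) = 1%:M.
Proof.
move=> us; apply/row_matrixP => i; rewrite !rowE mulmx1; set v := delta_mx _ _.
have dF : derivable F u v by exact: Cinf_derivable.
have [_ E] := @is_derive_comp R m n.+1 _ setT G F u v openT (CG 1%N) I dF.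
rewrite mulmxA -(derive_jac v openT (CF 1%N) I) -E.
rewrite (near_eq_derive (g := fun u => u)) ?derive_id//.
have := @near_norm_lt R _ _ (fun y : 'rV[R]_n.+1 => y) u 2 cvg_id (sphere_norm_lt2 us).
by apply: filterS => y; exact: GF.
Qed.

(** As [G] is smooth on the ambient space, a curve in [S] is pulled back to a smooth curve on the
    round sphere. *)
Lemma velocity_image u v : velocity S (F u) v -> sphere n u ->
  exists h, dot h u = 0 /\ v = h *m jac F u.
Proof.
move=> [c [/smoothT_Cinf Cc c0 cS cv]] us.
have dc : derivable c 0 1 by exact: Cinf_derivable.
pose g (t : R) := G (c t).
have Cg : Cinf setT g by exact: (Cicomp_mx CG Cc).
have g0 : g 0 = u by rewrite /g c0 sphere_retract.
have gS : \forall t \near (0 : R)^'+, sphere n (g t) /\ c t = F (g t).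
  apply: filterS cS => t [u' us' uE]; rewrite /g -uE sphere_retract//.
exists ('D_1 g 0); split.
  apply: (@velocity_sphere R n); exists g; split=> //; first exact: Cinf_smooth.
  by apply: filterS gS => t [].
have [d D] := @is_derive_comp R n.+1 m R setT F g 0 1 openT (CF 1%N) I (Cinf_derivable Cg).
rewrite -{1}g0 -D -cv; apply: right_derive_eq => //; first by rewrite g0.
by apply: filterS gS => t [].
Qed.

(** The witness is the line through [u] in direction [h], normalized and pushed forward by [F]. *)
Lemma velocity_imageP u h : sphere n u -> dot h u = 0 -> velocity S (F u) (h *m jac F u).
Proof.
move=> us hu; pose q (t : R) := u + t *: h.
have dq : is_derive (0 : R) (1 : R) q h by exact: is_derive_affine.
have Cq : Cinf setT q.
  by apply: CiDT; [exact: CicstT|apply: CiZT; [exact: CiidT|exact: CicstT]].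
have qq t : sqnorm (q t) = 1 + t ^+ 2 * sqnorm h.
  rewrite -!dot_self /q dotDl !dotDr !dotZl [dot u (t *: h)]dotC [dot h (t *: h)]dotC !dotZl.
  by rewrite hu !dot_self us; ring.
have q0 t : 0 < sqnorm (q t).
  rewrite qq ltr_pwDl// mulr_ge0 ?sqr_ge0// -dot_self sumr_ge0// => i _.
  by rewrite -expr2 sqr_ge0.
pose N t := (Num.sqrt (sqnorm (q t)))^-1.
have CN : Cinf setT N.
  move=> k; apply: CkV; [exact: openT|by move=> t _; rewrite gt_eqF// sqrtr_gt0|].
  apply: Ck_sqrt; [exact: openT|by []|].
  by apply: Ck_sqnorm; [exact: openT|exact: Cq].
have N0 : N 0 = 1 by rewrite /N qq expr0n/= mul0r addr0 sqrtr1 invr1.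
(* Derivative at 0 of the constant [N ^+ 2 * sqnorm q], where [sqnorm q] is stationary. *)
have DN : 'D_1 N 0 = 0.
  have [d0 D0] := is_derive_sqnorm (Cinf_derivable Cq : derivable q 0 1).
  have dN : is_derive (0 : R) (1 : R) N ('D_1 N 0).
    by split; [exact: Cinf_derivable|reflexivity].
  have dqn : is_derive (0 : R) (1 : R) (fun t => sqnorm (q t)) 0.
    by split=> //; rewrite D0; have [_ ->] := dq; rewrite /q scale0r addr0 hu mulr0.
  have [_ E] : is_derive (0 : R) (1 : R) (fun t => (N t * N t) * sqnorm (q t)) (2 * 'D_1 N 0).
    apply: is_derive_eq; rewrite /GRing.scale /= qq N0; ring.
  move: E; rewrite (_ : (fun t => _) = fun=> 1); last first.
    apply/funext => t; rewrite -expr2 exprVn sqr_sqrtr ?ltW// mulVf// gt_eqF//.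
  by rewrite derive_cst => /esym/eqP; rewrite mulf_eq0 pnatr_eq0 /= => /eqP.
pose w t := N t *: q t.
have Cw : Cinf setT w by exact: CiZT.
have w0 : w 0 = u by rewrite /w N0 scale1r /q scale0r addr0.
exists (fun t => F (w t)); split.
- by apply: Cinf_smooth; exact: (Cicomp_mx CF Cw).
- by rewrite w0.
- apply: nearW => t; exists (w t) => //.
  rewrite /sphere /= -dot_self /w dotZl dotC dotZl dot_self mulrA -expr2 exprVn sqr_sqrtr ?ltW//.
  by rewrite mulVf// gt_eqF.
- have [_ ->] := @is_derive_comp R n.+1 m R setT F w 0 1 openT (CF 1%N) I (Cinf_derivable Cw).
  rewrite w0; congr (_ *m _).
  have dwj j : is_derive (0 : R) (1 : R) (fun t => w t ord0 j) (h ord0 j).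
    have dN : is_derive (0 : R) (1 : R) N 0 by split=> //; exact: Cinf_derivable.
    have dqj : is_derive (0 : R) (1 : R) (fun t => q t ord0 j) (h ord0 j) by exact: is_derive_coord.
    rewrite (_ : (fun t => w t ord0 j) = (fun t => N t * q t ord0 j)).
      by apply: is_derive_eq; rewrite /GRing.scale /= N0; ring.
    by apply/funext => t; rewrite mxE.
  by have [_ ->] := is_derive_rv dwj.
Qed.

Lemma tangent_imageP u v : sphere n u ->
  tangent S (F u) v <-> exists h, dot h u = 0 /\ v = h *m jac F u.
Proof.
move=> us; split; last first.
  by move=> [h [hu ->]]; left; exact: velocity_imageP.
case=> /velocity_image/(_ us)[h [hu E]]; first by exists h.
by exists (- h); rewrite mulNmx -E opprK dotC dotNr dotC hu oppr0.
Qed.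

(** All tangent vectors are images of vectors orthogonal to [u], a space of dimension [n]; [n]
    independent ones span. *)
Lemma frame_change k p (E E' : 'M[R]_(k, m)) : k = n -> S p -> frame S p E -> 
  (forall i, tangent S p (row i E')) -> exists A, E' = A *m E.
Proof.
move=> kn [u us <-] [Ef Et] Et'.
pose K := kermx u^T *m jac F u.
have sub (X : 'M[R]_(k, m)) : (forall i, tangent S (F u) (row i X)) -> (X <= K)%MS.
  move=> Xt; apply/row_subP => i; have /(tangent_imageP _ us)[h [hu ->]] := Xt i.
  apply: submxMr; apply/sub_kermxP; rewrite -/(mulmx h u^T) dot_mulmx hu.
  by apply/matrixP => a b; rewrite !mxE mul0rn.
have rK : (\rank K <= k)%N.
  apply: leq_trans (mxrankM_maxl _ _) _; rewrite mxrank_ker mxrank_tr kn.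
  suff -> : \rank u = 1%N by rewrite subn1.
  rewrite rank_rV; case: eqP => // u0; move: us; rewrite /sphere /= u0 -dot_self dot0l.
  by move/esym/eqP; rewrite oner_eq0.
have KE : (K <= E)%MS.
  have := mxrank_leqif_eq (sub _ Et) => -[le1 /esym eqE]; have := eqE.
  rewrite (eqP Ef) => h; have : (k == \rank K)%N.
    by rewrite eqn_leq rK andbT -{1}(eqP Ef).
  by rewrite -h => /andP[].
by have /submxP[A ->] := submx_trans (sub _ Et') KE; exists A.
Qed.

End ParametrizedSphere.

(** * An orientation of a parametrized sphere *)

Section SphereOrientation.
Context {R : realType}.
Variables (n m : nat) (F : 'rV[R]_n.+1 -> 'rV[R]_m) (G : 'rV[R]_m -> 'rV[R]_n.+1).
Hypotheses (CF : Cinf setT F) (CG : Cinf setT G) (GF : forall u, `|u| < 2 -> G (F u) = u).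

Let S := F @` sphere n.

(** The orientation of the round sphere as a boundary, outward normal [G p] first, transported by
    [F]. *)
Definition sphere_orient (p : 'rV[R]_m) (E : 'M[R]_(n, m)) : Prop :=
  [/\ S p, frame S p E & 0 < \det (col_mx (G p) (E *m jac G p) : 'M[R]_(1 + n))].

(** Complete [u] to a basis [W] whose first row is proportional to [u], then multiply the other rows
    by a matrix that makes the whole determinant a square. *)
Lemma sphere_complete (u : 'rV[R]_n.+1) : (0 < n)%N -> u != 0 ->
  exists K : 'M[R]_(n, n.+1), 0 < \det (col_mx u K : 'M[R]_(1 + n)).
Proof.
move=> n0 u0.
pose W : 'M[R]_(1 + n) := row_ebase u.
have uW : u = col_ebase u 0 0 *: usubmx W.
  rewrite -[LHS](mulmx_ebase u) (_ : \rank u = 1%N); last by rewrite rank_rV u0.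
  rewrite [col_ebase u]mx11_scalar -mulmxA mul_scalar_mx; congr (_ *: _); first by rewrite !mxE.
  rewrite -[row_ebase u]/W -{1}[W]vsubmxK pid_mx_row.
  by apply: etrans (@mul_row_col R 1 1 n n.+1 _ _ _ _) _; rewrite mul1mx mul0mx addr0.
have c0 : col_ebase u 0 0 != 0 by apply: contra u0 => /eqP c0; rewrite uW c0 scale0r.
set c := col_ebase u 0 0 in uW c0 *.
have dW : \det W != 0 by have := row_ebase_unit u; rewrite unitmxE unitfE.
have [A dA] : exists A : 'M[R]_n, \det A = c * \det W.
  move: (c * \det W) n0 => d; clear; case: n => // k _.
  by exists (block_mx d%:M 0 0 1%:M : 'M[R]_(1 + k)); rewrite (@det_ublock R 1 k) det1 mulr1 det_scalar1.
exists (A *m dsubmx W).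
have -> : (col_mx u (A *m dsubmx W) : 'M[R]_(1 + n)) = block_mx c%:M 0 0 A *m W.
  rewrite -{2}[W]vsubmxK; apply/esym; apply: etrans (@mul_block_col R 1 n 1 n n.+1 _ _ _ _ _ _) _.
  by rewrite !mul0mx addr0 add0r mul_scalar_mx -uW.
rewrite det_mulmx det_ublock det_scalar1 dA mulrAC -expr2 lt_def sqr_ge0 andbT sqrf_eq0.
by rewrite mulf_neq0.
Qed.

Lemma sphere_orient_orientation : (0 < n)%N -> orientation S sphere_orient.
Proof.
move=> n0; split.
- by move=> p E [].
- move=> p E P [Sp [Ef Et] Ed]; have [u us up] := Sp.
  have -> : sphere_orient p (P *m E) <-> 0 < \det P * \det (col_mx (G p) (E *m jac G p) : 'M[R]_(1 + n)).
    have dE : \det (col_mx (G p) (P *m E *m jac G p) : 'M[R]_(1 + n)) =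
        \det P * \det (col_mx (G p) (E *m jac G p) : 'M[R]_(1 + n)).
      have -> : \det P = \det (block_mx 1%:M 0 0 P : 'M[R]_(1 + n)) by rewrite det_ublock det1 mul1r.
      rewrite -det_mulmx; congr (\det _).
      apply/esym; apply: etrans (@mul_block_col R 1 n 1 n n.+1 _ _ _ _ _ _) _.
      by rewrite mul1mx !mul0mx addr0 add0r mulmxA.
    rewrite -dE; split; first by case.
    move=> dP; split=> //; split.
      have PU : row_free P.
        rewrite row_free_unit unitmxE unitfE; move: dP; rewrite dE => dP.
        by apply/eqP => P0; move: dP; rewrite P0 mul0r ltxx.
      by rewrite /row_free mxrankMfree.
    move=> i; rewrite -up; apply/(tangent_imageP CF CG GF) => //.
    have Ej j : exists h, dot h u = 0 /\ row j E = h *m jac F u.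
      by have := (tangent_imageP CF CG GF (row j E) us).1; rewrite up; apply.
    have [h Hh] := choice Ej.
    exists (\sum_j P i j *: h j); split.
      rewrite (big_morph (fun x => dot x u) (fun x y => dotDl x y u) (dot0l u)) big1// => j _.
      by rewrite dotZl; have [-> _] := Hh j; rewrite mulr0.
    rewrite row_mul mulmx_sum_row mulmx_suml; apply: eq_bigr => j _.
    by rewrite -scalemxAl mxE; have [_ ->] := Hh j.
  by rewrite pmulr_lgt0.
move=> p [u us up].
have u0 : u != 0.
  apply/eqP => u0; move: us; rewrite /sphere /= u0 -dot_self dot0l => /esym/eqP.
  by rewrite oner_eq0.
have [K dK] := sphere_complete n0 u0.
have CdK : continuous (fun q => \det (col_mx (G q) K : 'M[R]_(1 + n))).
  apply: Cinf_continuous => k; apply: (@Ck_det R _ (1 + n)); first exact: openT.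
  apply/Ck_mx => [|i j]; first exact: openT.
  case: (split_ordP i) => i' ->.
    apply: (@Ck_ext _ _ _ _ _ (fun x => G x i' j)) => [|x _|]; first exact: openT.
      by rewrite col_mxEu.
    by apply: Cicoord.
  by apply: (@Ck_ext _ _ _ _ _ (fun x => K i' j)) => [|x _|]; [exact: openT|rewrite col_mxEd|exact: Ck_cst].
(* A fixed complement [K] of [u] is projected orthogonally to [G q] and pushed forward: a continuous
   frame near [p]. *)
pose E (q : 'rV[R]_m) := (K - (K *m (G q)^T) *m G q) *m jac F (G q).
exists [set q | 0 < \det (col_mx (G q) K : 'M[R]_(1 + n))], E; split.
- exact: open_pos.
- by rewrite /= -up (sphere_retract GF).
- have CGt : Cinf setT (fun q => (G q)^T).
    move=> k; apply/Ck_mx => [|i j]; first exact: openT.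
    apply: (@Ck_ext _ _ _ _ _ (fun x => G x j i)) => [|x _|]; first exact: openT.
      by rewrite mxE.
    by apply: Cicoord.
  apply: continuous_subspaceT; apply: (Cinf_continuous (f := E)) => k; apply: Ck_mulmx; first exact: openT.
    apply: CkB; [exact: openT|exact: Ck_cst|].
    apply: Ck_mulmx; [exact: openT| |exact: CG].
    by apply: Ck_mulmx; [exact: openT|exact: Ck_cst|exact: CGt].
  have CJ : Cinf setT (jac F) by move=> k'; apply: Ck_jac; [exact: openT|exact: CF].
  exact: (Cicomp_mx CJ CG).
- move=> q [[v vs vq] /= dq].
  have Gq : G q = v by rewrite -vq (sphere_retract GF).
  have EJ : E q *m jac G q = K - (K *m v^T) *m v.
    by rewrite /E Gq -vq -mulmxA (jac_retract CF CG GF)// mulmx1.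
  have dE : \det (col_mx (G q) (E q *m jac G q) : 'M[R]_(1 + n)) = \det (col_mx v K : 'M[R]_(1 + n)).
    rewrite EJ Gq; have d1 : \det (block_mx 1%:M 0 (- (K *m v^T)) 1%:M : 'M[R]_(1 + n)) = 1.
      by rewrite det_lblock !det1 mulr1.
    rewrite -[RHS]mul1r -{}d1 -det_mulmx; congr (\det _).
    apply/esym; apply: etrans (@mul_block_col R 1 n 1 n n.+1 _ _ _ _ _ _) _.
    by rewrite !mul1mx mul0mx addr0 mulNmx addrC.
  have dE0 : 0 < \det (col_mx (G q) (E q *m jac G q) : 'M[R]_(1 + n)) by rewrite dE -Gq.
  split=> //; first by exists v.
  split.
    have U : (col_mx (G q) (E q *m jac G q) : 'M[R]_(1 + n)) \in unitmx by rewrite unitmxE unitfE gt_eqF.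
    have : row_free (E q *m jac G q).
      apply/row_freeP; exists (rsubmx (invmx (col_mx (G q) (E q *m jac G q) : 'M[R]_(1 + n)))).
      move: U; set X : 'M[R]_(1 + n) := invmx _ => U.
      have H : (col_mx (G q) (E q *m jac G q) : 'M[R]_(1 + n)) *m row_mx (lsubmx X) (rsubmx X) = 1%:M.
        by rewrite hsubmxK; exact: mulmxV U.
      have := etrans (esym (@mul_col_row R 1 n n.+1 1 n (G q) (E q *m jac G q) (lsubmx X) (rsubmx X))) H.
      by rewrite scalar_mx_block => /eq_block_mx[_ _ _].
    rewrite /row_free => /eqP Er; rewrite eqn_leq rank_leq_row /= -{1}Er.
    exact: mxrankM_maxl.
  move=> i; rewrite -vq; apply/(tangent_imageP CF CG GF) => //.
  exists (row i (K - K *m v^T *m v)); split; last by rewrite -row_mul vq /E Gq.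
  have : row i (K - K *m v^T *m v) *m v^T = 0.
    rewrite -row_mul mulmxBl -[K *m v^T *m v *m v^T]mulmxA mulmx_trmx vs mulmx1 subrr.
    by apply/rowP => j; rewrite !mxE.
  by rewrite dot_mulmx => /matrixP/(_ 0 0); rewrite !mxE mulr1n.
Qed.

End SphereOrientation.

(** * Orientations read in a coordinate patch *)

Section OrientedPatch.
Context {R : realType}.

(** The two vectors of every frame are exchanged; conjugation by the transposition preserves
    determinants of base changes. *)
Lemma orientation_reverse m (S : set 'rV[R]_m) (o : 'rV[R]_m -> set 'M[R]_(2, m)) :
  orientation S o -> orientation S (fun p E => o p (xrow 0 1 E)).
Proof.
move=> [or1 or2 or3]; pose s := tperm (0 : 'I_2) 1.
have fr p E : frame S p (row_perm s E) -> frame S p E.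
  move=> [Ef Et]; split.
    move: Ef; rewrite row_permE /row_free eqmxMfull//.
    by rewrite row_full_unit unitmx_perm.
  move=> i; have := Et (s i); rewrite (_ : row (s i) _ = row i E)//.
  by apply/rowP => j; rewrite !mxE /s tpermK.
split.
- by move=> p E /or1[Sp Ef]; split=> //; exact: fr.
- move=> p E P oE; have := or2 p _ (row_perm s (col_perm s P)) oE.
  have -> : row_perm s (col_perm s P) *m xrow 0 1 E = xrow 0 1 (P *m E).
    rewrite /xrow -/s !row_permE col_permE tpermV -/s -!mulmxA; congr (_ *m (_ *m _)).
    by rewrite mulmxA -perm_mxM /s tperm2 perm_mx1 mul1mx.
  have -> : \det (row_perm s (col_perm s P)) = \det P; last by [].
  rewrite row_permE col_permE !det_mulmx det_perm tpermV -/s det_perm mulrCA -expr2 sqrr_sign mulr1.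
  by [].
- move=> p /or3[U [E [oU Up cE Eo]]]; exists U, (fun q => xrow 0 1 (E q)); split=> //.
    have cX : continuous (fun X : 'M[R]_(2, m) => xrow 0 1 X).
      move=> X; apply: continuous_mx => i j; rewrite (_ : (fun y => _) = (fun y : 'M[R]_(2, m) => y (s i) j)).
        exact: coord_continuous.
      by apply/funext => y; rewrite mxE.
    apply/subspace_continuousP => x Ux B nB.
    by have /subspace_continuousP/(_ x Ux) h := cE; exact: h (cX (E x) B nB).
  move=> q /Eo; rewrite (_ : xrow 0 1 (xrow 0 1 (E q)) = E q)//.
  by apply/matrixP => i j; rewrite !mxE tpermK.
Qed.

Lemma locally_constant_sign (T : topologicalType) (P : T -> Prop) (g : T -> R) x0 :
  {for x0, continuous g} -> (\forall x \near x0, g x != 0 /\ (P x <-> 0 < g x)) ->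
  \forall x \near x0, P x0 <-> P x.
Proof.
move=> cg nP; have [g0 P0] := nbhs_singleton nP.
have : \forall x \near x0, 0 < g x0 * g x.
  apply: (@near_open _ _ (fun x => g x0 * g x) [set x : R | 0 < x] x0).
  - by apply: cvgM; [exact: cvg_cst|exact: cg].
  - exact: open_gt.
  - by rewrite /= -expr2 lt_def sqr_ge0 sqrf_eq0 g0.
move: nP; apply: filterS2 => x [_ Px] gg; apply: (iff_trans P0); apply: (iff_trans _ (iff_sym Px)).
by split=> h; [rewrite -(pmulr_rgt0 _ h)|rewrite -(pmulr_lgt0 _ h)].
Qed.

Variables (k m : nat) (S : set 'rV[R]_m) (Psi : 'rV[R]_k -> 'rV[R]_m) (H : 'rV[R]_m -> 'rV[R]_k) (Mb : R).
Hypotheses (CPsi : Cinf setT Psi) (CH : Cinf setT H).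
Hypothesis PsiS : forall w, `|w| < Mb -> S (Psi w) /\ H (Psi w) = w.
Hypothesis spanS : forall p (E E' : 'M[R]_(k, m)), S p -> frame S p E ->
  (forall i, tangent S p (row i E')) -> exists A, E' = A *m E.

Lemma patch_retract w : `|w| < Mb -> jac Psi w *m jac H (Psi w) = 1%:M.
Proof.
move=> wM; apply/row_matrixP => i; rewrite !rowE mulmx1; set v := delta_mx _ _.
have dF : derivable Psi w v by exact: Cinf_derivable.
have [_ E] := @is_derive_comp R m k _ setT H Psi w v openT (CH 1%N) I dF.
rewrite mulmxA -(derive_jac v openT (CPsi 1%N) I) -E.
rewrite (near_eq_derive (g := fun u => u)) ?derive_id//.
have := @near_norm_lt R _ _ (fun y : 'rV[R]_k => y) w Mb cvg_id wM.
by apply: filterS => y /PsiS[].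
Qed.

Lemma patch_curve w q : `|w| < Mb -> exists c : R -> 'rV[R]_k,
  [/\ Cinf setT c, c 0 = w, \forall t \near (0 : R), `|c t| < Mb &
    is_derive (0 : R) (1 : R) (fun t => Psi (c t)) (q *m jac Psi w)].
Proof.
move=> wM; pose c (t : R) := w + t *: q.
have Cc : Cinf setT c by apply: CiDT; [exact: CicstT|apply: CiZT; [exact: CiidT|exact: CicstT]].
have c0 : c 0 = w by rewrite /c scale0r addr0.
have dc : is_derive (0 : R) (1 : R) c q by exact: is_derive_affine.
exists c; split=> //.
  by apply: near_norm_lt; [exact: Cinf_continuous|rewrite c0].
have := @is_derive_comp R k m R setT Psi c 0 1 openT (CPsi 1%N) I (Cinf_derivable Cc).
by have [_ ->] := dc; rewrite c0.
Qed.

Lemma near_right_of_near (P : R -> Prop) : (\forall t \near (0 : R), P t) -> \forall t \near (0 : R)^'+, P t.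
Proof. exact: cvg_at_right_filter. Qed.

Lemma patch_velocity w q : `|w| < Mb -> velocity S (Psi w) (q *m jac Psi w).
Proof.
move=> wM; have [c [Cc c0 cM [_ Dc]]] := patch_curve q wM.
exists (fun t => Psi (c t)); split=> //.
- by apply: Cinf_smooth; exact: (Cicomp_mx CPsi Cc).
- by rewrite c0.
- by apply: near_right_of_near; apply: filterS cM => t /PsiS[].
Qed.

Lemma patch_frame w : `|w| < Mb -> frame S (Psi w) (jac Psi w).
Proof.
move=> wM; split; first by apply/row_freeP; exists (jac H (Psi w)); exact: patch_retract.
by move=> i; left; rewrite rowE; exact: patch_velocity.
Qed.

(** Whether the Jacobian frame is positive is locally constant on the ball, hence constant by
    convexity; any other frame differs from it by the matrix [M]. *)
Lemma patch_orient (o : 'rV[R]_m -> set 'M[R]_(k, m)) : orientation S o ->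
  exists2 e : R, e != 0 & forall w M, `|w| < Mb -> o (Psi w) (M *m jac Psi w) <-> 0 < e * \det M.
Proof.
move=> oo; have [or1 or2 or3] := oo.
(* [B] is the change of basis from the Jacobian frame to [E], read off with the left inverse
   [jac H]. *)
have chg w E : `|w| < Mb -> o (Psi w) E -> let B := E *m jac H (Psi w) in
    E = B *m jac Psi w /\ \det B != 0 /\ forall M, o (Psi w) (M *m jac Psi w) <-> 0 < \det B * \det M.
  move=> wM oE B; have [Sp EF] := or1 _ _ oE.
  have [A EA] := spanS Sp (patch_frame wM) EF.2.
  have AB : A = B by rewrite /B EA -mulmxA patch_retract// mulmx1.
  have [A' JA] := spanS Sp EF (patch_frame wM).2.
  have A'B : A' *m B = 1%:M.
    by rewrite /B mulmxA -JA patch_retract.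
  have dd : \det A' * \det B = 1 by rewrite -det_mulmx A'B det1.
  have B0 : \det B != 0 by apply/eqP => B0; move: dd; rewrite B0 mulr0 => /esym/eqP; rewrite oner_eq0.
  split; first by rewrite -AB.
  split=> // M; rewrite {1}JA mulmxA (or2 _ _ _ oE) det_mulmx.
  have -> : \det A' = (\det B)^-1 by rewrite -[LHS](mulfK B0) dd mul1r.
  have -> : \det B * \det M = (\det M / \det B) * (\det B) ^+ 2 by field.
  by rewrite (pmulr_lgt0 (\det M / \det B)) ?exprn_even_gt0.
pose P w := o (Psi w) (jac Psi w).
have loc w0 : `|w0| < Mb -> \forall w \near w0, P w0 <-> P w.
  move=> wM; have [U [E [oU U0 cE Eo]]] := or3 (Psi w0) (PsiS wM).1.
  have cPsi : continuous Psi by exact: Cinf_continuous.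
  have nM : \forall w \near w0, `|w| < Mb by apply: (@near_norm_lt R _ _ (fun w : 'rV[R]_k => w)); first exact: cvg_id.
  have nU : \forall w \near w0, U (Psi w) by apply: cPsi; exact: open_nbhs_nbhs.
  have nSU : \forall w \near w0, (S `&` U) (Psi w).
    by move: nM nU; apply: filterS2 => w /PsiS[? _]; split.
  have CJ : Cinf setT (fun w => jac H (Psi w)).
    by apply: (Cicomp_mx _ CPsi) => k'; apply: Ck_jac; [exact: openT|exact: CH].
  have cEP : {for w0, continuous (fun w => E (Psi w))}.
    by apply: (within_comp cE) => //; [exact: cPsi|exact: nbhs_singleton nSU].
  apply: (@locally_constant_sign _ P (fun w => \det (E (Psi w) *m jac H (Psi w)))).
    apply: (@continuous_comp _ _ _ (fun w => E (Psi w) *m jac H (Psi w)) (fun X : 'M[R]_k => \det X)); last first.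
      by apply: Cinf_continuous => k'; apply: Ck_det; [exact: openT|exact: Ck_id].
    apply: continuous_mx => i j.
    rewrite (_ : (fun y => _) = (fun y => \sum_a E (Psi y) i a * jac H (Psi y) a j)); last first.
      by apply/funext => y; rewrite mxE.
    apply: (@continuous_sum_dot R m _ (fun a w => E (Psi w) i a) (fun a w => jac H (Psi w) a j)) => a.
      by apply: (@continuous_comp _ _ _ (fun w => E (Psi w)) (fun X : 'M[R]_(k, m) => X i a)); [exact: cEP|exact: coord_continuous].
    by apply: Cinf_continuous; exact: Cicoord.
  move: nM nSU; apply: filterS2 => w wM' /Eo oE.
  have [_ [B0 /(_ 1%:M)]] := chg w _ wM' oE; rewrite mul1mx det1 mulr1 => PB.
  by split.
have const w w' : `|w| < Mb -> `|w'| < Mb -> P w -> P w'.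
  move=> wM w'M; pose q (t : R) := w + t *: (w' - w).
  have cq : continuous q.
    by apply: Cinf_continuous; apply: CiDT; [exact: CicstT|apply: CiZT; [exact: CiidT|exact: CicstT]].
  have <- : q 0 = w by rewrite /q scale0r addr0.
  have <- : q 1 = w' by rewrite /q scale1r addrC subrK.
  apply: (iffLR (@locally_constant_segment R (fun t => P (q t)) 0 1 ler01 _)) => t t01.
  exact: (cq t _ (loc (q t) (ball_convex wM w'M t01))).
have key w M : `|w| < Mb -> o (Psi w) (M *m jac Psi w) <-> (if `[< P w >] then 0 < \det M else \det M < 0).
  move=> wM; have [U [E [oU U0 cE Eo]]] := or3 (Psi w) (PsiS wM).1.
  have oE := Eo (Psi w) (conj (PsiS wM).1 U0).
  have [_ [B0 HM]] := chg w _ wM oE.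
  have P1 : P w <-> 0 < \det (E (Psi w) *m jac H (Psi w)).
    by have := HM 1%:M; rewrite mul1mx det1 mulr1.
  case: asboolP => Pw; rewrite HM; first by rewrite pmulr_rgt0//; exact/P1.
  rewrite nmulr_rgt0// lt_neqAle B0 leNgt; apply/negP => h; apply: Pw; exact/P1.
have [[w0 w0M]|no] := pselect (exists w : 'rV[R]_k, `|w| < Mb); last first.
  exists 1 => [|w M wM]; first by rewrite oner_neq0.
  by case: no; exists w.
have PP w : `|w| < Mb -> `[< P w >] = `[< P w0 >].
  by move=> wM; apply: asbool_equiv_eq; split; apply: const.
exists (if `[< P w0 >] then 1 else -1); first by case: ifP => _; rewrite ?oppr_eq0 oner_neq0.
move=> w M wM; rewrite key// PP//; case: ifP => _; first by rewrite mul1r.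
by rewrite mulN1r oppr_gt0.
Qed.

End OrientedPatch.

(** * Tangent vectors of subsets and of the equator *)

Section OneSidedTangents.
Context {R : realType}.

Lemma velocity_sub d (A B : set 'rV[R]_d) p v : A `<=` B -> velocity A p v -> velocity B p v.
Proof. by move=> AB [c [h1 h2 h3 h4]]; exists c; split=> //; apply: filterS h3 => t /AB. Qed.

Lemma tangent_sub d (A B : set 'rV[R]_d) p v : A `<=` B -> tangent A p v -> tangent B p v.
Proof. by move=> AB [h|h]; [left|right]; exact: velocity_sub AB h. Qed.

Lemma tangentN d (A : set 'rV[R]_d) p v : tangent A p v -> tangent A p (- v).
Proof. by case=> h; [right; rewrite opprK|left]. Qed.

Lemma velocity_scale d (A : set 'rV[R]_d) p v k : 0 <= k -> A p -> velocity A p v -> velocity A p (k *: v).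
Proof.
move=> k0 Ap [c [/smoothT_Cinf Cc c0 cA cv]].
have Ckt : Cinf setT (fun t : R => k * t) by apply: CiMT; [exact: CicstT|exact: CiidT].
have dk : is_derive (0 : R) (1 : R) (fun t : R => k * t) k.
  by apply: is_derive_eq; rewrite /GRing.scale /=; ring.
exists (fun t => c (k * t)); split.
- by apply: Cinf_smooth; exact: (Cicomp1_mx Cc).
- by rewrite mulr0.
- move: k0; rewrite le_eqVlt => /orP[/eqP <-|k0].
    by apply: nearW => t; rewrite mul0r c0.
  have cA' : \forall t \near (0 : R), 0 < t -> A (c t) by exact: cA.
  have ck : {for (0 : R), continuous (fun t : R => k * t)} by exact: Cinf_continuous.
  have := ck [set x | 0 < x -> A (c x)]; rewrite mulr0 => /(_ cA') N.
  have {}N : \forall t \near (0 : R), 0 < k * t -> A (c (k * t)) by exact: N.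
  suff : \forall t \near (0 : R), 0 < t -> A (c (k * t)) by [].
  by apply: filterS N => t h t0; apply: h; rewrite mulr_gt0.
- by have [_ ->] := is_derive_comp1 Cc dk; rewrite mulr0 cv.
Qed.

Lemma tangent_scale d (A : set 'rV[R]_d) p v k : A p -> tangent A p v -> tangent A p (k *: v).
Proof.
move=> Ap tv; have [k0|k0] := leP 0 k.
  by case: tv => h; [left|right; rewrite -scalerN]; exact: velocity_scale.
rewrite -[k]opprK scaleNr; apply: tangentN.
have k0' : 0 <= - k by rewrite oppr_ge0 ltW.
by case: tv => h; [left|right; rewrite -scalerN]; exact: velocity_scale.
Qed.

Lemma incl_row d (v : 'rV[R]_d) j : Defs.incl v ord0 (rshift 1 j) = v ord0 j.
Proof. exact: (row_mxEr (0 : 'rV[R]_1)). Qed.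

Lemma incl_inj k d : injective (@Defs.incl R k d).
Proof. by move=> A B E; have [] := @eq_row_mx R k 1 d _ _ _ _ E. Qed.

Lemma inclZ d (v : 'rV[R]_d) a : Defs.incl (a *: v) = a *: Defs.incl v.
Proof. by apply/esym; apply: etrans (@scale_row_mx R 1 1 d a 0 v) _; rewrite scaler0. Qed.

Lemma inclN d (v : 'rV[R]_d) : Defs.incl (- v) = - Defs.incl v.
Proof. by rewrite -scaleN1r inclZ scaleN1r. Qed.

Lemma head_ord0 d (x : 'rV[R]_(1 + d)) : x ord0 ord0 = x ord0 (lshift d ord0).
Proof. by congr (x _ _); exact: val_inj. Qed.

Lemma incl_head d (v : 'rV[R]_d) : Defs.incl v ord0 ord0 = 0.
Proof. by rewrite (head_ord0 (Defs.incl v : 'rV[R]_(1 + d))) /Defs.incl (row_mxEl (0 : 'rV[R]_1)) mxE. Qed.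

Lemma incl_of_head0 d (x : 'rV[R]_(1 + d)) : x ord0 ord0 = 0 -> x = Defs.incl (rsubmx x).
Proof.
move=> x0; rewrite -[LHS]hsubmxK /Defs.incl; congr row_mx.
by apply/rowP => j; rewrite (ord1 j) !mxE -head_ord0.
Qed.

Lemma dot_incl d (v w : 'rV[R]_d) : dot (Defs.incl v) (Defs.incl w) = dot v w.
Proof.
have -> : dot (Defs.incl v) (Defs.incl w) = \sum_(i < 1 + d) (Defs.incl v : 'rV[R]_(1 + d)) ord0 i * (Defs.incl w : 'rV[R]_(1 + d)) ord0 i by [].
rewrite big_split_ord /= big_ord1 -head_ord0 incl_head mul0r add0r.
by apply: eq_bigr => i _; rewrite !incl_row.
Qed.

Lemma Ci_incl (V : normedModType R) d (f : V -> 'rV[R]_d) : Cinf setT f -> Cinf setT (fun x => Defs.incl (f x)).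
Proof. by move=> Cf k; apply: Ck_row_mx; [exact: openT|exact: Ck_cst|exact: Cf]. Qed.

Lemma velocity_incl d (A : set 'rV[R]_d) (B : set 'rV[R]_d.+1) p v : (forall x, A x -> B (Defs.incl x)) ->
  velocity A p v -> velocity B (Defs.incl p) (Defs.incl v).
Proof.
move=> AB [c [/smoothT_Cinf Cc c0 cA cv]]; exists (fun t => Defs.incl (c t)); split.
- by apply: Cinf_smooth; exact: Ci_incl.
- by rewrite c0.
- by apply: filterS cA => t /AB.
- have dc : is_derive (0 : R) (1 : R) c v by split=> //; exact: Cinf_derivable.
  by have [_ ->] := is_derive_row_mx (is_derive_cst (0 : 'rV[R]_1) (0 : R) (1 : R)) dc.
Qed.

Lemma tangent_incl d (A : set 'rV[R]_d) (B : set 'rV[R]_d.+1) p v : (forall x, A x -> B (Defs.incl x)) ->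
  tangent A p v -> tangent B (Defs.incl p) (Defs.incl v).
Proof. by move=> AB [h|h]; [left|right; rewrite -inclN]; exact: velocity_incl AB h. Qed.

Lemma tangent_head0 d (A : set 'rV[R]_d.+1) (p v : 'rV[R]_d.+1) : (forall x, A x -> x ord0 ord0 = 0) ->
  tangent A p v -> v ord0 ord0 = 0.
Proof.
move=> A0; have V w : velocity A p w -> w ord0 ord0 = 0.
  move=> [c [/smoothT_Cinf Cc c0 cA <-]].
  have Ch : Cinf setT (fun t => c t ord0 ord0) by exact: Cicoord.
  have dc : derivable c 0 1 by exact: Cinf_derivable.
  have [d1 <-] : is_derive (0 : R) (1 : R) (fun t => c t ord0 ord0) ('D_1 c 0 ord0 ord0).
    by apply: is_derive_coord; split.
  have [d2 D2] := is_derive_cst (0 : R) (0 : R) (1 : R); rewrite -[RHS]D2.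
  have cA0 : \forall t \near (0 : R)^'+, c t ord0 ord0 = 0 by apply: filterS cA => t /A0.
  apply: right_derive_eq => //.
  have cont : {for 0, continuous (fun t => c t ord0 ord0)} by exact: Cinf_continuous.
  have L1 : c r ord0 ord0 @[r --> (0 : R)^'+] --> c 0 ord0 ord0 by apply: cvg_at_right_filter.
  apply: (@cvg_unique R (@norm_hausdorff R R) (c r ord0 ord0 @[r --> (0 : R)^'+])) => //.
  by apply: cvg_near_cst.
by case=> /V // /eqP; rewrite mxE oppr_eq0 => /eqP.
Qed.

Lemma velocity_head_ge0 d (A : set 'rV[R]_d.+1) (p v : 'rV[R]_d.+1) : (forall x, A x -> 0 <= x ord0 ord0) -> p ord0 ord0 = 0 ->
  velocity A p v -> 0 <= v ord0 ord0.
Proof.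
move=> A0 p0 [c [/smoothT_Cinf Cc c0 cA <-]].
have dc : derivable c 0 1 by exact: Cinf_derivable.
have [d1 <-] : is_derive (0 : R) (1 : R) (fun t => c t ord0 ord0) ('D_1 c 0 ord0 ord0).
  by apply: is_derive_coord; split.
apply: right_derive_ge0 => //; first by rewrite c0.
by apply: filterS cA => t /A0.
Qed.

End OneSidedTangents.

(** * Stereographic projection *)

Section Stereographic.
Context {R : realType}.

(** Inverse stereographic projection from the pole (1, 0): the unit ball goes to the half where the
    first coordinate is at most 0, the unit sphere to the equator. *)
Definition stereo d (z : 'rV[R]_d) : 'rV[R]_(1 + d) :=
  row_mx ((sqnorm z - 1) / (sqnorm z + 1))%:M ((2 / (sqnorm z + 1)) *: z).

Definition stereo_inv d (x : 'rV[R]_(1 + d)) : 'rV[R]_d := (1 - x ord0 ord0)^-1 *: rsubmx x.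

Lemma sqnorm1_gt0 d (z : 'rV[R]_d) : 0 < sqnorm z + 1.
Proof. by rewrite ltr_wpDl// sqnorm_ge0. Qed.

Lemma sqnorm1_neq0 d (z : 'rV[R]_d) : sqnorm z + 1 != 0.
Proof. by rewrite gt_eqF// sqnorm1_gt0. Qed.

Lemma stereo_head d (z : 'rV[R]_d) : stereo z ord0 ord0 = (sqnorm z - 1) / (sqnorm z + 1).
Proof. by rewrite head_ord0 /stereo row_mxEl mxE eqxx mulr1n. Qed.

Lemma one_sub_stereo_head d (z : 'rV[R]_d) : 1 - stereo z ord0 ord0 = 2 / (sqnorm z + 1).
Proof. by rewrite stereo_head; have := sqnorm1_neq0 z => ?; field. Qed.

Lemma stereoK d : cancel (@stereo d) (@stereo_inv d).
Proof.
move=> z; rewrite /stereo_inv one_sub_stereo_head /stereo row_mxKr scalerA mulVf ?scale1r//.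
by rewrite mulf_neq0 ?invr_eq0 ?sqnorm1_neq0// pnatr_eq0.
Qed.

Lemma sqnorm_row_mx m n (x : 'rV[R]_m) (y : 'rV[R]_n) : sqnorm (row_mx x y) = sqnorm x + sqnorm y.
Proof.
rewrite /sqnorm big_split_ord /=; congr (_ + _); apply: eq_bigr => i _.
  by rewrite row_mxEl.
by rewrite row_mxEr.
Qed.

Lemma sqnormZ d k (z : 'rV[R]_d) : sqnorm (k *: z) = k ^+ 2 * sqnorm z.
Proof. by rewrite -!dot_self dotZl dotC dotZl dot_self mulrA -expr2. Qed.

Lemma stereo_sphere d (z : 'rV[R]_d) : sphere d (stereo z).
Proof.
suff : sqnorm (stereo z) = 1 by []; rewrite /stereo sqnorm_row_mx sqnormZ /sqnorm big_ord1 mxE eqxx mulr1n -/(sqnorm z).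
by have := sqnorm1_neq0 z => ?; field.
Qed.

Lemma Ci_stereo d : Cinf setT (@stereo d).
Proof.
have Cs k : Ck k setT (fun z : 'rV[R]_d => sqnorm z) by apply: Ck_sqnorm; [exact: openT|exact: Ck_id].
have Ci k : Ck k setT (fun z : 'rV[R]_d => (sqnorm z + 1)^-1).
  apply: CkV; [exact: openT|by move=> z _; exact: sqnorm1_neq0|].
  by apply: CkD; [exact: openT|exact: Cs|exact: Ck_cst].
move=> k; apply: Ck_row_mx; first exact: openT.
  apply: Ck_scalar_mx; first exact: openT.
  by apply: CkM; [exact: openT|apply: CkB; [exact: openT|exact: Cs|exact: Ck_cst]|exact: Ci].
apply: CkZ; [exact: openT| |exact: Ck_id].
by apply: CkM; [exact: openT|exact: Ck_cst|exact: Ci].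
Qed.

Lemma stereo_unit d (z : 'rV[R]_d) : sqnorm z = 1 -> stereo z = Defs.incl z.
Proof. by move=> z1; rewrite /stereo z1 subrr mul0r raddf0 divff ?scale1r// -(natrD _ 1 1) pnatr_eq0. Qed.

Lemma stereo_equator d (z : 'rV[R]_d.+1) : equator d (stereo z) <-> sqnorm z = 1.
Proof.
split=> [[w w1 wz]|z1]; last by rewrite stereo_unit//; exists z.
have := congr1 (fun x : 'rV[R]_(1 + d.+1) => x ord0 ord0) wz.
rewrite /= incl_head stereo_head => /esym/eqP.
by rewrite mulf_eq0 invr_eq0 (negbTE (sqnorm1_neq0 z)) orbF subr_eq0 => /eqP.
Qed.

Lemma stereo_derive d (z v : 'rV[R]_d) : sqnorm z = 1 ->
  v *m jac (@stereo d) z = row_mx (dot v z)%:M (v - dot v z *: z).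
Proof.
move=> z1; pose c (t : R) := z + t *: v.
have dc : is_derive (0 : R) (1 : R) c v by exact: is_derive_affine.
have c0 : c 0 = z by rewrite /c scale0r addr0.
have [dc1 Dc1] := dc.
have [_ E] := @is_derive_comp R d (1 + d) R setT (@stereo d) c 0 1 openT (@Ci_stereo d 1%N) I dc1.
rewrite -c0 -{1}Dc1 -E.
have [ds Ds] := is_derive_sqnorm dc1; rewrite Dc1 c0 in Ds.
have dN : is_derive (0 : R) (1 : R) (fun t => sqnorm (c t)) (2 * dot v z) by split.
have N0 : sqnorm (c 0) + 1 = 2 by rewrite c0 z1.
have n2 : (2 : R) != 0 by rewrite pnatr_eq0.
have dI : is_derive (0 : R) (1 : R) (fun t => (sqnorm (c t) + 1)^-1) (- (2 * dot v z) / 4).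
  have d1 : is_derive (0 : R) (1 : R) (fun t => sqnorm (c t) + 1) (2 * dot v z).
    by apply: is_derive_eq; rewrite addr0.
  have := @is_deriveV R _ 0 _ 1 _ d1; rewrite N0 => /(_ n2) dV.
  by apply: is_derive_eq; rewrite /GRing.scale /=; field.
have h1 : is_derive (0 : R) (1 : R) (fun t => ((sqnorm (c t) - 1) / (sqnorm (c t) + 1))%:M : 'rV[R]_1) (dot v z)%:M.
  apply: is_derive_rv => j; rewrite (ord1 j) mxE mulr1n.
  rewrite (_ : (fun t => _) = (fun t => (sqnorm (c t) - 1) * (sqnorm (c t) + 1)^-1)); last first.
    by apply/funext => t; rewrite mxE mulr1n.
  by apply: is_derive_eq; rewrite /GRing.scale /= N0 c0 z1; field.
have h2 : is_derive (0 : R) (1 : R) (fun t => (2 / (sqnorm (c t) + 1)) *: c t) (v - dot v z *: z).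
  apply: is_derive_rv => j; rewrite !mxE.
  have dcj := is_derive_coord j dc.
  rewrite (_ : (fun t => _) = (fun t => 2 * (sqnorm (c t) + 1)^-1 * c t ord0 j)); last first.
    by apply/funext => t; rewrite mxE.
  by apply: is_derive_eq; rewrite /GRing.scale /= N0 c0; field.
by have [_ ->] := is_derive_row_mx h1 h2; rewrite c0.
Qed.

Lemma jac_comp n m p (F : 'rV[R]_m -> 'rV[R]_p) (g : 'rV[R]_n -> 'rV[R]_m) x :
  Cinf setT F -> Cinf setT g -> jac (fun x => F (g x)) x = jac g x *m jac F (g x).
Proof.
move=> CF Cg; have CFg : Cinf setT (fun x => F (g x)) by exact: (Cicomp_mx CF Cg).
apply/row_matrixP => i; rewrite !rowE mulmxA; set v := delta_mx _ _.
rewrite -(derive_jac v openT (CFg 1%N) I) -(derive_jac v openT (Cg 1%N) I).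
by have [_ ->] := @is_derive_comp R m p _ setT F g x v openT (CF 1%N) I (Cinf_derivable Cg).
Qed.

End Stereographic.

(** * The orientation induced on a slice of a sphere *)

Section SliceSphere.
Context {R : realType}.
Variables (S : set 'rV[R]_5) (L : set 'rV[R]_4) (oL : 'rV[R]_4 -> set 'rV[R]_4).
Variables (Psi : 'rV[R]_2 -> 'rV[R]_5) (H : 'rV[R]_5 -> 'rV[R]_2) (Mb sg : R).
Hypotheses (CPsi : Cinf setT Psi) (CH : Cinf setT H).
Hypothesis PsiS : forall w, `|w| < Mb -> S (Psi w) /\ H (Psi w) = w.
Hypothesis spanS : forall p (E E' : 'M[R]_(2, 5)), S p -> frame S p E ->
  (forall i, tangent S p (row i E')) -> exists A, E' = A *m E.
Hypothesis S4 : S `<=` sphere 4.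
Hypothesis SL : S `&` equator 3 = @Defs.incl R 1 4 @` L.
Hypothesis oLL : orientation (k := 1) L oL.

(* The upper half of S lies on the positive side of the first coordinate, so
   the condition on [x] says that it points out of it; outward vector first,
   [col_mx x e] is then the frame that orients the boundary by [e]. *)
Definition slice_frame (z : 'rV[R]_4) (w : 'rV[R]_2) (Q : 'M[R]_2) (x : 'rV[R]_5) (e : 'rV[R]_4) :=
  [/\ `|w| < Mb, Psi w = Defs.incl z, Q *m jac Psi w = col_mx x (Defs.incl e), 0 < sg * \det Q &
   x ord0 ord0 < 0 /\ oL z e].

Hypothesis frames : forall z, L z -> exists w Q x e, slice_frame z w Q x e.

Lemma slice_link z : (S `&` equator 3) (Defs.incl z) <-> L z.
Proof.
rewrite SL; split; last by move=> Lz; exists z.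
by case=> z' Lz' /incl_inj <-.
Qed.

Lemma slice_tangent z w Q x e v : slice_frame z w Q x e -> tangent S (Defs.incl z) v ->
  exists a b, v = a *: x + b *: Defs.incl e.
Proof.
move=> [wM wz QJ Qd _] tv.
have Sz : S (Defs.incl z) by rewrite -wz; have [] := PsiS wM.
have Qu : Q \in unitmx.
  by rewrite unitmxE unitfE; apply: contraTneq Qd => ->; rewrite mulr0 ltxx.
have := patch_frame CPsi CH PsiS wM; rewrite wz => fJ.
have [i|A EA] := spanS (E' := \matrix_(i, j) v ord0 j) Sz fJ.
  by rewrite (_ : row i _ = v)//; apply/rowP => j; rewrite !mxE.
pose q : 'rV[R]_(1 + 1) := row ord0 A *m invmx Q.
exists (lsubmx q ord0 ord0), (rsubmx q ord0 ord0).
have -> : v = q *m col_mx x (Defs.incl e).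
  rewrite -QJ mulmxA mulmxKV// -row_mul -EA.
  by apply/rowP => j; rewrite !mxE.
rewrite -{1}[q]hsubmxK; apply: etrans (@mul_row_col R 1 1 1 5 _ _ _ _) _.
by rewrite {1}[lsubmx q]mx11_scalar {1}[rsubmx q]mx11_scalar !mul_scalar_mx.
Qed.

(** A patch curve with velocity [- x] has positive first coordinate for small positive times, so it
    enters the upper half. *)
Lemma slice_x_tangent z w Q x e : slice_frame z w Q x e ->
  tangent S (Defs.incl z) x /\ velocity (S `&` upper_half 4) (Defs.incl z) (- x).
Proof.
move=> [wM wz QJ Qd [x0 _]]; pose q : 'rV[R]_2 := usubmx (Q : 'M[R]_(1 + 1, 2)).
have xE : x = q *m jac Psi w.
  rewrite /q mul_usub_mx -[LHS](col_mxKu x (Defs.incl e)); congr usubmx.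
  exact: esym QJ.
split; first by left; rewrite -wz xE; exact: patch_velocity CPsi PsiS _ _ wM.
have [c [Cc c0 cM dP]] := patch_curve CPsi (- q) wM.
exists (fun t => Psi (c t)); split.
- by apply: Cinf_smooth; exact: (Cicomp_mx CPsi Cc).
- by rewrite c0.
- have dh := is_derive_coord ord0 dP.
  have [d0 D0] := dh; rewrite mulNmx -xE mxE in D0.
  have h0 : Psi (c 0) ord0 ord0 = 0 by rewrite c0 wz incl_head.
  have L1 := right_derive_cvg d0; rewrite D0 h0 in L1.
  have pos : \forall t \near (0 : R)^'+, 0 < t^-1 *: (Psi (c t) ord0 ord0 - 0).
    by apply: (L1 [set y : R | 0 < y]); apply: open_nbhs_nbhs; split; [exact: open_gt|rewrite /= oppr_gt0].
  have cM' : \forall t \near (0 : R)^'+, `|c t| < Mb by exact: near_right_of_near.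
  near=> t; have [St _] : S (Psi (c t)) /\ H (Psi (c t)) = c t.
    by apply: PsiS; near: t.
  split=> //; split; first exact: S4.
  have t0 : 0 < t by near: t; exact: nbhs_right_gt.
  have : 0 < t^-1 *: (Psi (c t) ord0 ord0 - 0) by near: t.
  by rewrite subr0 -[_ *: _]/(_ * _) pmulr_rgt0 ?invr_gt0// => /ltW.
- by have [_ ->] := dP; rewrite mulNmx -xE.
Unshelve. all: by end_near. Qed.

Lemma equator_head (p : 'rV[R]_5) : equator 3 p -> p ord0 ord0 = 0.
Proof. by move=> [z _ <-]; exact: incl_head. Qed.

Lemma head_comb a b (x : 'rV[R]_5) (e : 'rV[R]_4) : (a *: x + b *: Defs.incl e) ord0 ord0 = a * x ord0 ord0.
Proof. by rewrite mxE [X in X + _]mxE [X in _ + X]mxE incl_head mulr0 addr0. Qed.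

Lemma slice_frameP z w Q x e (E : 'rV[R]_4) : slice_frame z w Q x e ->
  frame (S `&` equator 3) (Defs.incl z) (Defs.incl E) <-> exists2 b, b != 0 & E = b *: e.
Proof.
move=> fr; have [wM wz QJ Qd [x0 oe]] := fr; have [or1 _ _] := oLL.
have [Lz [ef et]] := or1 _ _ oe.
have r1 d (y : 'rV[R]_d) : row ord0 y = y by apply/rowP => j; rewrite mxE.
have rk d (y : 'rV[R]_d) : row_free y = (y != 0) by rewrite /row_free rank_rV; case: (y == 0).
have e0 : e != 0 by rewrite -rk.
split.
  move=> [Ef /(_ ord0)]; rewrite r1 => Et.
  have [a [b Eab]] := slice_tangent fr (tangent_sub (@subIsetl _ _ _) Et).
  have a0 : a = 0.
    have := congr1 (fun y : 'rV[R]_5 => y ord0 ord0) Eab; rewrite /= incl_head head_comb => /esym/eqP.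
    by rewrite mulf_eq0 (lt_eqF x0) orbF => /eqP.
  move: Eab; rewrite a0 scale0r add0r -inclZ => /incl_inj Eb; exists b => //.
  apply/eqP => b0; move: Ef; rewrite Eb b0 scale0r rk.
  by rewrite (_ : Defs.incl 0 = 0) ?eqxx//; have := inclZ (0 : 'rV[R]_4) 0; rewrite !scale0r.
move=> [b b0 ->]; split.
  rewrite rk; apply: contra e0 => /eqP h.
  have : Defs.incl (b *: e) = Defs.incl (0 *: e) by rewrite h inclZ scale0r.
  by move=> /incl_inj/eqP; rewrite scale0r scaler_eq0 (negbTE b0).
move=> i; rewrite (ord1 i) r1; apply: (@tangent_incl R 4 L); first by move=> y /slice_link.
by apply: tangent_scale => //; have := et ord0; rewrite r1.
Qed.

(** An outward vector is a positive multiple of [x] plus a multiple of [e]. A triangular base change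
    relates the frame it forms with [E] to the frame of [x] and [e], and [Q] relates the latter to
    the patch. *)
Lemma slice_boundary oS k z w Q x e E : k != 0 ->
  (forall w M, `|w| < Mb -> oS (Psi w) (M *m jac Psi w) <-> 0 < k * \det M) ->
  slice_frame z w Q x e ->
  boundary_orientation (k := 1) (S `&` upper_half 4) (S `&` equator 3) oS (Defs.incl z) (Defs.incl E) <->
  exists2 b, E = b *: e & 0 < k * sg * b.
Proof.
move=> k0 Hk fr; have [wM wz QJ Qd [x0 oe]] := fr; have [or1 _ _] := oLL.
have [Lz [ef et]] := or1 _ _ oe.
have hQ a c b : oS (Defs.incl z) (col_mx (a *: x + c *: Defs.incl e) (Defs.incl (b *: e)) : 'M[R]_(1 + 1, 5)) <->
    0 < k * (a * b * \det Q).
  have -> : (col_mx (a *: x + c *: Defs.incl e) (Defs.incl (b *: e)) : 'M[R]_(1 + 1, 5)) =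
      (block_mx a%:M c%:M 0 b%:M : 'M[R]_(1 + 1)) *m (Q : 'M[R]_(1 + 1, 2)) *m jac Psi w.
    rewrite -mulmxA QJ; apply/esym; apply: etrans (@mul_block_col R 1 1 1 1 5 _ _ _ _ _ _) _.
    by rewrite !mul_scalar_mx mul0mx add0r inclZ.
  by rewrite -wz Hk// (@det_mulmx R 2) (@det_ublock R 1 1) !det_scalar1.
have sgn a b : 0 < a -> (0 < k * (a * b * \det Q)) = (0 < k * sg * b).
  move=> a0; have sg0 : sg != 0 by apply: contraTneq Qd => ->; rewrite mul0r ltxx.
  have sg2 : 0 < sg ^+ 2 by rewrite exprn_even_gt0.
  rewrite -(pmulr_rgt0 _ sg2).
  have -> : sg ^+ 2 * (k * (a * b * \det Q)) = (a * (sg * \det Q)) * (k * sg * b) by ring.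
  by rewrite pmulr_rgt0// mulr_gt0.
have outx : outward (S `&` upper_half 4) (S `&` equator 3) (Defs.incl z) x.
  have [tx vx] := slice_x_tangent fr; split=> //.
  move=> /tangent_head0 h; move: x0; rewrite h ?ltxx//.
  by move=> y [_ /equator_head].
split.
  move=> [_ /(slice_frameP E fr)[b b0 Eb] [v [[vF vB] ov]]]; exists b => //.
  have tv : tangent S (Defs.incl z) v.
    by right; apply: velocity_sub vF; exact: subIsetl.
  have [a [c vE]] := slice_tangent fr tv.
  have a0 : 0 < a.
    have v0 : v ord0 ord0 <= 0.
      have : 0 <= (- v) ord0 ord0.
        apply: velocity_head_ge0 vF; last exact: incl_head.
        by move=> y [_ []].
      by rewrite mxE oppr_ge0.
    have : 0 <= a.
      by move: v0; rewrite vE head_comb nmulr_lle0.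
    rewrite le_eqVlt => /orP[/eqP a0|//]; case: vB.
    rewrite vE -a0 scale0r add0r; apply: tangent_scale; first exact/slice_link.
    apply: (@tangent_incl R 4 L); first by move=> y /slice_link.
    have := et ord0; rewrite (_ : row ord0 e = e)//; by apply/rowP => j; rewrite mxE.
  by move: ov; rewrite vE Eb hQ sgn.
move=> [b Eb bk]; split; first exact/slice_link.
  apply/(slice_frameP E fr); exists b => //.
  by apply: contraTneq bk => ->; rewrite mulr0 ltxx.
exists x; split=> //.
by have := hQ 1 0 b; rewrite scale1r scale0r addr0 -Eb sgn// => ->.
Qed.

Lemma slice_induced oS k : k != 0 ->
  (forall w M, `|w| < Mb -> oS (Psi w) (M *m jac Psi w) <-> 0 < k * \det M) ->
  (fun p E => boundary_orientation (k := 1) (S `&` upper_half 4) (S `&` equator 3) oS (Defs.incl p) (Defs.incl E)) =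
  (fun p E => if 0 < k * sg then oL p E else oL p (- E)).
Proof.
move=> k0 Hk; apply/funext => z; apply/funext => E; apply/propext.
have [or1 or2 _] := oLL.
have [Lz|nL] := pselect (L z); last first.
  split; first by move=> [/slice_link].
  by case: ifP => _ /or1[].
have [w [Q [x [e fr]]]] := frames Lz; have [_ _ _ Qd [_ oe]] := fr.
rewrite (slice_boundary E k0 Hk fr).
have sg0 : sg != 0 by apply: contraTneq Qd => ->; rewrite mul0r ltxx.
have oE y : oL z y <-> exists2 b, y = b *: e & 0 < b.
  split=> [oy|[b -> b0]]; last by rewrite (frame1_scale _ oLL oe).
  have [_ [yf yt]] := or1 _ _ oy.
  have : frame (S `&` equator 3) (Defs.incl z) (Defs.incl y).
    have r1 d (v : 'rV[R]_d) : row ord0 v = v by apply/rowP => j; rewrite mxE.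
    have rk d (v : 'rV[R]_d) : row_free v = (v != 0) by rewrite /row_free rank_rV; case: (v == 0).
    split.
      rewrite rk; move: yf; rewrite rk; apply: contra => /eqP h.
      have : Defs.incl y = Defs.incl (0 *: y) by rewrite h inclZ scale0r.
      by move=> /incl_inj y0; rewrite y0 scale0r.
    move=> i; rewrite (ord1 i) r1; apply: (@tangent_incl R 4 L); first by move=> ? /slice_link.
    by have := yt ord0; rewrite r1.
  by move=> /(slice_frameP y fr)[b b0 yb]; exists b => //; move: oy; rewrite yb (frame1_scale _ oLL oe).
have [ks|ks] := ltP 0 (k * sg); rewrite oE.
  by split=> -[b Eb h]; exists b => //; [rewrite -(pmulr_rgt0 _ ks)|rewrite pmulr_rgt0].
have ks' : k * sg < 0 by rewrite lt_neqAle ks mulf_neq0.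
split=> -[b Eb h]; exists (- b); rewrite ?scaleNr -?Eb ?opprK//.
  by rewrite oppr_gt0 -(nmulr_rgt0 _ ks').
by rewrite nmulr_rgt0 ?oppr_lt0.
Qed.

(** Subtracting a multiple of [x], whose first coordinate is nonzero, leaves a vector tangent to the
    4-sphere with first coordinate 0, hence tangent to the equator. *)
Lemma slice_transverse : transverse (sphere 4) S (equator 3).
Proof.
move=> p Sp Ep y /tangent_sphere yp.
have [z Lz zp] : (@Defs.incl R 1 4 @` L) p by rewrite -SL.
have [w [Q [x [e fr]]]] := frames Lz; have [wM wz QJ Qd [x0 oe]] := fr.
have [tx _] := slice_x_tangent fr; rewrite zp in tx.
have x0' : x ord0 ord0 != 0 by rewrite lt_eqF.
pose a := y ord0 ord0 / x ord0 ord0; pose v := y - a *: x.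
exists (a *: x), v; split; last by rewrite addrC subrK.
  exact: tangent_scale.
have v0 : v ord0 ord0 = 0 by rewrite !mxE /a divfK// subrr.
have vE := incl_of_head0 (v0 : (v : 'rV[R]_(1 + 4)) ord0 ord0 = 0).
have xp : dot x p = 0 by apply: tangent_sphere; apply: tangent_sub tx; exact: S4.
have vp : dot v p = 0 by rewrite dotBl dotZl xp yp mulr0 subrr.
have z1 : sphere 3 z.
  by have [z' z1 z'p] := Ep; move: z'p; rewrite -zp => /incl_inj <-.
rewrite vE -zp; left; apply: (@velocity_incl R 4 (sphere 3)); first by move=> q qs; exists q.
have zz : dot (rsubmx (v : 'rV[R]_(1 + 4))) z = 0 by rewrite -dot_incl -vE zp.
have retr (u : 'rV[R]_4) : `|u| < 2 -> u = u by [].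
have := @velocity_imageP R 3 4 (fun u => u) (@CiidT R _) z (rsubmx (v : 'rV[R]_(1 + 4))) z1 zz.
have -> : (fun u : 'rV[R]_4 => u) @` sphere 3 = sphere 3.
  by apply/seteqP; split=> [r [q qs <-]|r rs] //; exists r.
have -> : jac (fun u : 'rV[R]_4 => u) z = 1%:M.
  apply/row_matrixP => i; rewrite !rowE mulmx1 -(derive_jac (delta_mx 0 i) openT (Ck_id 1 setT) I).
  by rewrite derive_id.
by rewrite mulmx1.
Qed.

(** An orientation of [S] induces [oL] or its opposite according to the sign of [k * sg]; exchanging
    the vectors of its frames yields the other one. *)
Lemma slice_quasi_orientation oS : orientation (k := 2) S oS ->
  induced_quasi_orientation S = [set oL; fun p E => oL p (- E)].
Proof.
move=> ooS; have patch o := @patch_orient R 2 5 S Psi H Mb CPsi CH PsiS spanS o.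
have [k k0 Hk] := patch oS ooS.
have opp2 : (fun p E => oL p (- - E)) = oL by apply/funext => p; apply/funext => E; rewrite opprK.
apply/seteqP; split=> o.
  move=> [oS' [ooS' ->]]; have [k' k'0 Hk'] := patch oS' ooS'.
  by rewrite (slice_induced k'0 Hk'); case: (0 < k' * sg); [left|right].
have Hk' w M : `|w| < Mb -> oS (Psi w) (xrow 0 1 (M *m jac Psi w)) <-> 0 < - k * \det M.
  move=> wM; rewrite xrowE mulmxA Hk// det_mulmx det_perm odd_tperm /=.
  by rewrite mulN1r mulrN mulNr.
have k'0 : - k != 0 by rewrite oppr_eq0.
have oo' := orientation_reverse ooS.
have [kp|kn] := ltP 0 (k * sg).
  have kn : (0 < - k * sg) = false by rewrite mulNr oppr_gt0 ltNge ltW.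
  case=> ->.
    by exists oS; split=> //; rewrite (slice_induced k0 Hk) kp.
  by exists (fun p E => oS p (xrow 0 1 E)); split=> //; rewrite (slice_induced k'0 Hk') kn.
have kn' : (0 < k * sg) = false by rewrite ltNge kn.
(* Any point of [L] would give [0 < sg * \det Q]; with [sg = 0] there is none, and [oL] and its
   opposite are both empty. *)
have [sg0|sg0] := eqVneq sg 0.
  have noL : oL = fun _ => set0.
    apply/funext => p; apply/seteqP; split=> // E oE.
    have [or1 _ _] := oLL; have [Lp _] := or1 _ _ oE.
    have [w [Q [x [e [_ _ _ Qd _]]]]] := frames Lp.
    by move: Qd; rewrite sg0 mul0r ltxx.
  move=> oE; exists oS; split=> //; rewrite (slice_induced k0 Hk) kn' noL.
  by case: oE => ->; rewrite noL.
have kp : 0 < - k * sg by rewrite mulNr oppr_gt0 lt_neqAle mulf_neq0.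
case=> ->.
  by exists (fun p E => oS p (xrow 0 1 E)); split=> //; rewrite (slice_induced k'0 Hk') kp.
by exists oS; split=> //; rewrite (slice_induced k0 Hk) kn'.
Qed.

End SliceSphere.

(** * Slice spheres from diffeomorphisms of R^4 *)

Section SphereOfDiffeo.
Context {R : realType}.
Variables (Th Th' : 'rV[R]_4 -> 'rV[R]_4).
Hypothesis DTh : diffeo Th Th'.

Definition stereo_image (u : 'rV[R]_3) : 'rV[R]_5 := stereo (Th (Defs.incl u)).

Lemma Ci_stereo_image : Cinf setT stereo_image.
Proof.
have [CT _ _ _] := DTh.
by apply: (Cicomp_mx (@Ci_stereo R 4)); apply: (Cicomp_mx CT); apply: Ci_incl; exact: CiidT.
Qed.

(** The explicit inverse is smooth only off the pole; the image of the closed ball of radius 2 is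
    compact there, so the inverse extends smoothly to R^5. *)
Lemma stereo_image_retract : exists G : 'rV[R]_5 -> 'rV[R]_3,
  Cinf setT G /\ forall u, `|u| <= 2 -> G (stereo_image u) = u.
Proof.
have [CT CT' TK _] := DTh.
pose B := [set u : 'rV[R]_3 | `|u - 0| <= 2].
pose f (x : 'rV[R]_5) : 'rV[R]_3 := rsubmx (Th' (stereo_inv (x : 'rV[R]_(1 + 4))) : 'rV[R]_(1 + 3)).
have fK u : f (stereo_image u) = u.
  rewrite /f /stereo_image stereoK TK; exact: (row_mxKr (0 : 'rV[R]_1)).
have cA : compact (stereo_image @` B).
  apply: continuous_compact; last exact: compact_ball.
  by apply: continuous_subspaceT; exact: Cinf_continuous Ci_stereo_image.
have Chd : Cinf setT (fun x : 'rV[R]_(1 + 4) => 1 - x ord0 ord0).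
  by apply: CiBT; [exact: CicstT|apply: Cicoord; exact: CiidT].
have sf : smooth (stereo_image @` B) f.
  move=> _ [u _ <-]; pose U := [set x : 'rV[R]_(1 + 4) | 0 < 1 - x ord0 ord0].
  have oU : open U by apply: open_pos; exact: Cinf_continuous.
  exists U, f; split=> //.
    by rewrite /U /= one_sub_stereo_head divr_gt0// sqnorm1_gt0.
  move=> k; apply: (@Ck_comp_mx R _ 4 1 3 k U setT (fun z : 'rV[R]_(1 + 3) => rsubmx z)) => //.
  - exact: openT.
  - exact: Cirsub.
  - apply: (@Ck_comp_mx R _ 4 1 4 k U setT Th') => //; first exact: openT.
    apply: CkZ => //; last by apply: Ck_sub (@Cirsub R 4 k); exact: subsetT.
    apply: CkV => //; first by move=> x Ux; rewrite gt_eqF.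
    by apply: Ck_sub (Chd k); exact: subsetT.
have [G [CG GE]] := smooth_extension_rV (@has_bumps_rV R 5) cA sf.
exists G; split=> // u u2; rewrite GE ?fK//; exists u => //.
by rewrite /B /= subr0.
Qed.

Lemma disk_norm_le2 d (u : 'rV[R]_d) : disk d u -> `|u| <= 2.
Proof.
move=> us; apply: (@le_trans _ _ 1); last by rewrite ler1n.
apply: norm_le_coord => // i j; rewrite (ord1 i).
have : `|u ord0 j| ^+ 2 <= 1.
  rewrite real_normK ?num_real//; apply: le_trans us.
  by rewrite /sqnorm (bigD1 j)//= lerDl sumr_ge0// => k _; exact: sqr_ge0.
by rewrite expr_le1.
Qed.

(** [stereo_image] embeds the whole 3-disk, so the sphere comes with the ball it bounds. The patch
    conditions are carried through [stereo], under which the radial direction becomes the first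
    coordinate. *)
Lemma diffeo_doubly_slice (L : set 'rV[R]_4) (oL : 'rV[R]_4 -> set 'rV[R]_4)
    (psi : 'rV[R]_2 -> 'rV[R]_4) (psi' : 'rV[R]_4 -> 'rV[R]_2) (Mb sg : R) :
  (forall z, L z <-> sqnorm z = 1 /\ exists u, sphere 2 u /\ Th (Defs.incl u) = z) ->
  Cinf setT psi -> Cinf setT psi' -> (forall w, `|w| < Mb -> psi' (psi w) = w) ->
  (forall w, `|w| < Mb -> exists u, sphere 2 u /\ Th (Defs.incl u) = psi w) ->
  orientation (k := 1) L oL ->
  (forall z, L z -> exists w (Q : 'M[R]_2) (v e : 'rV[R]_4),
    [/\ `|w| < Mb, psi w = z, Q *m jac psi w = col_mx v e, 0 < sg * \det Q &
      [/\ dot v z < 0, dot e z = 0 & oL z e]]) ->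
  weakly_doubly_slice L [set oL; fun p E => oL p (- E)].
Proof.
move=> LE Cpsi Cpsi' psiK psiS oLL fr.
have CF := Ci_stereo_image; have [G [CG GF]] := stereo_image_retract.
have [CT CT' TK T'K] := DTh.
have GF' u : `|u| < 2 -> G (stereo_image u) = u by move=> /ltW; exact: GF.
pose S := stereo_image @` sphere 2.
have emb A : A `<=` disk 3 -> embedding A stereo_image.
  move=> Ad; split; first exact: Cinf_smooth.
  by exists G; split=> [|u /Ad/disk_norm_le2]; [exact: Cinf_smooth|exact: GF].
have sd : (sphere 2 : set 'rV[R]_3) `<=` disk 3 by move=> u us; rewrite /disk /= (us : sqnorm u = 1).
have S4 : S `<=` sphere 4 by move=> _ [u _ <-]; exact: stereo_sphere.
have SL : S `&` equator 3 = @Defs.incl R 1 4 @` L.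
  apply/seteqP; split=> p.
    move=> [[u us <-] /(stereo_equator (Th (Defs.incl u)))z1].
    exists (Th (Defs.incl u)); first by apply/LE; split=> //; exists u.
    by rewrite /stereo_image stereo_unit.
  move=> [z /LE[z1 [u [us uz]]] <-]; split; last by exists z.
  by exists u => //; rewrite /stereo_image uz stereo_unit.
pose Psi w := stereo (psi w) : 'rV[R]_5.
have CPsi : Cinf setT Psi by apply: (Cicomp_mx (@Ci_stereo R 4)).
pose H x := psi' (Th (Defs.incl (G x))).
have CH : Cinf setT H by apply: (Cicomp_mx Cpsi'); apply: (Cicomp_mx CT); exact: Ci_incl.
have PsiS w : `|w| < Mb -> S (Psi w) /\ H (Psi w) = w.
  move=> wM; have [u [us uw]] := psiS w wM; have E : Psi w = stereo_image u by rewrite /Psi -uw.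
  by split; [exists u|rewrite E /H GF ?uw ?psiK//; exact: disk_norm_le2 (sd u us)].
have spanS p (E E' : 'M[R]_(2, 5)) : S p -> frame S p E ->
    (forall i, tangent S p (row i E')) -> exists A, E' = A *m E.
  by apply: (frame_change CF CG GF').
have frames z : L z -> exists w Q x e, slice_frame oL Psi Mb sg z w Q x e.
  move=> Lz; have [w [Q [v [e [wM wz QJ Qd [vz ez oe]]]]]] := fr z Lz.
  have [z1 _] := (LE z).1 Lz.
  exists w, Q, (v *m jac (@stereo R 4) z), e; split=> //.
  - by rewrite /Psi wz stereo_unit.
  - rewrite (jac_comp w (@Ci_stereo R 4) Cpsi) mulmxA QJ wz.
    apply: etrans (@mul_col_mx R 1 1 4 5 _ _ _) _; congr col_mx.
    by rewrite stereo_derive// ez scale0r subr0 raddf0.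
  - split=> //; rewrite stereo_derive//.
    by rewrite (head_ord0 (row_mx (dot v z)%:M _)) row_mxEl mxE eqxx mulr1n.
exists S; split=> //.
- by exists stereo_image; split=> //; exact: emb.
- exists stereo_image; split=> //; first exact: emb.
  by move=> _ [u _ <-]; exact: stereo_sphere.
- exact: (slice_transverse CPsi PsiS S4 SL frames).
have ooS := sphere_orient_orientation CF CG GF' isT.
exact: (slice_quasi_orientation CPsi CH PsiS spanS S4 SL oLL frames ooS).
Qed.

End SphereOfDiffeo.

(** * Doubles of tangles are doubly slice *)

Section TangleDoubles.
Context {R : realType}.

(** A round sphere translated by 2 misses the unit 3-sphere; the patch of radius 0 makes the patch
    conditions vacuous. *)
Lemma empty_doubly_slice (L : set 'rV[R]_4) (oL : 'rV[R]_4 -> set 'rV[R]_4) : (forall z, ~ L z) ->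
  orientation (k := 1) L oL -> weakly_doubly_slice L [set oL; fun p E => oL p (- E)].
Proof.
move=> L0 oLL; pose c : 'rV[R]_(1 + 3) := pt4 2 0.
have D : diffeo (fun z : 'rV[R]_4 => z + c) (fun z => z - c).
  split.
  - by apply: CiDT; [exact: CiidT|exact: CicstT].
  - by apply: CiBT; [exact: CiidT|exact: CicstT].
  - by move=> z; rewrite addrK.
  - by move=> z; rewrite subrK.
apply: (@diffeo_doubly_slice _ _ _ D L oL (fun=> 0) (fun=> 0) 0 1) => //.
- move=> z; split=> [/L0//|[z1 [u [us uz]]]]; exfalso.
  have h : z ord0 ord0 = 2.
    by rewrite -uz mxE incl_head add0r (head_ord0 c) pt4_hd.
  have : z ord0 ord0 ^+ 2 <= 1.
    by rewrite -z1 /sqnorm big_ord_recl lerDl sumr_ge0// => i _; exact: sqr_ge0.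
  by rewrite h => ?; lra.
- exact: CicstT.
- exact: CicstT.
- by move=> w; rewrite normr_lt0.
- by move=> w; rewrite normr_lt0.
- by move=> z /L0.
Qed.
Lemma det_rotation (a b : R) :
  \det (block_mx a%:M (- b)%:M b%:M a%:M : 'M[R]_(1 + 1)) = a ^+ 2 + b ^+ 2.
Proof.
pose i : 'I_(1 + 1) := lshift 1 ord0; pose j : 'I_(1 + 1) := rshift 1 ord0.
have det2 (A : 'M[R]_(1 + 1)) : \det A = A i i * A j j - A i j * A j i.
  rewrite (@expand_det_row R 2 A ord0) !big_ord_recl big_ord0 /cofactor !det_mx11 !mxE.
  rewrite addr0 expr0 expr1 mul1r mulN1r mulrN.
  by congr (A _ _ * A _ _ - A _ _ * A _ _); exact: val_inj.
rewrite det2 block_mxEul block_mxEur block_mxEdl block_mxEdr !mxE /= !mulr1n; ring.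
Qed.

(** Near the unit 3-sphere the spun sphere is R times the line, with frame [X], [axis0]. A positive
    base change turns this frame into an inward radial component followed by the direction of the
    link, which is the one prescribed by [oL]. *)
Lemma arcs_doubly_slice n t G (oL : 'rV[R]_4 -> set 'rV[R]_4) : @arc_data R n.+1 t G ->
  orientation (k := 1) (tangle_double (arc_union n.+1 t)) oL ->
  (forall i s y, (i < n.+1)%N -> `|s| <= 1 -> y ^+ 2 + sqnorm (t i s) = 1 ->
      oL (pt4 y (t i s)) (double_dir (t i) y s)) ->
  weakly_doubly_slice (tangle_double (arc_union n.+1 t)) [set oL; fun p E => oL p (- E)].
Proof.
move=> D oLL Hdir; have [AS AI Aint] := D.
have Td : arc_union n.+1 t `<=` disk 3 by move=> x [j [r [jn r1 <-]]]; exact: (as_disk AS jn r1).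
have [ls [dirs [LS tr]]] := arc_system_lines AS.
have dZ x v k : 0 < k -> arc_direction n.+1 t x v -> arc_direction n.+1 t x (k *: v).
  move=> k0 H i s i_n s1 ts; have [k' k'0 ->] := H i s i_n s1 ts.
  by exists (k * k'); rewrite ?mulr_gt0// scalerA.
have [l [a [b [rho [Hl lT ldir]]]]] := line_system_line dZ LS tr.
have [Th [Th' [psi [psi' [Mb [sg [DTh HTh [Cpsi Cpsi' psiK psiS] sg0 Hpsi]]]]]]] := spun_sphere Hl.
have unit_bounds (z : 'rV[R]_(1 + 3)) : sqnorm z = 1 -> `|z| < 2 /\ disk 3 (rsubmx z).
  move=> z1; split; first exact: (@sphere_norm_lt2 R 3 z z1).
  move: z1; rewrite {1}(pt4_eta z) sqnorm_pt4 /disk /= => <-.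
  by rewrite lerDr sqr_ge0.
apply: (diffeo_doubly_slice DTh _ Cpsi Cpsi' (fun w _ => psiK w) psiS oLL (sg := sg)).
  move=> z; rewrite (tangle_doubleP z Td); split=> [[Tz z1]|[z1 uz]]; split=> //.
    have [z2 zd] := unit_bounds z z1; apply/(HTh z (ltW z2)).
    by have [s ls'] := (lT _ zd).2 Tz; exists s.
  have [z2 zd] := unit_bounds z z1; apply/(lT _ zd).
  by have [s ls'] := (HTh z (ltW z2)).1 uz; exists s.
move=> z /(tangle_doubleP z Td)[Tz z1]; have [z2 zd] := unit_bounds z z1.
have [s sx] := (lT _ zd).2 Tz; have [i [r [i_n r1 tx]]] := Tz.
have [w [Q [wM wz QJ Qd]]] := Hpsi z s z2 (esym sx).
have [|k k0 kt] := ldir s _ i r i_n r1 (etrans tx (esym sx)); first by rewrite sx.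
pose y : R := (z : 'rV[R]_(1 + 3)) ord0 (lshift 3 ord0); pose d := dot ('D_1 l s) (rsubmx (z : 'rV[R]_(1 + 3))).
have zE : z = pt4 y (rsubmx (z : 'rV[R]_(1 + 3))) by exact: pt4_eta.
have yt1 : y ^+ 2 + sqnorm (t i r) = 1 by rewrite tx -sqnorm_pt4 -zE.
pose X : 'rV[R]_(1 + 3) := row_mx 0 ('D_1 l s).
have XE : X = pt4 0 ('D_1 l s) by rewrite /X /pt4 raddf0.
have YE : axis0 = pt4 (1 : R) 0 by [].
have Xz : dot X z = d by rewrite XE zE dot_pt4 mul0r add0r.
have Yz : dot (axis0) z = y by rewrite YE zE dot_pt4 mul1r dot0l addr0.
(* With [d] and [y] the products of the point [z] with [X] and [axis0]: the first row gives a vector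
   with product - (d^2 + y^2) with [z], the second one orthogonal to [z]. As a rotation up to scale,
   [A] preserves orientation. *)
pose A : 'M[R]_(1 + 1) := block_mx (- d)%:M (- y)%:M y%:M (- d)%:M.
have dA : \det A = d ^+ 2 + y ^+ 2 by rewrite det_rotation sqrrN.
(* The line runs along the arc with velocity [k *: 'D_1 (t i) r], [k > 0], so the tangent vector
   found is a positive multiple of [double_dir]. *)
have eE : y *: X + (- d) *: axis0 = k *: double_dir (t i) y r.
  rewrite XE YE /double_dir /pt4 !scale_row_mx add_row_mx !scale_scalar_mx !scaler0 addr0 scalerA.
  rewrite mulr0 raddf0 add0r mulr1 /d kt dotZl tx mulrN scalerA mulrC.
  by rewrite [k * y]mulrC.
have dy : 0 < d ^+ 2 + y ^+ 2.
  rewrite lt_def addr_ge0 ?sqr_ge0// andbT paddr_eq0 ?sqr_ge0// !sqrf_eq0.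
  apply/negP => /andP[/eqP d0 /eqP y0]; have := double_dir_neq0 D i_n r1 yt1.
  have : k *: double_dir (t i) y r = 0 by rewrite -eE d0 y0 oppr0 !scale0r addr0.
  by move/eqP; rewrite scaler_eq0 (gt_eqF k0) /= => ->.
exists w, (A *m Q), ((- d) *: X + (- y) *: axis0), (y *: X + (- d) *: axis0); split=> //.
- rewrite -mulmxA QJ; apply: etrans (@mul_block_col R 1 1 1 1 4 _ _ _ _ _ _) _.
  by rewrite !mul_scalar_mx.
- rewrite (@det_mulmx R 2) dA mulrCA pmulr_rgt0//.
- split.
  + rewrite dotDl !dotZl Xz Yz !mulNr -opprD oppr_lt0 -!expr2; exact: dy.
  + by rewrite dotDl !dotZl Xz Yz mulNr mulrC subrr.
  + have oz := Hdir i r y i_n r1 yt1; rewrite tx -zE in oz.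
    by rewrite eE (frame1_scale _ oLL oz).
Qed.

End TangleDoubles.

Theorem theorem1p5 (R : realType) (n : nat) (T : set 'rV[R]_3)
    (hT : is_tangle n T) :
  is_link n (tangle_double T) /\
  forall Q : set ('rV[R]_4 -> set 'rV[R]_4),
    quasi_orientation (tangle_double T) Q -> weakly_doubly_slice (tangle_double T) Q.
Proof.
have [t [G [D TE]]] := tangle_arcs hT; rewrite -TE; split; first exact: double_is_link D.
move=> Q [oL [oLL ->]].
have [t' [G' [D' TE' Hdir]]] := arcs_oriented D oLL.
(* Without arcs there is no line to spin, so the empty link is treated apart. *)
rewrite -TE' in oLL *; case: n D' oLL Hdir {D TE TE' hT} => [|m] D' oLL Hdir.
  apply: empty_doubly_slice oLL => z; case: D' => AS _ _.
  by move=> [[x [i [s []]]]|[x [i [s []]]]].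
exact: arcs_doubly_slice D' oLL Hdir.
Qed.
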